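(* Let $F$ be a field and let $\mathrm{G}_2$ be the split group of type $\mathrm{G}_2$ over $F$, with $\mathrm{SL}_3\subset\mathrm{G}_2$ embedded as a subsystem subgroup. There exists a $\mathrm{G}_2$-torsor $E$ over a certain smooth base scheme $X$ over $F$ such that for $R=E/\mathrm{SL}_3$ one has $$\mathrm{CH}^i(R)=\begin{cases}\mathbb{Z},&\text{if } i=0,3;\\ \mathbb{Z}/2,&\text{if } i=2,5;\\ 0,&\text{otherwise.}\end{cases}$$
   Context: $\mathrm{CH}^i$ denotes the Chow group of codimension $i$ cycles modulo rational equivalence. The subsystem subgroup $\mathrm{SL}_3\subset\mathrm{G}_2$ is the one corresponding to the $\mathrm{A}_2$-subsystem of long roots. *)

(* Defs.v *)
From HB Require Import structures.
From mathcomp Require Import all_boot all_order all_algebra.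
From mathcomp Require Import ring ring_quotient.
From mathcomp Require Import all_classical topology.
From mathcomp Require Import freeg.

Set Implicit Arguments.
Unset Strict Implicit.
Unset Printing Implicit Defensive.

Import GRing.Theory.
Local Open Scope classical_set_scope.
Local Open Scope ring_scope.

(* Rings of sections over the empty set are zero, hence [comPzRingType].      *)

Definition is_rmorph (A B : comPzRingType) (f : A -> B) : Prop :=
  GRing.zmod_morphism f /\ GRing.monoid_morphism f.

Definition prime_ideal (A : comPzRingType) (P : set A) : Prop :=
  [/\ P 0, forall a b, P a -> P b -> P (a + b),
      forall a b, P b -> P (a * b), ~ P 1
    & forall a b, P (a * b) -> P a \/ P b].

Definition is_localization (A B : comPzRingType) (s : A) (f : A -> B) : Prop :=
  [/\ is_rmorph f,
      exists t, f s * t = 1,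
      forall b, exists n a, f s ^+ n * b = f a
    & forall a, f a = 0 -> exists n, s ^+ n * a = 0].

Definition generated_by (A : comPzRingType) (S : set A) : Prop :=
  forall P : set A, P 1 -> (forall a b, P a -> P b -> P (a - b)) ->
    (forall a b, P a -> P b -> P (a * b)) -> S `<=` P -> forall a, P a.

Definition finite_type (A B : comPzRingType) (f : A -> B) : Prop :=
  exists s : seq B, generated_by (range f `|` [set` s]).

(* P is the polynomial algebra A[x_0, ..., x_(n-1)].                          *)
Definition is_polynomial_algebra (A P : comPzRingType) (g : A -> P) (n : nat)
    (x : 'I_n -> P) : Prop :=
  is_rmorph g /\
  forall (C : comPzRingType) (u : {rmorphism A -> C}) (y : 'I_n -> C),
    exists2 h : {rmorphism P -> C},
      (forall a, h (g a) = u a) /\ (forall i, h (x i) = y i)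
    & forall h' : {rmorphism P -> C},
        (forall a, h' (g a) = u a) -> (forall i, h' (x i) = y i) -> h' =1 h.

Definition finite_presentation (A B : comPzRingType) (f : A -> B) : Prop :=
  exists (P : comPzRingType) (g : A -> P) (n : nat) (x : 'I_n -> P)
         (h : {rmorphism P -> B}) (s : seq P),
    [/\ is_polynomial_algebra g x,
        forall a, h (g a) = f a,
        forall b, exists p, h p = b
      & forall p, h p = 0 <->
          exists c : 'I_(size s) -> P, p = \sum_(k < size s) c k * s`_k].

(* The infinitesimal lifting problems of [f : A -> B]: a square-zero          *)
(* surjection [p : C -> D] and a commutative square [p \o u = v \o f].        *)
Definition lifting_problem (A B C D : comPzRingType) (f : A -> B)
    (p : {rmorphism C -> D}) (u : {rmorphism A -> C}) (v : {rmorphism B -> D})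
    : Prop :=
  [/\ forall d, exists c, p c = d,
      forall c c', p c = 0 -> p c' = 0 -> c * c' = 0
    & forall a, p (u a) = v (f a)].

Definition is_lift (A B C D : comPzRingType) (f : A -> B)
    (p : {rmorphism C -> D}) (u : {rmorphism A -> C}) (v : {rmorphism B -> D})
    (w : {rmorphism B -> C}) : Prop :=
  (forall b, p (w b) = v b) /\ (forall a, w (f a) = u a).

Definition formally_smooth (A B : comPzRingType) (f : A -> B) : Prop :=
  forall (C D : comPzRingType) p (u : {rmorphism A -> C}) (v : {rmorphism B -> D}),
    lifting_problem f p u v -> exists w, is_lift f p u v w.

Definition formally_etale (A B : comPzRingType) (f : A -> B) : Prop :=
  forall (C D : comPzRingType) p (u : {rmorphism A -> C}) (v : {rmorphism B -> D}),
    lifting_problem f p u v ->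
    exists2 w, is_lift f p u v w & forall w', is_lift f p u v w' -> w' =1 w.

(* Data of a space with a sheaf of F-algebras. Only the values of [sec] and   *)
(* [str] at open sets, and of [res U V] for open [V `<=` U], are meaningful.  *)
Record rspace (F : fieldType) := RSpace {
  pt :> topologicalType;
  sec : set pt -> comPzRingType;
  res : forall U V : set pt, sec U -> sec V;
  str : forall U : set pt, F -> sec U
}.

Arguments sec {F} r U.
Arguments res {F r} U V s.
Arguments str {F} r U c.

Section Schemes.
Variable F : fieldType.

Definition is_presheaf (X : rspace F) : Prop :=
  [/\ forall U V : set X, open U -> open V -> V `<=` U ->
        is_rmorph (@res F X U V),
      forall (U : set X) (s : sec X U), open U -> res U U s = s,
      forall (U V W : set X) (s : sec X U), open U -> open V -> open W ->
        W `<=` V -> V `<=` U -> res V W (res U V s) = res U W s,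
      forall U : set X, open U -> is_rmorph (str X U)
    & forall (U V : set X) c, open U -> open V -> V `<=` U ->
        res U V (str X U c) = str X V c].

Definition is_sheaf (X : rspace F) : Prop :=
  forall (C : set (set X)) (s : forall U, sec X U),
    (forall U, C U -> open U) ->
    (forall U V, C U -> C V -> res U (U `&` V) (s U) = res V (U `&` V) (s V)) ->
    exists! t : sec X (\bigcup_(U in C) U),
      forall U, C U -> res (\bigcup_(U in C) U) U t = s U.

(* The germ of [s] at [x] is a unit of the stalk. On a scheme, the negation   *)
(* says that [s] vanishes in the residue field of [x].                        *)
Definition unit_at (X : rspace F) (x : X) (U : set X) (s : sec X U) : Prop :=
  exists V : set X, [/\ open V, V x, V `<=` U
                      & exists t : sec X V, res U V s * t = 1].

Definition basic_open (X : rspace F) (U : set X) (s : sec X U) : set X :=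
  [set x | unit_at x s].

(* U is isomorphic to Spec (sec X U): x |-> {s | s vanishes at x} is a        *)
(* homeomorphism onto the prime spectrum, and the sections over the basic     *)
(* open set D(s) are the localization of sec X U at s. (Stalks are then       *)
(* localizations at primes, so that they are local rings.)                    *)
Definition affine (X : rspace F) (U : set X) : Prop :=
  [/\ open U,
      forall x, U x -> prime_ideal [set s : sec X U | ~ unit_at x s],
      forall P : set (sec X U), prime_ideal P ->
        exists! x, U x /\ P = [set s | ~ unit_at x s],
      forall (V : set X) x, open V -> V `<=` U -> V x ->
        exists2 s : sec X U, unit_at x s & basic_open s `<=` V
    & forall s : sec X U, is_localization s (@res F X U (basic_open s))].

Definition is_scheme (X : rspace F) : Prop :=
  [/\ is_presheaf X, is_sheaf X & forall x : X, exists2 U, affine U & U x].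

Record scheme := Scheme { rspace_of :> rspace F; schemeP : is_scheme rspace_of }.

Record shom (X Y : scheme) := SHom {
  hmap :> X -> Y;
  hopen : forall V, open V -> open (hmap @^-1` V);
  pull : forall V, open V -> sec Y V -> sec X (hmap @^-1` V);
  pull_rmorph : forall V (oV : open V), is_rmorph (pull oV);
  pull_res : forall U V (oU : open U) (oV : open V) s, V `<=` U ->
    pull oV (res U V s) = res (hmap @^-1` U) (hmap @^-1` V) (pull oU s);
  pull_str : forall V (oV : open V) c, pull oV (str Y V c) = str X (hmap @^-1` V) c;
  pull_local : forall V (oV : open V) x s,
    V (hmap x) -> unit_at x (pull oV s) -> unit_at (hmap x) s
}.

Section Composition.
Variables (X Y Z : scheme) (g : shom Y Z) (f : shom X Y).

Let m : X -> Z := fun x => g (f x).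
Let om V (oV : open V) : open (m @^-1` V) := hopen f (hopen g oV).
Let pl V (oV : open V) (s : sec Z V) : sec X (m @^-1` V) :=
  pull f (hopen g oV) (pull g oV s).

Let pl_rmorph V (oV : open V) : is_rmorph (pl oV).
Proof.
have [gB [g1 gM]] := pull_rmorph g oV.
have [fB [f1 fM]] := pull_rmorph f (hopen g oV).
split=> [s t|]; first by rewrite /pl gB fB.
by split=> [|s t]; rewrite /pl ?g1 ?f1 ?gM ?fM.
Qed.

Let pl_res U V (oU : open U) (oV : open V) s : V `<=` U ->
  pl oV (res U V s) = res (m @^-1` U) (m @^-1` V) (pl oU s).
Proof.
move=> sVU; rewrite /pl (pull_res g oU oV) // (pull_res f (hopen g oU)) //.
by move=> y /sVU.
Qed.

Let pl_str V (oV : open V) c : pl oV (str Z V c) = str X (m @^-1` V) c.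
Proof. by rewrite /pl !pull_str. Qed.

Let pl_local V (oV : open V) x s : V (m x) -> unit_at x (pl oV s) -> unit_at (m x) s.
Proof. by move=> Vx us; apply: (pull_local (oV := oV) Vx); apply: pull_local us. Qed.

Definition scomp : shom X Z := SHom om pl_rmorph pl_res pl_str pl_local.

End Composition.

Definition gsec (T : scheme) : comPzRingType := sec T setT.

Definition gpull (T' T : scheme) (h : shom T' T) : gsec T -> gsec T' :=
  pull h openT.

(* Diagonal a closed immersion, tested on the affine charts U x V of X x X.   *)
Definition separated (X : scheme) : Prop :=
  forall U V : set X, affine U -> affine V ->
    affine (U `&` V) /\
    generated_by (range (@res F X U (U `&` V)) `|` range (@res F X V (U `&` V))).

Definition separated_of_finite_type (X : scheme) : Prop :=
  [/\ separated X, compact [set: X]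
    & forall U : set X, affine U -> finite_type (str X U)].

Definition smooth (X : scheme) : Prop :=
  forall U : set X, affine U ->
    finite_presentation (str X U) /\ formally_smooth (str X U).

Definition etale (X Y : scheme) (f : shom X Y) : Prop :=
  forall (V : set Y) (U : set X) (oV : open V), affine V -> affine U ->
    U `<=` f @^-1` V ->
    finite_presentation (fun s => res (f @^-1` V) U (pull f oV s)) /\
    formally_etale (fun s => res (f @^-1` V) U (pull f oV s)).

(* A subgroup functor of GL_n, given by its points in 'M_n.                   *)
Definition mxfunctor (n : nat) := forall S : comPzRingType, set 'M[S]_n.

(* A right action of G on E; by Yoneda, an action of the group                *)
(* G(T) = G(Gamma(T, O_T)) on E(T) = shom T E, natural in the F-scheme T. The *)
(* value of [act] on matrices outside of G is irrelevant.                     *)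
Definition action_map (n : nat) (E : scheme) :=
  forall T : scheme, shom T E -> 'M[gsec T]_n -> shom T E.

Definition is_action n (G : mxfunctor n) (E : scheme) (act : action_map n E) : Prop :=
  [/\ forall (T : scheme) (e : shom T E), act T e 1%:M = e,
      forall (T : scheme) (e : shom T E) A B, G _ A -> G _ B ->
        act T (act T e A) B = act T e (A *m B)
    & forall (T T' : scheme) (h : shom T' T) (e : shom T E) A, G _ A ->
        act T' (scomp e h) (map_mx (gpull h) A) = scomp (act T e A) h].

(* E is a torsor over X in the étale topology. Equivalently E -> X is the     *)
(* quotient E / G of étale sheaves, the action of G on E being free.          *)
Definition is_torsor n (G : mxfunctor n) (E : scheme) (act : action_map n E)
    (X : scheme) (q : shom E X) : Prop :=
  [/\ is_action G act,
      forall (T : scheme) (e : shom T E) A, G _ A -> scomp q (act T e A) = scomp q e,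
      forall (T : scheme) (e e' : shom T E), scomp q e = scomp q e' ->
        exists! A, G _ A /\ act T e A = e'
    & exists (U : scheme) (j : shom U X) (l : shom U E),
        [/\ etale j, forall x, exists u, j u = x & scomp q l = j]].

Definition codim_ge (X : scheme) (x : X) (n : nat) : Prop :=
  exists c : nat -> X, c 0%N = x /\
    forall k, (k < n)%N -> closure [set c k.+1] (c k) /\ c k <> c k.+1.

(* The codimension of the integral closed subscheme closure {x}.              *)
Definition codim (X : scheme) (x : X) (n : nat) : Prop :=
  codim_ge x n /\ ~ codim_ge x n.+1.

(* Ideals of the stalk at x, as families of sets of sections closed under     *)
(* passage to smaller neighbourhoods of x.                                    *)
Definition germ_ideal (X : scheme) (x : X) (I : forall U, set (sec X U)) : Prop :=
  [/\ forall (U V : set X) s, open U -> open V -> V `<=` U -> V x ->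
        (I U s <-> I V (res U V s)),
      forall U, open U -> U x -> I U 0,
      forall U s t, open U -> U x -> I U s -> I U t -> I U (s + t)
    & forall U s t, open U -> U x -> I U t -> I U (s * t)].

(* W = closure {w} with its reduced structure, x a point of W, and a a        *)
(* section near x: there are ideals I_0 < ... < I_n of O_{X,x} that contain   *)
(* the ideal of W and the germ of a; that is, O_{W,x}/(a) has length >= n.    *)
Definition length_ge (X : scheme) (w x : X) (U : set X) (a : sec X U) (n : nat)
    : Prop :=
  exists I : nat -> forall V, set (sec X V),
    (forall k, (k <= n)%N ->
       [/\ germ_ideal x (I k), I k U a
         & forall V (s : sec X V), open V -> V x -> ~ unit_at w s -> I k V s]) /\
    (forall k, (k < n)%N ->
       (forall V, open V -> V x -> I k V `<=` I k.+1 V) /\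
       exists V (s : sec X V), [/\ open V, V x, I k.+1 V s & ~ I k V s]).

Definition ord_length (X : scheme) (w x : X) (U : set X) (a : sec X U) (n : nat) : Prop :=
  length_ge w x a n /\ ~ length_ge w x a n.+1.

(* The order n at x of the rational function r on closure {w} defined by the  *)
(* germ at w of f: one has r = a / b with a, b nonzero in O_{W,x}, and        *)
(* n = length (O_{W,x}/(a)) - length (O_{W,x}/(b)).                           *)
Definition order_at (X : scheme) (w x : X) (U : set X) (f : sec X U) (n : int) : Prop :=
  exists (V : set X) (a b : sec X V) (la lb : nat),
    [/\ open V /\ V x, unit_at w a /\ unit_at w b,
        ~ unit_at w (res V (U `&` V) b * res U (U `&` V) f - res V (U `&` V) a),
        ord_length w x a la /\ ord_length w x b lb
      & n = la%:Z - lb%:Z].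

Definition codim_pt (X : scheme) (i : nat) := {x : X | `[< codim x i >]}.

Definition cycles (X : scheme) (i : nat) := {freeg (codim_pt X i) / int}.

(* To be used with w of codimension i - 1, so that a point of codimension i   *)
(* on closure {w} has codimension 1 in it.                                    *)
Definition is_div (X : scheme) (i : nat) (w : X) (U : set X) (f : sec X U)
    (c : cycles X i) : Prop :=
  forall y : codim_pt X i,
    (closure [set w] (val y) -> order_at w (val y) f (coeff y c)) /\
    (~ closure [set w] (val y) -> coeff y c = 0).

Definition principal_cycle (X : scheme) (i : nat) (c : cycles X i) : Prop :=
  exists (j : nat) (w : X) (U : set X) (f : sec X U),
    [/\ i = j.+1, codim w j, open U, unit_at w f & is_div w f c].

Definition rat_triv (X : scheme) (i : nat) : {pred cycles X i} :=
  fun c => `[< forall P : set (cycles X i), P 0 ->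
                 (forall a b, P a -> P b -> P (a - b)) ->
                 (forall a, principal_cycle a -> P a) -> P c >].

Lemma rat_triv_zmod_closed X i : zmod_closed (@rat_triv X i).
Proof.
split=> [|a b]; rewrite !unfold_in; first exact: asboolT.
move=> /asboolP Pa /asboolP Pb; apply/asboolP => P P0 PB Pd.
exact: PB (Pa P P0 PB Pd) (Pb P P0 PB Pd).
Qed.

HB.instance Definition _ X i :=
  GRing.isZmodClosed.Build (cycles X i) (@rat_triv X i) (@rat_triv_zmod_closed X i).

Definition CH (i : nat) (X : scheme) : zmodType := Quotient.quot (@rat_triv X i).

End Schemes.

Definition zmod_iso (A B : zmodType) : Prop :=
  exists f : {additive A -> B}, bijective f.

(* Split octonions as Zorn vector matrices (a, v; w, b), stored as the row    *)
(* vector (a, v, w, b) of length 8.                                           *)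
Section Zorn.
Variable S : comPzRingType.
Implicit Types (x y : 'rV[S]_((1 + 3) + (3 + 1))) (v w : 'rV[S]_3).

Definition zorn (a : S) v w (b : S) : 'rV[S]_((1 + 3) + (3 + 1)) :=
  row_mx (row_mx a%:M v) (row_mx w b%:M).

Definition zornA x : S := lsubmx (lsubmx x) 0 0.
Definition zornV x : 'rV[S]_3 := rsubmx (lsubmx x).
Definition zornW x : 'rV[S]_3 := lsubmx (rsubmx x).
Definition zornB x : S := rsubmx (rsubmx x) 0 0.

Definition dot v w : S := (v *m w^T) 0 0.

Definition cross v w : 'rV[S]_3 :=
  \row_(i < 3) (v 0 (i + 1) * w 0 (i + 2) - v 0 (i + 2) * w 0 (i + 1)).

Definition zorn_mul x y : 'rV[S]_((1 + 3) + (3 + 1)) :=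
  zorn (zornA x * zornA y + dot (zornV x) (zornW y))
       (zornA x *: zornV y + zornB y *: zornV x - cross (zornW x) (zornW y))
       (zornA y *: zornW x + zornB x *: zornW y + cross (zornV x) (zornV y))
       (zornB x * zornB y + dot (zornW x) (zornV y)).

Definition zorn_norm x : S := zornA x * zornB x - dot (zornV x) (zornW x).

End Zorn.

(* The split group of type G_2, as automorphism group of the split octonions. *)
Definition G2 : mxfunctor ((1 + 3) + (3 + 1)) := fun S =>
  [set A | (exists B, A *m B = 1%:M /\ B *m A = 1%:M) /\
           forall x y, zorn_mul (x *m A) (y *m A) = zorn_mul x y *m A].

(* g acts by (a, v; w, b) |-> (a, v g; w g^-T, b), where g^-1 = \adj g. The   *)
(* weights of v are short roots of G_2 that sum to 0, and the roots of SL_3   *)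
(* are their differences, which are the long roots.                           *)
Definition SL3 : mxfunctor ((1 + 3) + (3 + 1)) := fun S =>
  [set A | exists2 g : 'M[S]_3, \det g = 1 &
     A = block_mx (block_mx 1%:M 0 0 g) 0 0 (block_mx (\adj g)^T 0 0 1%:M)].

Section ZornLemmas.
Variable S : comPzRingType.
Implicit Types x y : 'rV[S]_((1 + 3) + (3 + 1)).

Lemma zorn_decomp x : x = zorn (zornA x) (zornV x) (zornW x) (zornB x).
Proof. by rewrite /zorn /zornA /zornB -!mx11_scalar !hsubmxK. Qed.

Lemma zornK a v w b : let z := zorn a v w b in
  [/\ @zornA S z = a, zornV z = v, zornW z = w & zornB z = b].
Proof.
by rewrite /zornA /zornV /zornW /zornB /zorn !(row_mxKl, row_mxKr) !mxE eqxx.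
Qed.

Lemma zorn_mulE (a a' b b' : S) v v' w w' :
  zorn_mul (zorn a v w b) (zorn a' v' w' b') =
  zorn (a * a' + dot v w') (a *: v' + b' *: v - cross w w')
       (a' *: w + b *: w' + cross v v') (b * b' + dot w v').
Proof.
by rewrite /zorn_mul; have [-> -> -> ->] := zornK a v w b;
  have [-> -> -> ->] := zornK a' v' w' b'.
Qed.

Lemma sum3 (f : 'I_3 -> S) : \sum_i f i = f 0 + f 1 + f 2%R.
Proof.
rewrite !big_ord_recl big_ord0 addr0 addrA.
by congr (f _ + f _ + f _); apply: val_inj.
Qed.

Lemma dotE (v w : 'rV[S]_3) :
  dot v w = v 0 0 * w 0 0 + v 0 1 * w 0 1 + v 0 2%R * w 0 2%R.
Proof. by rewrite /dot mxE sum3 !mxE. Qed.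

Lemma crossE (v w : 'rV[S]_3) :
  [/\ cross v w 0 0 = v 0 1 * w 0 2%R - v 0 2%R * w 0 1,
      cross v w 0 1 = v 0 2%R * w 0 0 - v 0 0 * w 0 2%R
    & cross v w 0 2%R = v 0 0 * w 0 1 - v 0 1 * w 0 0].
Proof.
by split; rewrite !mxE; congr (v _ _ * w _ _ - v _ _ * w _ _); apply: val_inj.
Qed.

Lemma adj3E (g : 'M[S]_3) i j : \adj g j i =
  g (i + 1) (j + 1) * g (i + 2%R) (j + 2%R) - g (i + 1) (j + 2%R) * g (i + 2%R) (j + 1).
Proof.
pose G (m n : nat) : S := g (inord m) (inord n).
have gE k l : g k l = G k l by rewrite /G !inord_val.
rewrite mxE /cofactor (expand_det_row _ 0) big_ord_recl big_ord1 /cofactor !det_mx11 !mxE !gE.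
move: G gE => G _.
have eqs : (1 %% 3 = 1)%N * (2 %% 3 = 2)%N * (3 %% 3 = 0)%N * (4 %% 3 = 1)%N by [].
case: i => [[|[|[|//]]] ?]; case: j => [[|[|[|//]]] ?];
rewrite !lift0 /= /bump /= ?(expr0, expr1, exprS, mul1r, mulN1r, opprK, mulr1);
rewrite ?(eqs, add0n, addn0, addSn); generalize (G 0 0)%N (G 0 1)%N (G 0 2)%N
  (G 1 0)%N (G 1 1)%N (G 1 2)%N (G 2 0)%N (G 2 1)%N (G 2 2)%N => *; ring.
Qed.

(* The octonions so defined form a composition algebra.                       *)
Lemma zorn_normM x y : zorn_norm (zorn_mul x y) = zorn_norm x * zorn_norm y.
Proof.
rewrite /zorn_norm /zorn_mul.
have [-> -> -> ->] := zornK (zornA x * zornA y + dot (zornV x) (zornW y))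
       (zornA x *: zornV y + zornB y *: zornV x - cross (zornW x) (zornW y))
       (zornA y *: zornW x + zornB x *: zornW y + cross (zornV x) (zornV y))
       (zornB x * zornB y + dot (zornW x) (zornV y)).
have [c0 c1 c2] := crossE (zornW x) (zornW y).
have [d0 d1 d2] := crossE (zornV x) (zornV y).
move: (cross _ _) (cross _ _) c0 c1 c2 d0 d1 d2 => c d c0 c1 c2 d0 d1 d2.
move: (zornV x) (zornW x) (zornV y) (zornW y) c0 c1 c2 d0 d1 d2 => vx wx vy wy c0 c1 c2 d0 d1 d2.
rewrite !dotE !mxE c0 c1 c2 d0 d1 d2.
ring.
Qed.

Lemma mul_zorn a v w b (g h : 'M[S]_3) :
  zorn a v w b *m block_mx (block_mx 1%:M 0 0 g) 0 0 (block_mx h 0 0 1%:M)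
  = zorn a (v *m g) (w *m h) b.
Proof.
by rewrite /zorn !mul_row_block !mulmx0 !addr0 !add0r !mulmx1.
Qed.

Lemma cross_mul (v w : 'rV[S]_3) (g : 'M[S]_3) :
  cross (v *m g) (w *m g) = cross v w *m (\adj g)^T.
Proof.
have [c0 c1 c2] := crossE v w.
apply/rowP => j; rewrite [RHS]mxE sum3 c0 c1 c2 ![_^T _ _]mxE !adj3E !mxE !sum3.
have [-> -> ->] : [/\ 0 + 1 = 1 :> 'I_3, 0 + 2%R = 2%R :> 'I_3 & 1 + 1 = 2%R :> 'I_3].
  by split; apply: val_inj.
have [-> -> ->] : [/\ 1 + 2%R = 0 :> 'I_3, 2%R + 1 = 0 :> 'I_3 & 2%R + 2%R = 1 :> 'I_3].
  by split; apply: val_inj.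
ring.
Qed.

Lemma SL3_G2 : SL3 (S := S) `<=` G2 (S := S).
Proof.
move=> A [g dg ->].
have gh : g *m \adj g = 1%:M by rewrite mul_mx_adj dg.
have hg : \adj g *m g = 1%:M by rewrite mul_adj_mx dg.
split.
  exists (block_mx (block_mx 1%:M 0 0 (\adj g)) 0 0 (block_mx g^T 0 0 1%:M)).
  have one n1 n2 : block_mx 1%:M 0 0 1%:M = 1%:M :> 'M[S]_(n1 + n2).
    by rewrite -scalar_mx_block.
  by split; rewrite !mulmx_block !(mulmx0, mul0mx, addr0, add0r, mulmx1)
     -?trmx_mul ?gh ?hg ?trmx1 ?one.
set h := (\adj g)^T.
have dotgh v w : dot (v *m g) (w *m h) = dot v w.
  by rewrite /dot trmx_mul trmxK mulmxA -(mulmxA v) gh mulmx1.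
have dh : \det h = 1.
  by have := congr1 (fun M => \det M) gh; rewrite det_mulmx det1 dg mul1r det_tr.
have adjh : (\adj h)^T = g.
  apply: trmx_inj; rewrite trmxK -[LHS]mulmx1.
  have <- : h *m g^T = 1%:M by rewrite -trmx_mul gh trmx1.
  by rewrite mulmxA mul_adj_mx dh mul1mx.
move=> x y; rewrite [x]zorn_decomp [y]zorn_decomp [in RHS]zorn_mulE.
rewrite !mul_zorn -/h zorn_mulE !dotgh !cross_mul adjh.
have doth v w : dot (v *m h) (w *m g) = dot v w.
  by rewrite /dot trmx_mul mulmxA -(mulmxA v) -trmx_mul gh trmx1 mulmx1.
by rewrite doth !mulmxDl mulNmx !scalemxAl.
Qed.
End ZornLemmas.

(* Main.v *)
Require Import Defs.
From HB Require Import structures.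
From mathcomp Require Import all_boot all_order all_algebra.
From mathcomp Require Import ring zify.
From mathcomp Require Import all_classical topology freeg.

(* The torsor is trivial. X is the punctured cone x1 y1 + x2 y2 = z^2, times
 the multiplicative group with coordinate h, and E = X x G2. As SL3 is the
 stabilizer in G2 of an idempotent e0, and the orbit of e0 consists of all
 idempotents (a, v; w, b) of trace 1 and norm 0, the quotient R = E / SL3
 consists of the pairs of a point of the punctured cone and a Zorn matrix
 of norm 0 and invertible trace h = a + b, via (x, h, g) |-> (x, h e0 g^-1).
 Upper bound: R is covered by strata that are open in affine spaces, so
 that CH(R) is generated by the generic points of the strata, and divisors
 of coordinates leave the classes 1, P (x1 = x2 = z = 0), T (a = v = 0) and
 P T, with 2 P = div x2 since z is a local parameter along P.
 Lower bound: R is open in Spec B. A function of B-modules that is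
 additive in extensions, and vanishes on B / p if p has codimension > i or
 lies outside R, factors through CH^i. Such functions are obtained from
 lengths at a maximal ideal. The quadrics ab - v.w and z^2 - x1 y1 - x2 y2
 have matrix factorizations (f, g), whose Herbrand quotient
 lam(ker f / im g) - lam(ker g / im f) is additive; for the second one
 f = g, and already lam(ker f / im f) is additive mod 2. It vanishes on
 modules killed by x1, .., z, and on modules killed by a + b by symmetry. *)

Set Implicit Arguments.
Unset Strict Implicit.
Unset Printing Implicit Defensive.

Import GRing.Theory.
Local Open Scope classical_set_scope.
Local Open Scope ring_scope.

(** The base is chosen for its Chow ring. The punctured cone is a line bundle without its zero
    section over a split projective quadric of dimension 3, so its Chow ring is that of the quadric
    modulo the hyperplane class H: Z in degree 0 and Z/2 in degree 2, as H^2 is twice the class of a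
    line and H times a line is a point. The fibre G2/SL3 is the affine quadric ab = v.w, a + b = 1,
    with Z in degrees 0 and 3. The coordinate h does not change Chow groups. It makes R part of a
    product of two cones, so that lengths can be taken at closed points outside of R where a cone is
    singular; R itself is smooth. An additive function is zero on B/(p, f), f not in p, by the
    multiplication by f on B/p; this is why it respects rational equivalence. Additivity forces
    two-periodic homology in place of a quotient, and Koszul homology in place of the restriction to
    a subscheme. Codimension is defined by chains of points, so both bounds rest on the heights of
    primes in polynomial rings, found by induction on the variables. *)

Local Notation cring := comPzRingType.

(** * Quotients of setoid rings *)

Record preRing := PreRing {
 pcar :> Type;
 peq : pcar -> pcar -> Prop;
 pzero : pcar; pone : pcar;
 padd : pcar -> pcar -> pcar; pmul : pcar -> pcar -> pcar; popp : pcar -> pcar;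
 peq_refl : forall x, peq x x;
 peq_sym : forall x y, peq x y -> peq y x;
 peq_trans : forall x y z, peq x y -> peq y z -> peq x z;
 padd_eq : forall x x' y y', peq x x' -> peq y y' -> peq (padd x y) (padd x' y');
 pmul_eq : forall x x' y y', peq x x' -> peq y y' -> peq (pmul x y) (pmul x' y');
 popp_eq : forall x x', peq x x' -> peq (popp x) (popp x');
 paddA : forall x y z, peq (padd x (padd y z)) (padd (padd x y) z);
 paddC : forall x y, peq (padd x y) (padd y x);
 padd0 : forall x, peq (padd pzero x) x;
 paddN : forall x, peq (padd (popp x) x) pzero;
 pmulA : forall x y z, peq (pmul x (pmul y z)) (pmul (pmul x y) z);
 pmulC : forall x y, peq (pmul x y) (pmul y x);
 pmul1 : forall x, peq (pmul pone x) x;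
 pmulD : forall x y z, peq (pmul (padd x y) z) (padd (pmul x z) (pmul y z))
}.

Section Quo.
Variable P : preRing.

(** Two kinds of rings are built this way: terms modulo equality in all models, and local fractions
    modulo equality of germs. A class is a predicate, so that extensionality identifies equivalent
    elements, and choice gives back representatives. *)
Definition quo := {c : set P | exists x, c = peq x}.

Definition qpi (x : P) : quo := exist _ (peq x) (ex_intro _ x erefl).

Lemma qpiP x y : qpi x = qpi y <-> peq x y.
split=> [[exy]|exy]; first by rewrite exy; exact: peq_refl.
apply: eq_exist; apply/funext=> z; apply/propext; split.
 by apply: peq_trans; apply: peq_sym.
exact: peq_trans.
Qed.
Lemma qpi_surj q : exists x, q = qpi x.
by case: q=> c [x xc]; exists x; apply: eq_exist. Qed.

Definition qrep q : P := sval (cid (qpi_surj q)).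
Lemma qrepK q : qpi (qrep q) = q.
by rewrite /qrep; case: cid. Qed.
Lemma qrepP x : peq (qrep (qpi x)) x.
by apply/qpiP; rewrite qrepK. Qed.

HB.instance Definition _ := gen_eqMixin quo.
HB.instance Definition _ := gen_choiceMixin quo.

Definition qadd q r := qpi (padd (qrep q) (qrep r)).
Definition qmul q r := qpi (pmul (qrep q) (qrep r)).
Definition qopp q := qpi (popp (qrep q)).

Lemma qaddE x y : qadd (qpi x) (qpi y) = qpi (padd x y).
by apply/qpiP; apply: padd_eq; apply: qrepP. Qed.
Lemma qmulE x y : qmul (qpi x) (qpi y) = qpi (pmul x y).
by apply/qpiP; apply: pmul_eq; apply: qrepP. Qed.
Lemma qoppE x : qopp (qpi x) = qpi (popp x).
by apply/qpiP; apply: popp_eq; apply: qrepP. Qed.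
Lemma qaddA : associative qadd.
move=> a b c; have [[[x ->] [y ->]] [z ->]] := (qpi_surj a, qpi_surj b, qpi_surj c).
by rewrite !qaddE; apply/qpiP; apply: paddA.
Qed.
Lemma qaddC : commutative qadd.
move=> a b.
by apply/qpiP; apply: paddC.
Qed.
Lemma qadd0 : left_id (qpi (pzero P)) qadd.
by move=> a; have [x ->] := qpi_surj a; rewrite !qaddE; apply/qpiP; apply: padd0. Qed.
Lemma qaddN : left_inverse (qpi (pzero P)) qopp qadd.
by move=> a; have [x ->] := qpi_surj a; rewrite !(qaddE, qoppE); apply/qpiP; apply: paddN. Qed.
Lemma qmulA : associative qmul.
move=> a b c; have [[[x ->] [y ->]] [z ->]] := (qpi_surj a, qpi_surj b, qpi_surj c).
by rewrite !qmulE; apply/qpiP; apply: pmulA.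
Qed.
Lemma qmulC : commutative qmul.
move=> a b.
by apply/qpiP; apply: pmulC.
Qed.
Lemma qmul1 : left_id (qpi (pone P)) qmul.
by move=> a; have [x ->] := qpi_surj a; rewrite !qmulE; apply/qpiP; apply: pmul1. Qed.
Lemma qmulD : left_distributive qmul qadd.
move=> a b c; have [[[x ->] [y ->]] [z ->]] := (qpi_surj a, qpi_surj b, qpi_surj c).
by rewrite !(qmulE, qaddE); apply/qpiP; apply: pmulD.
Qed.

HB.instance Definition _ := GRing.isZmodule.Build quo qaddA qaddC qadd0 qaddN.
HB.instance Definition _ := GRing.Zmodule_isComPzRing.Build quo qmulA qmulC qmul1 qmulD.

Lemma qpiD x y : qpi (padd x y) = qpi x + qpi y. by rewrite -qaddE. Qed.
Lemma qpiM x y : qpi (pmul x y) = qpi x * qpi y. by rewrite -qmulE. Qed.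
Lemma qpiN x : qpi (popp x) = - qpi x. by rewrite -qoppE. Qed.

End Quo.

Section RMorph.
Variables (A B : cring).

Lemma rmD (f : A -> B) : is_rmorph f -> {morph f : x y / x + y}.
move=> [fB _] x y; have f0: f 0 = 0 by rewrite -(subrr 0) fB subrr.
have fN z: f (- z) = - f z by rewrite -sub0r fB f0 sub0r.
by rewrite -{1}[y]opprK fB fN opprK.
Qed.
Lemma rmB (f : A -> B) : is_rmorph f -> {morph f : x y / x - y}.
by move=> [fB _]. Qed.
Lemma rm0 (f : A -> B) : is_rmorph f -> f 0 = 0.
by move=> [fB _]; rewrite -(subrr 0) fB subrr. Qed.
Lemma rmN (f : A -> B) : is_rmorph f -> {morph f : x / - x}.
by move=> fm x; rewrite -sub0r rmB // rm0 // sub0r. Qed.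
Lemma rm1 (f : A -> B) : is_rmorph f -> f 1 = 1.
by move=> [_ [f1 _]]. Qed.
Lemma rmM (f : A -> B) : is_rmorph f -> {morph f : x y / x * y}.
by move=> [_ [_ fM]]. Qed.
Lemma rmX (f : A -> B) n : is_rmorph f -> {morph f : x / x ^+ n}.
by move=> fm x; elim: n=> [|n IH]; rewrite ?rm1 // !exprS rmM // IH. Qed.
Lemma rm_sum (f : A -> B) (I : Type) (r : seq I) (P : pred I) (G : I -> A) :
 is_rmorph f -> f (\sum_(i <- r | P i) G i) = \sum_(i <- r | P i) f (G i).
by move=> fm; apply: (big_morph f (rmD fm) (rm0 fm)). Qed.

Definition mkrm (f : A -> B) (fm : is_rmorph f) : {rmorphism A -> B} :=
 HB.pack_for (GRing.RMorphism.type A B) f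
 (GRing.isZmodMorphism.Build A B f (fst fm)) (GRing.isMonoidMorphism.Build A B f (snd fm)).

Lemma rm_of (f : {rmorphism A -> B}) : is_rmorph f.
by split=> [x y|]; [exact: rmorphB | split=> [|x y]; [exact: rmorph1 | exact: rmorphM]]. Qed.

End RMorph.

Lemma rm_comp (A B C : cring) (f : A -> B) (g : B -> C) : is_rmorph f -> is_rmorph g -> is_rmorph (g \o f).
move=> fm gm; split=> [x y|] /=; first by rewrite (rmB fm) (rmB gm).
by split=> [|x y] /=; rewrite ?(rm1 fm, rm1 gm, rmM fm, rmM gm).
Qed.
Lemma rm_id (A : cring) : is_rmorph (@id A).
by []. Qed.

(** * Universal algebras of solutions *)

Inductive term (F I : Type) :=
 | TVar (i : I) | TConst (c : F) | TAdd (t u : term F I) | TMul (t u : term F I)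
 | TOpp (t : term F I).

Section Solutions.
Variables (F : cring) (I : Type).

Fixpoint tev (S : cring) (j : F -> S) (c : I -> S) (t : term F I) : S :=
 match t with
 | TVar i=> c i
 | TConst a=> j a
 | TAdd t u=> tev j c t + tev j c u
 | TMul t u=> tev j c t * tev j c u
 | TOpp t=> - tev j c t
 end.

Variable Sol : forall S : cring, (F -> S) -> (I -> S) -> Prop.

(** Equality is semantic, not generated by relations: the ring laws are inherited from the models,
    and no ideal of relations has to be handled. *)
Definition teq (t u : term F I) : Prop :=
 forall (S : cring) (j : F -> S) (c : I -> S),
 is_rmorph j -> Sol j c -> tev j c t = tev j c u.

Lemma teq_trans t u v : teq t u -> teq u v -> teq t v.
by move=> tu uv S j c jm sc; rewrite tu // uv. Qed.

Definition usol_pre : preRing.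
apply: (@PreRing (term F I) teq (TConst _ 0) (TConst _ 1) (@TAdd F I) (@TMul F I) (@TOpp F I)).
- by [].
- by move=> t u tu S j c jm sc; rewrite tu.
- exact: teq_trans.
- by move=> t t' u u' tt' uu' S j c jm sc /=; rewrite tt' // uu'.
- by move=> t t' u u' tt' uu' S j c jm sc /=; rewrite tt' // uu'.
- by move=> t t' tt' S j c jm sc /=; rewrite tt'.
- by move=> t u v S j c jm sc /=; rewrite addrA.
- by move=> t u S j c jm sc /=; rewrite addrC.
- by move=> t S j c jm sc /=; rewrite (rm0 jm) add0r.
- by move=> t S j c jm sc /=; rewrite (rm0 jm) addNr.
- by move=> t u v S j c jm sc /=; rewrite mulrA.
- by move=> t u S j c jm sc /=; rewrite mulrC.
- by move=> t S j c jm sc /=; rewrite (rm1 jm) mul1r.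
- by move=> t u v S j c jm sc /=; rewrite mulrDl.
Defined.

(* The universal F-algebra with a point of Sol, provided that Sol is given by
 equations. *)
Definition usol : cring := quo usol_pre.

Definition uterm (t : term F I) : usol := qpi (P := usol_pre) t.
Definition ustr (a : F) : usol := uterm (TConst I a).
Definition ugen (i : I) : usol := uterm (TVar F i).

Lemma utermD t u : uterm (TAdd t u) = uterm t + uterm u.
exact: (qpiD _). Qed.
Lemma utermM t u : uterm (TMul t u) = uterm t * uterm u.
exact: (qpiM _). Qed.
Lemma utermN t : uterm (TOpp t) = - uterm t.
exact: (qpiN _). Qed.
Lemma ustr_rm : is_rmorph ustr.
split=> [x y|]; first rewrite -utermN -utermD.
 by apply/qpiP=> S j c jm sc /=; rewrite (rmB jm).
split=> // x y; rewrite -utermM.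
by apply/qpiP=> S j c jm sc /=; rewrite (rmM jm).
Qed.
Lemma usol_ind (Q : usol -> Prop) :
 (forall a, Q (ustr a)) -> (forall i, Q (ugen i)) ->
 (forall a b, Q a -> Q b -> Q (a + b)) -> (forall a b, Q a -> Q b -> Q (a * b)) ->
 (forall a, Q a -> Q (- a)) -> forall a, Q a.
move=> Qc Qv QD QM QN a; have [t ->] := qpi_surj a.
elim: t=> [i|c|t Qt u Qu|t Qt u Qu|t Qt]; [exact: Qv|exact: Qc| | |].
- by rewrite [qpi _]utermD; apply: QD.
- by rewrite [qpi _]utermM; apply: QM.
- by rewrite [qpi _]utermN; apply: QN.
Qed.
Lemma usol_ext (S : cring) (f g : usol -> S) : is_rmorph f -> is_rmorph g ->
 (forall a, f (ustr a) = g (ustr a)) -> (forall i, f (ugen i) = g (ugen i)) -> f =1 g.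
move=> fm gm fgc fgv; apply: usol_ind=> //.
- by move=> a b fa fb; rewrite (rmD fm) (rmD gm) fa fb.
- by move=> a b fa fb; rewrite (rmM fm) (rmM gm) fa fb.
- by move=> a fa; rewrite (rmN fm) (rmN gm) fa.
Qed.

Section Eval.
Variables (S : cring) (j : F -> S) (c : I -> S).
Hypotheses (jm : is_rmorph j) (sc : Sol j c).

Definition uev (a : usol) : S := tev j c (qrep a).

Lemma uev_term t : uev (uterm t) = tev j c t.
exact: (qrepP (P := usol_pre) t). Qed.
Lemma uev_rm : is_rmorph uev.
split=> [a b|].
 have [[x ->] [y ->]] := (qpi_surj a, qpi_surj b).
 by rewrite -utermN -utermD !uev_term.
split=> [|a b]; first by rewrite (uev_term _) /= (rm1 jm).
have [[x ->] [y ->]] := (qpi_surj a, qpi_surj b).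
by rewrite -utermM !uev_term.
Qed.
Lemma uev_str a : uev (ustr a) = j a. exact: uev_term. Qed.
Lemma uev_gen i : uev (ugen i) = c i. exact: uev_term. Qed.

End Eval.

(** This is how the generators are shown to be a solution themselves: their equations hold because
    they hold at every solution. *)
Lemma usol_sep (a b : usol) :
 (forall (S : cring) (j : F -> S) (c : I -> S), is_rmorph j -> Sol j c ->
 uev j c a = uev j c b) -> a = b.
have [[x ->] [y ->]] := (qpi_surj a, qpi_surj b)=> H.
by apply/qpiP=> S j c jm sc; have := H S j c jm sc; rewrite !uev_term.
Qed.

End Solutions.

(** * Open subschemes of spectra *)

Section Fractions.
Variables (A : cring) (p : set A).
Hypothesis pp : prime_ideal p.

Lemma prime0 : p 0. by case: pp. Qed.
Lemma primeD a b : p a -> p b -> p (a + b). by case: pp=> _ + _ _ _; apply. Qed.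
Lemma primeMl a b : p b -> p (a * b). by case: pp=> _ _ + _ _; apply. Qed.
Lemma primeMr a b : p a -> p (a * b). by rewrite mulrC; apply: primeMl. Qed.
Lemma prime1 : ~ p 1. by case: pp. Qed.
Lemma primeM a b : p (a * b) -> p a \/ p b. by case: pp=> _ _ _ _; apply. Qed.
Lemma primeN a : p a -> p (- a). by rewrite -mulN1r; apply: primeMl. Qed.
Lemma primeB a b : p a -> p b -> p (a - b).
by move=> pa pb; apply: primeD=> //; apply: primeN. Qed.
Lemma primenM a b : ~ p a -> ~ p b -> ~ p (a * b).
by move=> pa pb /primeM[]. Qed.
Lemma primeX a n : p (a ^+ n) -> p a.
by elim: n=> [/prime1//|n IH]; rewrite exprS=> /primeM[//|/IH]. Qed.
Lemma primenX a n : ~ p a -> ~ p (a ^+ n).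
by move=> na /primeX. Qed.
Lemma prime_sum (J : Type) (r : seq J) (P : pred J) (G : J -> A) :
 (forall i, P i -> p (G i)) -> p (\sum_(i <- r | P i) G i).
by move=> H; elim/big_ind: _=> //; [exact: prime0 | exact: primeD]. Qed.

(** Pairs (numerator, denominator) are compared in the localization at [p]; the factor [u] accounts
    for zero divisors. *)
Definition feq (x y : A * A) : Prop :=
 exists2 u, ~ p u & u * (x.1 * y.2 - y.1 * x.2) = 0.

Lemma feq_refl x : feq x x.
by exists 1; [exact: prime1 | rewrite subrr mulr0]. Qed.
Lemma feq_sym x y : feq x y -> feq y x.
by move=> [u pu e]; exists u=> //; rewrite -[LHS]opprK -mulrN opprB e oppr0. Qed.
Lemma feq_trans x y z : ~ p y.2 -> feq x y -> feq y z -> feq x z.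
move=> py [u pu e] [v pv e']; exists (u * v * y.2); first by do ?apply: primenM.
have -> : u * v * y.2 * (x.1 * z.2 - z.1 * x.2) =
 v * z.2 * (u * (x.1 * y.2 - y.1 * x.2)) + u * x.2 * (v * (y.1 * z.2 - z.1 * y.2)) by ring.
by rewrite e e' !mulr0 addr0.
Qed.
Lemma feq_unit x y : ~ p x.2 -> feq x y -> p x.1 -> p (y.1).
move=> px [u pu e] px1.
have e': u * (x.1 * y.2) = u * (y.1 * x.2) by apply/eqP; rewrite -subr_eq0 -mulrBr e.
have : p (u * (y.1 * x.2)) by rewrite -e'; apply/primeMl/primeMr.
by move=> /primeM[//|/primeM[]].
Qed.

Definition fadd (x y : A * A) := (x.1 * y.2 + y.1 * x.2, x.2 * y.2).
Definition fmul (x y : A * A) := (x.1 * y.1, x.2 * y.2).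
Definition fopp (x : A * A) := (- x.1, x.2).

Lemma feqD x x' y y' : feq x x' -> feq y y' -> feq (fadd x y) (fadd x' y').
move=> [u pu e] [v pv e']; exists (u * v); first exact: primenM.
rewrite /=; transitivity (v * y.2 * y'.2 * (u * (x.1 * x'.2 - x'.1 * x.2)) +
 u * x.2 * x'.2 * (v * (y.1 * y'.2 - y'.1 * y.2))); first by ring.
by rewrite e e' !mulr0 addr0.
Qed.
Lemma feqM x x' y y' : feq x x' -> feq y y' -> feq (fmul x y) (fmul x' y').
move=> [u pu e] [v pv e']; exists (u * v); first exact: primenM.
rewrite /=; transitivity (v * y.1 * y'.2 * (u * (x.1 * x'.2 - x'.1 * x.2)) +
 u * x'.1 * x.2 * (v * (y.1 * y'.2 - y'.1 * y.2))); first by ring.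
by rewrite e e' !mulr0 addr0.
Qed.
Lemma feqN x x' : feq x x' -> feq (fopp x) (fopp x').
move=> [u pu e]; exists u=> //=.
by rewrite -[RHS]oppr0 -e; ring.
Qed.
Lemma feqE x y : x.1 * y.2 = y.1 * x.2 -> feq x y.
by move=> e; exists 1; [exact: prime1 | rewrite e subrr mulr0]. Qed.

End Fractions.

(** The union of the opens D(x) of Spec A, for x in [r]. The base, the torsor, the quotient and its
    étale cover are all of this quasi-affine form, although the punctured cone is not affine. *)
Definition qapt (A : cring) (r : seq A) :=
 {p : set A | prime_ideal p /\ exists2 x, x \in r & ~ p x}.

Section Points.
Variables (A : cring) (r : seq A).
Local Notation X := (qapt r).

HB.instance Definition _ := gen_eqMixin X.
HB.instance Definition _ := gen_choiceMixin X.

Definition idl (x : X) : set A := sval x.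

Lemma idlP (x : X) : prime_ideal (idl x). by case: x=> p []. Qed.
Lemma idl_inj (x y : X) : idl x = idl y -> x = y.
by case: x y=> [p Hp] [q Hq] e; apply: eq_exist. Qed.

Definition D (s : A) : set X := [set x | ~ idl x s].

Lemma D1 : D 1 = setT.
by apply/seteqP; split=> // x _; exact: prime1 (idlP x). Qed.
Lemma DM s t : D (s * t) = D s `&` D t.
apply/seteqP; split=> x; last by move=> [xs xt]; apply: primenM=> //; exact: idlP.
by move=> xst; split=> H; apply: xst; [apply: primeMr | apply: primeMl]; rewrite //; exact: idlP.
Qed.

Definition qaop (W : set X) : Prop :=
 forall x, W x -> exists s, D s x /\ D s `<=` W.

Lemma qaopT : qaop setT.
by exists 1; rewrite D1. Qed.
Lemma qaopI : setI_closed qaop.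
move=> U V oU oV x [/oU[s [xs sU]] /oV[t [xt tV]]].
by exists (s * t); rewrite DM; split=> // y [/sU ? /tV ?].
Qed.
Lemma qaop_bigU (I : Type) (f : I -> set X) : (forall i, qaop (f i)) -> qaop (\bigcup_i f i).
move=> of_ x [i _ fx]; have [s [xs sf]] := of_ i x fx.
by exists s; split=> // y /sf; exists i.
Qed.

HB.instance Definition _ := isOpenTopological.Build X qaopT qaopI qaop_bigU.

Lemma qaopE (W : set X) : open W = qaop W. by []. Qed.
Lemma open_D s : open (D s). by exists s; split. Qed.

End Points.

Section Sections.
Variables (A : cring) (r : seq A).
Local Notation X := (qapt r).

(** A section assigns to each point a fraction that represents its germ; near each point it has to
    be equivalent to one constant fraction. Values off [U] are arbitrary. *)
Definition locfrac (U : set X) (f : X -> A * A) : Prop :=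
 forall x, U x -> exists a s, ~ idl x s /\
 forall y, U y -> ~ idl y s -> ~ idl y (f y).2 /\ feq (idl y) (f y) (a, s).

Lemma locfrac_den U f x : locfrac U f -> U x -> ~ idl x (f x).2.
by move=> lf Ux; have [a [s [xs /(_ x Ux xs)[]]]] := lf x Ux. Qed.
Lemma locfrac_const (U : set X) a s : U `<=` D s -> locfrac U (fun=> (a, s)).
move=> Us x Ux; exists a, s; split=> [|y Uy ys]; first exact: Us.
by split=> //; apply: feq_refl; apply: idlP.
Qed.
Lemma locfracD U f g : locfrac U f -> locfrac U g -> locfrac U (fun x=> fadd (f x) (g x)).
move=> lf lg x Ux; have [[a [s [xs Hf]]] [b [t [xt Hg]]]] := (lf x Ux, lg x Ux).
exists (fadd (a, s) (b, t)).1, (s * t); have [_ _ _ _ pm] := idlP x.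
split=> [/pm[]//|y Uy yst]; have py := idlP y.
have [ys yt]: ~ idl y s /\ ~ idl y t.
 by split=> H; apply: yst; [apply: primeMr | apply: primeMl].
have [[fy ef] [gy eg]] := (Hf y Uy ys, Hg y Uy yt).
by split=> /=; [exact: primenM | exact: (feqD py ef eg)].
Qed.
Lemma locfracM U f g : locfrac U f -> locfrac U g -> locfrac U (fun x=> fmul (f x) (g x)).
move=> lf lg x Ux; have [[a [s [xs Hf]]] [b [t [xt Hg]]]] := (lf x Ux, lg x Ux).
exists (a * b), (s * t); have [_ _ _ _ pm] := idlP x.
split=> [/pm[]//|y Uy yst]; have py := idlP y.
have [ys yt]: ~ idl y s /\ ~ idl y t.
 by split=> H; apply: yst; [apply: primeMr | apply: primeMl].
have [[fy ef] [gy eg]] := (Hf y Uy ys, Hg y Uy yt).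
by split=> /=; [exact: primenM | exact: (feqM py ef eg)].
Qed.
Lemma locfracN U f : locfrac U f -> locfrac U (fun x=> fopp (f x)).
move=> lf x Ux; have [a [s [xs Hf]]] := lf x Ux.
exists (- a), s; split=> // y Uy ys; have [fy ef] := Hf y Uy ys.
by split=> //; apply: (feqN ef).
Qed.

Section Pre.
Variable U : set X.

Definition locsec := {f : X -> A * A | locfrac U f}.
Implicit Types f g h : locsec.

Let sub1 : U `<=` D 1. by rewrite D1. Qed.

Definition lseq f g := forall x, U x -> feq (idl x) (sval f x) (sval g x).
Definition ls0 : locsec := exist _ _ (locfrac_const 0 sub1).
Definition ls1 : locsec := exist _ _ (locfrac_const 1 sub1).
Definition lsD f g : locsec := exist _ _ (locfracD (svalP f) (svalP g)).
Definition lsM f g : locsec := exist _ _ (locfracM (svalP f) (svalP g)).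
Definition lsN f : locsec := exist _ _ (locfracN (svalP f)).

Let lsE f g : (forall x, (sval f x).1 * (sval g x).2 = (sval g x).1 * (sval f x).2) -> lseq f g.
by move=> H x Ux; apply: feqE (H x); apply: idlP. Qed.

Let ls_sym f g : lseq f g -> lseq g f.
by move=> fg x Ux; apply: feq_sym (fg x Ux). Qed.
Let ls_trans f g h : lseq f g -> lseq g h -> lseq f h.
move=> fg gh x Ux; apply: feq_trans (fg x Ux) (gh x Ux); first exact: idlP.
exact: locfrac_den (svalP g) Ux.
Qed.
Let lsD_eq f f' g g' : lseq f f' -> lseq g g' -> lseq (lsD f g) (lsD f' g').
by move=> ff' gg' x Ux; apply: (feqD (idlP x) (ff' x Ux) (gg' x Ux)). Qed.
Let lsM_eq f f' g g' : lseq f f' -> lseq g g' -> lseq (lsM f g) (lsM f' g').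
by move=> ff' gg' x Ux; apply: (feqM (idlP x) (ff' x Ux) (gg' x Ux)). Qed.
Let lsN_eq f f' : lseq f f' -> lseq (lsN f) (lsN f').
by move=> ff' x Ux; apply: (feqN (ff' x Ux)). Qed.
Let ls_refl f : lseq f f. exact: lsE. Qed.
Let lsDA f g h : lseq (lsD f (lsD g h)) (lsD (lsD f g) h).
by apply: lsE=> x /=; ring. Qed.
Let lsDC f g : lseq (lsD f g) (lsD g f).
by apply: lsE=> x /=; ring. Qed.
Let lsD0 f : lseq (lsD ls0 f) f.
by apply: lsE=> x /=; ring. Qed.
Let lsDN f : lseq (lsD (lsN f) f) ls0.
by apply: lsE=> x /=; ring. Qed.
Let lsMA f g h : lseq (lsM f (lsM g h)) (lsM (lsM f g) h).
by apply: lsE=> x /=; ring. Qed.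
Let lsMC f g : lseq (lsM f g) (lsM g f).
by apply: lsE=> x /=; ring. Qed.
Let lsM1 f : lseq (lsM ls1 f) f.
by apply: lsE=> x /=; ring. Qed.
Let lsMD f g h : lseq (lsM (lsD f g) h) (lsD (lsM f h) (lsM g h)).
by apply: lsE=> x /=; ring. Qed.

Definition secpre : preRing := PreRing ls_refl ls_sym ls_trans lsD_eq lsM_eq lsN_eq
 lsDA lsDC lsD0 lsDN lsMA lsMC lsM1 lsMD.

End Pre.

Definition qasec (U : set X) : cring := quo (secpre U).

Definition mksec U (f : X -> A * A) (lf : locfrac U f) : qasec U :=
 qpi (P := secpre U) (exist _ f lf).

Definition secfun U (q : qasec U) : X -> A * A := sval (qrep q : locsec U).

Lemma secfunP U (q : qasec U) : locfrac U (secfun q).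
exact: svalP. Qed.

Definition germ U (q : qasec U) (x : X) (a s : A) : Prop :=
 ~ idl x s /\ feq (idl x) (secfun q x) (a, s).

Variable U : set X.
Implicit Types (q : qasec U) (x : X).

Lemma secfun_mk f (lf : locfrac U f) x : U x -> feq (idl x) (secfun (mksec lf) x) (f x).
exact: (qrepP (P := secpre U) _). Qed.
Lemma germ_mk f (lf : locfrac U f) x a s : U x ->
 ~ idl x s -> feq (idl x) (f x) (a, s) -> germ (mksec lf) x a s.
move=> Ux xs e; split=> //; apply: feq_trans (secfun_mk lf Ux) e; first exact: idlP.
exact: locfrac_den lf Ux.
Qed.
Lemma germ_loc q x : U x -> exists a s, ~ idl x s /\
 forall y, U y -> ~ idl y s -> germ q y a s.
move=> Ux; have [a [s [xs H]]] := secfunP q Ux; exists a, s; split=> // y Uy ys.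
by have [] := H y Uy ys.
Qed.
Lemma germ_ex q x : U x -> exists a s, germ q x a s.
by move=> Ux; have [a [s [xs /(_ x Ux xs)]]] := germ_loc q Ux; exists a, s. Qed.
Lemma germ_feq q x a s b t : U x -> germ q x a s -> germ q x b t -> feq (idl x) (a, s) (b, t).
move=> Ux [xs e] [xt e']; apply: feq_trans (feq_sym e) e'; first exact: idlP.
exact: locfrac_den (secfunP q) Ux.
Qed.
Lemma germ_chg q x a s b t : germ q x a s -> ~ idl x t ->
 feq (idl x) (a, s) (b, t) -> germ q x b t.
by move=> [xs e] xt e'; split=> //; apply: feq_trans e e'=> //; apply: idlP. Qed.
Lemma germ_ext q q' : (forall x, U x -> exists a s, germ q x a s /\ germ q' x a s) -> q = q'.
move=> H; rewrite -[q](qrepK _) -[q'](qrepK _).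
suff H': lseq (qrep q) (qrep q') by apply/(qpiP _).
move=> x Ux; have [a [s [[xs e] [_ e']]]] := H x Ux.
by apply: feq_trans e (feq_sym e'); first exact: idlP.
Qed.
Lemma germD q q' x a s b t : U x -> germ q x a s -> germ q' x b t ->
 germ (q + q') x (a * t + b * s) (s * t).
move=> Ux [xs e] [xt e']; have xst: ~ idl x (s * t) by apply: primenM=> //; apply: idlP.
split=> //;
apply: feq_trans ((qrepP (P := secpre U) (padd (qrep q) (qrep q'))) x Ux) _; [exact: idlP | | exact (feqD (idlP x) e e')].
exact: locfrac_den (locfracD (secfunP q) (secfunP q')) Ux.
Qed.
Lemma germM q q' x a s b t : U x -> germ q x a s -> germ q' x b t ->
 germ (q * q') x (a * b) (s * t).
move=> Ux [xs e] [xt e']; have xst: ~ idl x (s * t) by apply: primenM=> //; apply: idlP.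
split=> //;
apply: feq_trans ((qrepP (P := secpre U) (pmul (qrep q) (qrep q'))) x Ux) _; [exact: idlP | | exact (feqM (idlP x) e e')].
exact: locfrac_den (locfracM (secfunP q) (secfunP q')) Ux.
Qed.
Lemma germN q x a s : U x -> germ q x a s -> germ (- q) x (- a) s.
move=> Ux [xs e]; split=> //;
apply: feq_trans ((qrepP (P := secpre U) (popp (qrep q))) x Ux) _; [exact: idlP | | exact: feqN e].
exact: locfrac_den (secfunP q) Ux.
Qed.
Lemma germ0 x : U x -> germ (0 : qasec U) x 0 1.
move=> Ux; split; first exact: prime1 (idlP x).
exact: (qrepP (P := secpre U) _ x Ux).
Qed.
Lemma germ1 x : U x -> germ (1 : qasec U) x 1 1.
move=> Ux; split; first exact: prime1 (idlP x).
exact: (qrepP (P := secpre U) _ x Ux).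
Qed.

End Sections.

Section Space.
Variables (F : fieldType) (A : cring) (jA : F -> A) (r : seq A).
Hypothesis jm : is_rmorph jA.
Local Notation X := (qapt r).

Lemma locfrac_sub (U V : set X) f : V `<=` U -> locfrac U f -> locfrac V f.
move=> VU lf x Vx; have [a [s [xs H]]] := lf x (VU x Vx); exists a, s; split=> // y Vy.
by apply: H; apply: VU.
Qed.

(** The record [rspace] asks for a restriction between any two sets; 0 is a dummy value for [V] not
    inside [U]. *)
Definition qares (U V : set X) (q : qasec U) : qasec V :=
 match pselect (V `<=` U) with
 | left H=> mksec (locfrac_sub H (secfunP q))
 | right _=> 0
 end.

Lemma germ_res U V (q : qasec U) x a s : V `<=` U -> V x ->
 germ q x a s -> germ (qares V q) x a s.
move=> VU Vx [xs e]; rewrite /qares; case: pselect=> // H.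
exact: germ_mk Vx xs e.
Qed.
Lemma germ_of_res U V (q : qasec U) x a s : V `<=` U -> V x ->
 germ (qares V q) x a s -> germ q x a s.
move=> VU Vx g; have [b [t g']] := germ_ex q (VU x Vx).
apply: (germ_chg g'); first by case: g.
exact: (germ_feq Vx (germ_res VU Vx g') g).
Qed.

Definition mkfr (V : set X) a s (H : V `<=` D s) : qasec V := mksec (locfrac_const a H).

Lemma germ_fr V a s (H : V `<=` D s) x : V x -> germ (mkfr a H) x a s.
move=> Vx; apply: germ_mk=> //; first exact: (H x Vx).
by apply: feq_refl; apply: idlP.
Qed.
Lemma sub_D1 (V : set X) : V `<=` D 1. by rewrite D1. Qed.
Definition qaglob (V : set X) (a : A) : qasec V := mkfr a (@sub_D1 V).
Definition qastr (V : set X) (c : F) : qasec V := qaglob V (jA c).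

Lemma gglob V x a : V x -> germ (qaglob V a) x a 1.
exact: germ_fr. Qed.
Lemma germ_tr (V : set X) (q : qasec V) x a s b t : V x -> germ q x a s ->
 ~ idl x t -> a * t = b * s -> germ q x b t.
move=> Vx g xt e; apply: germ_chg g xt _.
by apply: feqE=> //; apply: idlP.
Qed.
Lemma glob_rm V : is_rmorph (qaglob V).
split=> [a b|]; last split=> [|a b].
- apply: germ_ext=> x Vx; exists (a - b), 1; split; first exact: gglob.
 apply: germ_tr Vx (germD Vx (gglob a Vx) (germN Vx (gglob b Vx))) _ _.
 exact: prime1 (idlP x).
 ring.
- by apply: germ_ext=> x Vx; exists 1, 1; split; [exact: gglob | exact: germ1].
- apply: germ_ext=> x Vx; exists (a * b), 1; split; first exact: gglob.
 apply: germ_tr Vx (germM Vx (gglob a Vx) (gglob b Vx)) _ _.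
 exact: prime1 (idlP x).
 ring.
Qed.
Lemma qastr_rmorph V : is_rmorph (qastr V).
exact: rm_comp jm (glob_rm V). Qed.
Lemma qares_rmorph U V : V `<=` U -> is_rmorph (@qares U V).
move=> VU; split=> [p q|]; last split=> [|p q].
- apply: germ_ext=> x Vx; have Ux := VU x Vx.
 have [[a [s gp]] [b [t gq]]] := (germ_ex p Ux, germ_ex q Ux).
 eexists; eexists; split; first exact: germ_res (germD Ux gp (germN Ux gq)).
 exact: germD (germ_res VU Vx gp) (germN Vx (germ_res VU Vx gq)).
- by apply: germ_ext=> x Vx; exists 1, 1; split; [apply: germ_res (germ1 (VU x Vx)) | exact: germ1].
- apply: germ_ext=> x Vx; have Ux := VU x Vx.
 have [[a [s gp]] [b [t gq]]] := (germ_ex p Ux, germ_ex q Ux).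
 eexists; eexists; split; first exact: germ_res (germM Ux gp gq).
 exact: germM (germ_res VU Vx gp) (germ_res VU Vx gq).
Qed.
Lemma res_glob U V a : V `<=` U -> qares V (qaglob U a) = qaglob V a.
move=> VU; apply: germ_ext=> x Vx; exists a, 1; split; last exact: gglob.
exact: germ_res (gglob a (VU x Vx)).
Qed.
Lemma qares_res U V W (q : qasec U) : W `<=` V -> V `<=` U ->
 qares W (qares V q) = qares W q.
move=> WV VU; apply: germ_ext=> x Wx;
have [a [s g]] := germ_ex q (VU x (WV x Wx)); exists a, s; split; last exact: germ_res (subset_trans WV VU) Wx g.
exact: (germ_res WV Wx (germ_res VU (WV x Wx) g)).
Qed.
Lemma qares_id U (q : qasec U) : qares U q = q.
by apply: germ_ext=> x Ux; have [a [s g]] := germ_ex q Ux; exists a, s; split=> //; apply: germ_res.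
Qed.

Definition qaspace : rspace F := @RSpace F X (@qasec A r) qares qastr.

Lemma qa_presheaf : is_presheaf qaspace.
split.
- by move=> U V _ _; apply: qares_rmorph.
- by move=> U s _; apply: qares_id.
- by move=> U V W s _ _ _; apply: qares_res.
- by move=> U _; apply: qastr_rmorph.
- by move=> U V c _ _; apply: res_glob.
Qed.
(** To glue, choose for each point one member of the cover through it and take the fraction of its
    section there. As germs agree on overlaps, the result is locally equivalent to one fraction,
    whatever the choices. *)
Lemma qa_sheaf : is_sheaf qaspace.
move=> C s Copen compat; set W := \bigcup_(U in C) U.
have same (U V : set X) y a t : C U -> C V -> U y -> V y ->
 germ (s U) y a t -> germ (s V) y a t.
 move=> CU CV Uy Vy g.
 apply: (@germ_of_res V (U `&` V))=> //.
 by rewrite -[qares _ _](compat U V CU CV); apply: germ_res.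
have ch x: exists U, W x -> C U /\ U x.
 by case: (pselect (W x))=> [[U CU Ux]|nW]; [exists U | exists set0].
have [u Hu] := choice ch.
pose f x := secfun (s (u x)) x.
have lf: locfrac W f.
 move=> x [U CU Ux]; have [a [t [xt H]]] := germ_loc (s U) Ux.
 have := Copen U CU; rewrite qaopE=> /(_ x Ux)[v [xv vU]].
 exists (a * v), (t * v); split; first exact (primenM (idlP x) xt xv).
 move=> y Wy ytv; have py := idlP y.
 have yt: ~ idl y t by move=> ?; apply: ytv; apply: primeMr.
 have yv: ~ idl y v by move=> ?; apply: ytv; apply: primeMl.
 have Uy := vU y yv; have [Cuy uyy] := Hu y Wy.
 split; first exact: locfrac_den (secfunP _) uyy.
 have [_ e] := same _ _ _ _ _ CU Cuy Uy uyy (H y Uy yt).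
 by apply: feq_trans e _=> //; apply: feqE=> //=; ring.
have gg U x a t: C U -> U x -> germ (s U) x a t -> germ (mksec lf) x a t.
 move=> CU Ux g; have Wx: W x by exists U.
 have [Cux uxx] := Hu x Wx; have [xt e] := same _ _ _ _ _ CU Cux Ux uxx g.
 exact: germ_mk.
exists (mksec lf); split=> [U CU|t Ht].
 apply: germ_ext=> x Ux; have [a [v g]] := germ_ex (s U) Ux; exists a, v; split=> //.
 by apply: germ_res=> //; [move=> y Uy; exists U | exact: gg g].
apply: germ_ext=> x [U CU Ux]; have [a [v g]] := germ_ex (s U) Ux; exists a, v.
split; first exact: gg g.
have UW: U `<=` W by exists U.
by apply: (germ_of_res UW Ux); rewrite [qares _ _](Ht U CU).
Qed.
(** If the germ is b/t with b nonzero at [x], then t/b is an inverse on the neighbourhood where t b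
    does not vanish. *)
Lemma unit_germ (U : set X) (q : qasec U) x a s : open U -> U x -> germ q x a s ->
 unit_at (X := qaspace) x q <-> ~ idl x a.
move=> oU Ux g; have px := idlP x; split=> [[V [oV Vx VU [t e]]]|xa].
 have [b [v gt]] := germ_ex t Vx.
 have gq := germM Vx (germ_res VU Vx g) gt.
 have e': qares V q * t = 1 by [].
 rewrite e' in gq;
 move=> pa; have := feq_unit px _ (germ_feq Vx gq (germ1 Vx)) (primeMr px _ pa).
 by move=> /(_ (fst gq)) /(prime1 px).
have [b [t [xt H]]] := germ_loc q Ux.
have xb: ~ idl x b.
 move=> xb; apply: xa;
 exact (@feq_unit _ _ px (b, t) _ xt (germ_feq Ux (H x Ux xt) g) xb).
pose V := U `&` D (t * b).
have Vx: V x by split=> //; apply: primenM.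
exists V; split=> //; first by apply: openI=> //; apply: open_D.
 exact: subIsetl.
have Vb: V `<=` D b by move=> y [_]; rewrite DM=> -[].
have Vt: V `<=` D t by move=> y [_]; rewrite DM=> -[].
exists (mkfr t Vb); apply: germ_ext=> y Vy; exists 1, 1; split; last exact: germ1.
have [Uy _] := Vy;
apply: germ_tr Vy (germM Vy (germ_res (@subIsetl _ U _) Vy (H y Uy (Vt y Vy))) (germ_fr t Vb Vy)) _ _.
 exact: prime1 (idlP y).
ring.
Qed.

End Space.

(** * Ideals and prime avoidance *)

Section Ideals.
Variable A : cring.

Definition ideal (J : set A) : Prop :=
 [/\ J 0, forall a b, J a -> J b -> J (a + b) & forall a b, J b -> J (a * b)].

Lemma primeI p : prime_ideal p -> ideal p.
by split; [exact: prime0 | exact: primeD | exact: primeMl]. Qed.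
Lemma ideal_sum (I : set A) (J : Type) (r : seq J) (P : pred J) (G : J -> A) :
 ideal I -> (forall i, P i -> I (G i)) -> I (\sum_(i <- r | P i) G i).
by move=> [I0 ID IM] H; elim/big_ind: _. Qed.

Definition idadd (J : set A) (b : A) : set A := [set c | exists j x, J j /\ c = j + x * b].

Lemma idaddI J b : ideal J -> ideal (idadd J b).
move=> [J0 JD JM]; split.
- by exists 0, 0; split=> //; ring.
- move=> _ _ [j [x [Jj ->]]] [k [y [Jk ->]]]; exists (j + k), (x + y).
 by split; [exact: JD | ring].
- move=> a _ [j [x [Jj ->]]]; exists (a * j), (a * x).
 by split; [exact: JM | ring].
Qed.
Lemma idaddS J b : J `<=` idadd J b.
by move=> j Jj; exists j, 0; split=> //; ring. Qed.
Lemma idadd_x J b : ideal J -> idadd J b b.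
by move=> [J0 _ _]; exists 0, 1; split=> //; ring. Qed.
Lemma idadd_min J b K : ideal K -> J `<=` K -> K b -> idadd J b `<=` K.
by move=> [K0 KD KM] JK Kb _ [j [x [/JK Kj ->]]]; apply: KD=> //; apply: KM. Qed.
Lemma prime_avoid (J : set A) s : ideal J -> (forall n, ~ J (s ^+ n)) ->
 exists p, [/\ prime_ideal p, J `<=` p & ~ p s].
move=> Jid Js.
pose G I := [/\ ideal I, J `<=` I & forall n, ~ I (s ^+ n)].
have GJ: G J by split.
have [|I [[I0|[Iid JI Is]] Imax]] := @Zorn_bigcup _ [set I | I = set0 \/ G I].
- move=> C CP Ctot; have [[I0 [CI0 GI0]]|noC] := pselect (exists I, C I /\ G I); last first.
 left; apply/seteqP; split=> // a [I CI Ia]; have [e|GI] := CP I CI; first by rewrite e in Ia.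
 by case: noC; exists I.
 have GC I a: C I -> I a -> G I by move=> CI Ia; case: (CP I CI)=> // e; rewrite e in Ia.
 right; split; last by move=> n [I CI Isn]; have [_ _ /(_ n)] := GC I _ CI Isn.
 split.
 - by exists I0; have [[]] := GI0.
 - move=> a b [I CI Ia] [K CK Kb].
 have [IK|KI] := Ctot I K CI CK.
 by exists K=> //; have [[_ KD _] _ _] := GC _ _ CK Kb; apply: KD=> //; apply: IK.
 by exists I=> //; have [[_ ID _] _ _] := GC _ _ CI Ia; apply: ID=> //; apply: KI.
 - by move=> a b [I CI Ib]; exists I=> //; have [[_ _ IM] _ _] := GC _ _ CI Ib; apply: IM.
 by move=> j Jj; exists I0; have [_ /(_ j Jj)] := GI0.
- exfalso; apply: (Imax J); last by right.
 by rewrite I0; split=> // /(_ 0); apply; have [] := Jid.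
exists I.
have [I0 ID IM] := Iid.
have big b: ~ I b -> exists n, idadd I b (s ^+ n).
 move=> nIb; apply: contrapT=> H; apply: (Imax (idadd I b)); last first.
 right; split; [exact: idaddI | exact: subset_trans JI (idaddS b) |].
 by move=> n Hn; apply: H; exists n.
 by split=> [|/(_ b (idadd_x b Iid))//]; exact: idaddS.
split=> //; last by move=> Is1; apply: (Is 1).
split=> // [I1|a b Iab]; first exact: (Is 0).
apply: contrapT=> /not_orP[/big[n [j [x [Ij ej]]]] /big[m [k [y [Ik ek]]]]].
apply: (Is (n + m)); rewrite exprD ej ek.
have -> : (j + x * a) * (k + y * b) = (k + y * b) * j + (x * a) * k + (x * y) * (a * b) by ring.
by apply: (ID); [apply: ID; apply: IM | apply: IM].
Qed.

Definition idg (T : set A) : set A := [set c | exists L : seq (A * A),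
 (forall x, x \in L -> T x.2) /\ c = \sum_(x <- L) x.1 * x.2].

Lemma idg_ideal T : ideal (idg T).
split.
- by exists [::]; rewrite big_nil.
- move=> _ _ [L [TL ->]] [K [TK ->]]; exists (L ++ K); split; last by rewrite big_cat.
 by move=> x; rewrite mem_cat=> /orP[/TL|/TK].
- move=> a _ [L [TL ->]]; exists [seq (a * x.1, x.2) | x <- L]; split.
 by move=> x /mapP[y /TL Ty ->].
 by rewrite big_map big_distrr /=; apply: eq_bigr=> x _; rewrite mulrA.
Qed.
Lemma idg_sub T : T `<=` idg T.
move=> t Tt; exists [:: (1, t)]; split; last by rewrite big_seq1 mul1r.
by move=> x; rewrite inE=> /eqP ->.
Qed.
Lemma idg_min T I : ideal I -> T `<=` I -> idg T `<=` I.
move=> Iid TI _ [L [TL ->]]; rewrite big_seq; apply: ideal_sum=> // x /TL/TI.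
by have [_ _ IM] := Iid; apply: IM.
Qed.
Lemma idg_mono (T T' : set A) : T `<=` T' -> idg T `<=` idg T'.
by move=> TT'; apply: idg_min (idg_ideal _) (subset_trans TT' (@idg_sub T')). Qed.
Lemma rad_idg T s : (forall p, prime_ideal p -> T `<=` p -> p s) -> exists n, idg T (s ^+ n).
move=> H; apply: contrapT=> no.
have [n Hn|p [pp Tp ps]] := @prime_avoid _ s (idg_ideal T).
 by apply: no; exists n.
by apply: ps; apply: H=> //; apply: subset_trans Tp; apply: idg_sub.
Qed.
Lemma idg_pow T n : idg T 1 -> idg [set t ^+ n | t in T] 1.
move=> T1; have [p pp Tp|m] := @rad_idg [set t ^+ n | t in T] 1; last by rewrite expr1n.
apply: (idg_min (primeI pp) _ T1)=> t Tt; apply: (primeX pp _).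
by apply: Tp; exists t.
Qed.

End Ideals.

Lemma idg_map (A B : cring) (f : A -> B) (T : set A) c : is_rmorph f ->
 idg T c -> idg (f @` T) (f c).
move=> fm [L [TL ->]]; exists [seq (f x.1, f x.2) | x <- L]; split.
 by move=> x /mapP[y /TL Ty ->]; exists y.2.
by rewrite (rm_sum _ _ _ fm) big_map; apply: eq_bigr=> x _; rewrite (rmM fm).
Qed.
Lemma unif_bnd (T : eqType) (L : seq T) (P : T -> nat -> Prop) :
 (forall x m n, (m <= n)%N -> P x m -> P x n) ->
 (forall x, x \in L -> exists n, P x n) -> exists n, forall x, x \in L -> P x n.
move=> mono; elim: L=> [|y L IH] H; first by exists 0.
have [|n Hn] := IH; first by move=> x xL; apply: H; rewrite inE xL orbT.
have [m Hm] := H y (mem_head _ _); exists (maxn m n)=> x.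
rewrite inE=> /predU1P[->|/Hn]; first exact: mono (leq_maxl _ _) Hm.
exact: mono (leq_maxr _ _).
Qed.

(** * Affine opens and their sections *)

Section Affine.
Variables (F : fieldType) (A : cring) (jA : F -> A) (r : seq A).
Hypothesis jm : is_rmorph jA.
Local Notation X := (qapt r).
Local Notation Y := (qaspace jA r).

(** For such [s] every prime of A that avoids [s] is a point of X. So D(s) is a principal open of
    the whole of Spec A, and arguments with ideals of A apply to it. *)
Definition good (s : A) : Prop := exists2 x, x \in r & exists c, s = c * x.

Lemma goodM a s : good s -> good (a * s).
by move=> [x xr [c ->]]; exists x=> //; exists (a * c); rewrite mulrA. Qed.
Lemma good_pt p s : prime_ideal p -> ~ p s -> good s -> exists x : X, idl x = p.
move=> pp ps [x xr [c e]].
have H: prime_ideal p /\ exists2 x, x \in r & ~ p x.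
 by split=> //; exists x=> // px; apply: ps; rewrite e; apply: primeMl.
by exists (exist _ p H).
Qed.
Lemma DMl s t : D (s * t) `<=` (D s : set X). by rewrite DM. Qed.
Lemma DMr s t : D (s * t) `<=` (D t : set X). by rewrite DM. Qed.
(** The annihilator of [a] lies in no prime that avoids [s], hence contains a power of [s]. *)
Lemma glob_eq0 s a : good s -> qaglob (D s : set X) a = 0 -> exists n, s ^+ n * a = 0.
move=> gs e; pose T := [set c | c * a = 0].
have Tid: ideal T.
 split; rewrite /T /=; first exact: mul0r.
 by move=> b c eb ec; rewrite mulrDl ec addr0.
 by move=> b c ec; rewrite -mulrA ec mulr0.
have [|n Hn] := @rad_idg A T s; last by exists n; exact: (idg_min Tid _ Hn).
move=> p pp Tp; apply: contrapT=> ps; have [x xp] := good_pt pp ps gs.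
have xs: D s x by rewrite /D /= xp.
have := germ_feq xs (gglob a xs); rewrite e=> /(_ _ _ (germ0 xs))[u].
rewrite xp mulr1 mul0r subr0=> pu e'; exact: pu (Tp u e').
Qed.
Lemma glob_frac s (q : qasec (D s : set X)) : good s ->
 exists n a, qaglob _ (s ^+ n) * q = qaglob _ a.
move=> gs.
(* The denominators t with which [q] is a single fraction on D(t). They lie in no common prime that
   avoids [s], so the ideal that they generate contains a power of [s]. *)
pose T := [set t | D t `<=` (D s : set X) /\ good t /\
 exists a, forall y : X, D t y -> germ q y a t].
have [|N [L [TL eN]]] := @rad_idg A T s.
 move=> p pp Tp; apply: contrapT=> ps; have [x xp] := good_pt pp ps gs.
 have xs: D s x by rewrite /D /= xp.
 have [a [t [xt H]]] := germ_loc q xs.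
 have : p (t * s).
 apply: Tp; split; [exact: DMr | split; [exact: goodM | exists (a * s)=> y yts]].
 have ys := DMr yts;
 by apply: (germ_tr ys (H y ys (DMl yts)) yts); ring.
 by rewrite -xp=> /(primeM (idlP x))[].
have ch t: exists a, T t -> forall y : X, D t y -> germ q y a t.
 by have [[_ [_ [a Ha]]]|nT] := pselect (T t); [exists a | exists 0].
have [al Hal] := choice ch.
pose P (z : (A * A) * (A * A)) m :=
 (z.1.2 * z.2.2) ^+ m * (al z.1.2 * z.2.2 - al z.2.2 * z.1.2) = 0.
have [| |m Hm] := @unif_bnd _ [seq (x, y) | x <- L, y <- L] P.
- by move=> z m n mn; rewrite /P -(subnK mn) exprD -mulrA=> ->; rewrite mulr0.
- move=> z /allpairsP[[x y] [xL yL ->]].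
 have [Tx Ty] := (TL x xL, TL y yL).
 apply: glob_eq0; first by have [_ [? _]] := Ty; apply: goodM.
 apply: germ_ext=> w wxy; exists 0, 1; split; last exact: germ0.
 have [wx wy] := (DMl wxy, DMr wxy); have ws: D s w by have [sub _] := Tx; apply: sub.
 have [u wu e] := germ_feq ws (Hal _ Tx w wx) (Hal _ Ty w wy).
 apply: (germ_chg (gglob _ wxy)); first exact: prime1 (idlP w).
 by exists u=> //=; rewrite !mulr1 subr0.
(* The cross products of two of the fractions a/t agree only after multiplication by (t t')^m.
   Written as a t^m / t^(m+1) the fractions have equal cross products, so that the numerators can be
   summed. *)
pose T2 := [set t' | exists2 x, x \in L & t' = x.2 ^+ m.+1].
have ch2 t': exists b, T2 t' -> exists2 x, x \in L & t' = x.2 ^+ m.+1 /\ b = al x.2 * x.2 ^+ m.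
 have [[x xL e]|nT] := pselect (T2 t'); last by exists 0.
 by exists (al x.2 * x.2 ^+ m)=> _; exists x.
have [be Hbe] := choice ch2.
have [|M [K [TK eM]]] := @rad_idg A T2 s.
 move=> p pp Tp; apply: (primeX pp (n := N)); rewrite eN.
 rewrite big_seq; apply: prime_sum=> // x xL; apply: primeMl=> //.
 by apply: (primeX pp _); apply: Tp; exists x.
exists M, (\sum_(x <- K) x.1 * be x.2).
apply: germ_ext=> y ys; exists (\sum_(x <- K) x.1 * be x.2), 1; split; last exact: gglob.
have [z zK yz]: exists2 z, z \in K & D z.2 y.
 apply: contrapT=> H; apply: (primenX (n := M) (idlP y) ys).
 rewrite eM big_seq; apply: prime_sum; first exact: idlP.
 move=> x xK; apply: primeMl; first exact: idlP.
 by apply: contrapT=> yx; apply: H; exists x.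
have [z' zL [ez ebz]] := Hbe _ (TK z zK).
have yz': D z'.2 y by move=> h; apply: yz; rewrite ez exprS; apply: primeMr=> //; apply: idlP.
have gq: germ q y (be z.2) z.2.
 apply: (germ_tr ys (Hal _ (TL _ zL) y yz') yz).
 by rewrite ebz ez exprS; ring.
apply: (germ_tr ys (germM ys (gglob _ ys) gq)); first exact: prime1 (idlP y).
rewrite mulr1 eM big_distrl big_distrl /= !big_seq; apply: eq_bigr=> x xK.
rewrite -!mulrA; congr (_ * _); have [x' xL [ex ebx]] := Hbe _ (TK x xK).
have /Hm : (x', z') \in [seq (x, y) | x <- L, y <- L] by apply/allpairsP; exists (x', z').
rewrite ebz ebx ez ex=> /eqP; rewrite mulrBr subr_eq0=> /eqP e.
rewrite !exprS; transitivity ((x'.2 * z'.2) ^+ m * (al z'.2 * x'.2)); first by rewrite exprMn; ring.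
by rewrite -e exprMn; ring.
Qed.

Definition cov (U : set X) (L : seq A) : Prop :=
 forall x, U x -> exists2 s, s \in L & [/\ good s, D s `<=` U & D s x].

(** On each of the finitely many D(s) that cover [U] the section is a fraction, killed by some power
    of [v]; the largest exponent works for all. *)
Lemma glob_kill U L v (q : qasec U) : cov U L ->
 (forall y, U y -> D v y -> germ q y 0 1) -> exists m, qaglob U (v ^+ m) * q = 0.
move=> cU q0.
pose P s m := good s -> D s `<=` U -> forall y, D s y -> germ (qaglob U (v ^+ m) * q) y 0 1.
have [| |m Hm] := @unif_bnd _ L P.
- move=> s m n mn H gs sU y ys; have Uy := sU y ys.
 rewrite -(subnK mn) exprD (rmM (glob_rm U)) -mulrA.
 apply: (germ_tr Uy (germM Uy (gglob _ Uy) (H gs sU y ys))).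
 exact: prime1 (idlP y).
 ring.
- move=> s _; have [[gs sU]|H] := pselect (good s /\ D s `<=` U); last first.
 by exists 0=> gs sU; case: H.
 have [n [a e]] := glob_frac (qares _ q) gs.
 have [|m em] := @glob_eq0 _ a (goodM v gs).
 apply: germ_ext=> y yvs; exists 0, 1; split; last exact: germ0.
 have [yv ys] := (DMl yvs, DMr yvs); have Uy := sU y ys.
 have g := germM ys (gglob (s ^+ n) ys) (germ_res sU ys (q0 y Uy yv)).
 rewrite e in g; have := germ_feq ys (gglob a ys) g.
 move=> /(germ_chg (gglob a yvs)) H.
 apply: (germ_tr yvs (H _)); rewrite ?mulr1 ?mulr0 //; exact: prime1 (idlP y).
 exists m=> _ _ y ys; have Uy := sU y ys.
 have [b [t g]] := germ_ex q Uy.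
 have g2 := germM ys (gglob (s ^+ n) ys) (germ_res sU ys g); rewrite e in g2.
 have [u yu /= eu] := germ_feq ys g2 (gglob a ys).
 apply: (germ_chg (germM Uy (gglob _ Uy) g)); first exact: prime1 (idlP y).
 exists (u * s ^+ (n + m)).
 by apply: primenM; [| | apply: primenX]; rewrite //; exact: idlP.
 rewrite exprMn in em.
 move/eqP: eu; rewrite mulr1 mulrBr subr_eq0=> /eqP eu.
 rewrite /= exprD; transitivity (s ^+ m * v ^+ m * (u * (s ^+ n * b))); first by ring.
 rewrite eu; transitivity (u * t * (v ^+ m * s ^+ m * a)); first by ring.
 by rewrite em mulr0.
exists m; apply: germ_ext=> y Uy; exists 0, 1; split; last exact: germ0.
by have [s sL [gs sU ys]] := cU y Uy; apply: (Hm s).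
Qed.
(** The identity holds on D(s) by [glob_frac]. The difference of the two sides on [U] vanishes on
    D(s), so by [glob_kill] a further power of [s] kills it. *)
Lemma cov_frac U L s (q : qasec U) : cov U L -> good s -> D s `<=` U ->
 exists n a, qaglob U (s ^+ n) * q = qaglob U a.
move=> cU gs sU; have [n [a e]] := glob_frac (qares _ q) gs.

have [|m em] := @glob_kill U L s (qaglob U (s ^+ n) * q - qaglob U a) cU.
 move=> y Uy ys; have [b [t g]] := germ_ex q Uy.
 have g2 := germM ys (gglob (s ^+ n) ys) (germ_res sU ys g); rewrite e in g2.
 have [u yu /= eu] := germ_feq ys g2 (gglob a ys).
 apply: (germ_chg (germD Uy (germM Uy (gglob _ Uy) g) (germN Uy (gglob a Uy)))).
 exact: prime1 (idlP y).
 exists u=> //=; rewrite -[RHS]eu; ring.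
exists (m + n), (s ^+ m * a); apply/eqP; rewrite -subr_eq0 exprD !(rmM (glob_rm U)).
by rewrite -mulrA -mulrBr em.
Qed.

End Affine.

Lemma feq_num (A : cring) (p : set A) (pp : prime_ideal p) a s b t :
 ~ p s -> feq p (a, s) (b, t) -> p a -> p b.
exact: (@feq_unit _ _ pp (a, s) _). Qed.

Section AffineOpens.
Variables (F : fieldType) (A : cring) (jA : F -> A) (r : seq A).
Hypothesis jm : is_rmorph jA.
Local Notation X := (qapt r).
Local Notation Y := (qaspace jA r).

(** The usual criterion of affineness: principal opens inside [U] whose functions generate the unit
    ideal of the sections over [U]. Its two directions are [aff_affine] and [affine_data]. *)
Definition aff_data (U : set X) (L : seq A) : Prop :=
 [/\ open U, forall s, s \in L -> good r s /\ D s `<=` U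
 & idg [set qaglob U s | s in [set` L]] 1].

Lemma nunit_germ (U : set X) (q : qasec U) x a s : open U -> U x -> germ q x a s ->
 (~ unit_at (X := Y) x q) <-> idl x a.
move=> oU Ux g; have [h1 h2] := unit_germ jA oU Ux g; split=> [nu|xa /h1//].
by apply: contrapT=> /h2.
Qed.
Lemma aff_cov U L : aff_data U L -> cov U L.
move=> [oU LU [K [KL e1]]] x Ux.
apply: contrapT=> H; have px := idlP x.
have h: forall q : qasec U, idg [set qaglob U s | s in [set` L]] q ->
 exists a s, germ q x a s /\ idl x a.
 apply: idg_min; last first.
 move=> _ [s sL <-]; exists s, 1; split; first exact: gglob.
 by apply: contrapT=> xs; apply: H; exists s; have [gs sU] := LU s sL.
 split; first by exists 0, 1; split; [exact: germ0 | exact: prime0].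
 move=> p q [a [s [g xa]]] [b [t [g' xb]]]; eexists; eexists; split; first exact: germD g g'.
 by apply: primeD=> //; apply: primeMr.
 move=> p q [b [t [g' xb]]]; have [a [s g]] := germ_ex p Ux.
 by eexists; eexists; split; [exact: germM g g' | exact: primeMl].
have [|a [s [g xa]]] := h 1; first by exists K.

exact: (prime1 px) (@feq_unit _ _ px (a, s) _ (fst g) (germ_feq Ux g (germ1 Ux)) xa).
Qed.
Lemma aff_patch (U : set X) L (I : set (qasec U)) : aff_data U L -> ideal I ->
 (forall s, s \in L -> exists n, I (qaglob U (s ^+ n))) -> I 1.
move=> [_ _ one] Iid H; have [I0 ID IM] := Iid.
pose P s n := I (qaglob U (s ^+ n)).
have [||N HN] := @unif_bnd _ L P; last 1 first.
- apply: (idg_min Iid _ (idg_pow N one))=> _ [_ [s sL <-] <-].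
 by rewrite -(rmX _ (glob_rm U)); apply: HN.
- move=> s m n mn; rewrite /P -(subnK mn) exprD (rmM (glob_rm U)); exact: IM.
- by [].
Qed.

Definition secinv_fun (U : set X) (q : qasec U) y := ((secfun q y).2, (secfun q y).1).

Lemma secinv_lf (U : set X) (q : qasec U) (W : set X) : open U -> W `<=` basic_open (X := Y) q ->
 W `<=` U -> locfrac W (secinv_fun q).
move=> oU Wq WU x Wx; have [a [s [xs H]]] := germ_loc q (WU x Wx).
have nz y: W y -> ~ idl y s -> ~ idl y a.
 by move=> Wy ys; have [h _] := unit_germ jA oU (WU y Wy) (H y (WU y Wy) ys); apply: h; apply: Wq.
exists (s * s), (a * s); split; first by apply: (primenM (idlP x))=> //; exact: nz.
move=> y Wy yas; have py := idlP y; have Uy := WU y Wy.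
have ys: ~ idl y s by move=> h; apply: yas; apply: primeMl.
have [_ e] := H y Uy ys; split=> /=.
 move=> h; apply: (nz y Wy ys); exact: (feq_unit _ (locfrac_den (secfunP q) Uy) e h).
have [u yu eu] := e; exists (u * s); first exact: primenM.
rewrite /=; transitivity (- s * (s * (u * ((secfun q y).1 * s - a * (secfun q y).2)))).
 ring.
by rewrite eu !mulr0.
Qed.
Lemma aff_affine (U : set X) L : aff_data U L -> affine (X := Y) U.
move=> aU; have [oU LU one] := aU; have cU := aff_cov aU; have gm := glob_rm U.
split=> //.
- move=> x Ux; have px := idlP x.
 have E (q : qasec U) a s : germ q x a s -> [set q | ~ unit_at (X := Y) x q] q <-> idl x a.
 by move=> g; exact (nunit_germ oU Ux g).
 split.
 + by apply/(E _ _ _ (germ0 Ux)); apply: prime0.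
 + move=> p q; have [[a [s g]] [b [t g']]] := (germ_ex p Ux, germ_ex q Ux).
 move=> /(E _ _ _ g) xa /(E _ _ _ g') xb; apply/(E _ _ _ (germD Ux g g')).
 by apply: primeD=> //; apply: primeMr.
 + move=> p q; have [[a [s g]] [b [t g']]] := (germ_ex p Ux, germ_ex q Ux).
 by move=> /(E _ _ _ g') xb; apply/(E _ _ _ (germM Ux g g')); apply: primeMl.
 + by move=> /(E _ _ _ (germ1 Ux)) /(prime1 px).
 + move=> p q; have [[a [s g]] [b [t g']]] := (germ_ex p Ux, germ_ex q Ux).
 move=> /(E _ _ _ (germM Ux g g')) /(primeM px)[xa|xb]; [left | right].
 exact/(E _ _ _ g).
 exact/(E _ _ _ g').
(* [P] avoids some s of [L], so its trace [p] on A is a point of D(s). Fractions with powers of s as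
   denominators show that [P] consists of the sections that vanish there. *)
- move=> P pP; pose p := [set a | P (qaglob U a)].
 have pp: prime_ideal p.
 split; rewrite /p /=.
 + by rewrite (rm0 gm); apply: prime0.
 + by move=> a b; rewrite (rmD gm); apply: primeD.
 + by move=> a b; rewrite (rmM gm); apply: primeMl.
 + by rewrite (rm1 gm); apply: prime1.
 + by move=> a b; rewrite (rmM gm); apply: primeM.
 have [s sL ps]: exists2 s, s \in L & ~ p s.
 apply: contrapT=> H; apply: (prime1 pP).
 apply: (idg_min (primeI pP) _ one)=> _ [s sL <-].
 by apply: contrapT=> ps; apply: H; exists s.
 have [gs sU] := LU s sL; have [x xp] := good_pt pp ps gs.
 have Ux: U x by apply: sU; rewrite /D /= xp.
 exists x; split.
 split=> //; apply/seteqP; split=> q; have [n [a e]] := cov_frac q cU gs sU;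
 have [b [t g]] := germ_ex q Ux.
 move=> Pq; apply/(nunit_germ oU Ux g); have pa: p a.
 by rewrite /p /= -e; apply: primeMl.
 have g2 := germM Ux (gglob (s ^+ n) Ux) g; rewrite e in g2.
 rewrite -xp in pa.
 have := feq_num (idlP x) (prime1 (idlP x)) (germ_feq Ux (gglob a Ux) g2) pa.
 by move=> /(primeM (idlP x))[|//]; rewrite xp=> /(primeX pp).
 move=> /(nunit_germ oU Ux g) xb.
 have g2 := germM Ux (gglob (s ^+ n) Ux) g; rewrite e in g2.

 have xa := feq_num (idlP x) (fst g2) (germ_feq Ux g2 (gglob a Ux)) (primeMl (idlP x) _ xb).
 rewrite xp /p /= -e in xa; have [|//] := primeM pP xa.
 by rewrite (rmX _ gm)=> /(primeX pP).
 move=> y [Uy Py]; apply: idl_inj; rewrite xp; apply/seteqP; split=> a.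
 by rewrite /p Py=> /(nunit_germ oU Uy (gglob a Uy)).
 by move=> ya; rewrite /p Py; apply/(nunit_germ oU Uy (gglob a Uy)).
- move=> V x; rewrite qaopE=> oV VU Vx; have [v [xv vV]] := oV x Vx.
 exists (qaglob U v); first exact/(unit_germ jA oU (VU x Vx) (gglob v (VU x Vx))).
 move=> y uy; have Uy: U y by have [V' [_ V'y V'U _]] := uy; apply: V'U.
 by apply: vV; apply/(unit_germ jA oU Uy (gglob v Uy)).
- move=> q; set W := basic_open q.
 have WU: W `<=` U by move=> y [V' [_ V'y V'U _]]; apply: V'U.
 have oW: open W.
 rewrite qaopE=> y Wy; have [V' [oV' V'y V'U et]] := Wy.
 have := oV'; rewrite qaopE=> /(_ y V'y)[v [yv vV']].
 by exists v; split=> // z zv; exists V'; split=> //; apply: vV'.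
 have Wm := qares_rmorph WU.
 have ch s: exists na : nat * A, s \in L -> qaglob U (s ^+ na.1) * q = qaglob U na.2.
 have [sL|nsL] := boolP (s \in L); last by exists (0, 0).
 by have [gs sU] := LU s sL; have [n [a e]] := cov_frac q cU gs sU; exists (n, a).
 have [na Hna] := choice ch.
 (* On D(s) the section [q] is the fraction [(na s).2] / s^n, so D(w s) is the part of D(s) where
    [q] is invertible. *)
 pose w s := (na s).2 * s.
 have wW s: s \in L -> D (w s) `<=` W.
 move=> sL y yw; have [ya ys] := (DMl yw, DMr yw).
 have [gs sU] := LU s sL; have Uy := sU y ys; have [b [t g]] := germ_ex q Uy.
 apply/(unit_germ jA oU Uy g)=> yb; apply: ya.
 have g2 := germM Uy (gglob (s ^+ (na s).1) Uy) g; rewrite (Hna s sL) in g2.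

 exact: (feq_num (idlP y) (fst g2) (germ_feq Uy g2 (gglob _ Uy)) (primeMl (idlP y) _ yb)).
 have cW: cov W [seq w s | s <- L].
 move=> y Wy; have Uy := WU y Wy; have [s sL [gs sU ys]] := cU y Uy.
 exists (w s); first by apply/mapP; exists s.
 split; [exact: goodM | exact: wW |].
 have [b [t g]] := germ_ex q Uy.
 apply: (primenM (idlP y))=> // ya.
 have g2 := germM Uy (gglob (s ^+ (na s).1) Uy) g; rewrite (Hna s sL) in g2.

 have := feq_num (idlP y) (prime1 (idlP y)) (germ_feq Uy (gglob _ Uy) g2) ya.
 move=> /(primeM (idlP y))[/(primeX (idlP y))//|yb].
 by have [h _] := unit_germ jA oU Uy g; exact: (h Wy yb).
 have wE s m: s \in L ->
 qaglob U (w s ^+ m) = qaglob U (s ^+ (m + (na s).1 * m)) * q ^+ m.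
 move=> sL; rewrite exprMn (rmM gm) !(rmX _ gm) -(Hna s sL) exprD exprM !(rmM gm, rmX _ gm).
 by rewrite exprMn; ring.
 split=> //.
 + exists (mksec (secinv_lf oU (@subset_refl _ W) WU)); apply: germ_ext=> y Wy.
 have Uy := WU y Wy; have [a [s g]] := germ_ex q Uy.
 have ya: ~ idl y a by have [h _] := unit_germ jA oU Uy g; apply: h.
 exists 1, 1; split; last exact: germ1.
 have gi: germ (mksec (secinv_lf oU (@subset_refl _ W) WU)) y s a.
 apply: germ_mk=> //; have [_ [u yu /= eu]] := g; exists u=> //=.
 by rewrite -[RHS]oppr0 -eu; ring.
 apply: (germ_tr Wy (germM Wy (germ_res WU Wy g) gi)); first exact: prime1 (idlP y).
 ring.
 + move=> b; pose I := [set c : qasec U | exists n (al : qasec U),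
 qares W q ^+ n * (qares W c * b) = qares W al].
 suff [n [al e]] : I 1 by exists n, al; rewrite (rm1 Wm) mul1r in e.
 apply: (aff_patch aU).
 split.
 * by exists 0, 0; rewrite (rm0 Wm); ring.
 * move=> c d [n [al e]] [m [be e']]; exists (n + m), (q ^+ m * al + q ^+ n * be).
 by rewrite !(rmD Wm, rmM Wm, rmX _ Wm) -e -e' exprD; ring.
 * move=> c d [n [al e]]; exists n, (c * al); rewrite !(rmM Wm) -e; ring.
 move=> s sL; have [gs sU] := LU s sL.
 have [m [c e]] := cov_frac b cW (goodM _.2 gs) (wW s sL).
 exists (m + (na s).1 * m), m, (qaglob U c); rewrite !(res_glob _ WU) -e.
 have -> : qaglob W (((na s).2 * s) ^+ m) = qares W (qaglob U (w s ^+ m)) by rewrite res_glob.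
 by rewrite wE // (rmM Wm) (rmX _ Wm) (res_glob _ WU); ring.
 + move=> b b0; pose I := [set c : qasec U | exists n, q ^+ n * (c * b) = 0].
 suff [n e]: I 1 by exists n; rewrite mul1r in e.
 apply: (aff_patch aU).
 split.
 * by exists 0; rewrite mul0r mulr0.
 * move=> c d [n e] [m e']; exists (n + m).
 transitivity (q ^+ m * (q ^+ n * (c * b)) + q ^+ n * (q ^+ m * (d * b))).
 by rewrite exprD; ring.
 by rewrite e e' !mulr0 addr0.
 * by move=> c d [n e]; exists n; rewrite -mulrA mulrCA e mulr0.
 move=> s sL.
 have [|m e] := @glob_kill A r U L (w s) b cU.
 move=> y Uy yw; apply: (germ_of_res WU (wW s sL y yw)).
 by rewrite [qares _ _]b0; apply: germ0; apply: wW yw.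
 exists (m + (na s).1 * m), m; rewrite -[RHS]e wE //; ring.
Qed.
Lemma one_aff (s : A) : good r s -> aff_data (D s) [:: s].
split; first exact: open_D.
 by move=> t; rewrite inE=> /eqP ->; split=> //.
exists [:: (mkfr 1 (@subset_refl _ _), qaglob _ s)]; split.
 by move=> x; rewrite inE=> /eqP ->; exists s=> //=; rewrite mem_head.
rewrite big_seq1; apply: germ_ext=> y ys; exists 1, 1; split; first exact: germ1.
apply: (germ_tr ys (germM ys (germ_fr 1 _ ys) (gglob s ys))).
 exact: prime1 (idlP y).
ring.
Qed.
Lemma qa_scheme : is_scheme Y.
split; [exact: qa_presheaf | exact: qa_sheaf |].
move=> x; have [s sr xs] := (svalP x).2; exists (D s)=> //.
by apply: aff_affine (one_aff _); exists s=> //; exists 1; rewrite mul1r.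
Qed.

Definition qascheme : scheme F := Scheme qa_scheme.

End AffineOpens.

(** * Gluing and morphisms of schemes *)

Section SchemeFacts.
Variables (F : fieldType) (T : scheme F).

Lemma res_rm (U V : set T) : open U -> open V -> V `<=` U -> is_rmorph (@res F T U V).
by have [[H _ _ _ _] _ _] := schemeP T; apply: H. Qed.
Lemma res_id (U : set T) (s : sec T U) : open U -> res U U s = s.
by have [[_ H _ _ _] _ _] := schemeP T; apply: H. Qed.
Lemma res_res (U V W : set T) (s : sec T U) : open U -> open V -> open W ->
 W `<=` V -> V `<=` U -> res V W (res U V s) = res U W s.
by have [[_ _ H _ _] _ _] := schemeP T; apply: H. Qed.
Lemma str_rm (U : set T) : open U -> is_rmorph (str T U).
by have [[_ _ _ H _] _ _] := schemeP T; apply: H. Qed.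
Lemma res_str (U V : set T) c : open U -> open V -> V `<=` U -> res U V (str T U c) = str T V c.
by have [[_ _ _ _ H] _ _] := schemeP T; apply: H. Qed.
Lemma sheaf_ext (W : set T) (s s' : sec T W) : open W ->
 (forall t, W t -> exists V, [/\ open V, V t, V `<=` W & res W V s = res W V s']) -> s = s'.
move=> oW H; pose C := [set V | [/\ open V, V `<=` W & res W V s = res W V s']].
have e: W = \bigcup_(U in C) U.
 apply/seteqP; split=> [t /H[V [oV Vt VW eV]]|t [V [_ VW _] Vt]]; last exact: VW.
 by exists V.
have [_ sh _] := schemeP T.
have [||t [_ Ht]] := sh C (fun U=> res W U s); first by move=> U [].
 move=> U V [oU UW _] [oV VW _].
 by rewrite !res_res; try (exact: openI).
rewrite -e in t Ht; rewrite -(Ht s)=> [|//]; apply: Ht.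
by move=> U [_ _ ->].
Qed.
(** Sections that a local property determines uniquely need no further gluing data: uniqueness on
    the overlaps is the compatibility. *)
Lemma sheaf_glue (P : forall U : set T, sec T U -> Prop) (W : set T) : open W ->
 (forall (U : set T) s s', open U -> U `<=` W -> P U s -> P U s' -> s = s') ->
 (forall (U V : set T) s, open U -> open V -> V `<=` U -> U `<=` W -> P U s -> P V (res U V s)) ->
 (forall t, W t -> exists U s, [/\ open U, U t, U `<=` W & P U s]) ->
 exists s : sec T W, forall U s', open U -> U `<=` W -> P U s' -> res W U s = s'.
move=> oW uni Pres ex; pose C := [set U | open U /\ U `<=` W /\ exists s, P U s].
have e: W = \bigcup_(U in C) U.
 apply/seteqP; split=> [t /ex[V [s [oV Vt VW PV]]]|t [V [_ [VW _]] Vt]]; last exact: VW.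
 by exists V=> //; split=> //; split=> //; exists s.
have ch U: exists s : sec T U, C U -> P U s.
 by have [[_ [_ [s Ps]]]|nC] := pselect (C U); [exists s | exists 0].
pose s U := sval (cid (ch U)).
have sP U: C U -> P U _ := svalP (cid (ch U)).
have [_ sh _] := schemeP T.
have [||t [Ht _]] := sh C s; first by move=> U [].
 move=> U V CU CV; have [[oU [UW _]] [oV [VW _]]] := (CU, CV).
 have oUV := openI oU oV.
 apply: (uni _)=> //; first by move=> x [/UW].
 by apply: (Pres U)=> //; apply: sP.
 by apply: (Pres V)=> //; apply: sP.
rewrite -e in t Ht; exists t=> U s' oU UW Ps'.
have CU: C U by split=> //; split=> //; exists s'.
by rewrite Ht //; apply: (uni U)=> //; apply: sP.
Qed.
Lemma unit_at_res (U V : set T) (s : sec T U) t : open U -> open V -> V `<=` U -> V t ->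
 unit_at t (res U V s) <-> unit_at t s.
move=> oU oV VU Vt; split=> [[W [oW Wt WV [i e]]]|[W [oW Wt WU [i e]]]].
 exists W; split=> //; first exact: subset_trans WV VU.
 by exists i; rewrite -e res_res.
have oWV := openI oW oV; exists (W `&` V); split=> //.
exists (res W _ i).
rewrite res_res // -(res_res (V := W)) //.
have rm := res_rm oW oWV (@subIsetl _ _ _).
by rewrite -(rmM rm) e (rm1 rm).
Qed.
Lemma unitM (U : set T) (s s' : sec T U) t : open U -> U t -> unit_at t s -> unit_at t s' ->
 unit_at t (s * s').
move=> oU Ut [V [oV Vt VU [i e]]] [V' [oV' V't V'U [i' e']]].
have oI := openI oV oV'; exists (V `&` V'); split=> //; first exact: subset_trans _ VU.
exists (res V _ i * res V' _ i').
have rm := res_rm oV oI (@subIsetl _ _ _); have rm' := res_rm oV' oI (@subIsetr _ _ _).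
have sub: V `&` V' `<=` U by apply: subset_trans VU.
rewrite (rmM (res_rm oU oI sub)) -(res_res s (V := V)) // -(res_res s' (V := V')) //.
by rewrite mulrACA -(rmM rm) -(rmM rm') e e' (rm1 rm) (rm1 rm') mul1r.
Qed.
Lemma open_basic (U : set T) (s : sec T U) : open (basic_open s).
rewrite openE=> t [V [oV Vt VU e]]; apply: filterS (open_nbhs_nbhs (conj oV Vt))=> x Vx.
by exists V.
Qed.
Lemma unit_prime (t : T) : prime_ideal [set s : gsec T | ~ unit_at t s].
have [_ _ /(_ t)[U [oU pU _ _ _] Ut]] := schemeP T.
have [P0 PD PM P1 PP] := pU t Ut.
have E s: [set s : gsec T | ~ unit_at t s] s <->
 [set s : sec T U | ~ unit_at t s] (res setT U s).
 have h := unit_at_res s openT oU (subsetT _) Ut.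
 by split=> [nu /h//|nu /h].
have rm := res_rm openT oU (subsetT _).
split.
- by apply/E; rewrite (rm0 rm).
- by move=> a b /E Pa /E Pb; apply/E; rewrite (rmD rm); apply: PD.
- by move=> a b /E Pb; apply/E; rewrite (rmM rm); apply: PM.
- by move=> /E; rewrite (rm1 rm).
- by move=> a b /E; rewrite (rmM rm)=> /PP[] H; [left | right]; apply/E.
Qed.

End SchemeFacts.

Section ShomExt.
Variables (F : fieldType) (T Y : scheme F).

Lemma pull_unit (f : shom T Y) (V : set Y) (oV : open V) (s : sec Y V) t :
 unit_at (f t) s -> unit_at t (pull f oV s).
move=> [W [oW Wt WV [i e]]]; exists (f @^-1` W); split=> //; first exact: hopen.
 by move=> x /WV.
exists (pull f oW i); rewrite -(pull_res f oV oW) //.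
by rewrite -(rmM (pull_rmorph f oW)) e (rm1 (pull_rmorph f oW)).
Qed.
(** The type of the comorphism depends on the map on points. So the maps on points are identified
    first, and the comorphisms are then compared locally within one type. *)
Lemma shom_ext (f g : shom T Y) : (forall t, f t = g t) ->
 (forall (V : set Y) (oV : open V) s t, V (f t) ->
 exists W, [/\ open W, W t, W `<=` f @^-1` V, W `<=` g @^-1` V
 & res (f @^-1` V) W (pull f oV s) = res (g @^-1` V) W (pull g oV s)]) -> f = g.
case: f g=> [m o p prm pr ps pl] [m' o' p' prm' pr' ps' pl'] /= /funext e.
move: o' p' prm' pr' ps' pl'; rewrite -{}e=> o' p' prm' pr' ps' pl' H.
have ep: p = p'.
 apply: functional_extensionality_dep=> V; apply: functional_extensionality_dep=> oV.
 apply/funext=> s; apply: sheaf_ext; first exact (o V oV).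
 by move=> t Vt; have [W [oW Wt WV _ e]] := H V oV s t Vt; exists W.
move: prm' pr' ps' pl'; rewrite -{}ep=> prm' pr' ps' pl' {H}.
by f_equal.
Qed.

End ShomExt.

(** * Morphisms to a quasi-affine scheme *)

Section MapsToQA.
Variables (F : fieldType) (A : cring) (jA : F -> A) (r : seq A).
Hypothesis jm : is_rmorph jA.
Local Notation X := (qapt r).
Local Notation Y := (qascheme r jm).
Variable T : scheme F.

Definition hom_of (e : shom T Y) (a : A) : gsec T := pull e (@openT Y) (qaglob setT a).

Lemma hom_of_rm e : is_rmorph (hom_of e).
exact: rm_comp (glob_rm (r := r) setT) (pull_rmorph e _). Qed.
Lemma hom_of_str e c : hom_of e (jA c) = str T setT c.
exact: (pull_str e _ c). Qed.
Lemma unit_hom_of e t a : unit_at t (hom_of e a) <-> ~ idl (e t : X) a.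
have U := unit_germ jA openT I (gglob a I).
split=> [u|/U u]; first by apply/U; exact: (pull_local I u).
exact: pull_unit.
Qed.
Lemma hom_of_Om e t : exists2 x, x \in r & unit_at t (hom_of e x).
by have [x xr xe] := (svalP (e t)).2; exists x=> //; apply/unit_hom_of. Qed.

(* [tau] is the pullback of [q] along a map f with comorphism phi. *)
Definition pullsto (phi : A -> gsec T) (f : T -> X) (V : set X) (q : qasec V)
 (U : set T) (tau : sec T U) : Prop :=
 forall t a s, U t -> germ q (f t) a s -> exists W, [/\ open W, W t, W `<=` U
 & res U W tau * res setT W (phi s) = res setT W (phi a)].

Lemma pull_pullsto e V (oV : open V) (q : qasec V) :
 pullsto (hom_of e) e q (pull e (oV : open (V : set Y)) (q : sec Y V)).
move=> t a s Vt g; have [b [v [xv H]]] := germ_loc q Vt.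
have [u xu /= eu] := germ_feq Vt (H _ Vt xv) g.
pose V' : set Y := V `&` D (v * u * s).
have oV': open V' by apply: openI=> //; exact: open_D.
have V'V: V' `<=` V by exact: subIsetl.
have V't: V' (e t).
 by split=> //; apply: (primenM (idlP _)); [apply: (primenM (idlP _)) | case: g].
have eV: @res F Y V V' q * res setT V' (qaglob setT s) =
 res setT V' (qaglob setT a).
 rewrite ![res setT _ _]res_glob //; apply: germ_ext=> y V'y; have [Vy yv] := V'y.
 have [/DMl yvv yuu] := (DMl yv, DMr (DMl yv));
 exists a, 1; split; last exact: gglob.
 apply: (germ_chg (germM V'y (germ_res V'V V'y (H y Vy yvv)) (gglob s V'y))).
 exact: prime1 (idlP y).
 by exists u=> //=; rewrite -[RHS]eu; ring.
have oe' := hopen e oV'.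
exists (e @^-1` V'); split=> //; first by move=> x /V'V.
have h := congr1 (pull e oV') eV.
rewrite (rmM (pull_rmorph e oV')) in h.
by rewrite (pull_res e oV oV') // !(pull_res e openT oV') in h.
Qed.
Lemma pullsto_uniq (phi : A -> gsec T) (f : T -> X) (V : set X) (q : qasec V)
 (U : set T) (s s' : sec T U) : open U -> U `<=` f @^-1` V ->
 (forall t a, ~ idl (f t) a -> unit_at t (phi a)) ->
 pullsto phi f q s -> pullsto phi f q s' -> s = s'.
move=> oU UV un Ps Ps'; apply: sheaf_ext=> // t Ut.
have [a [v g]] := germ_ex q (UV t Ut).
have [[W [oW Wt WU e]] [W' [oW' Wt' WU' e']]] := (Ps t a v Ut g, Ps' t a v Ut g).
have [Z [oZ Zt _ [i ei]]] := un t v (fst g).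
pose K := W `&` (W' `&` Z).
have oK: open K by apply: openI=> //; apply: openI.
have [KW KW' KZ]: [/\ K `<=` W, K `<=` W' & K `<=` Z] by split=> x [? []].
have KU := subset_trans KW WU.
exists K.
have f1: res U K s * res setT K (phi v) = res setT K (phi a).
 have := congr1 (res W K) e.
 by rewrite (rmM (res_rm oW oK KW)) !res_res //; exact: openT.
have f2: res U K s' * res setT K (phi v) = res setT K (phi a).
 have := congr1 (res W' K) e'.
 by rewrite (rmM (res_rm oW' oK KW')) !res_res //; exact: openT.
have f3: res setT K (phi v) * res Z K i = 1.
 have rZ := res_rm oZ oK KZ; have := congr1 (res Z K) ei.
 by rewrite (rmM rZ) (rm1 rZ) !res_res //; exact: openT.
by rewrite -[LHS]mulr1 -[RHS]mulr1 -f3 !mulrA f1 f2.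
Qed.
(** The image of a point t is the prime of the functions in A whose pullback vanishes at t, and the
    comorphism is determined because every germ on the target is a fraction of elements of A. *)
Lemma hom_of_inj e e' : hom_of e =1 hom_of e' -> e = e'.
move=> H; have ept t: e t = e' t.
 apply: idl_inj; apply/seteqP; split=> a.
 by move=> ea; apply: contrapT=> /(unit_hom_of e'); rewrite -H=> /(unit_hom_of e).
 by move=> ea; apply: contrapT=> /(unit_hom_of e); rewrite H=> /(unit_hom_of e').
apply: shom_ext=> // V oV s t Vt.
have e1: e @^-1` V = e' @^-1` V by apply/seteqP; split=> x; rewrite /= ept.
exists (e @^-1` V); split=> //; [exact: hopen | by rewrite e1|].
have oe := hopen e oV.
have P2 := @pull_pullsto e' V oV s.
apply: (pullsto_uniq (q := s) (phi := hom_of e) (f := e))=> //.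
- by move=> x a /(unit_hom_of e).
- rewrite res_id //; exact: pull_pullsto.
- move: (pull e' oV s) P2; rewrite -e1=> z P2; rewrite res_id // => x a v Vx g.
 have [|W [oW Wx WV eW]] := P2 x a v Vx; first by rewrite -(ept x).
 by exists W; rewrite !H.
Qed.

Section Existence.
Variable phi : A -> gsec T.
Hypotheses (pm : is_rmorph phi) (pstr : forall c, phi (jA c) = str T setT c).
Hypothesis pOm : forall t : T, exists2 x, x \in r & unit_at t (phi x).

Let ptOK (t : T) : prime_ideal [set a | ~ unit_at t (phi a)] /\
 exists2 x, x \in r & ~ ~ unit_at t (phi x).
have up := unit_prime t; split; last by have [x xr u] := pOm t; exists x.
split.
- by rewrite /= (rm0 pm); exact: (prime0 up).
- by move=> a b; rewrite /= (rmD pm); exact: (primeD up).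
- by move=> a b; rewrite /= (rmM pm); exact: (primeMl up).
- by rewrite /= (rm1 pm); exact: (prime1 up).
- by move=> a b; rewrite /= (rmM pm); exact: (primeM up).
Qed.

Definition ptmap (t : T) : X := exist _ _ (ptOK t).

Lemma ptmapP t a : ~ idl (ptmap t) a <-> unit_at t (phi a).
by split=> [|u]; [exact: contrapT | exact]. Qed.
Lemma ptmap_op (V : set X) : open V -> open (ptmap @^-1` V).
rewrite qaopE openE=> oV t /oV[s [ts sV]].
have : open_nbhs t (basic_open (phi s)) by split; [exact: open_basic | exact/ptmapP].
by move=> /open_nbhs_nbhs; apply: filterS=> x /ptmapP xs; apply: sV.
Qed.
Lemma pullsto_frac (V : set X) (q : qasec V) (U Z : set T) a s (i : sec T Z) :
 open U -> open Z -> U `<=` Z -> res setT Z (phi s) * i = 1 ->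
 (forall x, U x -> V (ptmap x) /\ germ q (ptmap x) a s) ->
 pullsto phi ptmap q (res setT U (phi a) * res Z U i).
move=> oU oZ UZ ei HU x b v Ux g; have [Vx g'] := HU x Ux.
have [u xu eu] := germ_feq Vx g' g.
have [K [oK Kx _ [k ek]]] := proj1 (ptmapP x u) xu.
have oI := openI oK oU; exists (K `&` U); split=> //.

have sZ: K `&` U `<=` Z by exact: subset_trans _ UZ.
rewrite (rmM (res_rm oU oI (@subIsetr _ _ _))) !res_res //; try exact: openT.
have rT := res_rm openT oI (subsetT _).
have e1: res setT (K `&` U) (phi s) * res Z _ i = 1.
 have rZ := res_rm oZ oI sZ; have := congr1 (res Z (K `&` U)) ei.
 by rewrite (rmM rZ) (rm1 rZ) !res_res //; exact: openT.
have e2: res setT (K `&` U) (phi u) * res K _ k = 1.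
 have rK := res_rm oK oI (@subIsetl _ _ _); have := congr1 (res K (K `&` U)) ek.
 by rewrite (rmM rK) (rm1 rK) !res_res //; exact: openT.
have e3 := congr1 (fun z=> res setT (K `&` U) (phi z)) eu.
rewrite (rmM pm) (rmB pm) !(rmM pm) (rm0 pm) in e3.
rewrite (rmM rT) (rmB rT) !(rmM rT) (rm0 rT) in e3.
move: e1 e2 e3; move: (res setT _ (phi a)) (res setT _ (phi v)) (res setT _ (phi b)).
move: (res setT _ _) (res setT _ (phi u)) (res Z _ i) (res K _ k).
move=> S U0 J K0 a0 v0 b0 e1 e2 e3.
have e4: a0 * v0 - b0 * S = 0.
 transitivity (K0 * (U0 * (a0 * v0 - b0 * S)) + (1 - U0 * K0) * (a0 * v0 - b0 * S)).
 ring.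
 by rewrite e3 e2; ring.
transitivity (b0 * (S * J) + J * (a0 * v0 - b0 * S)); first by ring.
by rewrite e1 e4; ring.
Qed.
(** Where [q] is a/s, the pullback is phi a / phi s on the open set on which phi s is invertible. *)
Lemma pullsto_loc (V : set X) (q : qasec V) t : open V -> V (ptmap t) ->
 exists U (s : sec T U), [/\ open U, U t, U `<=` ptmap @^-1` V & pullsto phi ptmap q s].
move=> oV Vt; have [a [s [xs H]]] := germ_loc q Vt.
have [Z [oZ Zt _ [i ei]]] := proj1 (ptmapP t s) xs.
pose U := Z `&` (ptmap @^-1` (V `&` D s)).
have oU: open U.
 by apply: openI=> //; apply: ptmap_op; apply: openI=> //; exact: open_D.
exists U, (res setT U (phi a) * res Z U i); split=> //; first by move=> x [_ []].
by apply: (pullsto_frac oU oZ _ ei)=> [x []//|x [_ [Vx xs']]]; split=> //; apply: H.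
Qed.
Lemma pullsto_ex (V : set X) (oV : open V) (q : qasec V) :
 exists tau : sec T (ptmap @^-1` V), pullsto phi ptmap q tau.
have un t a: ~ idl (ptmap t) a -> unit_at t (phi a) by move/ptmapP.
have oW: open (ptmap @^-1` V) by exact: ptmap_op.
have [|U U' s oU oU' U'U UV Ps|t Vt|tau Ht] :=
 @sheaf_glue F T (fun U tau=> pullsto phi ptmap q tau) _ oW.
- by move=> U s s' oU UV; apply: pullsto_uniq.
- move=> t a v U't g; have [W [oW' Wt WU e]] := Ps t a v (U'U t U't) g.
 have oI := openI oW' oU'; exists (W `&` U').
 have := congr1 (res W (W `&` U')) e.
 by rewrite (rmM (res_rm oW' oI (@subIsetl _ _ _))) !res_res //; exact: openT.
- exact: pullsto_loc.
exists tau=> t a s Vt g.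
have [U [sg [oU Ut UV Ps]]] := pullsto_loc q oV Vt.
have [W [oW' Wt WU e]] := Ps t a s Ut g; exists W; split=> //; first exact: subset_trans WU UV.
by rewrite -e -(Ht U sg oU UV Ps) res_res.
Qed.

Definition pbk (V : set X) (oV : open V) (q : qasec V) : sec T (ptmap @^-1` V) :=
 sval (cid (pullsto_ex oV q)).

Lemma pbkP (V : set X) (oV : open V) (q : qasec V) : pullsto phi ptmap q (pbk oV q).
exact: (svalP _). Qed.
Lemma pbk_eq (V : set X) (oV : open V) (q : qasec V) tau :
 pullsto phi ptmap q tau -> pbk oV q = tau.
have un t a: ~ idl (ptmap t) a -> unit_at t (phi a) by move/ptmapP.
move=> H; exact (pullsto_uniq (ptmap_op oV) (@subset_refl _ _) un (@pbkP V oV q) H).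
Qed.
Lemma pullsto_one (V : set X) (q : qasec V) (U : set T) (tau : sec T U) :
 open U -> U `<=` ptmap @^-1` V ->
 (forall t, U t -> exists a s W, [/\ germ q (ptmap t) a s, open W, W t, W `<=` U
 & res U W tau * res setT W (phi s) = res setT W (phi a)]) ->
 pullsto phi ptmap q tau.
move=> oU UV H t b v Ut g; have [a [s [W [g' oW Wt WU e]]]] := H t Ut.
have [u xu eu] := germ_feq (UV t Ut) g' g.
have [K [oK Kx _ [k ek]]] := proj1 (ptmapP t _) (primenM (idlP _) xu (fst g')).
have oI := openI oK oW; exists (K `&` W); split=> //.
 exact: subset_trans _ WU.
have e1 := congr1 (res W (K `&` W)) e.
rewrite (rmM (res_rm oW oI (@subIsetr _ _ _))) !res_res // in e1; try exact: openT.
have rT := res_rm openT oI (subsetT _).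
have e2: res setT (K `&` W) (phi (u * s)) * res K _ k = 1.
 have rK := res_rm oK oI (@subIsetl _ _ _); have := congr1 (res K (K `&` W)) ek.
 by rewrite (rmM rK) (rm1 rK) !res_res //; exact: openT.
have e3 := congr1 (fun z=> res setT (K `&` W) (phi z)) eu.
rewrite (rmM pm) (rmB pm) !(rmM pm) (rm0 pm) in e3.
rewrite (rmM rT) (rmB rT) !(rmM rT) (rm0 rT) in e3.
rewrite (rmM pm) (rmM rT) in e2.
move: e1 e2 e3; move: (res setT _ (phi a)) (res setT _ (phi v)) (res setT _ (phi b)).
move: (res setT _ _) (res setT _ (phi u)) (res K _ k) (res U _ tau).
move=> S U0 K0 T0 a0 v0 b0 e1 e2 e3.
have e4: U0 * S * (T0 * v0 - b0) = 0.
 transitivity (U0 * (T0 * S * v0 - b0 * S)); first by ring.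
 by rewrite e1.
apply/eqP; rewrite -subr_eq0; apply/eqP.
transitivity (K0 * (U0 * S * (T0 * v0 - b0)) + (1 - U0 * S * K0) * (T0 * v0 - b0)); first by ring.
by rewrite e4 e2; ring.
Qed.

Definition agree (U : set T) (tau : sec T U) t a s := exists W, [/\ open W, W t, W `<=` U
 & res U W tau * res setT W (phi s) = res setT W (phi a)].

Lemma agree_op (U : set T) (tau tau' : sec T U) t a s b v : open U ->
 agree tau t a s -> agree tau' t b v ->
 agree (tau + tau') t (a * v + b * s) (s * v) /\ agree (tau * tau') t (a * b) (s * v).
move=> oU [W [oW Wt WU e]] [W' [oW' Wt' WU' e']].
have oI := openI oW oW'.
have e1 := congr1 (res W (W `&` W')) e.
have e2 := congr1 (res W' (W `&` W')) e'.
rewrite (rmM (res_rm oW oI (@subIsetl _ _ _))) !res_res // in e1; try exact: openT.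
rewrite (rmM (res_rm oW' oI (@subIsetr _ _ _))) !res_res // in e2; try exact: openT.
have IU: W `&` W' `<=` U by exact: subset_trans _ WU.
have rU := res_rm oU oI IU; have rT := res_rm openT oI (subsetT _).
split; exists (W `&` W'); split=> //.
 by rewrite (rmD pm) !(rmM pm) (rmD rU) (rmD rT) !(rmM rT) -e1 -e2; ring.
by rewrite !(rmM pm) (rmM rU) !(rmM rT) -e1 -e2; ring.
Qed.
Lemma pullsto_one' (V : set X) (q : qasec V) (U : set T) (tau : sec T U) :
 open U -> U `<=` ptmap @^-1` V ->
 (forall t, U t -> exists a s, germ q (ptmap t) a s /\ agree tau t a s) ->
 pullsto phi ptmap q tau.
move=> oU UV H; apply: pullsto_one=> // t Ut.
by have [a [s [g [W [oW Wt WU e]]]]] := H t Ut; exists a, s, W.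
Qed.
Lemma pullsto_glob (V : set X) a : open V ->
 pullsto phi ptmap (qaglob V a) (res setT (ptmap @^-1` V) (phi a)).
move=> oV; have oU := ptmap_op oV.
apply: pullsto_one'=> // t Vt; exists a, 1; split; first exact: gglob.
exists (ptmap @^-1` V); split=> //.

by rewrite res_id // (rm1 pm) (rm1 (res_rm openT oU (subsetT _))) mulr1.
Qed.
Lemma pbk_rm (V : set X) (oV : open V) : is_rmorph (pbk oV).
have oU := ptmap_op oV.
have E0: pbk oV 0 = 0.

 by rewrite -(rm0 (glob_rm V)) (pbk_eq _ (pullsto_glob (a := 0) oV)) (rm0 pm) (rm0 (res_rm openT oU (subsetT _))).
have ED p q: pbk oV (p + q) = pbk oV p + pbk oV q.
 apply: pbk_eq; apply: pullsto_one'=> // t Vt.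
 have [[a [s g]] [b [v g']]] := (germ_ex p Vt, germ_ex q Vt).
 exists (a * v + b * s), (s * v); split; first exact: germD.
 exact (proj1 (agree_op oU (pbkP oV Vt g) (pbkP oV Vt g'))).
split=> [p q|]; last split=> [|p q].
- have EN: pbk oV (- q) = - pbk oV q by apply/eqP; rewrite -subr_eq0 opprK -ED addNr E0.
 by rewrite ED EN.
-
 by rewrite -(rm1 (glob_rm V)) (pbk_eq _ (pullsto_glob (a := 1) oV)) (rm1 pm) (rm1 (res_rm openT oU (subsetT _))).
- apply: pbk_eq; apply: pullsto_one'=> // t Vt.
 have [[a [s g]] [b [v g']]] := (germ_ex p Vt, germ_ex q Vt).
 exists (a * b), (s * v); split; first exact: germM.
 exact (proj2 (agree_op oU (pbkP oV Vt g) (pbkP oV Vt g'))).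
Qed.
Lemma pbk_res (U V : set X) (oU : open U) (oV : open V) (q : qasec U) : V `<=` U ->
 pbk oV (qares V q) = res (ptmap @^-1` U) (ptmap @^-1` V) (pbk oU q).
move=> VU; have [oU' oV'] := (ptmap_op oU, ptmap_op oV).
have VU': ptmap @^-1` V `<=` ptmap @^-1` U by move=> x /VU.
apply: pbk_eq; apply: pullsto_one'=> // t Vt; have Ut := VU _ Vt.
have [a [s g]] := germ_ex q Ut; exists a, s; split; first exact: germ_res.
have [W [oW Wt WU e]] := pbkP oU Ut g; have oI := openI oW oV'.
exists (W `&` ptmap @^-1` V).
have := congr1 (res W (W `&` ptmap @^-1` V)) e.
by rewrite (rmM (res_rm oW oI (@subIsetl _ _ _))) !res_res //; exact: openT.
Qed.
Lemma pbk_str (V : set X) (oV : open V) c : pbk oV (qastr jA V c) = str T (ptmap @^-1` V) c.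
rewrite (pbk_eq _ (pullsto_glob (a := jA c) oV)) pstr res_str //; [exact: openT | exact: ptmap_op].
Qed.
Lemma pbk_local (V : set X) (oV : open V) t (q : qasec V) :
 V (ptmap t) -> unit_at t (pbk oV q) -> unit_at (X := Y) (ptmap t) q.
move=> Vt u; have [a [s g]] := germ_ex q Vt; apply/(unit_germ jA oV Vt g)/ptmapP.
have [W [oW Wt WU e]] := pbkP oV Vt g.

apply/(unit_at_res _ openT oW (subsetT _) Wt); rewrite -e.
apply: unitM=> //; first exact/(unit_at_res _ (ptmap_op oV) oW WU Wt).
by apply/(unit_at_res _ openT oW _ Wt)/ptmapP; case: g.
Qed.

Definition shom_of : shom T Y :=
 @SHom F T Y ptmap ptmap_op pbk pbk_rm pbk_res pbk_str pbk_local.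

Lemma hom_of_shom_of a : hom_of shom_of a = phi a.
rewrite /= (pbk_eq _ (pullsto_glob (a := a) openT)).
by apply: res_id; exact: openT.
Qed.

End Existence.
(** With [hom_of_inj] this describes the functor of points: a morphism is an algebra map from A
    under which, at each point of T, some member of [r] becomes a unit. *)
Lemma hom_of_ex (phi : A -> gsec T) : is_rmorph phi ->
 (forall c, phi (jA c) = str T setT c) ->
 (forall t : T, exists2 x, x \in r & unit_at t (phi x)) ->
 exists e : shom T Y, hom_of e =1 phi.
by move=> pm pstr pOm; exists (shom_of pm pstr pOm); apply: hom_of_shom_of. Qed.

End MapsToQA.

(** * Noetherian rings and finite presentation *)

Section Noetherian.
Variable B : cring.

Definition subring (S : set B) : Prop :=
 [/\ S 1, forall a b, S a -> S b -> S (a - b) & forall a b, S a -> S b -> S (a * b)].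

Lemma subring0 S : subring S -> S 0.
by move=> [S1 SB _]; rewrite -(subrr 1); apply: SB. Qed.
Lemma subringN S a : subring S -> S a -> S (- a).
by move=> Sr Sa; rewrite -sub0r; have [_ SB _] := Sr; apply: SB=> //; apply: subring0. Qed.
Lemma subringD S a b : subring S -> S a -> S b -> S (a + b).
by move=> Sr Sa Sb; rewrite -[b]opprK; have [_ SB _] := Sr; apply: SB=> //; apply: subringN.
Qed.
Lemma subringX S a n : subring S -> S a -> S (a ^+ n).
by move=> [S1 _ SM] Sa; elim: n=> [|n IH]; rewrite // exprS; apply: SM.
Qed.
Lemma subring_sum S (J : Type) (r : seq J) (P : pred J) (G : J -> B) : subring S ->
 (forall i, P i -> S (G i)) -> S (\sum_(i <- r | P i) G i).
by move=> Sr H; elim/big_ind: _=> //; [exact: subring0 | move=> a b; exact: subringD].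
Qed.

Definition sideal (S I : set B) : Prop :=
 [/\ I `<=` S, I 0, forall a b, I a -> I b -> I (a + b)
 & forall a b, S a -> I b -> I (a * b)].

Definition smod (S G : set B) : set B := [set g | exists L : seq (B * B),
 (forall x, x \in L -> S x.1 /\ G x.2) /\ g = \sum_(x <- L) x.1 * x.2].

Lemma smodD S G a b : smod S G a -> smod S G b -> smod S G (a + b).
move=> [L [HL ->]] [K [HK ->]]; exists (L ++ K); split; last by rewrite big_cat.
by move=> x; rewrite mem_cat=> /orP[/HL|/HK].
Qed.
Lemma smodM S G a b : subring S -> S a -> smod S G b -> smod S G (a * b).
move=> [_ _ SM] Sa [L [HL ->]]; exists [seq (a * x.1, x.2) | x <- L]; split.
 by move=> x /mapP[y /HL[? ?] ->]; split=> //; apply: SM.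
by rewrite big_map big_distrr /=; apply: eq_bigr=> x _; rewrite mulrA.
Qed.
Lemma smod0 S G : smod S G 0.
by exists [::]; rewrite big_nil. Qed.
Lemma smod_mem S G a : subring S -> G a -> smod S G a.
move=> [S1 _ _] Ga; exists [:: (1, a)]; split; last by rewrite big_seq1 mul1r.
by move=> x; rewrite inE=> /eqP ->.
Qed.

Definition noethS (S : set B) : Prop := forall I, sideal S I ->
 exists l : seq B, (forall x, x \in l -> I x) /\ I `<=` smod S [set` l].

Section Hilbert.
Variables (S : set B) (x : B).
Hypotheses (Sr : subring S) (Sn : noethS S).

Definition polyof n : set B :=
 [set g | exists e : nat -> B, (forall i, S (e i)) /\ g = \sum_(i < n) e i * x ^+ i].

Definition adj : set B := [set g | exists n, polyof n g].

Lemma polyof_le m n : (m <= n)%N -> polyof m `<=` polyof n.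
move=> mn _ [e [Se ->]]; exists (fun i=> if (i < m)%N then e i else 0); split.
 by move=> i; case: ifP=> // _; apply: subring0.
rewrite (big_ord_widen n (fun i=> e i * x ^+ i)) //= big_mkcond.
by apply: eq_bigr=> i _; case: ifP=> // _; rewrite mul0r.
Qed.
Lemma polyof0 n : polyof n 0.
exists (fun=> 0); split=> [_|]; first exact: subring0.
by rewrite big1 // => i _; rewrite mul0r.
Qed.
Lemma polyofB n a b : polyof n a -> polyof n b -> polyof n (a - b).
move=> [e [Se ->]] [d [Sd ->]]; exists (fun i=> e i - d i).
split=> [i|]; first by have [_ SB _] := Sr; apply: SB.
by rewrite -sumrB; apply: eq_bigr=> i _; rewrite mulrBl.
Qed.
Lemma polyofD n a b : polyof n a -> polyof n b -> polyof n (a + b).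
move=> [e [Se ->]] [d [Sd ->]]; exists (fun i=> e i + d i).
split=> [i|]; first exact: subringD.
by rewrite -big_split; apply: eq_bigr=> i _; rewrite mulrDl.
Qed.
Lemma polyofZ n s a : S s -> polyof n a -> polyof n (s * a).
move=> Ss [e [Se ->]]; exists (fun i=> s * e i).
split=> [i|]; first by have [_ _ SM] := Sr; apply: SM.
by rewrite big_distrr /=; apply: eq_bigr=> i _; rewrite mulrA.
Qed.
Lemma polyof_shift n k a : polyof n a -> polyof (k + n) (x ^+ k * a).
move=> [e [Se ->]]; elim: k=> [|k [d [Sd ed]]].
 by exists e; rewrite mul1r.
exists (fun i=> if i is j.+1 then d j else 0); split.
 by move=> [|i]; [exact: subring0 | exact: Sd].
rewrite exprS -mulrA ed big_ord_recl mul0r add0r big_distrr /=.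
by apply: eq_bigr=> i _; rewrite exprS; ring.
Qed.
Lemma polyofS n a : polyof n.+1 a <-> exists c h, [/\ S c, polyof n h & a = c * x ^+ n + h].
split=> [[e [Se ->]]|[c [h [Sc [e [Se ->]] ->]]]].
 exists (e n), (\sum_(i < n) e i * x ^+ i); split=> //; first by exists e.
 by rewrite big_ord_recr addrC.
exists (fun i=> if i == n then c else e i); split; first by move=> i; case: ifP.
rewrite big_ord_recr /= eqxx addrC; congr (_ + _); apply: eq_bigr=> i _.
by rewrite ltn_eqF.
Qed.
Lemma polyof_const s : S s -> polyof 1 s.
by exists (fun=> s); rewrite big_ord1 mulr1. Qed.
Lemma adj_subring : subring adj.
split.
- by exists 1; apply: polyof_const; case: Sr.
- move=> a b [n Ha] [m Hb]; exists (maxn n m); apply: polyofB.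
 exact: polyof_le (leq_maxl _ _) _ Ha.
 exact: polyof_le (leq_maxr _ _) _ Hb.
- move=> a b [n [e [Se ->]]] [m Hb]; exists (n + m); rewrite big_distrl /=.
 elim/big_ind: _=> [|u v|i _]; [exact: polyof0 | exact: polyofD |].
 rewrite -mulrA; apply: polyofZ=> //; apply: polyof_le (polyof_shift i Hb).
 by rewrite leq_add2r ltnW.
Qed.
Lemma adj_x : adj x.
exists 2; exists (fun i=> if i == 1 then 1 else 0); split.
 by move=> i; case: ifP=> _; [case: Sr | exact: subring0].
by rewrite big_ord_recr big_ord1 /= mul0r add0r mul1r.
Qed.
Lemma adj_sub : S `<=` adj.
by exists 1; apply: polyof_const. Qed.
(** Hilbert's basis theorem, for S[x] inside a fixed ring. As x may be algebraic over S, all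
    finitely generated algebras are reached by adjoining one generator after another, with no
    quotient of a polynomial ring. *)
Lemma hilbert : noethS adj.
move=> I [IS I0 ID IM].
have ar := adj_subring.
have IB a b: I a -> I b -> I (a - b).
 move=> Ia Ib; apply: ID=> //; rewrite -mulN1r; apply: IM=> //.
 by apply: subringN; case: ar.
(* An element of I may have several expressions in x. The leading coefficients of all of them still
   form an ideal of S, which grows with n. *)
pose Lc n := [set c | S c /\ exists2 h, polyof n h & I (c * x ^+ n + h)].
have Lc_id n: sideal S (Lc n).
 split; first by move=> c [].
 - by split; [exact: subring0 | exists 0; [exact: polyof0 | rewrite mul0r addr0]].
 - move=> a b [Sa [h Hh Ia]] [Sb [k Hk Ib]]; split; first exact: subringD.
 exists (h + k); first exact: polyofD.
 by rewrite mulrDl addrACA; apply: ID.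
 - move=> a b Sa [Sb [h Hh Ib]]; split; first by have [_ _ SM] := Sr; apply: SM.
 exists (a * h); first exact: polyofZ.
 by rewrite -mulrA -mulrDr; apply: IM=> //; apply: adj_sub.
have Lc_shift n k c: Lc n c -> Lc (k + n) c.
 move=> [Sc [h Hh Ic]]; split=> //; exists (x ^+ k * h); first exact: polyof_shift.
 rewrite exprD mulrCA -mulrDr; apply: IM=> //; apply: subringX=> //; exact: adj_x.
pose L := [set c | exists n, Lc n c].
have L_id: sideal S L.
 split; first by move=> c [n []].
 - by exists 0; have [_ ? _ _] := Lc_id 0.
 - move=> a b [n Ha] [m Hb]; exists (m + n); have [_ _ D _] := Lc_id (m + n)%N.
 by apply: D; [exact: Lc_shift | rewrite addnC; exact: Lc_shift].
 - by move=> a b Sa [n Hb]; exists n; have [_ _ _ M] := Lc_id n; apply: M.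
have [l [lL Ll]] := Sn L_id.
have [||N HN] := @unif_bnd B l (fun c n=> Lc n c).
- by move=> c m n mn; rewrite -(subnK mn); apply: Lc_shift.
- by [].
have [ln Hln] := choice (fun n=> Sn (Lc_id n)).
have ch c n: exists f, Lc n c -> exists2 h, polyof n h & f = c * x ^+ n + h /\ I f.
 have [[Sc [h Hh Ic]]|no] := pselect (Lc n c); last by exists 0.
 by exists (c * x ^+ n + h)=> _; exists h.
have [fc0 Hfc0] := choice (fun cn : B * nat=> ch cn.1 cn.2).
pose fc n c := fc0 (c, n).
have Hfc n c: Lc n c -> exists2 h, polyof n h & fc n c = c * x ^+ n + h /\ I (fc n c).
 exact: (Hfc0 (c, n)).
pose G := [seq fc N c | c <- l] ++ flatten [seq [seq fc n c | c <- ln n] | n <- iota 0 N].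
exists G; split.
 move=> g; rewrite mem_cat=> /orP[/mapP[c cl ->]|/flatten_mapP[n _ /mapP[c cl ->]]].
 by have [h _ []] := Hfc N c (HN c cl).
 by have [h _ []] := Hfc n c (proj1 (Hln n) c cl).
suff H n g: I g -> polyof n g -> smod adj [set` G] g.
 by move=> g Ig; have [n Hn] := IS g Ig; apply: H Hn.
elim: n g=> [|n IH] g Ig.
 by move=> [e [_ ->]]; rewrite big_ord0; apply: smod0.
move=> /polyofS[c [h [Sc Hh eg]]].
have Lcn: Lc n c by split=> //; exists h=> //; rewrite -eg.
suff [g' [Ig' Gg' [h' Hh' eg']]] : exists g', [/\ I g', smod adj [set` G] g'
 & exists2 h', polyof n h' & g' = c * x ^+ n + h'].
 rewrite -(subrK g' g); apply: smodD=> //; apply: IH; first exact: IB.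
 by rewrite eg eg' opprD addrACA subrr add0r; apply: polyofB.
have build m k (lm : seq B) : (forall d, d \in lm -> Lc m d) ->
 (forall d, d \in lm -> fc m d \in G) -> n = (k + m) -> smod S [set` lm] c ->
 exists g', [/\ I g', smod adj [set` G] g' & exists2 h', polyof n h' & g' = c * x ^+ n + h'].
 move=> lmL lmG enk [K [HK ec]].
 exists (\sum_(z <- K) z.1 * x ^+ k * fc m z.2).
 have xk: adj (x ^+ k) by apply: subringX=> //; exact: adj_x.
 have Hz z: z \in K -> adj (z.1 * x ^+ k).
 by move=> /HK[Sz _]; have [_ _ aM] := ar; apply: aM=> //; apply: adj_sub.
 split.
 - rewrite big_seq; elim/big_ind: _=> // z zK; apply: IM; first exact: Hz.
 by have [_ /lmL Lz] := HK z zK; have [? _ []] := Hfc m z.2 Lz.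
 - rewrite big_seq; elim/big_ind: _=> [|a b|z zK]; [exact: smod0 | exact: smodD |].
 apply: smodM=> //; first exact: Hz.
 by apply: smod_mem=> //; have [_ zl] := HK z zK; apply: lmG.
 - have chh d: exists h, Lc m d -> polyof m h /\ fc m d = d * x ^+ m + h.
 have [Ld|nL] := pselect (Lc m d); last by exists 0.
 by have [h0 Hh0 [e0 _]] := Hfc m d Ld; exists h0.
 have [hh Hhh] := choice chh.
 exists (\sum_(z <- K) z.1 * (x ^+ k * hh z.2)).
 rewrite big_seq; elim/big_ind: _=> [|a b|z zK]; [exact: polyof0 | exact: polyofD |].
 have [Sz zl] := HK z zK; apply: polyofZ=> //; rewrite enk; apply: polyof_shift.
 by have [] := Hhh z.2 (lmL _ zl).
 rewrite ec big_distrl -big_split /= !big_seq; apply: eq_bigr=> z zK.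
 have [Sz zl] := HK z zK; have [_ ->] := Hhh z.2 (lmL _ zl).
 by rewrite enk exprD; ring.
have [nN|Nn] := ltnP n N.
 apply: (build n 0 _)=> //; first exact: (proj1 _).
 move=> d dl; rewrite mem_cat; apply/orP; right; apply/flatten_mapP.
 by exists n; [rewrite mem_iota| apply/mapP; exists d].
 exact: (proj2 (Hln n)).
apply: (build N (n - N)%N l)=> //; first by move=> d dl; rewrite mem_cat map_f.
 lia.
by apply: Ll; exists n.
Qed.

End Hilbert.

Definition noeth : Prop := forall I, ideal I -> exists l : seq B,
 (forall x, x \in l -> I x) /\ I `<=` idg [set` l].

Lemma fg_noeth (F : fieldType) (j : F -> B) (s : seq B) : is_rmorph j ->
 generated_by (range j `|` [set` s]) -> noeth.
move=> jm gen.
have [S [Sr Sn jS sS]] : exists S, [/\ subring S, noethS S, range j `<=` S & [set` s] `<=` S].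
 elim: s {gen} => [|x s [S [Sr Sn jS sS]]]; last first.
 exists (adj S x); split; [exact: adj_subring | exact: hilbert | |].
 by move=> y /jS; apply: adj_sub.
 move=> y /=; rewrite inE=> /predU1P[->|ys]; first exact: adj_x.
 by apply: adj_sub; apply: sS.
 exists (range j); split=> //.
 split; first by exists 1; rewrite ?(rm1 jm).
 by move=> _ _ [a _ <-] [b _ <-]; exists (a - b); rewrite ?(rmB jm).
 by move=> _ _ [a _ <-] [b _ <-]; exists (a * b); rewrite ?(rmM jm).
 move=> I [IS I0 ID IM].
 have [[c Ic c0]|no] := pselect (exists2 c, I (j c) & c != 0).
 exists [:: 1]; split.
 move=> y; rewrite inE=> /eqP ->; rewrite -(rm1 jm) -(mulVf c0) (rmM jm).
 exact: IM.
 move=> _ /IS[b _ <-]; exists [:: (j b, 1)]; split; last by rewrite big_seq1 mulr1.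
 by move=> y; rewrite inE=> /eqP -> /=; split; [exists b | rewrite mem_head].
 exists [::]; split=> // y Iy; have [b _ eb] := IS y Iy.
 have [b0|b0] := eqVneq b 0; first by rewrite -eb b0 (rm0 jm); apply: smod0.
 by case: no; exists b=> //; rewrite eb.
have Sall a: S a.
 by have [S1 SB SM] := Sr; apply: (gen S)=> // y [/jS|/sS].
move=> I [I0 ID IM]; have [|l [lI Il]] := Sn I; first by split=> // a b _; apply: IM.
by exists l; split=> // y /Il[L [HL ->]]; exists L; split=> // z /HL[].
Qed.

End Noetherian.

Lemma poly_alg_ex (A : cring) n : exists (P : cring) (g : A -> P) (x : 'I_n -> P),
 is_polynomial_algebra g x /\ generated_by (range g `|` range x).
pose Sol S (j : A -> S) (c : 'I_n -> S) := True.
exists _, (@ustr A 'I_n Sol), (@ugen A 'I_n Sol); split; last first.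
 move=> P P1 PB PM sP; have P0: P 0 by rewrite -(subrr 1); apply: PB.
 have PN a: P a -> P (- a) by rewrite -sub0r; apply: PB.
 apply: usol_ind=> //.
 - by move=> a; apply: sP; left.
 - by move=> i; apply: sP; right.
 - by move=> a b Pa Pb; rewrite -[b]opprK; apply: PB=> //; apply: PN.
split; first exact: ustr_rm.
move=> C u y; have um := rm_of u.
exists (mkrm (uev_rm (Sol := Sol) um (I : Sol C u y))).
 split=> [a|i]; first exact: (uev_str um I).
 exact: (uev_gen um I).
move=> h' h'g h'x a.
apply: (usol_ext (rm_of h') (uev_rm um I))=> [b|i].
 by rewrite (uev_str um I).
by rewrite (uev_gen um I).
Qed.
Lemma gen_trans (A B : cring) (f : A -> B) (T : set A) (S : set B) : is_rmorph f ->
 generated_by T -> generated_by (range f `|` S) -> generated_by (f @` T `|` S).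
move=> fm gA gB P P1 PB PM sP; apply: gB=> // b [[a _ <-]|Sb]; last by apply: sP; right.
apply: (gA [set a | P (f a)])=> /=.
- by rewrite (rm1 fm).
- by move=> x y; rewrite (rmB fm); apply: PB.
- by move=> x y; rewrite (rmM fm); apply: PM.
- by move=> t Tt; apply: sP; left.
Qed.
(** The polynomial algebra over A is finitely generated over the field, hence noetherian, so the
    kernel of a presentation is finitely generated. *)
Lemma fg_fp (F : fieldType) (A B : cring) (j : F -> A) (f : A -> B) (s : seq A) (l : seq B) :
 is_rmorph j -> is_rmorph f -> generated_by (range j `|` [set` s]) ->
 generated_by (range f `|` [set` l]) -> finite_presentation f.
move=> jm fm gA gB; have [P [g [x [pol gP]]]] := poly_alg_ex A (size l).
have [gm uni] := pol.
have [h [hg hx] _] := uni B (mkrm fm) (fun i=> l`_i).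
have nP: noeth P.
 apply: (fg_noeth (j := g \o j) (s := map g s ++ codom x)); first exact: rm_comp.
 have := gen_trans gm gA gP; congr generated_by; apply/seteqP; split=> y.
 move=> [[a [[c _ <-]|as_] <-]|[i _ <-]]; [by left; exists c | |].
 by right=> /=; rewrite mem_cat map_f.
 by right=> /=; rewrite mem_cat codom_f orbT.
 move=> [[c _ <-]|/=]; first by left; exists (j c)=> //; left.
 rewrite mem_cat=> /orP[/mapP[a as_ ->]|/codomP[i ->]]; first by left; exists a=> //; right.
 by right; exists i.
have Kid: ideal [set p | h p = 0].
 split; rewrite /= ?rmorph0 // => a b; first by move=> ea eb; rewrite rmorphD eb addr0.
 by move=> eb; rewrite rmorphM eb mulr0.
have [k [kK Kk]] := nP _ Kid.
exists P, g, _, x, h, k; split=> //.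
- apply: (gB [set b | exists p, h p = b])=> /=.
 + by exists 1; rewrite rmorph1.
 + by move=> _ _ [p <-] [q <-]; exists (p - q); rewrite rmorphB.
 + by move=> _ _ [p <-] [q <-]; exists (p * q); rewrite rmorphM.
 + move=> y [[a _ <-]|/= yl]; first by exists (g a).
 have il: (index y l < size l)%N by rewrite index_mem.
 by exists (x (Ordinal il)); rewrite hx nth_index.
- split=> [/Kk|[c ->]]; last first.
 rewrite rmorph_sum big1 // => i _; rewrite rmorphM [h k`_i](kK _ (mem_nth 0 (ltn_ord i))).
 ring.
 move: p; apply: idg_min.
 split.
 + by exists (fun=> 0); rewrite big1 // => i _; rewrite mul0r.
 + move=> _ _ [c ->] [d ->]; exists (fun i=> c i + d i).
 by rewrite -big_split; apply: eq_bigr=> i _; rewrite mulrDl.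
 + move=> a _ [c ->]; exists (fun i=> a * c i).
 by rewrite big_distrr /=; apply: eq_bigr=> i _; rewrite mulrA.
 move=> y yk; have ik: (index y k < size k)%N by rewrite index_mem.
 exists (fun i=> (i == Ordinal ik)%:R); rewrite (bigD1 (Ordinal ik)) //= eqxx mul1r nth_index //.
 by rewrite big1 ?addr0 // => i /negbTE ->; rewrite mul0r.
Qed.
Lemma idg_patch (R : cring) (E : eqType) (f : E -> R) (L : seq E) (I : set R) :
 idg [set f s | s in [set` L]] 1 -> ideal I ->
 (forall s, s \in L -> exists n, I (f s ^+ n)) -> I 1.
move=> one Iid H; have [I0 ID IM] := Iid.
have [||N HN] := @unif_bnd _ L (fun s n=> I (f s ^+ n)); last 1 first.
- by apply: (idg_min Iid _ (idg_pow N one))=> _ [_ [s sL <-] <-]; apply: HN.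
- by move=> s m n mn; rewrite -(subnK mn) exprD; exact: IM.
- by [].
Qed.
(** In a high power of the sum each term contains a high power of some [x.2]. Here [J] is a module
    over the subring [P] only, as in [sec_gen], where [P] is the algebra whose size is to be
    determined. *)
Lemma rad_sum (R : cring) (P J : set R) (L : seq (R * R)) : subring P ->
 J 0 -> (forall a b, J a -> J b -> J (a + b)) -> (forall a b, P a -> J b -> J (a * b)) ->
 (forall x, x \in L -> [/\ P x.1, P x.2 & exists n, J (x.2 ^+ n)]) ->
 exists M, J ((\sum_(x <- L) x.1 * x.2) ^+ M).
move=> Pr J0 JD JM; elim: L=> [|x L IH] H; first by exists 1; rewrite big_nil.
have [|M HM] := IH; first by move=> y yL; apply: H; rewrite inE yL orbT.
have [P1 P2 [n Jn]] := H x (mem_head _ _); have [_ _ PM] := Pr.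
rewrite big_cons; set w := \sum_(_ <- _) _ in HM *; set u := x.1 * x.2.
have Pw: P w.
 rewrite /w big_seq; apply: subring_sum=> // y yL.
 by have [|? ? _] := H y; [rewrite inE yL orbT| apply: PM].
have Pu: P u by apply: PM.
have Ju: J (u ^+ n) by rewrite exprMn; apply: JM=> //; apply: subringX.
have Jn' k a: J a -> J (a *+ k).
 by move=> Ja; elim: k=> [|k IHk]; rewrite // mulrS; apply: JD.
exists (n + M); rewrite exprDn; elim/big_ind: _=> // i _; apply: Jn'.
have [Mi|iM] := leqP M i.
 rewrite -(subnK Mi) exprD mulrA; apply: JM=> //.
 by apply: PM; apply: subringX.
have ni: (n <= n + M - i)%N by lia.
rewrite -(subnK ni) exprD.
have -> : u ^+ (n + M - i - n) * u ^+ n * w ^+ i = (u ^+ (n + M - i - n) * w ^+ i) * u ^+ n.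
 ring.
by apply: JM=> //; apply: PM; apply: subringX.
Qed.

(** * Sections over affine opens *)

Section OpenImmersion.
Variables (F : fieldType) (A : cring) (jA : F -> A) (r : seq A).
Hypothesis jm : is_rmorph jA.
Local Notation X := (qapt r).
Local Notation Y := (qascheme r jm).

(** Otherwise the functions of the principal opens inside [U] lie in a common prime of the sections,
    which by affineness is a point of [U]. But some principal open around this point lies in [U]. *)
Lemma affine_data (U : set X) : affine (X := Y) U -> exists L, aff_data U L.
move=> [oU _ pts _ _].
pose T := [set q | exists s, [/\ good r s, D s `<=` U & q = qaglob U s]].
have [P pP TP|n] := @rad_idg _ T 1; last first.
 rewrite expr1n=> -[K [KT e1]].
 have ch q: exists s, T q -> [/\ good r s, D s `<=` U & q = qaglob U s].
 by have [[s Hs]|no] := pselect (T q); [exists s | exists 0].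
 have [f Hf] := choice ch.
 exists [seq f x.2 | x <- K]; split=> //.
 by move=> s /mapP[x /KT/Hf[? ? _] ->].
 exists K; split=> // x xK; have [_ _ e] := Hf _ (KT x xK).
 by exists (f x.2)=> //=; apply/mapP; exists x.
have [x [[Ux Px] _]] := pts P pP.
have := oU; rewrite qaopE=> /(_ x Ux)[v [xv vU]]; have [y yr xy] := (svalP x).2.
have xvy: ~ idl x (v * y) by exact: (primenM (idlP x) xv xy).
have : P (qaglob U (v * y)).
 apply: TP; exists (v * y); split=> //; first by exists y=> //; exists v.
 exact: subset_trans (@DMl _ _ _ _) vU.
by rewrite Px=> /(nunit_germ jA oU Ux (gglob _ Ux)).
Qed.
Lemma sec_gen (U : set X) L (K : seq (qasec U * qasec U)) : cov U L ->
 (forall x, x \in K -> exists s, [/\ good r s, D s `<=` U & x.2 = qaglob U s]) ->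
 1 = \sum_(x <- K) x.1 * x.2 ->
 generated_by (range (qaglob U) `|` [set` map fst K]).
move=> cU HK e1 P P1 PB PM sP q; have Pr: subring P by split.
pose J := [set c | P c /\ P (c * q)].
have [||| |M] := @rad_sum _ P J K Pr.
- by split; rewrite ?mul0r; apply: subring0.
- by move=> a b [? ?] [? ?]; split; rewrite ?mulrDl; apply: subringD.
- by move=> a b Pa [? ?]; split; rewrite -?mulrA; apply: PM.
- move=> x xK; have [s [gs sU es]] := HK x xK; have Pg a: P (qaglob U a) by apply: sP; left.
 split; [by apply: sP; right; apply: map_f | by rewrite es|].
 have [n [a e]] := cov_frac q cU gs sU; exists n; rewrite es; split; first exact: subringX.
 by rewrite -(rmX _ (glob_rm U)) e.
by rewrite -e1 expr1n=> -[_]; rewrite mul1r.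
Qed.
Lemma aff_gen (U : set X) L : aff_data U L ->
 exists bs : seq (qasec U), generated_by (range (qaglob U) `|` [set` bs]).
move=> aU; have [oU LU [K [KL e1]]] := aU; exists (map fst K).
apply: (sec_gen (aff_cov aU))=> // x /KL[s sL <-].
by have [gs sU] := LU s sL; exists s.
Qed.
Lemma aff_sep (U V : set X) L M : aff_data U L -> aff_data V M ->
 aff_data (U `&` V) [seq s * t | s <- L, t <- M] /\
 generated_by (range (@qares A r U (U `&` V)) `|` range (@qares A r V (U `&` V))).
move=> [oU LU [K [KL eK]]] [oV MV [H [HM eH]]].

have rU := qares_rmorph (@subIsetl _ U V); have rV := qares_rmorph (@subIsetr _ U V).
pose N := [seq (qares (U `&` V) x.1 * qares _ y.1,
 qares (U `&` V) x.2 * qares _ y.2) | x <- K, y <- H].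
have eN: 1 = \sum_(z <- N) z.1 * z.2.
 have e1 := congr1 (qares (U `&` V)) eK; have e2 := congr1 (qares (U `&` V)) eH.
 rewrite (rm1 rU) in e1; rewrite (rm1 rV) in e2.
 rewrite big_allpairs_dep -[LHS]mulr1 {1}e1 e2 (rm_sum _ _ _ rU) (rm_sum _ _ _ rV).
 rewrite big_distrl; apply: eq_bigr=> x _; rewrite big_distrr; apply: eq_bigr=> y _.
 by rewrite (rmM rU) (rmM rV) mulrACA.
have HN z: z \in N -> exists s t, [/\ s \in L, t \in M & z.2 = qaglob _ (s * t)].
 move=> /allpairsP[[x y] [xK yH ->]]; have [[s sL <-] [t tM <-]] := (KL x xK, HM y yH).
 by exists s, t; rewrite !res_glob // (rmM (glob_rm (U `&` V))).
have aff: aff_data (U `&` V) [seq s * t | s <- L, t <- M].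
 split; first exact: openI.
 move=> z /allpairsP[[s t] [sL tM ->]]; have [[gs sU] [gt tV]] := (LU s sL, MV t tM).
 by split; [exact: goodM | move=> x; rewrite DM=> -[/sU ? /tV]].
 exists N; split=> // z /HN[s [t [sL tM ->]]]; exists (s * t)=> //=.
 by apply/allpairsP; exists (s, t).
split=> // P P1 PB PM sP.
apply: (sec_gen (K := N) (aff_cov aff))=> //.
- move=> z /HN[s [t [sL tM ->]]]; exists (s * t).
 have [[gs sU] [gt tV]] := (LU s sL, MV t tM).
 by split=> //; [exact: goodM | move=> x; rewrite DM=> -[/sU ? /tV]].
- move=> q [[a _ <-]|/= /mapP[z /allpairsP[[x y] [xK yH ->]] ->]].
 by apply: sP; left; exists (qaglob U a)=> //; apply: res_glob.
 by apply: PM; apply: sP; [left; exists x.1 | right; exists y.1].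
Qed.

Section Lift.
Variables (U : set X) (L : seq A).
Hypothesis aU : aff_data U L.
Variable C : cring.
Variable u : A -> C.
Hypotheses (um : is_rmorph u) (u1 : idg [set u s | s in [set` L]] 1).

(** The extension of [u] to the sections over [U], as a relation: [b] and [c] are given by the same
    fractions with denominators in [L]. The ring of sections need not be a localization of A, so no
    single fraction defines the map. *)
Definition lrel (b : qasec U) (c : C) : Prop := forall s, s \in L ->
 exists n a, qaglob U (s ^+ n) * b = qaglob U a /\ u (s ^+ n) * c = u a.

Lemma lift_patch (z : C) : (forall s, s \in L -> exists n, u (s ^+ n) * z = 0) -> z = 0.
move=> H; have id0: ideal [set c | c * z = 0].
 split; rewrite /= ?mul0r // => a b; first by move=> ea eb; rewrite mulrDl eb addr0.
 by move=> eb; rewrite -mulrA eb mulr0.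
have : [set c | c * z = 0] 1.
 by apply: (idg_patch u1 id0)=> s sL; have [n e] := H s sL; exists n; rewrite -(rmX _ um).
by rewrite /= mul1r.
Qed.
Lemma glob_eq0_aff s a : s \in L -> qaglob U a = 0 -> exists n, s ^+ n * a = 0.
move=> sL e; have [_ LU _] := aU; have [gs sU] := LU s sL; apply: glob_eq0 gs _.
by rewrite -(res_glob _ sU) e (rm0 (qares_rmorph sU)).
Qed.
Lemma lrel_uniq b c c' : lrel b c -> lrel b c' -> c = c'.
move=> R R'; apply/eqP; rewrite -subr_eq0; apply/eqP; apply: lift_patch=> s sL.
have [[n [a [e f]]] [m [a' [e' f']]]] := (R s sL, R' s sL).
have gm := glob_rm U.
have [|k ek] := @glob_eq0_aff s (s ^+ m * a - s ^+ n * a') sL.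
 by rewrite (rmB gm) !(rmM gm) -e -e'; ring.
exists (k + m + n); have := congr1 u ek.
rewrite !exprD !(rmM um) (rmB um) !(rmM um) (rm0 um) -f -f'=> e0.
by rewrite -[RHS]e0; ring.
Qed.
Lemma lrel_ex b : exists c, lrel b c.
have [oU LU _] := aU; have gm := glob_rm U.
have [||N HN] := @unif_bnd _ L (fun s n=> exists a, qaglob U (s ^+ n) * b = qaglob U a).
- move=> s m n mn [a e]; exists (s ^+ (n - m) * a).
 by rewrite -{1}(subnK mn) exprD !(rmM gm) -mulrA e.
- by move=> s sL; have [gs sU] := LU s sL; apply: (cov_frac b (aff_cov aU) gs sU).
have ch s: exists a, s \in L -> qaglob U (s ^+ N) * b = qaglob U a.
 by have [/HN[a e]|n] := boolP (s \in L); [exists a | exists 0].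
have [al Hal] := choice ch.
pose Q z m := (z.1 * z.2) ^+ m * (z.2 ^+ N * al z.1 - z.1 ^+ N * al z.2) = 0.
have [||m Hm] := @unif_bnd _ [seq (s, t) | s <- L, t <- L] Q.
- by move=> z m n mn; rewrite /Q -(subnK mn) exprD -mulrA=> ->; rewrite mulr0.
- move=> z /allpairsP[[s t] [sL tL ->]].
 have [[gs sU] [gt tU]] := (LU s sL, LU t tL).
 apply: (glob_eq0 (r := r)); first exact: goodM.
 have stU: D (s * t) `<=` U by move=> x /DMl/sU.
 rewrite -(res_glob _ stU) (rmB gm) !(rmM gm) -(Hal s sL) -(Hal t tL).
 by rewrite mulrCA subrr (rm0 (qares_rmorph stU)).
pose be s := s ^+ m * al s.
have Hbe s t: s \in L -> t \in L -> t ^+ (N + m) * be s = s ^+ (N + m) * be t.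
 move=> sL tL; have /Hm : (s, t) \in [seq (s, t) | s <- L, t <- L].
 by apply/allpairsP; exists (s, t).
 rewrite /Q mulrBr=> /eqP; rewrite subr_eq0=> /eqP.
 by rewrite exprMn /be !exprD=> e; move: e;
 set x := s ^+ m; set y := t ^+ m=> e;
 transitivity (x * y * (t ^+ N * al s)); [ring | rewrite e; ring].
have [K [KL e1]] := idg_pow (N + m) u1.
have ch2 c: exists s, [set t ^+ (N + m) | t in [set u s | s in [set` L]]] c ->
 s \in L /\ c = u (s ^+ (N + m)).
 have [[_ [s sL <-] <-]|no] := pselect ([set t ^+ (N + m) | t in [set u s | s in [set` L]]] c).
 by exists s=> _; rewrite (rmX _ um).
 by exists 0.
have [g Hg] := choice ch2.
(* The image of [b] has to be u (be s) / u (s^(N+m)) for each s. These fractions have equal cross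
   products, and [K] is a partition of unity in C for their denominators. *)
exists (\sum_(x <- K) x.1 * u (be (g x.2)))=> s sL; exists (N + m), (be s); split.
 by rewrite exprD !(rmM gm) -(Hal s sL); ring.
rewrite big_distrr -[RHS]mul1r e1 big_distrl /= !big_seq; apply: eq_bigr=> x xK.
have [gL eg] := Hg _ (KL x xK).
by rewrite mulrCA -mulrA -(rmM um) (Hbe _ _ gL sL) (rmM um) -eg.
Qed.

Definition lift_of b : C := sval (cid (lrel_ex b)).
Lemma lift_ofP b : lrel b (lift_of b). exact: (svalP _). Qed.
Lemma lrelD b c b' c' : lrel b c -> lrel b' c' -> lrel (b + b') (c + c').
move=> R R' s sL; have [[n [a [e f]]] [m [a' [e' f']]]] := (R s sL, R' s sL).
have gm := glob_rm U.
exists (n + m), (s ^+ m * a + s ^+ n * a'); rewrite !exprD.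
by rewrite !(rmM gm, rmD gm, rmM um, rmD um) -e -e' -f -f'; split; ring.
Qed.
Lemma lrelM b c b' c' : lrel b c -> lrel b' c' -> lrel (b * b') (c * c').
move=> R R' s sL; have [[n [a [e f]]] [m [a' [e' f']]]] := (R s sL, R' s sL).

exists (n + m), (a * a'); rewrite !exprD.
by rewrite !(rmM (glob_rm U), rmM um) -e -e' -f -f'; split; ring.
Qed.
Lemma lrel_glob a : lrel (qaglob U a) (u a).

by exists 0, a; rewrite (rm1 (glob_rm U)) (rm1 um) !mul1r.
Qed.
Lemma lift_of_glob a : lift_of (qaglob U a) = u a.
exact: lrel_uniq (lift_ofP _) (lrel_glob a). Qed.
Lemma lift_of_rm : is_rmorph lift_of.
have gm := glob_rm U.
have E0: lift_of 0 = 0 by rewrite -(rm0 gm) lift_of_glob (rm0 um).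
have ED b b': lift_of (b + b') = lift_of b + lift_of b'.
 exact: lrel_uniq (lift_ofP _) (lrelD (lift_ofP b) (lift_ofP b')).
have EN b: lift_of (- b) = - lift_of b.
 by apply/eqP; rewrite -subr_eq0 opprK -ED addNr E0.
split=> [b b'|]; first by rewrite ED EN.
split=> [|b b']; first by rewrite -(rm1 gm) lift_of_glob (rm1 um).
exact: lrel_uniq (lift_ofP _) (lrelM (lift_ofP b) (lift_ofP b')).
Qed.
Lemma lrel_of (w : qasec U -> C) b : is_rmorph w -> (forall a, w (qaglob U a) = u a) ->
 lrel b (w b).
move=> wm wu s sL; have [_ LU _] := aU; have [gs sU] := LU s sL.
have [n [a e]] := cov_frac b (aff_cov aU) gs sU.
by exists n, a; rewrite -!wu -e (rmM wm).
Qed.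

End Lift.

Lemma oi_uniq (U : set X) L (C : cring) (w w' : qasec U -> C) : aff_data U L ->
 is_rmorph w -> is_rmorph w' -> (forall a, w (qaglob U a) = w' (qaglob U a)) -> w =1 w'.
move=> aU wm w'm H b;
have u1: idg [set (w \o qaglob U) s | s in [set` L]] 1.
 have [_ _ one] := aU; have := idg_map wm one; rewrite (rm1 wm).
 by apply: idg_mono=> _ [_ [s sL <-] <-]; exists s.
apply: (lrel_uniq aU (rm_comp (glob_rm U) wm) u1); first exact: lrel_of.
by apply: lrel_of=> // a; rewrite -H.
Qed.
(** The sections over an affine open are formally étale over A: a lift of the map on A extends. With
    [oi_uniq], smoothness and étaleness can be tested on A. *)
Lemma oi_lift (U : set X) L (C D : cring) (p : C -> D) (u : A -> C) (v : qasec U -> D) :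
 aff_data U L -> is_rmorph p -> is_rmorph u -> is_rmorph v ->
 (forall d, exists c, p c = d) -> (forall c c', p c = 0 -> p c' = 0 -> c * c' = 0) ->
 (forall a, p (u a) = v (qaglob U a)) ->
 exists w : qasec U -> C, [/\ is_rmorph w, forall b, p (w b) = v b
 & forall a, w (qaglob U a) = u a].
move=> aU pm um vm psurj psq comm.
have v1: idg [set (v \o qaglob U) s | s in [set` L]] 1.
 have [_ _ one] := aU; have := idg_map vm one; rewrite (rm1 vm).
 by apply: idg_mono=> _ [_ [s sL <-] <-]; exists s.
have u1: idg [set u s | s in [set` L]] 1.
 pose J := [set d | exists2 c, idg [set u s | s in [set` L]] c & p c = d].
 have h: idg [set (v \o qaglob U) s | s in [set` L]] `<=` J.
 have [i0 iD iM] := idg_ideal [set u s | s in [set` L]].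
 apply: idg_min; last by move=> _ [s sL <-]; exists (u s); [apply: idg_sub; exists s | apply: comm].
 split; first by exists 0; rewrite ?(rm0 pm).
 by move=> _ _ [c Ic <-] [c' Ic' <-]; exists (c + c'); [apply: iD | rewrite (rmD pm)].
 move=> d' _ [c Ic <-]; have [k ek] := psurj d'.
 by exists (k * c); [apply: iM | rewrite (rmM pm) ek].
 have [c Ic pc] := h 1 v1; have [i0 iD iM] := idg_ideal [set u s | s in [set` L]].
 (* [c] is 1 modulo the square-zero kernel of [p], so 2 - c is its inverse. *)
 suff -> : 1 = (1 + 1 - c) * c by apply: iM.
 have : (1 - c) * (1 - c) = 0 by apply: psq; rewrite (rmB pm) (rm1 pm) pc subrr.
 by move=> e; apply/eqP; rewrite -subr_eq0 -[X in _ == X]e; apply/eqP; ring.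
exists (lift_of aU um u1); split; [exact: lift_of_rm | | exact: lift_of_glob].
move=> b; apply/eqP; rewrite -subr_eq0; apply/eqP.

apply: (lift_patch (rm_comp (glob_rm U) vm) v1)=> s sL.
have [n [a [e f]]] := lift_ofP aU um u1 b sL.
exists n; rewrite /= mulrBr -(rmM vm) e -!comm -(rmM pm) f.
ring.
Qed.
(** If a filter has no cluster point, the s for which D(s) misses a member of it form an ideal that
    no point of X contains. It contains a power of each member of [r], and then some member of the
    filter misses all of X. *)
Lemma qa_compact : compact [set: Y].
move=> Fl PF _; apply: contrapT=> no.
have noc (x : X) : exists s B, [/\ D s x, Fl B & B `&` D s = set0].
 apply: contrapT=> H; apply: no; exists x; split=> // B V FB.
 rewrite nbhsE=> -[W [oW Wx] WV]; move: oW; rewrite qaopE=> /(_ x Wx)[s [xs sW]].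
 apply: contrapT=> BV; apply: H; exists s, B; split=> //.
 apply/seteqP; split=> // y [By ys]; apply: BV; exists y; split=> //.
 by apply: WV; apply: sW.
pose J := [set s | exists2 B, Fl B & B `&` (D s) = set0].
have Jid: ideal J.
 split.
 - exists setT; first exact: filterT.
 by apply/seteqP; split=> // y [_]; apply; apply: prime0; exact: idlP.
 - move=> a b [B FB eB] [C FC eC]; exists (B `&` C); first exact: filterI.
 apply/seteqP; split=> // y [[By Cy] yab]; have py := idlP y.
 have ya: idl y a by apply: contrapT=> ya; have : (B `&` D a) y by []; rewrite eB.
 have yb: idl y b by apply: contrapT=> yb; have : (C `&` D b) y by []; rewrite eC.
 by apply: yab; apply: primeD.
 - move=> a b [B FB eB]; exists B=> //; apply/seteqP; split=> // y [By yab].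
 by rewrite -eB; split=> //; exact: DMr yab.
have Hr y: y \in r -> exists2 B, Fl B & B `&` (D y) = set0.
 move=> yr; have [p pp Jp|n Hn] := @rad_idg A J y.
 apply: contrapT=> py; have gy: good r y by exists y=> //; exists 1; rewrite mul1r.
 have [x xp] := good_pt pp py gy.
 have [s [B [xs FB eB]]] := noc x; apply: xs; rewrite xp; apply: Jp.
 by exists B.
 have [B FB eB] := idg_min Jid (@subset_refl _ J) Hn; exists B=> //.
 apply/seteqP; split=> // z [Bz zy]; rewrite -eB; split=> //.
 by apply: primenX=> //; exact: idlP.
have gen (l : seq A) : (forall y, y \in l -> exists2 B, Fl B & B `&` (D y) = set0) ->
 exists2 B, Fl B & forall y, y \in l -> B `&` (D y) = set0.
 elim: l=> [|y s IH] H; first by exists setT; [exact: filterT | ].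
 have [B FB HB] := IH (fun z zs=> H z (mem_behead (s := y :: s) zs)).
 have [C FC eC] := H y (mem_head _ _); exists (B `&` C); first exact: filterI.
 move=> z; rewrite inE=> /predU1P[->|zs].
 by apply/seteqP; split=> // w [[_ Cw] yw]; rewrite -eC.
 by apply/seteqP; split=> // w [[Bw _] zw]; rewrite -(HB z zs).
have [B FB HB] := gen r Hr; have [x Bx] := filter_ex (FF := PF) FB; have [y yr xy] := (svalP x).2.
by have : (B `&` D y) x by []; rewrite HB.
Qed.

End OpenImmersion.

Lemma gen_mono (B : cring) (S S' : set B) : S `<=` S' -> generated_by S -> generated_by S'.
by move=> SS gS P P1 PB PM sP; apply: gS=> // x /SS/sP. Qed.

(** * Finiteness, smoothness and étaleness *)

Section FiniteType.
Variables (F : fieldType) (A : cring) (jA : F -> A) (r : seq A).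
Hypothesis jm : is_rmorph jA.
Local Notation X := (qapt r).
Local Notation Y := (qascheme r jm).
Variable l : seq A.
Hypothesis lgen : generated_by (range jA `|` [set` l]).

Lemma sec_fg (U : set X) L : aff_data U L ->
 exists m : seq (qasec U), generated_by (range (qastr jA U) `|` [set` m]).
move=> aU; have [bs bgen] := aff_gen aU; exists (map (qaglob U) l ++ bs).
apply: gen_mono (gen_trans (glob_rm U) lgen bgen)=> x.
move=> [[a [[c _ <-]|al] <-]|xb]; [by left; exists c | |]; right; rewrite /= mem_cat.
 by rewrite map_f.
by rewrite xb orbT.
Qed.
Lemma qa_finite_type (U : set Y) : affine U -> finite_type (str Y U).
by move=> /affine_data[L aU]; have [m gm] := sec_fg aU; exists m. Qed.
Lemma qa_separated : Defs.separated Y.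
move=> U V /affine_data[L aU] /affine_data[M aV].
by have [aff gen] := aff_sep aU aV; split=> //; exact: (aff_affine jA aff).
Qed.
Lemma qa_sft : separated_of_finite_type Y.
by split; [exact: qa_separated | exact: qa_compact | exact: qa_finite_type]. Qed.
(** Only those maps from A that factor through an affine open of Y are asked to lift: A may be
    singular off Y, as the cone is at its vertex. *)
Lemma qa_smooth :
 (forall (U : set Y) (C D : cring) (p : {rmorphism C -> D}) (u : {rmorphism F -> C})
 (v : {rmorphism sec Y U -> D}), affine U -> lifting_problem (str Y U) p u v ->
 exists w : A -> C, [/\ is_rmorph w, forall a, p (w a) = v (qaglob U a)
 & forall c, w (jA c) = u c]) -> smooth Y.
move=> H U affU; have [L aU] := affine_data affU; split.
 have [m gm] := sec_fg aU.
 apply: (@fg_fp F F _ (fun c : F=> c) _ [::] m)=> //.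
 - exact: qastr_rmorph.
 - by move=> P P1 PB PM sP a; apply: sP; left.
move=> C D p u v LP; have [ps sq comm] := LP.
have [w [wm pw wu]] := H U C D p u v affU LP.
have [w' [w'm pw' w'g]] := oi_lift aU (rm_of p) wm (rm_of v) ps sq pw.
exists (mkrm w'm); split=> [b|c]; first exact: pw'.
by rewrite -wu; apply: w'g.
Qed.

End FiniteType.

Section EtaleMaps.
Variables (F : fieldType) (A1 A2 : cring) (j1 : F -> A1) (j2 : F -> A2).
Variables (r1 : seq A1) (r2 : seq A2) (jm1 : is_rmorph j1) (jm2 : is_rmorph j2).
Local Notation Y1 := (qascheme r1 jm1).
Local Notation Y2 := (qascheme r2 jm2).
Variables (l2 : seq A2) (l1 : seq A1) (f : shom Y1 Y2) (iota : A2 -> A1).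
Hypotheses (im : is_rmorph iota) (fi : forall b, hom_of f b = qaglob setT (iota b)).
Hypotheses (gen2 : generated_by (range j2 `|` [set` l2]))
 (gen1 : generated_by (range iota `|` [set` l1])) (fe : formally_etale iota).

(** A lift is found on A1 by [fe] and extended to the sections over the affine open by [oi_lift]; by
    [oi_uniq] its uniqueness can be checked on A1. *)
Lemma qa_etale : etale f.
move=> V U oV affV affU UV; have [[M aV] [L aU]] := (affine_data affV, affine_data affU).
set g := fun s=> _.
have oU: open U by case: affU.
have ofV := hopen f oV.
have gr: is_rmorph g := rm_comp (pull_rmorph f oV) (res_rm ofV oU UV).
have gg b: g (qaglob V b) = qaglob U (iota b).
 rewrite /g -(res_glob b (subsetT V)).
 have := pull_res f openT oV _ (subsetT _).
 move=> e; rewrite e res_res //; try exact: openT.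
 have := fi b; rewrite /hom_of=> ->; exact: res_glob.
split.
 have [m2 gm2] := sec_fg gen2 aV; have [bs gbs] := aff_gen aU.
 apply: (@fg_fp F _ _ (str Y2 V) g m2 (map (qaglob U) l1 ++ bs))=> //.
 exact: qastr_rmorph.
 apply: gen_mono (gen_trans (glob_rm U) gen1 gbs)=> x.
 move=> [[a [[c _ <-]|al] <-]|xb]; [left | right | right].
 - by exists (qaglob V c).
 - by rewrite /= mem_cat map_f.
 - by rewrite /= mem_cat xb orbT.
move=> C D p u v [ps sq comm].
have um := rm_of u; have vm := rm_of v;
have u0m := rm_comp (glob_rm V) um; have v0m := rm_comp (glob_rm U) vm.
have LP: lifting_problem iota p (mkrm u0m) (mkrm v0m).
 by split=> // a; rewrite (comm _) gg.
have [w0 [pw0 w0i] w0uni] := fe LP.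
have [w [wm pw wg]] := oi_lift aU (rm_of p) (rm_of w0) vm ps sq pw0.
have wgu b: w (g b) = u b.
 apply: (oi_uniq aV (rm_comp gr wm) um)=> a /=; rewrite gg wg.
 by [].
exists (mkrm wm); first by [].
move=> w' [pw' w'g]; apply: (oi_uniq aU (rm_of w') wm)=> a.

have LF: is_lift iota p (mkrm u0m) (mkrm v0m) (mkrm (rm_comp (glob_rm U) (rm_of w'))).
 split=> b; rewrite /=; first exact: pw'.
 by rewrite -gg.
by have := w0uni _ LF a; rewrite wg.
Qed.

End EtaleMaps.

Lemma formally_etale_id (A : cring) : formally_etale (@id A).
move=> C D p u v [ps sq comm]; exists u; first by split.
by move=> w' [_ w'u] a.
Qed.

Local Notation n8 := ((1 + 3) + (3 + 1))%N.

(** * Automorphisms of the split octonions *)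

Section RowMaps.
Variable S : cring.

Lemma row_delta n (x : 'rV[S]_n) : x = \sum_i x 0 i *: delta_mx 0 i.
apply/rowP=> j; rewrite summxE (bigD1 j) //= !mxE !eqxx mulr1 big1 ?addr0 // => i ij.
by rewrite !mxE eqxx eq_sym (negbTE ij) mulr0.
Qed.

Definition is_lin n m (f : 'rV[S]_n -> 'rV[S]_m) : Prop :=
 (forall x y, f (x + y) = f x + f y) /\ (forall a x, f (a *: x) = a *: f x).

Lemma lin_sum n m (f : 'rV[S]_n -> 'rV[S]_m) (c : 'I_n -> S) (g : 'I_n -> 'rV[S]_n) : is_lin f ->
 f (\sum_i c i *: g i) = \sum_i c i *: f (g i).
move=> [fD fZ]; have f0: f 0 = 0 by rewrite -(scale0r 0) fZ scale0r.
by rewrite (big_morph f fD f0); apply: eq_bigr=> i _; rewrite fZ.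
Qed.
Lemma lin_ext n m (f g : 'rV[S]_n -> 'rV[S]_m) : is_lin f -> is_lin g ->
 (forall i, f (delta_mx 0 i) = g (delta_mx 0 i)) -> f =1 g.
move=> fl gl H x; rewrite [x]row_delta (lin_sum _ _ fl) (lin_sum _ _ gl).
by apply: eq_bigr=> i _; rewrite H.
Qed.

Definition mxof n m (f : 'rV[S]_n -> 'rV[S]_m) : 'M[S]_(n, m) :=
 \matrix_(i, j) f (delta_mx 0 i) 0 j.

Lemma lin_mulmx n m (A : 'M[S]_(n, m)) : is_lin (fun x=> x *m A).
by split=> [x y|a x]; rewrite ?mulmxDl ?scalemxAl. Qed.
Lemma mxofE n m (f : 'rV[S]_n -> 'rV[S]_m) x : is_lin f -> x *m mxof f = f x.
move=> fl; move: x; apply: lin_ext (lin_mulmx _) fl _=> i.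
by apply/rowP=> j; rewrite -rowE !mxE.
Qed.
Lemma mulmx_ext n m (A B : 'M[S]_(n, m)) : (forall x : 'rV_n, x *m A = x *m B) -> A = B.
by move=> H; apply/row_matrixP=> i; rewrite !rowE. Qed.

End RowMaps.

Section ZornFacts.
Variable S : cring.
Implicit Types (x y : 'rV[S]_n8) (v w : 'rV[S]_3).

Lemma zorn_eq (a a' b b' : S) v v' w w' : a = a' -> (forall i, v 0 i = v' 0 i) ->
 (forall i, w 0 i = w' 0 i) -> b = b' -> zorn a v w b = zorn a' v' w' b'.
by move=> -> /rowP-> /rowP-> ->. Qed.
Lemma ord3P (P : 'I_3 -> Prop) : P 0 -> P 1 -> P 2%R -> forall i, P i.
move=> P0 P1 P2 [[|[|[|//]]] Hi].
- by rewrite (_ : Ordinal Hi = 0) //; apply: val_inj.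
- by rewrite (_ : Ordinal Hi = 1) //; apply: val_inj.
- by rewrite (_ : Ordinal Hi = 2%R) //; apply: val_inj.
Qed.
Lemma cross0 v w : cross v w 0 0 = v 0 1 * w 0 2%R - v 0 2%R * w 0 1.
by have [] := crossE v w. Qed.
Lemma cross1 v w : cross v w 0 1 = v 0 2%R * w 0 0 - v 0 0 * w 0 2%R.
by have [] := crossE v w. Qed.
Lemma cross2 v w : cross v w 0 2%R = v 0 0 * w 0 1 - v 0 1 * w 0 0.
by have [] := crossE v w. Qed.
Lemma rowDE n (v w : 'rV[S]_n) i : (v + w) 0 i = v 0 i + w 0 i. by rewrite mxE. Qed.
Lemma rowZE n a (v : 'rV[S]_n) i : (a *: v) 0 i = a * v 0 i. by rewrite mxE. Qed.
Lemma rowNE n (v : 'rV[S]_n) i : (- v) 0 i = - v 0 i. by rewrite mxE. Qed.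
Lemma row0E n i : (0 : 'rV[S]_n) 0 i = 0. by rewrite mxE. Qed.
Lemma zornD (a a' b b' : S) v v' w w' :
 zorn a v w b + zorn a' v' w' b' = zorn (a + a') (v + v') (w + w') (b + b').
by rewrite /zorn !add_row_mx !raddfD. Qed.
Lemma zornZ c (a b : S) v w : c *: zorn a v w b = zorn (c * a) (c *: v) (c *: w) (c * b).
by rewrite /zorn !scale_row_mx !scale_scalar_mx. Qed.
Lemma zorn0 : zorn 0 0 0 0 = 0 :> 'rV[S]_n8.
by rewrite /zorn raddf0 !row_mx0. Qed.
Lemma zorn_inj (a a' b b' : S) v v' w w' : zorn a v w b = zorn a' v' w' b' ->
 [/\ a = a', v = v', w = w' & b = b'].
move=> e; have [h1 h2 h3 h4] := zornK a v w b; have [k1 k2 k3 k4] := zornK a' v' w' b'.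
by split; [rewrite -h1 e k1 | rewrite -h2 e k2 | rewrite -h3 e k3 | rewrite -h4 e k4].
Qed.

End ZornFacts.

Ltac zring := apply: zorn_eq; [ | apply: ord3P | apply: ord3P | ];
 rewrite ?(rowDE, rowZE, rowNE, row0E, dotE, cross0, cross1, cross2); ring.

Section ZornLinear.
Variable S : cring.
Implicit Types (x y : 'rV[S]_n8) (v w : 'rV[S]_3).

Lemma zorn_mull y : is_lin (fun x=> zorn_mul x y).
split=> [x x'|a x].
 by rewrite (zorn_decomp x) (zorn_decomp x') (zorn_decomp y) zornD !zorn_mulE zornD; zring.
by rewrite (zorn_decomp x) (zorn_decomp y) zornZ !zorn_mulE zornZ; zring.
Qed.
Lemma zorn_mulr x : is_lin (zorn_mul x).
split=> [y y'|a y].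
 by rewrite (zorn_decomp x) (zorn_decomp y) (zorn_decomp y') zornD !zorn_mulE zornD; zring.
by rewrite (zorn_decomp x) (zorn_decomp y) zornZ !zorn_mulE zornZ; zring.
Qed.
Lemma lin_comp n m k (f : 'rV[S]_n -> 'rV[S]_m) (g : 'rV[S]_m -> 'rV[S]_k) :
 is_lin f -> is_lin g -> is_lin (g \o f).
by move=> [fD fZ] [gD gZ]; split=> [x y|a x] /=; rewrite ?fD ?gD ?fZ ?gZ. Qed.
(** Multiplicativity is reduced to finitely many identities between basis vectors, which exist over
    every base ring; the base change [G2_map] rests on this. *)
Lemma zorn_mult_basis (A : 'M[S]_n8) :
 (forall i j, zorn_mul (delta_mx 0 i *m A) (delta_mx 0 j *m A) =
 zorn_mul (delta_mx 0 i) (delta_mx 0 j) *m A) ->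
 forall x y, zorn_mul (x *m A) (y *m A) = zorn_mul x y *m A.
move=> H x y; move: x; apply: lin_ext=> [||i].
- exact: lin_comp (lin_mulmx A) (zorn_mull _).
- exact: lin_comp (zorn_mull _) (lin_mulmx A).
move: y; apply: lin_ext=> [||j //].
- exact: lin_comp (lin_mulmx A) (zorn_mulr _).
- exact: lin_comp (zorn_mulr _) (lin_mulmx A).
Qed.
Lemma G2M (A B : 'M[S]_n8) : G2 A -> G2 B -> G2 (A *m B).
move=> [[A' [AA' A'A]] HA] [[B' [BB' B'B]] HB]; split.
 exists (B' *m A'); split.
 by rewrite mulmxA -(mulmxA A) BB' mulmx1.
 by rewrite mulmxA -(mulmxA B') A'A mulmx1.
by move=> x y; rewrite !mulmxA HB HA.
Qed.
Lemma G2V (A B : 'M[S]_n8) : G2 A -> A *m B = 1%:M -> B *m A = 1%:M -> G2 B.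
move=> [_ HA] AB BA; split; first by exists A.
move=> x y; rewrite -[LHS]mulmx1 -AB mulmxA -HA -!mulmxA !BA !mulmx1.
by [].
Qed.
Lemma G2_1 : G2 (1%:M : 'M[S]_n8).
by split; [exists 1%:M; rewrite !mulmx1 | move=> x y; rewrite !mulmx1]. Qed.

(* The exponential of the derivation that sends (1, 0; 0, 0) to (0, v; 0, 0). *)
Definition EVf v x := let t := dot v (zornW x) in
 zorn (zornA x - t) (zornV x + (zornA x - zornB x - t) *: v)
 (zornW x + cross v (zornV x)) (zornB x + t).

Definition sgf x : 'rV[S]_n8 := zorn (zornB x) (- zornW x) (- zornV x) (zornA x).

Lemma EVfE v a u t b : EVf v (zorn a u t b) =
 zorn (a - dot v t) (u + (a - b - dot v t) *: v) (t + cross v u) (b + dot v t).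
by rewrite /EVf; have [-> -> -> ->] := zornK a u t b. Qed.
Lemma sgfE a u t b : sgf (zorn a u t b) = zorn b (- t) (- u) a.
by rewrite /sgf; have [-> -> -> ->] := zornK a u t b. Qed.
Lemma EVf_lin v : is_lin (EVf v).
split=> [x y|a x].
 by rewrite (zorn_decomp x) (zorn_decomp y) zornD !EVfE zornD; zring.
by rewrite (zorn_decomp x) zornZ !EVfE zornZ; zring.
Qed.
Lemma sgf_lin : is_lin sgf.
split=> [x y|a x].
 by rewrite (zorn_decomp x) (zorn_decomp y) zornD !sgfE zornD; zring.
by rewrite (zorn_decomp x) zornZ !sgfE zornZ; zring.
Qed.
Lemma EVfM v x y : zorn_mul (EVf v x) (EVf v y) = EVf v (zorn_mul x y).
rewrite [x]zorn_decomp [y]zorn_decomp zorn_mulE !EVfE zorn_mulE; zring.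
Qed.
Lemma sgfM x y : zorn_mul (sgf x) (sgf y) = sgf (zorn_mul x y).
rewrite [x]zorn_decomp [y]zorn_decomp zorn_mulE !sgfE zorn_mulE; zring. Qed.
Lemma EVfK v x : EVf (- v) (EVf v x) = x.
rewrite [x in LHS]zorn_decomp [x in RHS]zorn_decomp !EVfE; zring. Qed.
Lemma sgfK x : sgf (sgf x) = x.
by rewrite [x in LHS]zorn_decomp [x in RHS]zorn_decomp !sgfE !opprK. Qed.
Lemma G2_lin (f g : 'rV[S]_n8 -> 'rV[S]_n8) : is_lin f -> is_lin g -> cancel f g -> cancel g f ->
 (forall x y, zorn_mul (f x) (f y) = f (zorn_mul x y)) -> G2 (mxof f).
move=> fl gl fg gf H; split; last by move=> x y; rewrite !mxofE.
by exists (mxof g); split; apply: mulmx_ext=> x; rewrite mulmxA !mxofE // mulmx1.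
Qed.

Definition e0 : 'rV[S]_n8 := zorn 1 0 0 0.
Definition e1 : 'rV[S]_n8 := zorn 0 0 0 1.

(* An idempotent e = (a, v; w, b) with a = c^-1 is the image of e0. *)
Definition Aidf c (e x : 'rV[S]_n8) : 'rV[S]_n8 :=
 EVf (c *: zornV e) (sgf (EVf (zornW e) (sgf x))).

Lemma Aidf_e0 c e : c * zornA e = 1 -> zornA e + zornB e = 1 ->
 zornA e * zornB e = dot (zornV e) (zornW e) -> Aidf c e e0 = e.
move=> ca ab nn; rewrite [RHS]zorn_decomp /Aidf /e0; move: ca ab nn.
move: (zornA e) (zornB e) (zornV e) (zornW e)=> a b v w ca ab nn.
have eb: b = 1 - a by rewrite -ab; ring.
have e2: dot (c *: v) w = b.
 transitivity (c * dot v w); first by rewrite !dotE !rowZE; ring.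
 by rewrite -nn mulrA ca mul1r.
have -> : sgf (EVf w (sgf (zorn 1 0 0 0))) = zorn 1 0 w 0 by rewrite !(sgfE, EVfE); zring.
have e3: a * c = 1 by rewrite mulrC.
rewrite EVfE e2; apply: zorn_eq; last by ring.
- by rewrite eb; ring.
- move=> i; rewrite !(rowDE, rowZE, row0E) eb.
 transitivity ((a * c) * v 0 i); first by ring.
 by rewrite e3 mul1r.
- by apply: ord3P; rewrite rowDE ?(cross0, cross1, cross2) !row0E; ring.
Qed.
Lemma G2_Aidf c e : G2 (mxof (Aidf c e)).
set v := c *: zornV e; set w := zornW e.
have EK z x: EVf z (EVf (- z) x) = x by rewrite -{1}[z]opprK EVfK.
have gl: is_lin (fun x=> sgf (EVf (- w) (sgf (EVf (- v) x)))).
 apply: (lin_comp (f := fun x=> EVf _ _) _ sgf_lin).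
 apply: (lin_comp (f := fun x=> sgf _) _ (EVf_lin _)).
 exact: (lin_comp (EVf_lin _) sgf_lin).
have fl: is_lin (Aidf c e).
 apply: (lin_comp (f := fun x=> sgf _) _ (EVf_lin _)).
 apply: (lin_comp (f := fun x=> EVf w _) _ sgf_lin).
 exact: (lin_comp sgf_lin (EVf_lin _)).
apply: (G2_lin fl gl).
- by move=> x; rewrite /Aidf EVfK sgfK EVfK sgfK.
- by move=> x; rewrite /Aidf sgfK EK sgfK EK.
- by move=> x y; rewrite /Aidf EVfM sgfM EVfM sgfM.
Qed.
Lemma Aidf_lin c e : is_lin (Aidf c e).
apply: (lin_comp (f := fun x=> sgf _) _ (EVf_lin _)).
apply: (lin_comp (f := fun x=> EVf _ _) _ sgf_lin).
exact: (lin_comp sgf_lin (EVf_lin _)).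
Qed.

(* For an idempotent t, the map that is the identity where t = 1 and the
 swap where t = 0. *)
Definition mixf (t : S) x : 'rV[S]_n8 := t *: x + (1 - t) *: sgf x.

Lemma mixf_lin t : is_lin (mixf t).
have [sD sZ] := sgf_lin; split=> [x y|a x]; rewrite /mixf.
 by rewrite sD !scalerDr addrACA.
by rewrite sZ scalerDr !scalerA ![a * _]mulrC.
Qed.
Lemma mixfK t x : t * t = t -> mixf t (mixf t x) = x.
move=> tt; have [sD sZ] := sgf_lin.
have t0: t * (1 - t) = 0 by rewrite mulrBr mulr1 tt subrr.
have t1: (1 - t) * (1 - t) = 1 - t by rewrite mulrBl mul1r t0 subr0.
rewrite /mixf sD !sZ sgfK !scalerDr !scalerA tt t0 [(1 - t) * t]mulrC t0 t1 !scale0r.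
by rewrite addr0 add0r -scalerDl addrC subrK scale1r.
Qed.
Lemma mixfM t x y : t * t = t -> zorn_mul (mixf t x) (mixf t y) = mixf t (zorn_mul x y).
move=> tt; have t0: t * (1 - t) = 0 by rewrite mulrBr mulr1 tt subrr.
have t1: (1 - t) * (1 - t) = 1 - t by rewrite mulrBl mul1r t0 subr0.
have [lD lZ] := zorn_mull (mixf t y); rewrite /= in lD lZ.
rewrite {1}/mixf lD !lZ /mixf.
have [rD rZ] := zorn_mulr x; have [rD' rZ'] := zorn_mulr (sgf x).
rewrite rD rD' !rZ !rZ' !scalerDr !scalerA tt t0 [(1 - t) * t]mulrC t0 t1 !scale0r.
by rewrite addr0 add0r sgfM.
Qed.
Lemma G2_mixf t : t * t = t -> G2 (mxof (mixf t)).
move=> tt; apply: (G2_lin (mixf_lin t) (mixf_lin t))=> [x|x|x y]; rewrite ?mixfK //.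
exact: mixfM.
Qed.
Lemma e01 : e0 + e1 = zorn 1 0 0 1 :> 'rV[S]_n8.
by rewrite /e0 /e1 zornD !addr0 !add0r. Qed.
Lemma zorn_mul1x x : zorn_mul (e0 + e1) x = x.
by rewrite e01 [x in LHS]zorn_decomp [RHS]zorn_decomp zorn_mulE; zring. Qed.
Lemma zorn_mulx1 x : zorn_mul x (e0 + e1) = x.
by rewrite e01 [x in LHS]zorn_decomp [RHS]zorn_decomp zorn_mulE; zring. Qed.
Lemma G2_one (A : 'M[S]_n8) : G2 A -> (e0 + e1) *m A = e0 + e1.
move=> [[B [AB BA]] HA].
have ow: ((e0 + e1) *m B) *m A = e0 + e1 by rewrite -mulmxA BA mulmx1.
by rewrite -[LHS]zorn_mulx1 -{2}ow HA zorn_mul1x ow.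
Qed.
Lemma mulmx_inj (A B : 'M[S]_n8) x y : A *m B = 1%:M -> x *m A = y *m A -> x = y.
by move=> AB e; rewrite -[x]mulmx1 -[y]mulmx1 -AB !mulmxA e. Qed.
Lemma zorn_cayley a v w b : zorn_mul (zorn a v w b) (zorn a v w b) =
 (a + b) *: zorn a v w b - (a * b - dot v w) *: (e0 + e1).
by rewrite e01 zorn_mulE -scaleNr !zornZ zornD; zring. Qed.
(** Over a ring with zero divisors, trace s and norm n cannot be read off from e^2 = s e - n by
    division. Multiplication by f, the image of [e1], for which e f = 0, gives n f = 0, so n = 0 as
    A is invertible; then (s - 1) e = 0 gives s = 1. *)
Lemma G2_e0 (A : 'M[S]_n8) : G2 A -> let e := e0 *m A in
 zornA e + zornB e = 1 /\ zornA e * zornB e = dot (zornV e) (zornW e).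
move=> GA; have [[B [AB BA]] HA] := GA; set e := e0 *m A; rewrite /=.
set s := zornA e + zornB e; set n := zornA e * zornB e - dot (zornV e) (zornW e).
have ee: zorn_mul e e = e.
 by rewrite /e HA; congr (_ *m A); rewrite /e0 zorn_mulE; zring.
have cay: zorn_mul e e = s *: e - n *: (e0 + e1).
 by have := zorn_cayley (zornA e) (zornV e) (zornW e) (zornB e); rewrite -zorn_decomp.
set f := e1 *m A.
have ef: zorn_mul e f = 0.
 by rewrite /e /f HA -[RHS](mul0mx _ A); congr (_ *m A); rewrite /e0 /e1 zorn_mulE -zorn0; zring.
have [lD lZ] := zorn_mull f; rewrite /= in lD lZ.
have nf: n *: f = 0.
 have : zorn_mul (s *: e - n *: (e0 + e1)) f = 0 by rewrite -cay ee ef.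
 rewrite lD -scaleNr !lZ ef scaler0 add0r zorn_mul1x scaleNr=> /eqP.
 by rewrite oppr_eq0=> /eqP.
have n0: n = 0.
 have : n *: e1 = 0 by apply: (mulmx_inj AB); rewrite -scalemxAl nf mul0mx.
 by rewrite /e1 zornZ -zorn0=> /zorn_inj[_ _ _]; rewrite mulr1.
have s1: (s - 1) *: e = 0.
 by rewrite scalerBl scale1r -{2}ee cay n0 scale0r subr0 subrr.
have : (s - 1) *: e0 = 0 by apply: (mulmx_inj AB); rewrite -scalemxAl s1 mul0mx.
rewrite /e0 zornZ -zorn0=> /zorn_inj[+ _ _ _]; rewrite mulr1=> s0.
split; last by apply/eqP; rewrite -subr_eq0; apply/eqP.
by apply/eqP; rewrite -subr_eq0; apply/eqP.
Qed.
Lemma SL3_fix (A : 'M[S]_n8) : SL3 A -> e0 *m A = e0.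
by move=> [g _ ->]; rewrite /e0 mul_zorn !mul0mx. Qed.
(** The vectors (0, u; 0, 0) form the Peirce space of all y with e0 y = y and y e0 = 0, which an
    automorphism that fixes [e0] preserves. *)
Lemma G2_fix_V (A : 'M[S]_n8) : G2 A -> e0 *m A = e0 ->
 exists g : 'M_3, forall u, zorn 0 u 0 0 *m A = zorn 0 (u *m g) 0 0.
move=> [_ HA] fix0.
have fV u: exists u', zorn 0 u 0 0 *m A = zorn 0 u' 0 0.
 set y := _ *m A.
 have h1: zorn_mul e0 y = y.
 by rewrite -fix0 /y HA; congr (_ *m A); rewrite /e0 zorn_mulE; zring.
 have h2: zorn_mul y e0 = 0.
 by rewrite -fix0 /y HA -[RHS](mul0mx _ A) -zorn0; congr (_ *m A); rewrite /e0 zorn_mulE; zring.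
 rewrite [y]zorn_decomp in h1 h2 *; move: h1 h2.
 move: (zornA y) (zornB y) (zornV y) (zornW y)=> a b v w.
 rewrite /e0 !zorn_mulE -zorn0=> /zorn_inj[_ _ hw hb] /zorn_inj[ha _ _ _].
 exists v; congr zorn.
 - by rewrite -ha !dotE !row0E; ring.
 - by rewrite -hw; apply/rowP; apply: ord3P; rewrite !(rowDE, rowZE, row0E) ?(cross0, cross1, cross2) !row0E; ring.
 - by rewrite -hb !dotE !row0E; ring.
pose gf u := zornV (zorn 0 u 0 0 *m A).
have gfE u: zorn 0 u 0 0 *m A = zorn 0 (gf u) 0 0.
 by have [u' e] := fV u; rewrite /gf e; have [_ -> _ _] := zornK 0 u' 0 0.
exists (mxof gf)=> u; rewrite mxofE //.
split=> [x y|a x]; [have : zorn 0 (gf (x + y)) 0 0 = zorn 0 (gf x + gf y) 0 0 | have : zorn 0 (gf (a *: x)) 0 0 = zorn 0 (a *: gf x) 0 0].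
- have -> : zorn 0 (gf x + gf y) 0 0 = zorn 0 (gf x) 0 0 + zorn 0 (gf y) 0 0 by rewrite zornD !addr0.
 by rewrite -!gfE -mulmxDl zornD !addr0.
- by case/zorn_inj.
- have -> : zorn 0 (a *: gf x) 0 0 = a *: zorn 0 (gf x) 0 0 by rewrite zornZ !mulr0 scaler0.
 by rewrite -!gfE scalemxAl zornZ !mulr0 scaler0.
by case/zorn_inj.
Qed.
(** [G2_fix_V] gives the block g on the v-part; conjugation with the swap [sgf] gives the block h on
    the w-part. Compatibility with cross products forces h = (adj g)^T, and compatibility with the
    pairing forces g h^T = 1, which then says det g = 1. *)
Lemma SL3_stab (A : 'M[S]_n8) : G2 A -> e0 *m A = e0 -> SL3 A.
move=> GA fix0; have [_ HA] := GA.
have fix1: e1 *m A = e1.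
 by have := G2_one GA; rewrite mulmxDl fix0=> /addrI.
have [g gE] := G2_fix_V GA fix0.
pose s := mxof sgf; have sE x: x *m s = sgf x := mxofE x sgf_lin.
have Gs: G2 s := G2_lin sgf_lin sgf_lin sgfK sgfK sgfM.
have [h hE']: exists h : 'M_3, forall u, zorn 0 0 u 0 *m A = zorn 0 0 (u *m h) 0.
 have [|h hh] := G2_fix_V (G2M (G2M Gs GA) Gs).
 by rewrite !mulmxA !sE /e0 sgfE !oppr0 -/e1 fix1 /e1 sgfE !oppr0.
 exists h=> t; have := hh (- t); rewrite !mulmxA !sE sgfE oppr0 opprK=> /(congr1 sgf).
 by rewrite sgfK sgfE oppr0 mulNmx opprK.
have EA: A = block_mx (block_mx 1%:M 0 0 g) 0 0 (block_mx h 0 0 1%:M).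
 apply: mulmx_ext=> x; rewrite [x]zorn_decomp mul_zorn //.
 have -> : zorn (zornA x) (zornV x) (zornW x) (zornB x) = zornA x *: e0 + zorn 0 (zornV x) 0 0
 + zorn 0 0 (zornW x) 0 + zornB x *: e1.
 by rewrite /e0 /e1 !zornZ !zornD; zring.
 by rewrite !mulmxDl -!scalemxAl fix0 fix1 gE hE' /e0 /e1 !zornZ !zornD; zring.
have hcr u u': cross u u' *m h = cross (u *m g) (u' *m g).
 have := HA (zorn 0 u 0 0) (zorn 0 u' 0 0); rewrite !gE !zorn_mulE.
 have -> : zorn (0 * 0 + dot u 0) (0 *: u' + 0 *: u - cross 0 0) (0 *: 0 + 0 *: 0 + cross u u')
 (0 * 0 + dot 0 u') = zorn 0 0 (cross u u') 0 by zring.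
 rewrite hE'=> /zorn_inj[_ _ <- _]; apply/rowP=> i; rewrite !(rowDE, rowZE, row0E); ring.
have dgh u t: dot (u *m g) (t *m h) = dot u t.
 have := HA (zorn 0 u 0 0) (zorn 0 0 t 0); rewrite gE hE' !zorn_mulE.
 have -> : zorn (0 * 0 + dot u t) (0 *: 0 + 0 *: u - cross 0 t) (0 *: 0 + 0 *: t + cross u 0)
 (0 * 0 + dot 0 0) = dot u t *: e0 by rewrite /e0 zornZ; zring.
 by rewrite -scalemxAl fix0 /e0 zornZ=> /zorn_inj[e _ _ _]; rewrite mulr1 mul0r add0r in e.
have hE: h = (\adj g)^T.
 apply: mulmx_ext=> t.
 have H u u': cross u u' *m h = cross u u' *m (\adj g)^T.
 by rewrite -cross_mul.
 move: t; apply: lin_ext (lin_mulmx _) (lin_mulmx _) _.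
 have cb i: exists u u' : 'rV[S]_3, delta_mx 0 i = cross u u'.
 exists (delta_mx 0 (i + 1)), (delta_mx 0 (i + 2%R)); apply/rowP=> j.
 rewrite !mxE; move: i j; apply: ord3P; apply: ord3P; rewrite /= ?mulr1 ?mulr0 ?mul0r ?subr0 ?sub0r //.
 by move=> i; have [u [u' ->]] := cb i; apply: H.
exists g; last by rewrite -hE.
have gh: g *m h^T = 1%:M.
 apply/matrixP=> i j; have := dgh (delta_mx 0 i) (delta_mx 0 j).
 rewrite /dot trmx_mul !mulmxA -(mulmxA _ g).
 rewrite -rowE trmx_delta -colE !mxE=> ->.
 by rewrite (bigD1 j) //= !mxE !eqxx /= mulr1 big1 ?addr0 1?eq_sym // => k kj; rewrite !mxE (negbTE kj) mulr0.
have := congr1 (fun M : 'M_3=> M 0 0) gh; rewrite hE trmxK mul_mx_adj !mxE /= mulr1n.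
by rewrite mulr1n.
Qed.

End ZornLinear.

Section Naturality.
Variables (S S' : cring) (f : {rmorphism S -> S'}).

Lemma map_zorn a v w b : map_mx f (zorn a v w b) = zorn (f a) (map_mx f v) (map_mx f w) (f b).
by rewrite !map_row_mx !map_scalar_mx. Qed.
Lemma zorn_map (x : 'rV[S]_n8) : [/\ zornA (map_mx f x) = f (zornA x),
 zornV (map_mx f x) = map_mx f (zornV x), zornW (map_mx f x) = map_mx f (zornW x)
 & zornB (map_mx f x) = f (zornB x)].
have e: map_mx f x = zorn (f (zornA x)) (map_mx f (zornV x)) (map_mx f (zornW x)) (f (zornB x)).
 by rewrite {1}[x]zorn_decomp map_zorn.
by rewrite e; apply: zornK.
Qed.
Lemma map_dot (v w : 'rV[S]_3) : dot (map_mx f v) (map_mx f w) = f (dot v w).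
by rewrite !dotE !mxE !rmorphD !rmorphM. Qed.
Lemma rowME n (v : 'rV[S]_n) i : map_mx f v 0 i = f (v 0 i). by rewrite mxE. Qed.
Lemma map_zorn_mul (x y : 'rV[S]_n8) :
 map_mx f (zorn_mul x y) = zorn_mul (map_mx f x) (map_mx f y).
rewrite [x]zorn_decomp [y]zorn_decomp zorn_mulE !map_zorn zorn_mulE; apply: zorn_eq.
- by rewrite map_dot rmorphD rmorphM.
- by apply: ord3P; rewrite !(rowDE, rowZE, rowNE, cross0, cross1, cross2, rowME, rmorphD, rmorphM, rmorphB, rmorphN).
- by apply: ord3P; rewrite !(rowDE, rowZE, rowNE, cross0, cross1, cross2, rowME, rmorphD, rmorphM, rmorphB, rmorphN).
- by rewrite map_dot rmorphD rmorphM.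
Qed.
Lemma map_delta_mx m n i j : map_mx f (delta_mx i j : 'M[S]_(m, n)) = delta_mx i j.
by apply/matrixP=> k l; rewrite !mxE rmorph_nat. Qed.
Lemma map_1mx n : map_mx f (1%:M : 'M[S]_n) = 1%:M.
by rewrite rmorph1. Qed.
Lemma G2_map (A : 'M[S]_n8) : G2 A -> G2 (map_mx f A).
move=> [[B [AB BA]] HA]; split.
 by exists (map_mx f B); rewrite -!map_mxM AB BA !map_1mx.
apply: zorn_mult_basis=> i j.
by rewrite -!map_delta_mx -!map_mxM -!map_zorn_mul -map_mxM HA.
Qed.

End Naturality.

(** * Schemes given by equations *)

Section QAMaps.
Variables (F : fieldType) (A1 A2 : cring) (j1 : F -> A1) (j2 : F -> A2).
Variables (r1 : seq A1) (r2 : seq A2) (jm1 : is_rmorph j1) (jm2 : is_rmorph j2).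
Local Notation Y1 := (qascheme r1 jm1).
Local Notation Y2 := (qascheme r2 jm2).

Lemma qa_map_ex (iota : A2 -> A1) : is_rmorph iota -> (forall c, iota (j2 c) = j1 c) ->
 (forall y : Y1, exists2 x, x \in r2 & ~ idl (y : qapt r1) (iota x)) ->
 exists q : shom Y1 Y2, (forall b, hom_of q b = qaglob setT (iota b)) /\
 forall (T : scheme F) (e : shom T Y1) b, hom_of (scomp q e) b = hom_of e (iota b).
move=> im ij Om.
have [||y|q Hq] := @hom_of_ex F A2 j2 r2 jm2 Y1 (qaglob setT \o iota).
- exact: rm_comp im (glob_rm _).
- by move=> c; rewrite /= ij.
- have [x xr yx] := Om y; exists x=> //=.
 by apply/(unit_germ j1 openT _ (gglob _ _)).
exists q; split=> // T e b.
have := Hq b; rewrite /hom_of /= => Hb.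
by rewrite Hb (Prop_irrelevance (hopen q openT) openT).
Qed.

End QAMaps.

Section SolScheme.
Variables (F : fieldType) (I : Type).
Variable Sol : forall S : cring, (F -> S) -> (I -> S) -> Prop.
Variable r : seq (usol Sol).
Hypothesis Sol_gen : Sol (@ustr F I Sol) (@ugen F I Sol).
(** The structure maps [j] and [j'] are unrelated: the equations have integer coefficients, so any
    ring map preserves solutions. *)
Hypothesis Sol_map : forall (S S' : cring) (j : F -> S) (j' : F -> S') (f : {rmorphism S -> S'})
 (c : I -> S) (c' : I -> S'), (forall i, f (c i) = c' i) -> Sol j c -> Sol j' c'.

Definition solsch : scheme F := qascheme r (ustr_rm Sol).

Variable T : scheme F.

Definition pnt (e : shom T solsch) (i : I) : gsec T := hom_of e (@ugen F I Sol i).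

Lemma pnt_sol e : Sol (str T setT) (pnt e).
exact: (@Sol_map _ (gsec T) _ _
 (mkrm (hom_of_rm e)) _ (pnt e) _ Sol_gen)=> i. Qed.
Lemma pnt_inj e e' : pnt e =1 pnt e' -> e = e'.
move=> H; apply: hom_of_inj=> a; apply: (usol_ext (hom_of_rm e) (hom_of_rm e'))=> //.
by move=> c; rewrite (hom_of_str e) (hom_of_str e').
Qed.
Lemma pnt_ex (c : I -> gsec T) : Sol (str T setT) c ->
 (forall t : T, exists2 x, x \in r & unit_at t (uev (str T setT) c x)) ->
 exists e, pnt e =1 c.
move=> sc Om; have sm := @str_rm F T setT openT.
have [|||e He] := @hom_of_ex F _ _ r
 (ustr_rm Sol) T (uev (str T setT) c).
- exact: uev_rm.
- exact: uev_str.
- by [].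
by exists e=> i; rewrite /pnt He uev_gen.
Qed.

End SolScheme.

Section SolMaps.
Variables (F : fieldType) (I1 I2 : Type).
Variable Sol1 : forall S : cring, (F -> S) -> (I1 -> S) -> Prop.
Variable Sol2 : forall S : cring, (F -> S) -> (I2 -> S) -> Prop.
Variables (r1 : seq (usol Sol1)) (r2 : seq (usol Sol2)).
Local Notation Y1 := (solsch r1).
Local Notation Y2 := (solsch r2).

Lemma sol_map_ex (c : I2 -> usol Sol1) : Sol2 (@ustr F I1 Sol1) c ->
 (forall y : Y1, exists2 x, x \in r2 & ~ idl (y : qapt r1) (uev (@ustr F I1 Sol1) c x)) ->
 exists q : shom Y1 Y2, (forall b, hom_of q b = qaglob setT (uev (@ustr F I1 Sol1) c b)) /\
 forall (T : scheme F) (e : shom T Y1) i, pnt (scomp q e) i = hom_of e (c i).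
move=> sc Om; have sm := ustr_rm Sol1.
have [|q [Hq Hc]] := @qa_map_ex F (usol Sol1) (usol Sol2) _ _ r1 r2
 _ (ustr_rm Sol2) _ (uev_rm sm sc) _ Om.
 exact: uev_str.
by exists q; split=> // T e i; rewrite /pnt Hc (uev_gen sm sc).
Qed.
Lemma map_idl (q : shom Y1 Y2) (iota : usol Sol2 -> usol Sol1) (y : Y1) :
 (forall b, hom_of q b = qaglob setT (iota b)) ->
 forall b, idl (q y : qapt r2) b <-> idl (y : qapt r1) (iota b).
move=> H b; have h1 := unit_hom_of q y b; rewrite H in h1.
have h2 := unit_germ (ustr Sol1) openT I
 (gglob (iota b) (I : setT y)).
split=> h; apply: contrapT.
 by move=> /(proj2 h2) /(proj1 h1).
by move=> /(proj2 h1) /(proj1 h2).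
Qed.

End SolMaps.

Lemma usol_generated (F : fieldType) (I : Type) (Sol : forall S : cring, (F -> S) -> (I -> S) -> Prop)
 (L : set (usol Sol)) : (forall c, L (ustr Sol c)) -> (forall i, L (ugen Sol i)) -> generated_by L.
move=> Ls Lg P P1 PB PM sP; have P0: P 0 by rewrite -(subrr 1); apply: PB.
have PN a: P a -> P (- a) by rewrite -sub0r; apply: PB.
apply: usol_ind=> //.
- by move=> a; apply: sP.
- by move=> i; apply: sP.
- by move=> a b Pa Pb; rewrite -[b]opprK; apply: PB=> //; apply: PN.
Qed.
Lemma hom_of_comp (F : fieldType) (A : cring) (j : F -> A) (r : seq A) (jm : is_rmorph j)
 (T T' : scheme F) (e : shom T (qascheme r jm)) (h : shom T' T) a :
 hom_of (scomp e h) a = gpull h (hom_of e a).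
rewrite /gpull /= (Prop_irrelevance (hopen e openT) openT).
ring.
Qed.
Lemma gpull_rm (F : fieldType) (T T' : scheme F) (h : shom T' T) : is_rmorph (gpull h).
exact: pull_rmorph. Qed.

Section Inverse.
Variables (S : cring) (n : nat).
Definition ginv (A : 'M[S]_n) : 'M[S]_n :=
 match pselect (exists B, A *m B = 1%:M /\ B *m A = 1%:M) with
 | left H=> sval (cid H)
 | right _=> 1%:M
 end.
Lemma ginvP (A : 'M[S]_n) : (exists B, A *m B = 1%:M /\ B *m A = 1%:M) ->
 A *m ginv A = 1%:M /\ ginv A *m A = 1%:M.
by rewrite /ginv; case: pselect=> // H _; apply: (svalP (cid H)). Qed.
Lemma inv_uniq (A B C : 'M[S]_n) : B *m A = 1%:M -> A *m C = 1%:M -> B = C.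
by move=> e1 e2; rewrite -[RHS]mul1mx -e1 -mulmxA e2 mulmx1. Qed.
End Inverse.

Lemma idg4 (S : cring) (a b c d s : S) (L : set S) :
 (forall x, L x -> x = a \/ x = b \/ x = c \/ x = d) -> idg L s ->
 exists k1 k2 k3 k4, s = k1 * a + k2 * b + k3 * c + k4 * d.
move=> sL sLs.
suff : [set y | exists k1 k2 k3 k4, y = k1 * a + k2 * b + k3 * c + k4 * d] s by [].
apply: (idg_min _ _ sLs).
 split; first by exists 0, 0, 0, 0; ring.
 move=> _ _ [a1 [a2 [a3 [a4 ->]]]] [b1 [b2 [b3 [b4 ->]]]].
 by exists (a1 + b1), (a2 + b2), (a3 + b3), (a4 + b4); ring.
 move=> e _ [b1 [b2 [b3 [b4 ->]]]].
 by exists (e * b1), (e * b2), (e * b3), (e * b4); ring.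
move=> y /sL[->|[->|[->|->]]].
- by exists 1, 0, 0, 0; ring.
- by exists 0, 1, 0, 0; ring.
- by exists 0, 0, 1, 0; ring.
- by exists 0, 0, 0, 1; ring.
Qed.

(** * Equations of the base, the torsor, the quotient and its cover *)

Inductive xix := cx1 | cy1 | cx2 | cy2 | cz | ch | chi.
(** [eg] are the entries of the group element and [ek] those of its inverse, so that invertibility
    becomes a system of equations. *)
Inductive eix := ex of xix | eg of 'I_n8 & 'I_n8 | ek of 'I_n8 & 'I_n8.
Inductive bix := bx1 | by1 | bx2 | by2 | bz | ba | bb | bv of 'I_3 | bw of 'I_3.
(** The étale cover of R is the disjoint union of the loci where a and where b is invertible, in one
    algebra: the idempotent [utau] is 1 on the first and 0 on the second, [ulam] inverts the chosen
    coordinate, and [uhi] inverts h = a + b. *)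
Inductive uix := ub of bix | utau | ulam | uhi.

Section Equations.
Variable F : fieldType.
Implicit Types S : cring.

(* The punctured cone x1 y1 + x2 y2 = z^2, times the multiplicative group. *)
Definition xSol S (j : F -> S) (c : xix -> S) : Prop :=
 c cx1 * c cy1 + c cx2 * c cy2 = c cz * c cz /\ c ch * c chi = 1.

Definition mg S (c : eix -> S) : 'M[S]_n8 := \matrix_(i, j) c (eg i j).
Definition mk S (c : eix -> S) : 'M[S]_n8 := \matrix_(i, j) c (ek i j).

Definition eSol S (j : F -> S) (c : eix -> S) : Prop :=
 [/\ xSol j (fun i=> c (ex i)), mg c *m mk c = 1%:M, mk c *m mg c = 1%:M & G2 (mg c)].

Definition rv S (c : 'I_3 -> S) : 'rV[S]_3 := \row_i c i.

Definition bSol S (j : F -> S) (c : bix -> S) : Prop :=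
 c bx1 * c by1 + c bx2 * c by2 = c bz * c bz /\
 c ba * c bb = dot (rv (c \o bv)) (rv (c \o bw)).

Definition uSol S (j : F -> S) (c : uix -> S) : Prop :=
 [/\ bSol j (c \o ub), c utau * c utau = c utau,
 c ulam * (c utau * c (ub ba) + (1 - c utau) * c (ub bb)) = 1
 & c uhi * (c (ub ba) + c (ub bb)) = 1].

Lemma xSol_map S S' (j : F -> S) (j' : F -> S') (f : {rmorphism S -> S'}) (c : xix -> S) (c' : xix -> S') :
 (forall i, f (c i) = c' i) -> xSol j c -> xSol j' c'.
by move=> H [e e']; split; rewrite -!H -!rmorphM -?rmorphD ?e ?e' ?rmorph1.
Qed.
Lemma bSol_map S S' (j : F -> S) (j' : F -> S') (f : {rmorphism S -> S'}) (c : bix -> S) (c' : bix -> S') :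
 (forall i, f (c i) = c' i) -> bSol j c -> bSol j' c'.
move=> H [e e']; split; rewrite -!H -!rmorphM -?rmorphD ?e ?e' //.
rewrite -map_dot; have rE k: map_mx f (rv (c \o k)) = rv (c' \o k) by apply/rowP=> i; rewrite !mxE H.
by rewrite !rE.
Qed.
Lemma uSol_map S S' (j : F -> S) (j' : F -> S') (f : {rmorphism S -> S'}) (c : uix -> S) (c' : uix -> S') :
 (forall i, f (c i) = c' i) -> uSol j c -> uSol j' c'.
move=> H [eb et el eh]; split.
- by apply: bSol_map eb=> i; apply: H.
- by rewrite -!H -rmorphM et.
- by rewrite -!H -(rmorph1 f) -rmorphB -!rmorphM -rmorphD -rmorphM el.
- by rewrite -!H -rmorphD -rmorphM eh rmorph1.
Qed.
Lemma mg_map S S' (f : {rmorphism S -> S'}) (c : eix -> S) (c' : eix -> S') :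
 (forall i, f (c i) = c' i) -> map_mx f (mg c) = mg c'.
by move=> H; apply/matrixP=> i j; rewrite !mxE. Qed.
Lemma mk_map S S' (f : {rmorphism S -> S'}) (c : eix -> S) (c' : eix -> S') :
 (forall i, f (c i) = c' i) -> map_mx f (mk c) = mk c'.
by move=> H; apply/matrixP=> i j; rewrite !mxE. Qed.
Lemma eSol_map S S' (j : F -> S) (j' : F -> S') (f : {rmorphism S -> S'}) (c : eix -> S) (c' : eix -> S') :
 (forall i, f (c i) = c' i) -> eSol j c -> eSol j' c'.
move=> H [ex_ e1 e2 e3]; split.
- exact: xSol_map ex_=> i.
- by rewrite -(mg_map H) -(mk_map H) -map_mxM e1 map_1mx.
- by rewrite -(mg_map H) -(mk_map H) -map_mxM e2 map_1mx.
- by rewrite -(mg_map H); apply: G2_map.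
Qed.
Lemma xSol_gen : xSol (@ustr F _ xSol) (@ugen F _ xSol).
split; apply: usol_sep=> S j c jm sc; have em := uev_rm jm sc.
 by rewrite !(rmD em, rmM em) !(uev_gen jm sc); case: sc.
by rewrite !(rmM em, rm1 em) !(uev_gen jm sc); case: sc.
Qed.
Lemma bSol_gen : bSol (@ustr F _ bSol) (@ugen F _ bSol).
split; apply: usol_sep=> S j c jm sc; have em := uev_rm jm sc.
 by rewrite !(rmD em, rmM em) !(uev_gen jm sc); case: sc.
have /= <- := map_dot (mkrm em) _ _.
rewrite (rmM em) !(uev_gen jm sc); have [_ ->] := sc.
by congr dot; apply/rowP=> i; rewrite !mxE (uev_gen jm sc).
Qed.
Lemma uSol_gen : uSol (@ustr F _ uSol) (@ugen F _ uSol).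
split; first split; apply: usol_sep=> S j c jm sc; have em := uev_rm jm sc;
 have [[s1 s2] s3 s4 s5] := sc.
- by rewrite !(rmD em, rmM em) !(uev_gen jm sc).
- have /= <- := map_dot (mkrm em) _ _.
 rewrite (rmM em) !(uev_gen jm sc) s2.
 by congr dot; apply/rowP=> i; rewrite !mxE (uev_gen jm sc).
- by rewrite (rmM em) !(uev_gen jm sc).
- by rewrite (rmM em) (rmD em) !(rmM em) (rmB em) (rm1 em) !(uev_gen jm sc).
- by rewrite (rm1 em) (rmM em) (rmD em) !(uev_gen jm sc).
Qed.
Lemma eSol_gen : eSol (@ustr F _ eSol) (@ugen F _ eSol).
have sep m n (M N : 'M[usol eSol]_(m, n)) : (forall S (j : F -> S) c jm (sc : eSol j c),
 map_mx (mkrm (uev_rm jm sc)) M = map_mx (mkrm (uev_rm jm sc)) N) -> M = N.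
 move=> H; apply/matrixP=> i k; apply: usol_sep=> S j c jm sc.
 by have /matrixP/(_ i k) := H S j c jm sc; rewrite !mxE.
have gE S (j : F -> S) c jm (sc : eSol j c) :
 map_mx (mkrm (uev_rm jm sc)) (mg (ugen eSol)) = mg c.
 by apply: mg_map=> i; exact: (uev_gen jm sc).
have kE S (j : F -> S) c jm (sc : eSol j c) :
 map_mx (mkrm (uev_rm jm sc)) (mk (ugen eSol)) = mk c.
 by apply: mk_map=> i; exact: (uev_gen jm sc).
have e1: mg (ugen eSol) *m mk (ugen eSol) = 1%:M.
 by apply: sep=> S j c jm sc; rewrite map_mxM gE kE map_1mx; case: sc.
have e2: mk (ugen eSol) *m mg (ugen eSol) = 1%:M.
 by apply: sep=> S j c jm sc; rewrite map_mxM gE kE map_1mx; case: sc.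
split=> //.
- split; apply: usol_sep=> S j c jm sc; have em := uev_rm jm sc;
 have [[s1 s2] _ _ _] := sc.
 by rewrite !(rmD em, rmM em) !(uev_gen jm sc).
 by rewrite !(rmM em, rm1 em) !(uev_gen jm sc).
- split; first by exists (mk (ugen eSol)).
 apply: zorn_mult_basis=> i k; apply: sep=> S j c jm sc.
 set ff := mkrm _; have fg: map_mx ff _ = mg c := gE _ _ _ _ _.
 move: (delta_mx 0 i) (delta_mx 0 k)=> x y.
 transitivity (zorn_mul (map_mx ff x *m mg c) (map_mx ff y *m mg c)).
 by rewrite -fg -!(map_mxM ff) (map_zorn_mul ff).
 have [_ _ _ [_ HA]] := sc; rewrite HA -(map_zorn_mul ff) -fg.
 by rewrite -(map_mxM ff).
Qed.

Definition xk := nth cz [:: cx1; cy1; cx2; cy2].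
Definition bk := nth bz [:: bx1; by1; bx2; by2].
(** The coordinate z does not occur because its square lies in the ideal of the other four. *)
Definition rX : seq (usol xSol) := [seq ugen _ (xk i) | i <- iota 0 4].
Definition rE : seq (usol eSol) := [seq ugen _ (ex (xk i)) | i <- iota 0 4].
Definition hB : usol bSol := ugen _ ba + ugen _ bb.
(** The factor h removes the locus h = 0 from R while B itself remains the ring of the full cones,
    with the vertices at which the lower bound takes lengths. *)
Definition rB : seq (usol bSol) := [seq hB * ugen _ (bk i) | i <- iota 0 4].
Definition rU : seq (usol uSol) := [seq ugen _ (ub (bk i)) | i <- iota 0 4].

Definition Xs : scheme F := solsch rX.
Definition Es : scheme F := solsch rE.
Definition Rs : scheme F := solsch rB.
Definition Us : scheme F := solsch rU.

Lemma xgen : exists l : seq (usol xSol), generated_by (range (@ustr F _ xSol) `|` [set` l]).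
exists [:: ugen _ cx1; ugen _ cy1; ugen _ cx2; ugen _ cy2; ugen _ cz; ugen _ ch; ugen _ chi].
apply: usol_generated=> [c|]; first by left.
by right; case: i; rewrite /= !inE eqxx ?orbT.
Qed.
Lemma bgen : exists l : seq (usol bSol), generated_by (range (@ustr F _ bSol) `|` [set` l]).
exists ([:: ugen _ bx1; ugen _ by1; ugen _ bx2; ugen _ by2; ugen _ bz; ugen _ ba; ugen _ bb]
 ++ [seq ugen _ (bv i) | i <- enum 'I_3] ++ [seq ugen _ (bw i) | i <- enum 'I_3]).
apply: usol_generated=> [c|]; first by left.
move=> k; right; rewrite /=; case: k=> [|||||||i|i]; rewrite !inE ?eqxx ?orbT //.
 by rewrite mem_cat (map_f _) ?mem_enum ?orbT.
by rewrite mem_cat (map_f _ (mem_enum _ i)) ?orbT.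
Qed.
Lemma Xs_sft : separated_of_finite_type Xs.
by have [l gl] := xgen; apply: qa_sft gl. Qed.

(* A map from the cone to D = C / I lifts to C: correct the coordinates by a
 multiple of the value of the equation, x1, ..., y2 being unimodular. *)
Lemma cone_lift (Q C D : cring) (p : C -> D) (v : Q -> D) (j : F -> C) (x : xix -> Q) k1 k2 k3 k4 :
 is_rmorph p -> is_rmorph v -> (forall d, exists c, p c = d) ->
 (forall c c', p c = 0 -> p c' = 0 -> c * c' = 0) -> xSol (fun=> 0) x ->
 1 = k1 * x cx1 + k2 * x cy1 + k3 * x cx2 + k4 * x cy2 ->
 exists2 c, xSol j c & forall i, p (c i) = v (x i).
move=> pm vm ps sq [xe xh] ek.
have [y Hy] := choice (fun i=> ps (v (x i))).
have [K1 eK1] := ps (v k1); have [K2 eK2] := ps (v k2).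
have [K3 eK3] := ps (v k3); have [K4 eK4] := ps (v k4).
pose ep := y cx1 * y cy1 + y cx2 * y cy2 - y cz * y cz.
have pep: p ep = 0.
 rewrite (rmB pm) (rmD pm) !(rmM pm) !Hy -!(rmM vm) -(rmD vm) xe.
 ring.
pose nu := 1 - y ch * y chi.
have pnu: p nu = 0.
 by rewrite (rmB pm) (rm1 pm) (rmM pm) !Hy -(rmM vm) xh (rm1 vm) subrr.
pose one' := K1 * y cx1 + K2 * y cy1 + K3 * y cx2 + K4 * y cy2.
have pone: p (1 - one') = 0.
 rewrite (rmB pm) (rm1 pm) !(rmD pm) !(rmM pm) eK1 eK2 eK3 eK4 !Hy.
 by rewrite -!(rmM vm) -!(rmD vm) -ek (rm1 vm) subrr.
have epone: ep * (1 - one') = 0 by apply: sq.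
pose c i := match i with
 | cx1=> y cx1 - ep * K2 | cy1=> y cy1 - ep * K1
 | cx2=> y cx2 - ep * K4 | cy2=> y cy2 - ep * K3
 | cz=> y cz | ch=> y ch | chi=> y chi * (1 + nu) end.
have cs: xSol j c.

 split; rewrite /c.
 transitivity (y cz * y cz + ep * (1 - one') + ep * ep * (K1 * K2 + K3 * K4)).
 by rewrite /one' /ep; ring.
 by rewrite epone (sq _ _ pep pep); ring.

 by transitivity (1 - nu * nu); [rewrite /nu; ring | rewrite (sq _ _ pnu pnu) subr0].
exists c=> // i; case: i; rewrite /c //.
- by rewrite (rmB pm) (rmM pm) pep mul0r subr0.
- by rewrite (rmB pm) (rmM pm) pep mul0r subr0.
- by rewrite (rmB pm) (rmM pm) pep mul0r subr0.
- by rewrite (rmB pm) (rmM pm) pep mul0r subr0.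
- by rewrite (rmM pm) (rmD pm) (rm1 pm) pnu addr0 mulr1.
Qed.
Lemma Xs_smooth : smooth Xs.
have [l gl] := xgen; apply: (qa_smooth gl)=> U C D p u v affU [ps sq comm].
have [oU _ _ _ _] := affU.
have one: idg [set qaglob U x | x in [set` rX]] 1.
 have [P pP TP|n] := @rad_idg _ [set qaglob U x | x in [set` rX]] 1; last first.
 by rewrite expr1n.
 have [_ _ pts _ _] := affU; have [x [[Ux Px] _]] := pts P pP.
 have [y yr xy] := (svalP x).2.
 have : P (qaglob U y) by apply: TP; exists y.
 by rewrite Px=> /(nunit_germ _ oU Ux (gglob _ Ux)).
have gm := glob_rm (r := rX) U; have vm := rm_of v; have pm := rm_of p.
pose x i := qaglob U (ugen xSol i).
have [k1 [k2 [k3 [k4 ek]]]] : exists k1 k2 k3 k4 : qasec U,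
 1 = k1 * x cx1 + k2 * x cy1 + k3 * x cx2 + k4 * x cy2.
 apply: (idg4 _ one)=> w [y /mapP[i + ->] <-].
 by case: i=> [|[|[|[|i]]]] // _; [left|right;left|right;right;left|right;right;right].
have xs: xSol (fun=> 0) x := @xSol_map _ _ _ _ (mkrm gm) _ x (fun=> erefl) xSol_gen.
have uj := rm_of u.
have [c cs pc] := cone_lift u pm vm ps sq xs ek.
exists (uev u c); split.
- exact: uev_rm.
- apply: (usol_ext (rm_comp (uev_rm uj cs) pm) (rm_comp gm vm))=> [a|i] /=.
 by rewrite (uev_str uj cs).
 by rewrite (uev_gen uj cs).
- exact: uev_str.
Qed.

End Equations.

(** * The two torsors *)

Section Torsors.
Variable F : fieldType.
Implicit Types S : cring.
Local Notation XT := (Xs F).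
Local Notation ET := (Es F).
Local Notation RT := (Rs F).
Local Notation UT := (Us F).
Local Notation Eg := (@ugen F eix (@eSol F)).
Local Notation Ug := (@ugen F uix (@uSol F)).
Local Notation Bg := (@ugen F bix (@bSol F)).
Local Notation Xg := (@ugen F xix (@xSol F)).
Local Notation Estr := (@ustr F eix (@eSol F)).
Local Notation Ustr := (@ustr F uix (@uSol F)).
Local Notation Xstr := (@ustr F xix (@xSol F)).
Local Notation Bstr := (@ustr F bix (@bSol F)).

Lemma E_sol (T : scheme F) (e : shom T ET) : eSol (str T setT) (pnt e).
exact: (pnt_sol (@eSol_gen F) (@eSol_map F)). Qed.
Lemma E_ex (T : scheme F) (e : shom T ET) (c : eix -> gsec T) : eSol (str T setT) c ->
 (forall i, c (ex i) = pnt e (ex i)) -> exists e' : shom T ET, pnt e' =1 c.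
move=> sc H; apply: pnt_ex=> // t; have [x xr ux] := hom_of_Om e t; exists x=> //.
by move: xr ux=> /mapP[k _ ->]; rewrite (uev_gen (@str_rm F T setT openT) sc) H.
Qed.

Definition actc S (c : eix -> S) (A : 'M[S]_n8) (i : eix) : S :=
 match i with
 | ex k=> c (ex k)
 | eg i j=> (mg c *m A) i j
 | ek i j=> (ginv A *m mk c) i j
 end.

Lemma mg_actc S (c : eix -> S) A : mg (actc c A) = mg c *m A.
by apply/matrixP=> i j; rewrite mxE. Qed.
Lemma mk_actc S (c : eix -> S) A : mk (actc c A) = ginv A *m mk c.
by apply/matrixP=> i j; rewrite mxE. Qed.
Lemma eix_ext S (c c' : eix -> S) : (forall i, c (ex i) = c' (ex i)) ->
 mg c = mg c' -> mk c = mk c' -> c =1 c'.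
move=> H /matrixP eg_ /matrixP ek_ [k|i j|i j]; first exact: H.
 by have := eg_ i j; rewrite !mxE.
by have := ek_ i j; rewrite !mxE.
Qed.
Lemma actc_sol S (j : F -> S) (c : eix -> S) A : eSol j c -> G2 A -> eSol j (actc c A).
move=> [sx gk kg Gg] GA; have [i1 i2] := ginvP GA.1; split; rewrite ?mg_actc ?mk_actc //.
- by rewrite mulmxA -(mulmxA (mg c)) i1 mulmx1.
- by rewrite mulmxA -(mulmxA (ginv A)) kg mulmx1.
- exact: G2M.
Qed.

Definition act : action_map n8 ET := fun T e A =>
 match pselect (exists e' : shom T ET, pnt e' =1 actc (pnt e) A) with
 | left H=> sval (cid H)
 | right _=> e
 end.

Lemma actP (T : scheme F) (e : shom T ET) A : G2 A -> pnt (act e A) =1 actc (pnt e) A.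
move=> GA; rewrite /act; case: pselect=> [H|[]]; first exact: (svalP (cid H)).
by apply: (E_ex _)=> //; apply: actc_sol=> //; apply: E_sol.
Qed.
Lemma mg_act (T : scheme F) (e : shom T ET) A : G2 A -> mg (pnt (act e A)) = mg (pnt e) *m A.
by move=> GA; apply/matrixP=> i j; rewrite [LHS]mxE (actP e GA). Qed.
Lemma pnt_comp (T T' : scheme F) (e : shom T ET) (h : shom T' T) i :
 pnt (scomp e h) i = gpull h (pnt e i).
exact: hom_of_comp. Qed.
Lemma mk_eq S (j : F -> S) (c c' : eix -> S) : eSol j c -> eSol j c' ->
 mg c = mg c' -> mk c = mk c'.
move=> [_ _ kg _] [_ gk _ _] Hg; rewrite Hg in kg.
exact: inv_uniq kg gk.
Qed.
Lemma mg_trans S (j : F -> S) (c c' : eix -> S) : eSol j c ->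
 mg c *m (mk c *m mg c') = mg c'.
by move=> [_ gk _ _]; rewrite mulmxA gk mul1mx. Qed.
Lemma E_inj (T : scheme F) (e e' : shom T ET) : (forall i, pnt e (ex i) = pnt e' (ex i)) ->
 mg (pnt e) = mg (pnt e') -> e = e'.
move=> H Hg; apply: pnt_inj; apply: (eix_ext H Hg).
exact: (mk_eq (E_sol e) (E_sol e')).
Qed.
Lemma act_action (G : mxfunctor n8) : (forall S, G S `<=` @G2 S) -> is_action G act.
move=> sG; split.
- move=> T e; have G1 := G2_1; apply: E_inj=> [i|]; first exact: actP.
 by rewrite mg_act // mulmx1.
- move=> T e A B /sG GA /sG GB; have GAB := G2M GA GB; apply: E_inj=> [i|].
 by rewrite !actP //= actP.
 by rewrite !mg_act // mulmxA.
- move=> T T' h e A /sG GA; have GA': G2 _ := @G2_map _ _ (mkrm (gpull_rm h)) A GA.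
 apply: E_inj=> [i|]; first by rewrite (actP _ GA') /actc !pnt_comp (actP _ GA).
 have mgc (e' : shom T ET) : mg (pnt (scomp e' h)) = map_mx (mkrm (gpull_rm h)) (mg (pnt e')).
 by symmetry; apply: mg_map=> i; rewrite pnt_comp.
 by rewrite mg_act // !mgc mg_act // (map_mxM _).
Qed.
Lemma point_ngen (I : Type) (Sol : forall S : cring, (F -> S) -> (I -> S) -> Prop)
 (r : seq (usol Sol)) (y : solsch r) : exists2 x, x \in r & ~ idl (y : qapt r) x.
exact: (svalP y).2. Qed.
Lemma pi_ex : exists pi : shom ET XT, forall (T : scheme F) (e : shom T ET) i,
 pnt (scomp pi e) i = pnt e (ex i).
have sx: xSol Estr (fun i=> Eg (ex i)) by have [] := @eSol_gen F.
have [|q [_ Hq]] := @sol_map_ex F _ _ _ _ (rE F) (rX F) _ sx.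
 move=> y; have sm := ustr_rm (@eSol F).
 have [x /mapP[k k4 ->] yx] := point_ngen y.
 by exists (Xg (xk k)); [exact: map_f | rewrite (uev_gen sm sx)].
by exists q.
Qed.
Lemma G2_unique S (c c' : eix -> S) (j : F -> S) A : eSol j c ->
 mg c' = mg c *m A -> A = mk c *m mg c'.
by move=> [_ _ kg _] ->; rewrite mulmxA kg mul1mx. Qed.
Lemma trans_G2 S (c c' : eix -> S) (j : F -> S) : eSol j c -> eSol j c' ->
 G2 (mk c *m mg c').
by move=> [_ gk kg Gg] [_ _ _ Gg']; apply: G2M Gg'; apply: (G2V Gg). Qed.
Lemma pi_torsor : exists pi : shom ET XT, is_torsor (@G2) act pi.
have [pi Hpi] := pi_ex; exists pi; split; first by apply: (act_action _)=> S A.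
- by move=> T e A GA; apply: pnt_inj=> i; rewrite !Hpi actP.
- move=> T e e' Heq; have He i: pnt e (ex i) = pnt e' (ex i) by rewrite -!Hpi Heq.
 have se := E_sol e; have GA := trans_G2 se (E_sol e').
 exists (mk (pnt e) *m mg (pnt e')); split.
 split=> //; apply: E_inj=> [i|]; first by rewrite actP //=.
 by rewrite mg_act //; apply: mg_trans se.
 by move=> A [GA' <-]; symmetry; apply: (G2_unique se); rewrite mg_act.
have sm := ustr_rm (@xSol F).
have [|||j [Hj Hjc]] := @qa_map_ex F _ _ Xstr Xstr (rX F) (rX F) (ustr_rm _) (ustr_rm _) id.
- by [].
- by [].
- by move=> y; have [x xr yx] := point_ngen y; exists x.
(* The section x |-> (x, 1) of the trivial torsor; the étale cover is the identity of the base. *)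
pose c i : usol _ := match i with ex k=> Xg k | eg i j=> (1%:M) i j
 | ek i j=> (1%:M) i j end.
have mgc: mg c = 1%:M by apply/matrixP=> k l; rewrite mxE.
have mkc: mk c = 1%:M by [].
have sc: eSol Xstr c.
 by split; rewrite ?mgc ?mkc ?mulmx1 //; [exact: xSol_gen | exact: G2_1].
have [|l [Hl _]] := @sol_map_ex F _ _ _ _ (rX F) (rE F) c sc.
 move=> y; have [x /mapP[k k4 ->] yx] := point_ngen y.
 by exists (Eg (ex (xk k))); [exact: (map_f (fun i=> Eg (ex (xk i)))) | rewrite (uev_gen sm sc)].
exists XT, j, l; split.
- have [g2 gg2] := xgen F.
 refine (@qa_etale F _ _ _ _ _ _ _ _ g2 [::] j id Hj gg2 _ (@formally_etale_id _)).
 by move=> P _ _ _ sP a; apply: sP; left.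
- move=> x; exists x; apply: idl_inj; apply/seteqP; split=> b.
 by move/(map_idl (iota := id) x Hj b).
 by move=> h; apply/(map_idl (iota := id) x Hj b).
- by apply: pnt_inj=> i; rewrite Hpi /pnt Hl (uev_gen sm sc).
Qed.
Lemma zornZE S h (x : 'rV[S]_n8) : [/\ zornA (h *: x) = h * zornA x,
 zornV (h *: x) = h *: zornV x, zornW (h *: x) = h *: zornW x & zornB (h *: x) = h * zornB x].
have [-> -> -> ->]: let y := zorn (h * zornA x) (h *: zornV x) (h *: zornW x) (h * zornB x) in
 [/\ zornA (h *: x) = zornA y, zornV (h *: x) = zornV y, zornW (h *: x) = zornW y & zornB (h *: x) = zornB y].
 by rewrite -zornZ -zorn_decomp.
exact: zornK.
Qed.
Lemma dotZ S h (v w : 'rV[S]_3) : dot (h *: v) (h *: w) = h * h * dot v w.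
by rewrite !dotE !rowZE; ring. Qed.

(** The inverse matrix occurs since the group multiplies g from the right: e0 (g A)^-1 = e0 A^-1
    g^-1 equals e0 g^-1 when A fixes [e0]. *)
Definition qc S (c : eix -> S) (i : bix) : S :=
 let e := c (ex ch) *: (e0 S *m mk c) in
 match i with
 | bx1=> c (ex cx1) | by1=> c (ex cy1) | bx2=> c (ex cx2) | by2=> c (ex cy2)
 | bz=> c (ex cz) | ba=> zornA e | bb=> zornB e
 | bv i=> zornV e 0 i | bw i=> zornW e 0 i
 end.

Lemma rv_eta S (v : 'rV[S]_3) : rv (fun i=> v 0 i) = v.
by apply/rowP=> i; rewrite mxE. Qed.
Lemma mk_G2 S (j : F -> S) (c : eix -> S) : eSol j c -> G2 (mk c).
by move=> [_ gk kg Gg]; apply: (G2V Gg). Qed.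
Lemma qc_sol S (j : F -> S) (c : eix -> S) : eSol j c -> bSol j (qc c).
move=> sc; have [[s1 s2] _ _ _] := sc; split; first exact: s1.
have [_ en] := G2_e0 (mk_G2 sc).
rewrite /=; have [-> eV eW ->] := zornZE (c (ex ch)) (e0 S *m mk c).
transitivity (dot (zornV (c (ex ch) *: (e0 S *m mk c))) (zornW (c (ex ch) *: (e0 S *m mk c)))).
 by rewrite eV eW dotZ -en; ring.
by rewrite -[X in dot X _](rv_eta) -[X in dot _ X](rv_eta).
Qed.
Lemma qc_trace S (j : F -> S) (c : eix -> S) : eSol j c ->
 qc c ba + qc c bb = c (ex ch).
move=> sc; have [et _] := G2_e0 (mk_G2 sc).
by rewrite /qc; have [-> _ _ ->] := zornZE (c (ex ch)) (e0 S *m mk c); rewrite -mulrDr et mulr1.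
Qed.
Lemma map_e0 S S' (f : {rmorphism S -> S'}) : map_mx f (e0 S) = e0 S'.
by rewrite map_zorn rmorph1 rmorph0 !map_mx0. Qed.
Lemma qc_map S S' (f : {rmorphism S -> S'}) (c : eix -> S) (c' : eix -> S') :
 (forall i, f (c i) = c' i) -> forall i, f (qc c i) = qc c' i.
move=> H i; have e: map_mx f (c (ex ch) *: (e0 S *m mk c)) = c' (ex ch) *: (e0 S' *m mk c').
 by rewrite map_mxZ map_mxM map_e0 (mk_map H) H.
have [zA zV zW zB] := zorn_map f (c (ex ch) *: (e0 S *m mk c)); rewrite e in zA zV zW zB.
case: i=> [|||||||i|i]; rewrite /qc //.
 by have /rowP/(_ i) := zV; rewrite [RHS]mxE.
by have /rowP/(_ i) := zW; rewrite [RHS]mxE.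
Qed.
Lemma coneE S (c : bix -> S) (d : xix -> S) : c bx1 = d cx1 -> c by1 = d cy1 -> c bx2 = d cx2 -> c by2 = d cy2 ->
 c bz = d cz -> forall k, c (bk k) = d (xk k).
by move=> ? ? ? ? ? [|[|[|[|k]]]] //; rewrite /bk /xk /= !nth_nil. Qed.
Lemma q_ex : exists q : shom ET RT, forall (T : scheme F) (e : shom T ET) i,
 pnt (scomp q e) i = qc (pnt e) i.
have sg := @eSol_gen F; have sx := qc_sol sg; have sm := ustr_rm (@eSol F).
have [|q [_ Hq]] := @sol_map_ex F _ _ _ _ (rE F) (rB F) _ sx.
 move=> y; have py := idlP y.
 have hn: ~ idl y (Eg (ex ch)).
 have [[_ hh] _ _ _] := sg=> h; apply: (prime1 py); rewrite -hh.
 by have [_ _ PM _ _] := py; rewrite mulrC; apply: PM.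
 have ev b: uev Estr (qc Eg) (hB F * Bg b) = Eg (ex ch) * qc Eg b.
 by rewrite (rmM (uev_rm sm sx)) (rmD (uev_rm sm sx)) !(uev_gen sm sx) (qc_trace sg).
 have [x /mapP[k k4 ->] yx] := point_ngen y.
 exists (hB F * Bg (bk k)); [exact: (map_f (fun i=> hB F * Bg (bk i))) | rewrite ev; apply: primenM=> //].
 by rewrite (@coneE _ (qc Eg) (Eg \o ex)).
exists q=> T e i; rewrite Hq.
exact: (@qc_map _ _ (mkrm (hom_of_rm e)) Eg _).
Qed.
Lemma qc_ext S (c c' : eix -> S) : c =1 c' -> qc c =1 qc c'.
move=> H i; have e: mk c = mk c' by apply/matrixP=> k l; rewrite !mxE.
by rewrite /qc e !H.
Qed.
Lemma qc_act S (c : eix -> S) A : SL3 A -> qc (actc c A) =1 qc c.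
move=> sA i; have [i1 i2] := ginvP (SL3_G2 sA).1.
have e: e0 S *m mk (actc c A) = e0 S *m mk c.
 by rewrite mk_actc mulmxA -{1}(SL3_fix sA) -(mulmxA _ A) i1 mulmx1.
by rewrite /qc e.
Qed.
Lemma qc_eq S (j : F -> S) (c c' : eix -> S) : eSol j c -> eSol j c' -> qc c =1 qc c' ->
 (forall i, c (ex i) = c' (ex i)) /\ e0 S *m mk c = e0 S *m mk c'.
move=> sc sc' H; have hh: c (ex ch) = c' (ex ch) by rewrite -(qc_trace sc) -(qc_trace sc') !H.
have [[_ u] _ _ _] := sc; have [[_ u'] _ _ _] := sc'; split.
 case; [exact: (H bx1) | exact: (H by1) | exact: (H bx2) | exact: (H by2) | exact: (H bz) | exact: hh | ].
 rewrite -[LHS]mulr1 -u' -hh mulrA [c _ * _]mulrC.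
 by rewrite u mul1r.
have e: c (ex ch) *: (e0 S *m mk c) = c' (ex ch) *: (e0 S *m mk c').
 rewrite [LHS]zorn_decomp [RHS]zorn_decomp; apply: zorn_eq; [exact: (H ba)| | |exact: (H bb)].
 by move=> i; exact: (H (bv i)).
 by move=> i; exact: (H (bw i)).
rewrite -[LHS]scale1r -[RHS]scale1r -u mulrC -!scalerA e hh.
by [].
Qed.
Lemma mixf_zorn S (t a b : S) v w : mixf t (zorn a v w b) =
 zorn (t * a + (1 - t) * b) (t *: v - (1 - t) *: w) (t *: w - (1 - t) *: v) (t * b + (1 - t) * a).
by rewrite /mixf sgfE !zornZ zornD; apply: zorn_eq=> // i; rewrite !(rowDE, rowZE, rowNE); ring.
Qed.

Section Cover.
Variables (S : cring) (c : uix -> S).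

Definition eU : 'rV[S]_n8 :=
 c uhi *: zorn (c (ub ba)) (rv (c \o ub \o bv)) (rv (c \o ub \o bw)) (c (ub bb)).
(** Where tau = 1 the first coordinate of the idempotent [eU] is invertible and [Aidf] moves [e0] to
    it. Where tau = 0 the second one is, and the swap reduces to the first case. [mixf] treats both
    at once. *)
Definition kU : 'M[S]_n8 :=
 mxof (Aidf ((c (ub ba) + c (ub bb)) * c ulam) (mixf (c utau) eU)) *m mxof (mixf (c utau)).
Definition lc (i : eix) : S :=
 match i with
 | ex cx1=> c (ub bx1) | ex cy1=> c (ub by1) | ex cx2=> c (ub bx2) | ex cy2=> c (ub by2)
 | ex cz=> c (ub bz) | ex ch=> c (ub ba) + c (ub bb) | ex chi=> c uhi
 | eg i j=> ginv kU i j | ek i j=> kU i j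
 end.

Hypothesis sc : forall j : F -> S, uSol j c.

Lemma kU_e0 : e0 S *m kU = eU.
have [[s1 s2] s3 s4 s5] := sc (fun=> 0).
rewrite mulmxA (mxofE _ (Aidf_lin _ _)) (mxofE _ (mixf_lin _)).
move: s2 s3 s4 s5; rewrite /eU /= zornZ mixf_zorn.
move: (c _) (c (ub bb)) (c utau) (c uhi) (c ulam) (rv _) (rv _)=> a b t h l w v s2 s3 s4 s5.
have t0: t * (1 - t) = 0 by rewrite mulrBr mulr1 s3 subrr.
rewrite Aidf_e0.
- by rewrite -[zorn _ _ _ _]mixf_zorn mixfK.
- have [-> _ _ _] := zornK (t * (h * a) + (1 - t) * (h * b)) (t *: (h *: v) - (1 - t) *: (h *: w)) (t *: (h *: w) - (1 - t) *: (h *: v)) (t * (h * b) + (1 - t) * (h * a)).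
 by transitivity ((l * (t * a + (1 - t) * b)) * (h * (a + b))); [ring | rewrite s4 mul1r].
- have [-> _ _ ->] := zornK (t * (h * a) + (1 - t) * (h * b)) (t *: (h *: v) - (1 - t) *: (h *: w)) (t *: (h *: w) - (1 - t) *: (h *: v)) (t * (h * b) + (1 - t) * (h * a)).
 by transitivity (h * (a + b)); [ring | ].
- have [-> -> -> ->] := zornK (t * (h * a) + (1 - t) * (h * b)) (t *: (h *: v) - (1 - t) *: (h *: w)) (t *: (h *: w) - (1 - t) *: (h *: v)) (t * (h * b) + (1 - t) * (h * a)).
 transitivity ((t * t + (1 - t) * (1 - t)) * (h * h) * (a * b) + t * (1 - t) * ((h * a) * (h * a) + (h * b) * (h * b))); first by ring.
 transitivity ((t * t + (1 - t) * (1 - t)) * (h * h) * dot v w - t * (1 - t) * (h * h) * (dot v v + dot w w)).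
 by rewrite t0 s2 !mul0r addr0 subr0.
 by rewrite !dotE !(rowDE, rowNE, rowZE); ring.
Qed.
Lemma kU_G2 : G2 kU.
by apply: G2M; [exact: G2_Aidf | apply: G2_mixf; have [] := sc (fun=> 0)]. Qed.
Lemma lc_sol (j : F -> S) : eSol j lc.
have mgE: mg lc = ginv kU by apply/matrixP=> k l; rewrite mxE.
have mkE: mk lc = kU by apply/matrixP=> k l; rewrite mxE.
have [i1 i2] := ginvP kU_G2.1; have [[s1 s2] s3 s4 s5] := sc j.
split; rewrite ?mgE ?mkE //; first by split=> //=; rewrite mulrC.
exact: (G2V kU_G2).
Qed.
Lemma lc_q i : qc lc i = c (ub i).
have mkE: mk lc = kU by apply/matrixP=> k l; rewrite mxE.
have [_ _ _ s5] := sc (fun=> 0).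
have e: lc (ex ch) *: (e0 S *m mk lc) = zorn (c (ub ba)) (rv (c \o ub \o bv)) (rv (c \o ub \o bw)) (c (ub bb)).
 by rewrite mkE kU_e0 scalerA mulrC s5 scale1r.
have [zA zV zW zB] := zornK (c (ub ba)) (rv (c \o ub \o bv)) (rv (c \o ub \o bw)) (c (ub bb)).
by rewrite /qc e zV zW; case: i=> [|||||||i|i] //; rewrite mxE.
Qed.
End Cover.

Local Notation iota := (@uev F bix (@bSol F) (usol (@uSol F)) Ustr (fun i=> Ug (ub i))).

Lemma usol_lift S S' (p : S -> S') (c : bix -> S) (c' : uix -> S') :
 is_rmorph p -> (forall d, exists a, p a = d) ->
 (forall a a', p a = 0 -> p a' = 0 -> a * a' = 0) ->
 (forall j : F -> S, bSol j c) -> (forall j : F -> S', uSol j c') -> (forall i, p (c i) = c' (ub i)) ->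
 exists c1 : uix -> S, [/\ forall j : F -> S, uSol j c1, forall i, c1 (ub i) = c i & forall i, p (c1 i) = c' i].
move=> pm ps sq sb su pc.
have [[_ _] s3 s4 s5] := su (fun=> 0).
have [t0 pt0] := ps (c' utau); have [l0 pl0] := ps (c' ulam); have [h0 ph0] := ps (c' uhi).
pose e := t0 * t0 - t0; have pe: p e = 0 by rewrite (rmB pm) (rmM pm) !pt0 s3 subrr.
(* The Newton step 3 t^2 - 2 t^3 for lifting an idempotent through a square-zero kernel. The
   inverses are corrected below in the same way, by a factor 1 + (1 - product). *)
pose t := t0 * t0 * (3 - 2 * t0);
have pt: p t = c' utau.
 have -> : t = t0 + e * (1 - 2 * t0) by rewrite /t /e; ring.
 by rewrite (rmD pm) (rmM pm) pe mul0r addr0.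
have tt: t * t = t.
 have : t * t - t = e * e * (4 * e - 3) by rewrite /t /e; ring.
 by rewrite (sq _ _ pe pe) mul0r=> /subr0_eq.
clearbody t; pose w := t * c ba + (1 - t) * c bb; pose n := 1 - l0 * w.
have pw: p w = c' utau * c' (ub ba) + (1 - c' utau) * c' (ub bb).
 by rewrite (rmD pm) !(rmM pm) (rmB pm) (rm1 pm) pt !pc.
have pn: p n = 0 by rewrite (rmB pm) (rm1 pm) (rmM pm) pl0 pw s4 subrr.
pose m := 1 - h0 * (c ba + c bb).
have pm0: p m = 0 by rewrite (rmB pm) (rm1 pm) (rmM pm) (rmD pm) ph0 !pc s5 subrr.
exists (fun i=> match i with ub k=> c k | utau=> t | ulam=> l0 * (1 + n) | uhi=> h0 * (1 + m) end).
split=> [j||].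
- split; [exact: (sb j) | exact: tt | |].
 rewrite -/w; transitivity (1 - n * n); first by rewrite /n; ring.
 by rewrite (sq _ _ pn pn) subr0.
 transitivity (1 - m * m); first by rewrite /m; ring.
 by rewrite (sq _ _ pm0 pm0) subr0.
- by [].
- case=> [i|||] //.
 by rewrite (rmM pm) (rmD pm) (rm1 pm) pn addr0 mulr1.
 by rewrite (rmM pm) (rmD pm) (rm1 pm) pm0 addr0 mulr1.
Qed.
Lemma usol_lift_uniq S S' (p : S -> S') (c c1 : uix -> S) :
 is_rmorph p -> (forall a a', p a = 0 -> p a' = 0 -> a * a' = 0) ->
 (forall j : F -> S, uSol j c) -> (forall j : F -> S, uSol j c1) ->
 (forall i, c (ub i) = c1 (ub i)) -> p (c utau) = p (c1 utau) -> c =1 c1.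
move=> pm sq sc sc1 eb pt.
have [_ s3 s4 s5] := sc (fun=> 0); have [_ s3' s4' s5'] := sc1 (fun=> 0).
have et: c utau = c1 utau.
 move: s3 s3' pt; move: (c utau) (c1 utau)=> t t1 tt tt1 pt.
 have pd: p (t1 - t) = 0 by rewrite (rmB pm) pt subrr.

 (* Since t is idempotent, 1 - 2 t is its own inverse; so idempotents that agree modulo a
    square-zero kernel are equal. *)
 have e: (t1 - t) * (1 - 2 * t) = (t1 - t) * (t1 - t) - (t1 * t1 - t1) + (t * t - t) by ring.
 rewrite (sq _ _ pd pd) tt tt1 !subrr addr0 in e.
 have : (t1 - t) * (1 - 2 * t) * (1 - 2 * t) = (t1 - t) + 4 * (t1 - t) * (t * t - t) by ring.
 by rewrite e tt subrr mul0r mulr0 addr0=> /esym/subr0_eq.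
have inv_eq (a b w : S) : a * w = 1 -> b * w = 1 -> a = b.
 by move=> aw bw; rewrite -[LHS]mulr1 -bw [b * w]mulrC mulrA aw mul1r.
case=> [i|||] //; first by apply: (inv_eq _ _ _ s4); rewrite et !eb.
by apply: (inv_eq _ _ _ s5); rewrite !eb.
Qed.
Lemma iota_sol : bSol Ustr (fun i=> Ug (ub i)).
by have [] := @uSol_gen F. Qed.
Lemma iota_rm : is_rmorph iota.
exact: (uev_rm (ustr_rm _) iota_sol). Qed.
(** Idempotents and inverses lift uniquely through square-zero kernels, so adjoining [utau], [ulam]
    and [uhi] is étale. *)
Lemma iota_etale : formally_etale iota.
move=> C D p u v [ps sq comm].
have sm' := ustr_rm (@uSol F).
have um := rm_of u; have pm := rm_of p.
have sb: forall j : F -> C, bSol j (fun i=> u (Bg i)).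
 move=> j; exact: (bSol_map _ _ (@bSol_gen F)).
have su: forall j : F -> D, uSol j (fun i=> v (Ug i)).
 move=> j; exact: (uSol_map _ _ (@uSol_gen F)).
have ib i: iota (Bg i) = Ug (ub i) by rewrite (uev_gen sm' iota_sol).
have ic a: iota (Bstr a) = Ustr a by rewrite (uev_str sm' iota_sol).
have [|c1 [sc1 c1b pc1]] := usol_lift pm ps sq sb su; first by move=> i; rewrite comm ib.
have jm := rm_comp (ustr_rm (@bSol F)) um; have wm := uev_rm jm (sc1 _).
exists (mkrm wm); first split.
- apply: (usol_ext (rm_comp wm pm) (rm_of v))=> [a|i] /=.
 by rewrite (uev_str jm (sc1 _)) comm ic.
 by rewrite (uev_gen jm _).
- apply: (usol_ext (rm_comp iota_rm wm) um)=> [a|i] /=.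
 by rewrite ic (uev_str jm _).
 by rewrite ib (uev_gen jm _).
move=> w' [pw' w'u] b.
have sw': forall j : F -> C, uSol j (fun i=> w' (Ug i)).
 move=> j; exact: (uSol_map _ _ (@uSol_gen F)).
have ew: (fun i=> w' (Ug i)) =1 c1.
 by apply: (usol_lift_uniq pm sq)=> // [i|]; rewrite ?c1b ?pc1 -?ib.
apply: (usol_ext (rm_of w') wm)=> [a|i].
 by rewrite (uev_str jm (sc1 _)) -ic.
by rewrite (uev_gen jm _).
Qed.

Section LocalPrime.
Variables (A : cring) (r : seq A) (V : set (qapt r)) (x : qapt r) (Vx : V x).

Definition vanset : set (qasec V) := [set s | exists a t, germ s x a t /\ idl x a].

Lemma vanishE s a t : germ s x a t -> vanset s <-> idl x a.
move=> g; split=> [[b [t' [g' xb]]]|xa]; last by exists a, t.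
by have [xt _] := g'; apply: (feq_num (idlP x) xt (germ_feq Vx g' g)).
Qed.
Lemma vanish_prime : prime_ideal vanset.
have px := idlP x; split.
- by apply/(vanishE (germ0 Vx)); apply: prime0 px.
- move=> p q vp vq; have [[a [s gp]] [b [t gq]]] := (germ_ex p Vx, germ_ex q Vx).
 apply/(vanishE (germD Vx gp gq)); apply: (primeD px).
 by apply: (primeMr px); apply/(vanishE gp).
 by apply: (primeMr px); apply/(vanishE gq).
- move=> p q vq; have [[a [s gp]] [b [t gq]]] := (germ_ex p Vx, germ_ex q Vx).
 by apply/(vanishE (germM Vx gp gq)); apply: (primeMl px); apply/(vanishE gq).
- by move/(vanishE (germ1 Vx)); apply: prime1 px.
- move=> p q; have [[a [s gp]] [b [t gq]]] := (germ_ex p Vx, germ_ex q Vx).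
 move/(vanishE (germM Vx gp gq))=> /(primeM px)[h|h]; [left; exact/(vanishE gp)|right; exact/(vanishE gq)].
Qed.
Lemma fr_glob (u w : A) (H : V `<=` D (u * w)) : mkfr u H * qaglob V w = 1.
apply: germ_ext=> y Vy; exists 1, 1; split; last exact: germ1.
apply: (germ_chg (germM Vy (germ_fr u H Vy) (gglob w Vy))).
 exact: prime1 (idlP y).
by apply: (feqE (idlP y)); rewrite /=; ring.
Qed.

End LocalPrime.

Lemma prime_preim (A B : cring) (f : A -> B) (P : set B) : is_rmorph f -> prime_ideal P ->
 prime_ideal [set b | P (f b)].
move=> fm [Q0 QD QM Q1 QP]; split=> /=.
- by rewrite (rm0 fm).
- by move=> a b ha hb; rewrite (rmD fm); apply: QD.
- by move=> a b hb; rewrite (rmM fm); apply: QM.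
- by rewrite (rm1 fm).
- by move=> a b; rewrite (rmM fm); apply: QP.
Qed.
(** The point has a neighbourhood V on which h and one of a, b are invertible. With tau = 1 or 0
    this yields a solution of [uSol] in the sections over V, and the prime of the sections that
    vanish at the point pulls back to a point above it. *)
Lemma ju_surj (ju : shom UT RT) : (forall b, hom_of ju b = qaglob setT (iota b)) ->
 forall x : RT, exists u : UT, ju u = x.
move=> Hj x; have px := idlP x.
have [k hk uk]: exists2 k, ~ idl x (hB F * Bg k) & Ug (ub k) \in rU F.
 have [y /mapP[k k4 ->] yx] := point_ngen x; exists (bk k)=> //; exact: map_f.
have hh: ~ idl x (hB F) by move=> h; apply: hk; apply: (primeMr px).
have kk: ~ idl x (Bg k) by move=> h; apply: hk; apply: (primeMl px).
have [w [tau [hw tt we]]] : exists w tau, [/\ ~ idl x w, tau * tau = tau :> usol _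
 & tau * Bg ba + (1 - tau) * Bg bb = w].
 have [h|h] := pselect (idl x (Bg ba)).
 exists (Bg bb), 0; split; rewrite ?mul0r //; last by rewrite subr0 mul1r add0r.
 by move=> h'; apply: hh; apply: (primeD px).
 by exists (Bg ba), 1; rewrite ?mul1r subrr mul0r addr0.
pose V : set (qapt (rB F)) := D (hB F * w).
have Vx: V x by apply: primenM.
have H1: V `<=` D (hB F * w) by [].
have H2: V `<=` D (w * hB F) by rewrite mulrC.
have gm := glob_rm (r := rB F) V.
pose c i := match i with ub k=> qaglob V (Bg k) | utau=> qaglob V tau
 | ulam=> mkfr (hB F) H1 | uhi=> mkfr w H2 end.
pose j a := qaglob V (Bstr a); have jm: is_rmorph j := rm_comp (ustr_rm _) gm.
have sb: bSol j (fun i=> qaglob V (Bg i)).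
 exact: (@bSol_map F _ _ Bstr j (mkrm gm) Bg _ _ (@bSol_gen F)).
have sc: uSol j c.
 split; first exact: sb.
 - by rewrite -(rmM gm) tt.
 - transitivity (c ulam * qaglob V w); last exact: fr_glob.
 by rewrite -we (rmD gm) (rmM gm) (rmM gm) (rmB gm) (rm1 gm).
 - transitivity (c uhi * qaglob V (hB F)); last exact: fr_glob.
 by rewrite (rmD gm).
have em := uev_rm jm sc.

have vg b: vanset x _ <-> idl x b := vanishE Vx (gglob b Vx).
have sm' := ustr_rm (@uSol F).
have eiota b: uev j c (iota b) = qaglob V b.
 apply: (usol_ext (rm_comp iota_rm em) gm)=> [a|i] /=.
 by rewrite (uev_str sm' iota_sol) (uev_str jm sc).
 by rewrite (uev_gen sm' iota_sol) (uev_gen jm sc).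
have pQ: prime_ideal [set b | vanset x _] := prime_preim em (vanish_prime Vx).
have Qp: exists2 y, y \in rU F & ~ [set b | vanset x (uev j c b)] y.
 by exists (Ug (ub k))=> //=; rewrite (uev_gen jm sc)=> /vg.
exists (exist _ _ (conj pQ Qp) : qapt _).
apply: idl_inj; apply/seteqP; split=> b.
 move/(map_idl (iota := iota) _ Hj b)=> /=; rewrite eiota.
 exact: (proj1 (vg b)).
move=> h; apply/(map_idl (iota := iota) _ Hj b); rewrite /= eiota.
exact: (proj2 (vg b)).
Qed.
Lemma q_torsor : exists q : shom ET RT, is_torsor (@SL3) act q.
have [q Hq] := q_ex; exists q; split; first by apply: (act_action _)=> S A; apply: SL3_G2.
- by move=> T e A sA; apply: pnt_inj=> i; rewrite !Hq -(qc_act (pnt e) sA); apply: qc_ext; apply: actP; apply: SL3_G2.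
- move=> T e e' Heq.
 have Hqe: qc (pnt e) =1 qc (pnt e') by move=> i; rewrite -!Hq Heq.
 have se := E_sol e; have se' := E_sol e'; have [He ek] := qc_eq se se' Hqe.
 have GA := trans_G2 se se'.
 exists (mk (pnt e) *m mg (pnt e')); split; first split.
 + apply: SL3_stab=> //; rewrite mulmxA ek -mulmxA.
 by have [_ _ -> _] := se'; rewrite mulmx1.
 + apply: E_inj=> [i|]; first by rewrite (actP _ GA) /actc.
 by rewrite mg_act //; apply: mg_trans se.
 + by move=> A [/SL3_G2 GA' <-]; symmetry; apply: (G2_unique se); rewrite mg_act.
have sm := ustr_rm (@uSol F).
have [|ju [Hj _]] := @sol_map_ex F _ _ _ _ (rU F) (rB F) _ iota_sol.
 move=> y; have py := idlP y.
 have hn: ~ idl y (Ug (ub ba) + Ug (ub bb)).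
 have [_ _ _ hh] := @uSol_gen F=> h; apply: (prime1 py); rewrite -hh.
 exact: (primeMl py).
 have ev b: iota (hB F * Bg b) = (Ug (ub ba) + Ug (ub bb)) * Ug (ub b).
 by rewrite (rmM iota_rm) (rmD iota_rm) !(uev_gen sm iota_sol).
 have [x /mapP[k k4 ->] yx] := point_ngen y.
 by exists (hB F * Bg (bk k)); [exact: (map_f (fun i=> hB F * Bg (bk i))) | rewrite ev; apply: primenM].
have sg: forall j : F -> usol _, uSol j Ug by move=> j; exact: uSol_gen.
have sl := lc_sol sg Ustr.
have [|l [Hl Hlc]] := @sol_map_ex F _ _ _ _ (rU F) (rE F) _ sl.
 move=> y; have [x /mapP[k k4 ->] yx] := point_ngen y.
 by exists (Eg (ex (xk k))); [exact: (map_f (fun i=> Eg (ex (xk i)))) | rewrite (uev_gen sm sl) -[lc _ _](@coneE _ (Ug \o ub) (lc Ug \o ex))].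
exists UT, ju, l; split.
- have [g2 gg2] := bgen F.
 refine (@qa_etale F _ _ _ _ _ _ _ _ g2 [:: Ug utau; Ug ulam; Ug uhi] ju iota Hj gg2 _ iota_etale).
 apply: usol_generated=> [a|[i|||]].
 + by left; exists (Bstr a)=> //; rewrite (uev_str sm iota_sol).
 + by left; exists (Bg i)=> //; rewrite (uev_gen sm iota_sol).
 + by right; rewrite /= inE eqxx.
 + by right; rewrite /= !inE eqxx ?orbT.
 + by right; rewrite /= !inE eqxx ?orbT.
- exact: ju_surj.
- apply: pnt_inj=> i; rewrite Hq.
 have e: pnt l =1 (fun i=> qaglob setT (lc Ug i)) by move=> k; rewrite /pnt Hl (uev_gen sm sl).

 rewrite -(@qc_map _ _ (mkrm (glob_rm (r := rU F) setT)) (lc Ug) _)=> [|k]; last by [].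
 by rewrite (lc_q sg) /pnt Hj (uev_gen sm iota_sol).
Qed.

End Torsors.

(** * Subquotient modules and additive functions *)

Section Pairs.
Variable B : cring.
Implicit Types V W : lmodType B.

Definition submod V (N : set V) : Prop :=
 [/\ N 0, forall u v, N u -> N v -> N (u + v) & forall b v, N v -> N (b *: v)].

Definition linmap V W (f : V -> W) : Prop :=
 (forall u v, f (u + v) = f u + f v) /\ (forall b v, f (b *: v) = b *: f v).

Definition msum V (N K : set V) : set V := [set u | exists n k, [/\ N n, K k & u = n + k]].

Section Submodules.
Variables (V : lmodType B).
Implicit Types (N K : set V).

Lemma submodN N v : submod N -> N v -> N (- v).
by move=> [_ _ NZ] Nv; rewrite -scaleN1r; apply: NZ. Qed.
Lemma submodB N u v : submod N -> N u -> N v -> N (u - v).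
by move=> Ns Nu Nv; have [_ ND _] := Ns; apply: ND=> //; apply: submodN. Qed.
Lemma submod_sum N (J : Type) (r : seq J) (P : pred J) (G : J -> V) : submod N ->
 (forall i, P i -> N (G i)) -> N (\sum_(i <- r | P i) G i).
by move=> [N0 ND _] H; elim/big_ind: _. Qed.
Lemma msum_sm N K : submod N -> submod K -> submod (msum N K).
move=> [N0 ND NZ] [K0 KD KZ]; split.
- by exists 0, 0; rewrite addr0.
- move=> _ _ [n [k [Nn Kk ->]]] [n' [k' [Nn' Kk' ->]]]; exists (n + n'), (k + k').
 by split; [exact: ND | exact: KD | rewrite addrACA].
- by move=> b _ [n [k [Nn Kk ->]]]; exists (b *: n), (b *: k); rewrite scalerDr; split; auto.
Qed.
Lemma msum_l N K : submod K -> N `<=` msum N K.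
by move=> [K0 _ _] n Nn; exists n, 0; rewrite addr0. Qed.
Lemma msum_r N K : submod N -> K `<=` msum N K.
by move=> [N0 _ _] k Kk; exists 0, k; rewrite add0r. Qed.
Lemma msum_min N K M : submod M -> N `<=` M -> K `<=` M -> msum N K `<=` M.
by move=> [_ MD _] NM KM _ [n [k [/NM Mn /KM Mk ->]]]; apply: MD. Qed.
Lemma cap_sm N K : submod N -> submod K -> submod (N `&` K).
move=> [N0 ND NZ] [K0 KD KZ]; split=> //.
- by move=> u v [? ?] [? ?]; split; auto.
- by move=> b v [? ?]; split; auto.
Qed.
Lemma submodT : submod [set: V]. by []. Qed.

End Submodules.

Lemma lin0 V W (f : V -> W) : linmap f -> f 0 = 0.
by move=> [_ fZ]; rewrite -[0 in LHS](scale0r 0) fZ scale0r. Qed.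
Lemma linN V W (f : V -> W) v : linmap f -> f (- v) = - f v.
by move=> [_ fZ]; rewrite -!scaleN1r. Qed.
Lemma linB V W (f : V -> W) u v : linmap f -> f (u - v) = f u - f v.
by move=> fl; have [fD _] := fl; rewrite fD linN. Qed.
Lemma lin_id V : linmap (@id V). by []. Qed.
Lemma img_submod V W (f : V -> W) A : linmap f -> submod A -> submod (f @` A).
move=> fl [A0 AD AZ]; have [fD fZ] := fl; split.
- by exists 0=> //; apply: lin0.
- by move=> _ _ [u Au <-] [v Av <-]; exists (u + v); auto.
- by move=> b _ [u Au <-]; exists (b *: u); auto.
Qed.
Lemma pre_submod V W (f : V -> W) C : linmap f -> submod C -> submod (f @^-1` C).
move=> fl [C0 CD CZ]; have [fD fZ] := fl; split; rewrite /=.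
- by rewrite lin0.
- by move=> u v Cu Cv; rewrite fD; apply: CD.
- by move=> b u Cu; rewrite fZ; apply: CZ.
Qed.

(** A pair of submodules N inside N' stands for the module N'/N, so that submodules and quotients of
    N'/N are again pairs in the same ambient module. *)
Definition between V (N N' K : set V) := [/\ submod K, N `<=` K & K `<=` N'].

Definition noe V (N N' : set V) : Prop :=
 forall Q : set V -> Prop, (exists2 K, between N N' K & Q K) ->
 exists K, [/\ between N N' K, Q K & forall K', between N N' K' -> Q K' -> K `<=` K' -> K' `<=` K].

Lemma noe_sub V (N N' K K' : set V) : N `<=` K -> K' `<=` N' -> noe N N' -> noe K K'.
move=> NK KN H Q [M [Ms KM MK] QM].
have [|M' [[M's NM' M'N] [QM' KM' M'K] Mx]] := H (fun X=> [/\ Q X, K `<=` X & X `<=` K']).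
 by exists M; split=> //; [exact: subset_trans KM | exact: subset_trans KN].
exists M'; split=> // X [Xs KX XK] QX; apply: Mx; split=> //.
 exact: subset_trans KX.
exact: subset_trans KN.
Qed.
Lemma noe_refl V (N : set V) : noe N N.
by move=> Q [K [Ks NK KN] QK]; exists K; split=> // K' [_ _ K'N] _ _; apply: subset_trans NK. Qed.
(** First the intersection with N' is made maximal, then the sum with N' among submodules with that
    intersection; by the modular law a submodule with both maximal is maximal. *)
Lemma noe_ext V (N N' N'' : set V) : submod N' -> submod N'' -> N `<=` N' -> N' `<=` N'' ->
 noe N N' -> noe N' N'' -> noe N N''.
move=> N's N''s NN' NN'' H1 H2 Q [M [Ms NM MN] QM].
have [|X [[Xs NX XN] [K0 [bK0 QK0 eK0]] Xmax]] :=
 H1 (fun X=> exists K, [/\ between N N'' K, Q K & X = K `&` N']).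
 exists (M `&` N'); last by exists M.
 by split; [exact: cap_sm | move=> u Nu; split; auto | move=> u []].
have [|Y [[Ys NY YN] [K [bK QK eK eK']] Ymax]] :=
 H2 (fun Y=> exists K, [/\ between N N'' K, Q K, K `&` N' = X & Y = msum K N']).
 exists (msum K0 N'); last by exists K0.
 have [K0s NK0 K0N] := bK0.
 by split; [exact: msum_sm | exact: msum_r | apply: msum_min].
exists K; split=> // K' bK' QK' KK'.
have [Ks NK KN] := bK; have [K's NK' K'N] := bK'.
have eX: K' `&` N' `<=` X.
 apply: Xmax; [split | by exists K' | ].
 - exact: cap_sm.
 - by split; auto.
 - by [].
 - by rewrite -eK=> u [Ku Nu]; split; auto.
have eX': K' `&` N' = X.
 by apply/seteqP; split=> // u; rewrite -eK=> -[Ku Nu]; split; auto.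
have eY: msum K' N' `<=` Y.
 apply: Ymax; [split | by exists K' | ].
 - exact: msum_sm.
 - exact: msum_r.
 - exact: msum_min.
 - by rewrite eK'=> _ [k [n [Kk Nn ->]]]; exists k, n; split; auto.
move=> u K'u; have : Y u by apply: eY; apply: msum_l.
rewrite eK'=> -[k [n [Kk Nn e]]].
have : X n.
 rewrite -eX'; split=> //; have -> : n = u - k by rewrite e addrC addKr.
 by apply: submodB=> //; apply: KK'.
by rewrite -eK e=> -[Kn _]; have [_ KD _] := Ks; apply: KD.
Qed.
Lemma noe_map V W (f : V -> W) (A : set V) (C : set W) : linmap f -> submod A -> submod C ->
 noe C (msum (f @` A) C) -> noe (A `&` f @^-1` C) A.
move=> fl As Cs H Q [M bM QM].
have bet K: between (A `&` f @^-1` C) A K -> between C (msum (f @` A) C) (msum (f @` K) C).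
 move=> [Ks _ KA]; split; [|exact: msum_r (img_submod fl Ks)|].
 exact: msum_sm (img_submod fl Ks) Cs.
 by move=> _ [_ [c [[k Kk <-] Cc ->]]]; exists (f k), c; split=> //; exists k; auto.
have [|Y [_ [K [bK QK eK]] Ymax]] :=
 H (fun Y=> exists K, [/\ between (A `&` f @^-1` C) A K, Q K & Y = msum (f @` K) C]).
 by exists (msum (f @` M) C); [exact: bet | exists M].
exists K; split=> // K' bK' QK' KK'.
have [Ks NK KA] := bK; have [K's NK' K'A] := bK'.
have eY: msum (f @` K') C `<=` Y.
 apply: Ymax; [exact: bet | by exists K' | ].
 by rewrite eK=> _ [_ [c [[k Kk <-] Cc ->]]]; exists (f k), c; split=> //; exists k; auto.
move=> u K'u; have : Y (f u) by apply: eY; apply: msum_l.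
rewrite eK=> -[_ [c [[k Kk <-] Cc e]]].
rewrite -[u](subrK k); have [_ KD _] := Ks; apply: KD=> //; apply: NK; split.
 by apply: submodB=> //; [exact: K'A | exact: KA].
by rewrite /= linB // e addrC addKr.
Qed.
Lemma noe_img V W (f : V -> W) (A : set V) (C : set W) : linmap f -> submod A -> submod C ->
 noe (A `&` f @^-1` C) A -> noe C (msum (f @` A) C).
move=> fl As Cs H Q [M bM QM].
have bet K: between C (msum (f @` A) C) K -> between (A `&` f @^-1` C) A (A `&` f @^-1` K).
 move=> [Ks CK _]; split; first exact: cap_sm As (pre_submod fl Ks).
 by move=> u [Au Cu]; split=> //; apply: CK.
 by [].
have [|Y [_ [K [bK QK eK]] Ymax]] :=
 H (fun Y=> exists K, [/\ between C (msum (f @` A) C) K, Q K & Y = A `&` f @^-1` K]).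
 by exists (A `&` f @^-1` M); [exact: bet | exists M].
exists K; split=> // K' bK' QK' KK'.
have [Ks CK KA] := bK; have [K's CK' K'A] := bK'.
have eY: A `&` f @^-1` K' `<=` Y.
 apply: Ymax; [exact: bet | by exists K' | ].
 by rewrite eK=> u [Au Ku]; split=> //; apply: KK'.
move=> w K'w; have [_ [c [[a Aa <-] Cc e]]] := K'A w K'w.
have : Y a.
 apply: eY; split=> //; rewrite /=; have -> : f a = w - c by rewrite e addrK.
 by apply: submodB=> //; apply: CK'.
by rewrite eK e=> -[_ Ka]; have [_ KD _] := Ks; apply: KD=> //; apply: CK.
Qed.

(** N'/N is noetherian and each element of [L] acts nilpotently on it, so that it is supported where
    [L] vanishes. A larger [L] leaves fewer modules, on which the length at a point can be
    finite. *)
Definition mdom (L : set B) V (N N' : set V) : Prop :=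
 [/\ submod N, submod N', N `<=` N', noe N N'
 & forall l, L l -> exists k, forall v, N' v -> N (l ^+ k *: v)].

Lemma dom_sub L V (N N' K K' : set V) : submod K -> submod K' -> N `<=` K -> K `<=` K' -> K' `<=` N' ->
 mdom L N N' -> mdom L K K'.
move=> Ks K's NK KK KN [_ _ _ nN lN]; split=> //; first exact: noe_sub nN.
by move=> l /lN[k Hk]; exists k=> v /KN/Hk/NK.
Qed.
Lemma dom_mono (L L' : set B) V (N N' : set V) : L' `<=` L -> mdom L N N' -> mdom L' N N'.
by move=> LL [? ? ? ? H]; split=> // l /LL/H. Qed.

Section Additive.
Variable G : zmodType.
Definition mfun := forall V : lmodType B, set V -> set V -> G.

(** The second clause is invariance under the isomorphism from A / (A cap f^-1 C) to (f A + C) / C.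
    With f the identity it contains the second isomorphism theorem. *)
Definition additiv (L : set B) (lam : mfun) : Prop :=
 (forall V (N N' N'' : set V), submod N' -> N `<=` N' -> N' `<=` N'' -> mdom L N N'' ->
 lam V N N'' = lam V N N' + lam V N' N'') /\
 (forall V W (f : V -> W) (A : set V) (C : set W), linmap f ->
 mdom L (A `&` f @^-1` C) A -> mdom L C (msum (f @` A) C) ->
 lam V (A `&` f @^-1` C) A = lam W C (msum (f @` A) C)).

Variables (L : set B) (lam : mfun) (lamP : additiv L lam).

Lemma lam_refl V (N N' : set V) : mdom L N N' -> N' `<=` N -> @lam V N N' = 0.
move=> D NN; have e: N' = N by apply/seteqP; case: D.
rewrite e in D *; have [Ns _ _ _ _] := D.
have := proj1 lamP V N N N Ns (@subset_refl _ N) (@subset_refl _ N) D.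
by move/eqP; rewrite -subr_eq subrr=> /eqP.
Qed.
Lemma lam_cap V (A C : set V) : mdom L (A `&` C) A -> mdom L C (msum A C) ->
 @lam V (A `&` C) A = @lam V C (msum A C).
by have := proj2 lamP V V id A C (@lin_id V); rewrite image_id.
Qed.

End Additive.

(* Prime filtrations: a class of pairs closed under extensions that contains
 the cyclic modules B / q contains all noetherian pairs. *)
Section Filtration.
Hypothesis noeB : noe (set0 : set B^o) setT.

Lemma ann_submod V (N : set V) v : submod N -> submod ([set b | N (b *: v)] : set B^o).
move=> [N0 ND NZ]; split=> /=; first by rewrite scale0r.
- by move=> a b Na Nb; rewrite scalerDl; apply: ND.
- by move=> a b Nb; rewrite -scalerA; apply: NZ.
Qed.
(** An annihilator modulo N that is maximal among those of the multiples of [v] outside of N is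
    prime. *)
Lemma ann_prime V (N : set V) v : submod N -> ~ N v ->
 exists2 b, ~ N (b *: v) & prime_ideal [set c | N (c *: (b *: v))].
move=> Ns Nv; have [N0 ND NZ] := Ns.
have [|K [[Ks _ _] [b [Nb eK]] Kmax]] := noeB (Q := fun K=> exists b, ~ N (b *: v) /\ K = [set c | N (c *: (b *: v))]).
 exists [set c | N (c *: (1 *: v))]; last by exists 1; rewrite scale1r.
 by split=> //; apply: ann_submod.
exists b=> //; split; rewrite /=.
- by rewrite scale0r.
- by move=> x y Nx Ny; rewrite scalerDl; apply: ND.
- by move=> x y Ny; rewrite -scalerA; apply: NZ.
- by rewrite scale1r.
move=> x y Nxy; have [Ny|Ny] := pselect (N (y *: (b *: v))); [by right | left].
have : [set c | N (c *: ((y * b) *: v))] `<=` K.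
 apply: Kmax.
 - by split=> //; apply: ann_submod.
 - by exists (y * b); rewrite -scalerA.
 - by rewrite eK=> c /= Nc; rewrite -scalerA [c *: _]scalerA [c * y]mulrC -scalerA; apply: NZ.
by rewrite eK=> /(_ x); apply; rewrite /= -scalerA scalerA.
Qed.

Definition cyc V (N : set V) (v : V) : set V := msum [set b *: v | b in setT] N.

Lemma cyc_submod V (N : set V) v : submod N -> submod (cyc N v).
apply: msum_sm; split; first by exists 0; rewrite ?scale0r.
 by move=> _ _ [a _ <-] [b _ <-]; exists (a + b); rewrite ?scalerDl.
by move=> a _ [b _ <-]; rewrite ?scalerA.
Qed.
Lemma filtration V (N N' : set V) (Q : set V -> Prop) : mdom set0 N N' -> Q N ->
 (forall K v, between N N' K -> Q K -> N' v -> prime_ideal [set c | K (c *: v)] -> Q (cyc K v)) -> Q N'.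
move=> [Ns N's NN nN _] QN H.
have [|K [bK QK Kmax]] := nN Q; first by exists N=> //; split.
have [Ks NK KN] := bK; suff -> : N' = K by [].
apply/seteqP; split=> //; apply: contrapT=> /existsNP[v /not_implyP[N'v Kv]].
have [b Kb pb] := ann_prime Ks Kv.
have N'b: N' (b *: v) by have [_ _ NZ] := N's; apply: NZ.
have Qc := H K _ bK QK N'b pb; apply: Kb.
have cs: submod (cyc K (b *: v)) by apply: cyc_submod.
have csub: K `<=` cyc K (b *: v).
 by move=> k Kk; exists 0, k; rewrite add0r; split=> //; exists 0; rewrite ?scale0r.
apply: (Kmax (cyc K (b *: v)))=> //.
 split=> //; first exact: subset_trans csub.
 move=> _ [_ [k [[c _ <-] Kk ->]]]; have [_ ND NZ] := N's; apply: ND; last exact: KN.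
 exact: NZ.
exists (b *: v), 0; have [K0 _ _] := Ks; rewrite addr0; split=> //.
by exists 1; rewrite ?scale1r.
Qed.
Lemma lin_orbit V (v : V) : linmap (fun b : B^o=> b *: v).
by split=> [a b|a b]; rewrite ?scalerDl ?scalerA. Qed.
Lemma cyc_iso G (L : set B) (lam : mfun G) V (K : set V) v : additiv L lam -> submod K -> mdom L K (cyc K v) ->
 @lam V K (cyc K v) = @lam B^o [set c | K (c *: v)] setT.
move=> lamP Ks D; have e: [set c : B^o | K (c *: v)] = setT `&` (fun b : B^o=> b *: v) @^-1` K.
 by rewrite setTI.
rewrite e (proj2 lamP _ _ _ _ K (lin_orbit v)) //.
have [_ _ _ nD lD] := D; split; first exact: cap_sm _ (pre_submod (lin_orbit v) Ks).
- by [].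
- by [].
- exact: noe_sub noeB.
- move=> l Ll; have [k Hk] := lD l Ll; exists k=> b _; split=> //; rewrite /=.
 have -> : (l ^+ k *: b) *: v = l ^+ k *: (b *: v) by rewrite scalerA.
 apply: Hk.
 by exists (b *: v), 0; have [K0 _ _] := Ks; rewrite addr0.
Qed.

End Filtration.

End Pairs.

(** * Two-periodic homology and Herbrand quotients *)

Section Homology.
Variable B : cring.
Implicit Types (V W : lmodType B).

Definition mxact V n m (f : 'M[B]_(n, m)) (u : V ^ m) : V ^ n :=
 [ffun i=> \sum_j f i j *: u j].
Definition pw V n (N : set V) : set (V ^ n) := [set u | forall i, N (u i)].
Definition fmap V W n (f : V -> W) (u : V ^ n) : W ^ n := [ffun i=> f (u i)].

Lemma mxactL V n m (f : 'M[B]_(n, m)) : linmap (@mxact V n m f).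
split=> [u v|b v]; apply/ffunP=> i; rewrite !ffunE.
 by rewrite -big_split; apply: eq_bigr=> j _; rewrite ffunE scalerDr.
by rewrite scaler_sumr; apply: eq_bigr=> j _; rewrite ffunE !scalerA mulrC.
Qed.
Lemma mxactM V n m k (f : 'M[B]_(n, m)) (g : 'M[B]_(m, k)) (u : V ^ k) :
 mxact (f *m g) u = mxact f (mxact g u).
apply/ffunP=> i; rewrite !ffunE.
under eq_bigr do rewrite mxE scaler_suml.
rewrite exchange_big; apply: eq_bigr=> j _; rewrite ffunE scaler_sumr.
by apply: eq_bigr=> l _; rewrite scalerA.
Qed.
Lemma mxactD V n m (f g : 'M[B]_(n, m)) (u : V ^ m) : mxact (f + g) u = mxact f u + mxact g u.
by apply/ffunP=> i; rewrite !ffunE -big_split; apply: eq_bigr=> j _; rewrite mxE scalerDl.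
Qed.
Lemma mxactN V n m (f : 'M[B]_(n, m)) (u : V ^ m) : mxact (- f) u = - mxact f u.
by apply/ffunP=> i; rewrite !ffunE -sumrN; apply: eq_bigr=> j _; rewrite mxE scaleNr.
Qed.
Lemma mxact0 V n m (u : V ^ m) : mxact (0 : 'M[B]_(n, m)) u = 0.
by apply/ffunP=> i; rewrite !ffunE big1 // => j _; rewrite mxE scale0r. Qed.
Lemma mxactS V n b (u : V ^ n) : mxact (b%:M) u = b *: u.
apply/ffunP=> i; rewrite !ffunE (bigD1 i) //= mxE eqxx big1 ?addr0 // => j ji.
by rewrite mxE eq_sym (negbTE ji) scale0r.
Qed.
Lemma fmap_lin V W n (f : V -> W) : linmap f -> linmap (@fmap V W n f).
by move=> [fD fZ]; split=> [u v|b v]; apply/ffunP=> i; rewrite !ffunE. Qed.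
Lemma fmap_act V W n m (f : V -> W) (g : 'M[B]_(n, m)) u : linmap f ->
 fmap f (mxact g u) = mxact g (fmap f u).
move=> fl; have [fD fZ] := fl; apply/ffunP=> i; rewrite !ffunE.
elim/big_rec2: _=> [|j x y _ <-]; first exact: lin0.
by rewrite fD fZ ffunE.
Qed.
Lemma pw_sub V n (N : set V) : submod N -> submod (@pw V n N).
move=> [N0 ND NZ]; split=> [i|u v Nu Nv i|b v Nv i]; rewrite ffunE //; first exact: ND.
exact: NZ.
Qed.
Lemma pw_act V n m (f : 'M[B]_(n, m)) (N : set V) u : submod N -> pw N u -> pw N (mxact f u).
move=> Ns Nu i; rewrite ffunE; apply: submod_sum=> // j _.
by have [_ _ NZ] := Ns; apply: NZ.
Qed.
Lemma noe_pw V n (N N' : set V) : submod N -> submod N' -> N `<=` N' -> noe N N' -> noe (@pw V n N) (@pw V n N').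
move=> Ns N's NN nN.
pose F k : set (V ^ n) := [set u | forall i : 'I_n, if (i < k)%N then N' (u i) else N (u i)].
have Fs k: submod (F k).
 have [N0 ND NZ] := Ns; have [N'0 N'D N'Z] := N's.
 split=> [i|u v Fu Fv i|b v Fv i]; rewrite !ffunE; first by case: ifP.
 by have := Fu i; have := Fv i; case: ifP=> _ ? ?; auto.
 by have := Fv i; case: ifP=> _ ?; auto.
have H k: noe (F 0) (F k).
 elim: k=> [|k IH]; first exact: noe_refl.
 have FF: F k `<=` F k.+1.
 move=> u Fu i; have := Fu i; case: ifP=> [ik|_]; first by rewrite (leq_trans ik).
 by case: ifP=> // _ /NN.
 apply: (noe_ext (Fs k) (Fs k.+1) _ FF IH).
 by move=> u Fu i; have : if (i < 0)%N then N' (u i) else N _ := Fu i; case: ifP=> // _ /NN.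
 have [kn|nk] := ltnP k n; last first.
 apply: (noe_sub _ _ (@noe_refl _ _ (F k)))=> // u Fu i; have := Fu i.
 by rewrite (leq_trans _ nk) (leq_trans (ltn_ord i)) // leqW.
 pose p (u : V ^ n) := u (Ordinal kn).
 have pl: linmap p by split=> [u v|b v]; rewrite /p ffunE.
 have := noe_map pl (Fs k.+1) Ns; have eN: F k.+1 `&` p @^-1` N `<=` F k.
 move=> u [Fu Nu] i; have := Fu i; rewrite ltnS leq_eqVlt.
 case: (ltnP i k)=> [_|ki]; first by rewrite orbT.
 case: eqP=> //= ik; have -> : i = Ordinal kn by apply: val_inj.
 by [].
 move=> H; apply: (noe_sub eN (@subset_refl _ _)); apply: H.
 apply: noe_sub nN=> // _ [_ [v [[u Fu <-] Nv ->]]]; have [_ N'D _] := N's.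
 by apply: N'D; [have := Fu (Ordinal kn); rewrite ltnSn| exact: NN].
apply: (noe_sub _ _ (H n))=> [u Fu i|u Nu i]; last by rewrite ltn_ord.
by have : if (i < 0)%N then N' (u i) else N _ := Fu i.
Qed.

Section Cycles.
Variables (n : nat) (f g : 'M[B]_n).
(** The pair [Bd], [Zd] represents ker f / im g on (N'/N)^n. *)
Definition Zd V (N N' : set V) : set (V ^ n) := [set u | pw N' u /\ pw N (mxact f u)].
Definition Bd V (N N' : set V) : set (V ^ n) :=
 [set u | exists w v, [/\ pw N' w, pw N v & u = mxact g w + v]].

Lemma Zd_submod V (N N' : set V) : submod N -> submod N' -> submod (Zd N N').
move=> Ns N's; have := cap_sm (pw_sub n N's) (pre_submod (mxactL V f) (pw_sub n Ns)).
by [].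
Qed.
Lemma Bd_submod V (N N' : set V) : submod N -> submod N' -> submod (Bd N N').
move=> Ns N's; have -> : Bd N N' = msum (mxact g @` pw N') (pw N).
 apply/seteqP; split=> [u [w [v [Nw Nv ->]]]|u [_ [v [[w Nw <-] Nv ->]]]].
 by exists (mxact g w), v.
 by exists w, v.
by apply: msum_sm; [apply: img_submod (mxactL V g) _|]; apply: pw_sub.
Qed.

Hypothesis fg : f *m g = 0.

Lemma Bd_Zd V (N N' : set V) : submod N -> submod N' -> N `<=` N' -> Bd N N' `<=` Zd N N'.
move=> Ns N's NN u [w [v [Nw Nv ->]]]; have [_ N'D _] := pw_sub n N's.
have [fD _] := mxactL V f; split.
 by apply: N'D; [exact: pw_act | move=> i; apply: NN].
by rewrite fD -mxactM fg mxact0 add0r; apply: pw_act.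
Qed.

End Cycles.

(** A null-homotopy of the multiplication by l: if f u = 0 then l u = g (s u), so l kills ker f / im
    g. Homology thereby has smaller support than the module. *)
Definition nullh n (f g : 'M[B]_n) (l : B) := exists r s : 'M[B]_n, l%:M = r *m f + g *m s.

Lemma dom_H n (f g : 'M[B]_n) (L : set B) V (N N' : set V) : f *m g = 0 -> mdom L N N' ->
 mdom (L `|` nullh f g) (Bd g N N') (Zd f N N').
move=> fg [Ns N's NN nN lN]; split; [exact: Bd_submod | exact: Zd_submod | exact: Bd_Zd | | ].
 apply: (noe_sub _ _ (noe_pw Ns N's NN nN))=> [u Nu|u []//].
 by exists 0, u; rewrite (lin0 (mxactL V g)) add0r; split=> // i; rewrite ffunE; case: N's.
move=> l [/lN[k Hk]|[r [s e]]].
 exists k=> u [N'u _]; exists 0, (l ^+ k *: u); rewrite (lin0 (mxactL V g)) add0r; split=> //.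
 by move=> i; rewrite ffunE; case: N's.
 by move=> i; rewrite ffunE; apply: Hk.
exists 1=> u [N'u Nfu]; exists (mxact s u), (mxact r (mxact f u)); split; try exact: pw_act.
by rewrite -mxactS e mxactD !mxactM addrC.
Qed.

Section Half.
Variables (G : zmodType) (n : nat) (f g : 'M[B]_n) (L : set B).
Hypotheses (fg : f *m g = 0) (gf : g *m f = 0).
Let L' := L `|` (nullh f g `&` nullh g f).
Variables (lam : mfun B G) (lamP : additiv L' lam).

Definition hml (lam' : mfun B G) (n' : nat) (f' g' : 'M[B]_n') : mfun B G :=
 fun V N N'=> @lam' _ (Bd g' N N') (Zd f' N N').

Let dom1 V (N N' : set V) : mdom L N N' -> mdom L' (Bd g N N') (Zd f N N').
by move=> D; apply: dom_mono (dom_H fg D)=> l [|[]]; [left|right]. Qed.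
Let dom2 V (N N' : set V) : mdom L N N' -> mdom L' (Bd f N N') (Zd g N N').
by move=> D; apply: dom_mono (dom_H gf D)=> l [|[]]; [left|right]. Qed.

Definition Ed (f : 'M[B]_n) V (N N' N'' : set V) : set (V ^ n) := pw N' `&` Bd f N N''.

(** The defect from additivity is due to the connecting maps of the long exact sequence: [Bd g N N']
    and [Ed g N N' N''] represent the image of the one into ker f / im g of N'/N, and the last term
    belongs to the other. The sum is symmetric in f and g, so it cancels in a Herbrand quotient; for
    f = g it is twice one term and vanishes mod 2. *)
Lemma half_add V (N N' N'' : set V) : submod N' -> N `<=` N' -> N' `<=` N'' -> mdom L N N'' ->
 hml lam f g N N'' = hml lam f g N N' + hml lam f g N' N''
 - (@lam _ (Bd g N N') (Ed g N N' N'') + @lam _ (Bd f N N') (Ed f N N' N'')).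
move=> N's NN' NN'' D; have [Ns N''s NN nN lN] := D.
have D1: mdom L N N' by apply: dom_sub D.
have D2: mdom L N' N'' by apply: dom_sub D.
have fl := mxactL V f; have gl := mxactL V g; have [fD _] := fl; have [gD _] := gl.
have p0 K: submod K -> pw K 0 by move=> Ks i; rewrite ffunE; case: Ks.
have pD K (u v : V ^ n) : submod K -> pw K u -> pw K v -> pw K (u + v) by move=> /(pw_sub n)[_ + _]; apply.
have pB K (u v : V ^ n) : submod K -> pw K u -> pw K v -> pw K (u - v) by move=> /(pw_sub n) Ks; apply: submodB.
have pNN (K K' : set V) u : K `<=` K' -> pw K u -> pw K' u by move=> KK Ku i; apply: KK.
have Zs := Zd_submod f; have Bs := Bd_submod g;
have Es h: submod (Ed h N N' N'') by apply: cap_sm (pw_sub n N's) (Bd_submod h Ns N''s).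
have bE h: Bd h N N' `<=` Ed h N N' N''.
 move=> u [w [v [Nw Nv ->]]]; split; last by exists w, v; split=> //; apply: pNN Nw.
 by apply: (pD)=> //; [exact: pw_act | apply: pNN Nv].
have EZ: Ed g N N' N'' `<=` Zd f N N'.
 move=> u [N'u [w [v [Nw Nv e]]]]; split=> //.
 by rewrite e fD -mxactM fg mxact0 add0r; apply: pw_act.
have EZ': Ed f N N' N'' `<=` Zd g N N'.
 move=> u [N'u [w [v [Nw Nv e]]]]; split=> //.
 by rewrite e gD -mxactM gf mxact0 add0r; apply: pw_act.
(* M and Q represent the images in homology of the maps from N'/N to N''/N and from N''/N to
   N''/N'. *)
pose M := msum (Zd f N N') (Bd g N N'').
pose Q := msum (Zd f N N'') (Bd g N' N'').
have bz: Bd g N N'' `<=` Zd f N N'' by apply: Bd_Zd.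
have zz: Zd f N N' `<=` Zd f N N'' by move=> u [N'u Nu]; split=> //; apply: pNN N'u.
have MZ: M `<=` Zd f N N'' by apply: msum_min (Zs _ _ _ Ns N''s) zz bz.
have QZ: Q `<=` Zd f N' N''.
 apply: msum_min; [exact: Zs | by move=> u [N'u Nu]; split=> //; apply: pNN Nu | exact: Bd_Zd].
have Ms: submod M by apply: msum_sm; [exact: Zs | exact: Bs].
have Qs: submod Q by apply: msum_sm; [exact: Zs | exact: Bs].
have BM: Bd g N N'' `<=` M by apply: msum_r; apply: Zs.
have BQ: Bd g N' N'' `<=` Q by apply: msum_r; apply: Zs.
have [A1 A2] := lamP.
have eM: Zd f N N' `&` Bd g N N'' = Ed g N N' N''.
 by apply/seteqP; split=> [u [[? ?] ?]|u Eu]; [split | split; [exact: EZ | case: Eu]].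
have eQ: Zd f N N'' `&` Bd g N' N'' = M.
 apply/seteqP; split=> [u [[N''u Nu] [w [v [Nw Nv e]]]]|u Mu].
 exists v, (mxact g w); rewrite addrC; split=> //.
 move: Nu; rewrite e fD -mxactM fg mxact0 add0r.
 by [].
 by exists w, 0; rewrite addr0; split=> //; apply: p0.
 split; first exact: MZ.
 case: Mu=> z [b [[zN' _] [w [v [Nw Nv ->]]] ->]].
 exists w, (z + v); rewrite addrCA; split=> //.
 by apply: (pD)=> //; apply: pNN Nv.
have e1: hml lam f g N N' = lam (Bd g N N') (Ed g N N' N'') + lam (Ed g N N' N'') (Zd f N N').
 exact: A1 (dom1 D1).
have e2: hml lam f g N N'' = lam (Bd g N N'') M + lam M (Zd f N N'') by apply: A1 (dom1 D).
have e3: hml lam f g N' N'' = lam (Bd g N' N'') Q + lam Q (Zd f N' N'') by apply: A1 (dom1 D2).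
have e4: lam (Ed g N N' N'') (Zd f N N') = lam (Bd g N N'') M.
 rewrite -eM; apply: (lam_cap lamP).
 by rewrite eM; apply: dom_sub (dom1 D1)=> //; apply: Zs.
 by apply: dom_sub (dom1 D)=> //; apply: Bs.
have e5: lam M (Zd f N N'') = lam (Bd g N' N'') Q.
 rewrite -eQ; apply: (lam_cap lamP).
 by rewrite eQ; apply: dom_sub (dom1 D)=> //; apply: Zs.
 by apply: dom_sub (dom1 D2)=> //; apply: Bs.
have eP: Zd f N' N'' `&` mxact f @^-1` (Bd f N N') = Q.
 apply/seteqP; split=> [u [[N''u Nu] [w [v [Nw Nv e]]]]|u Qu].
 exists (u - w), w; rewrite subrK; split=> //.
 split; first by apply: pB=> //; apply: pNN Nw.
 by rewrite (linB _ _ fl) e addrC addKr.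
 by exists 0, w; rewrite (lin0 gl) add0r; split=> //; apply: p0.
 split; first exact: QZ.
 case: Qu=> z [b [[zN Nfz] [w [v [Nw Nv ->]]] ->]].
 exists v, (mxact f z).
 by rewrite !fD -[mxact f (mxact g w)]mxactM fg mxact0 add0r addrC.
have eE: msum (mxact f @` Zd f N' N'') (Bd f N N') = Ed f N N' N''.
 apply/seteqP; split=> [u [_ [b [[z [Nz Nfz] <-] [w [v [Nw Nv ->]]] ->]]]|u [N'u [w [v [Nw Nv e]]]]].
 split; first by apply: (pD)=> //; apply: (pD)=> //; [exact: pw_act | apply: pNN Nv].
 exists (z + w), v; rewrite fD addrA; split=> //.
 by apply: (pD)=> //; apply: pNN Nw.
 exists (mxact f w), v; split=> //.
 exists w; split=> //; have -> : mxact f w = u - v by rewrite e addrK.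
 by apply: pB=> //; apply: pNN Nv.
 by exists 0, v; rewrite (lin0 fl) add0r; split=> //; apply: p0.
have e6: lam Q (Zd f N' N'') = lam (Bd f N N') (Ed f N N' N'').
 rewrite -{1}eP -eE; apply: A2=> //.
 by rewrite eP; apply: dom_sub (dom1 D2)=> //; apply: Zs.
 by rewrite eE; apply: dom_sub (dom2 D1)=> //; apply: (Bd_submod f).
rewrite e2 -e4 e5 e1 e3 e6.
set a := lam (Bd g N N') _.
by rewrite [a + _]addrC [in RHS]addrACA addrK.
Qed.
Lemma half_map V W (h : V -> W) (A : set V) (C : set W) : linmap h ->
 mdom L (A `&` h @^-1` C) A -> mdom L C (msum (h @` A) C) ->
 hml lam f g (A `&` h @^-1` C) A = hml lam f g C (msum (h @` A) C).
move=> hl D D'; have [Ks As KA _ _] := D; have [Cs ACs CA _ _] := D'.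
set K := A `&` h @^-1` C in D Ks KA *; set A' := msum _ C in D' ACs CA *.
have gl := mxactL W g; have [fD _] := (mxactL W f); have [gD _] := gl.
have pl := fmap_lin n hl; have [hD _] := pl.
have pA' (u : W ^ n) : pw A' u -> exists a c, [/\ pw A a, pw C c & u = fmap h a + c].
 move=> Au; have /choice[p Hp] : forall i, exists p : V * W, [/\ A p.1, C p.2 & u i = h p.1 + p.2].
 by move=> i; have [_ [c [[a Aa <-] Cc e]]] := Au i; exists (a, c).
 exists [ffun i=> (p i).1], [ffun i=> (p i).2]; split=> [i|i|].
 - by rewrite ffunE; case: (Hp i).
 - by rewrite ffunE; case: (Hp i).
 - by apply/ffunP=> i; rewrite !ffunE; case: (Hp i).
have pC (u v : W ^ n) : pw C u -> pw C v -> pw C (u + v) by have [_ + _] := pw_sub n Cs; apply.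
have phA a: pw A a -> pw A' (fmap h a).
 by move=> Aa i; apply: msum_l=> //; rewrite ffunE; exists (a i).
have hK a: pw A a -> pw C (fmap h a) -> pw K a by move=> Aa Ca i; have := Ca i; rewrite ffunE.
have hC a: pw K a -> pw C (fmap h a) by move=> Ka i; rewrite ffunE; case: (Ka i).
have e1: Zd f K A `&` fmap h @^-1` Bd g C A' = Bd g K A.
 apply/seteqP; split=> [u [[Au Ku] [w [v [Aw Cv e]]]]|u Bu]; last first.
 split; first exact: (Bd_Zd fg Ks As KA).
 case: Bu=> w [v [Aw Kv ->]]; exists (fmap h w), (fmap h v).
 by rewrite hD (fmap_act _ _ hl); split; auto.
 have [a [c [Aa Cc ew]]] := pA' w Aw.
 exists a, (u - mxact g a); split=> //; last by rewrite addrC subrK.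
 apply: hK; first exact: (submodB (pw_sub n As) Au (pw_act g As Aa)).
 rewrite (linB _ _ pl) (fmap_act _ _ hl) e ew gD addrAC [mxact g _ + _ - _]addrC addKr.
 by apply: pC=> //; apply: pw_act.
have e2: msum (fmap h @` Zd f K A) (Bd g C A') = Zd f C A'.
 apply/seteqP; split=> [u [_ [b [[z [Az Kz] <-] Bb ->]]]|u [Au Cu]].
 have [_ ZD _] := Zd_submod f Cs ACs; apply: ZD; last exact: (Bd_Zd fg Cs ACs CA).
 by split; [exact: phA | rewrite -(fmap_act _ _ hl); apply: hC].
 have [a [c [Aa Cc ew]]] := pA' u Au; exists (fmap h a), c; split=> //.
 exists a; split=> //; apply: hK; first exact: pw_act.
 have -> : fmap h (mxact f a) = mxact f u - mxact f c by rewrite (fmap_act _ _ hl) ew fD addrK.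
 exact: (submodB (pw_sub n Cs) Cu (pw_act f Cs Cc)).
 by exists 0, c; rewrite (lin0 gl) add0r; split=> // i; rewrite ffunE; case: ACs.
rewrite /hml -e1 -e2; apply: (proj2 lamP)=> //; rewrite ?e1 ?e2; exact: dom1.
Qed.

End Half.

Definition her (G : zmodType) (lam : mfun B G) n (f g : 'M[B]_n) : mfun B G :=
 fun V N N'=> hml lam f g N N' - hml lam g f N N'.

Lemma her_additive (G : zmodType) (lam : mfun B G) n (f g : 'M[B]_n) L : f *m g = 0 -> g *m f = 0 ->
 additiv (L `|` (nullh f g `&` nullh g f)) lam -> additiv L (her lam f g).
move=> fg gf lamP.
have lamP': additiv (L `|` (nullh g f `&` nullh f g)) lam by rewrite [nullh g f `&` _]setIC.
split=> [V N N' N'' N's NN' NN'' D|V W h A C hl D D'].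
 rewrite /her (half_add fg gf lamP N's NN' NN'' D) (half_add gf fg lamP' N's NN' NN'' D).
 set a := (X in _ - X - _); set b := (X in _ - (_ - X)); have -> : a = b by apply: addrC.
 by rewrite opprB addrA addrNK opprD addrACA.
by rewrite /her (half_map fg lamP) // (half_map gf lamP').
Qed.
Lemma par_additive (G : zmodType) (lam : mfun B G) n (f : 'M[B]_n) L : f *m f = 0 -> (forall x : G, x + x = 0) ->
 additiv (L `|` nullh f f) lam -> additiv L (hml lam f f).
move=> ff G2; rewrite -{1}[nullh f f]setIid=> lamP.
split=> [V N N' N'' N's NN' NN'' D|V W h A C hl D D'].
 by rewrite (half_add ff ff lamP N's NN' NN'' D) G2 subr0.
by rewrite (half_map ff lamP).
Qed.

(** The value is lam (ker l) - lam (coker l), up to sign a Koszul Euler characteristic. It is the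
    additive substitute for restriction to l = 0, and turns a function on modules with nilpotent l
    into one without this condition. *)
Definition kos (G : zmodType) (lam : mfun B G) (l : B) : mfun B G := her lam (l%:M : 'M_1) 0.

Lemma kos_additive (G : zmodType) (lam : mfun B G) L l : additiv (l |` L) lam -> additiv L (kos lam l).
move=> lamP; apply: her_additive; rewrite ?mulmx0 ?mul0mx //.
have sub (L1 L2 : set B) : L1 `<=` L2 -> additiv L1 lam -> additiv L2 lam.
 move=> LL [A1 A2]; split=> [V N N' N'' N's NN' NN'' D|V W h A C hl D D'].
 by apply: A1=> //; apply: dom_mono D.
 by apply: A2=> //; [apply: dom_mono D | apply: dom_mono D'].
apply: sub lamP=> x [->|Lx]; [right | by left].
split; first by exists 1, 0; rewrite mul1mx mulmx0 addr0.
by exists 0, 1; rewrite mul0mx mulmx1 add0r.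
Qed.

End Homology.

(** * Length at a prime *)

Section Length.
Variables (B : cring) (y : set B) (py : prime_ideal y).
Implicit Types (V W : lmodType B).

(** The inclusion remains strict after localization at [y]. So [len_ge] and [len] concern the length
    of the localized module, without forming it. *)
Definition sstrict V (K K' : set V) : Prop :=
 K `<=` K' /\ exists2 v, K' v & forall u, ~ y u -> ~ K (u *: v).

Definition len_ge V (n : nat) (N N' : set V) : Prop := exists c : nat -> set V,
 (forall k, (k <= n)%N -> between N N' (c k)) /\ forall k, (k < n)%N -> sstrict (c k) (c k.+1).

(** The value is 0 by default if the length is infinite. *)
Definition len V (N N' : set V) : nat := xget 0%N [set n | len_ge n N N' /\ ~ len_ge n.+1 N N'].

Definition len_fin V (N N' : set V) : Prop := exists n, ~ len_ge n N N'.

Lemma len_ge_le V m n (N N' : set V) : (m <= n)%N -> len_ge n N N' -> len_ge m N N'.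
move=> mn [c [H1 H2]]; exists c; split=> k km; [apply: H1 | apply: H2]; exact: leq_trans mn.
Qed.
Lemma len_ge0 V (N N' : set V) : submod N -> N `<=` N' -> len_ge 0 N N'.
by exists (fun=> N); split=> // k _; split. Qed.
Lemma len_eq V n (N N' : set V) : len_ge n N N' -> ~ len_ge n.+1 N N' -> len N N' = n.
move=> H1 H2; apply: xget_unique=> // m [M1 M2]; apply/eqP; rewrite eqn_leq; apply/andP; split.
 by rewrite leqNgt; apply/negP=> mn; apply: H2; apply: len_ge_le M1.
by rewrite leqNgt; apply/negP=> mn; apply: M2; apply: len_ge_le H1.
Qed.
Lemma lenP V (N N' : set V) : submod N -> N `<=` N' -> len_fin N N' ->
 len_ge (len N N') N N' /\ ~ len_ge (len N N').+1 N N'.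
move=> Ns NN [n Hn]; suff [m [M1 M2]] : exists m, len_ge m N N' /\ ~ len_ge m.+1 N N' by rewrite (len_eq M1 M2).
elim: n Hn=> [|n IH] Hn; first by case: Hn; apply: len_ge0.
by have [h|h] := pselect (len_ge n N N'); [exists n | apply: IH].
Qed.
Lemma len_max V n (N N' : set V) : submod N -> N `<=` N' -> len_fin N N' -> len_ge n N N' -> (n <= len N N')%N.
move=> Ns NN fN H; have [_ M] := lenP Ns NN fN; rewrite leqNgt; apply/negP=> h.
by apply: M; apply: len_ge_le H.
Qed.
Lemma len_ge_sub V n (N N' K K' : set V) : N `<=` K -> K' `<=` N' -> len_ge n K K' -> len_ge n N N'.
move=> NK KN [c [H1 H2]]; exists c; split=> // k /H1[cs Kc cK]; split=> //.
 exact: subset_trans Kc.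
exact: subset_trans KN.
Qed.
Lemma len_fin_sub V (N N' K K' : set V) : N `<=` K -> K' `<=` N' -> len_fin N N' -> len_fin K K'.
by move=> NK KN [n H]; exists n=> /(len_ge_sub NK KN). Qed.
Lemma len_ge_step V n (N K K' : set V) : submod K' -> N `<=` K' -> len_ge n N K -> sstrict K K' ->
 len_ge n.+1 N K'.
move=> K's NK [c [H1 H2]] [KK [v K'v Hv]].
exists (fun k=> if (k <= n)%N then c k else K'); split=> k.
 case: (leqP k n)=> [kn _|nk _]; last by split.
 by have [cs Nc cK] := H1 k kn; split=> //; apply: subset_trans KK.
rewrite ltnS=> kn; rewrite kn; case: ltnP=> [|nk]; first exact: H2.
have -> : k = n by lia.
have [cs Nc cK] := H1 n (leqnn n); split; first exact: subset_trans KK.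
by exists v=> // u yu /cK; apply: Hv.
Qed.
Lemma len_cat V n m (N N' N'' : set V) : N `<=` N' -> len_ge n N N' -> len_ge m N' N'' -> len_ge (n + m) N N''.
move=> NN H [d [H1 H2]].
suff P k: (k <= m)%N -> len_ge (n + k) N (d k).
 by apply: len_ge_sub (P m _)=> //; have [] := H1 m _.
elim: k=> [_|k IH km].
 by rewrite addn0; have [_ Nd _] := H1 0 (leq0n _); apply: len_ge_sub H.
have [ds Nd dN] := H1 _ km; rewrite addnS; apply: (len_ge_step ds _ (IH (ltnW km)) (H2 k km)).
exact: subset_trans Nd.
Qed.
Lemma len_count V n (c : nat -> set V) (N : set V) : (forall k, (k <= n)%N -> submod (c k) /\ N `<=` c k) ->
 (forall k, (k < n)%N -> c k `<=` c k.+1) -> submod N ->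
 len_ge (count (fun k=> `[< sstrict (c k) (c k.+1) >]) (iota 0 n)) N (c n).
elim: n=> [|n IH] H1 H2 Ns.
 by apply: len_ge0; have [] := H1 0 _.
have H: len_ge (count (fun k=> `[< sstrict (c k) (c k.+1) >]) (iota 0 n)) N (c n).
 by apply: IH=> // k kn; [apply: H1; apply: leqW | apply: H2; apply: leqW].
have [cs Nc] := H1 n.+1 (leqnn _).
rewrite -addn1 iotaD count_cat /=.
case: asboolP=> [st|_]; rewrite ?addn1 ?addn0; first exact: len_ge_step st.
by apply: len_ge_sub H=> //; apply: H2.
Qed.
(** Each strict step of a chain remains strict after intersection with N' or after addition of N';
    the strict steps of the two new chains are counted. *)
Lemma len_split V n (N N' N'' : set V) : submod N -> submod N' -> submod N'' -> N `<=` N' -> N' `<=` N'' ->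
 len_ge n N N'' -> exists m1 m2, [/\ (n <= m1 + m2)%N, len_ge m1 N N' & len_ge m2 N' N''].
move=> Ns N's N''s NN' NN'' [c [H1 H2]].
pose c1 k := c k `&` N'; pose c2 k := msum (c k) N'.
have h1: len_ge (count (fun k=> `[< sstrict (c1 k) (c1 k.+1) >]) (iota 0 n)) N (c1 n).
 apply: len_count=> // k kn; last by have [s _] := H2 k kn; move=> u [cu Nu]; split; auto.
 have [cs Nc cN] := H1 k kn; split; first exact: cap_sm.
 by split; auto.
have h2: len_ge (count (fun k=> `[< sstrict (c2 k) (c2 k.+1) >]) (iota 0 n)) N' (c2 n).
 apply: len_count=> // k kn.
 have [cs Nc cN] := H1 k kn; split; first exact: msum_sm.
 exact: msum_r.
 by have [s _] := H2 k kn; move=> _ [a [b [ca Nb ->]]]; exists a, b; split; auto.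
exists (count (fun k=> `[< sstrict (c1 k) (c1 k.+1) >]) (iota 0 n)),
 (count (fun k=> `[< sstrict (c2 k) (c2 k.+1) >]) (iota 0 n)); split.
- rewrite -count_predUI; apply: leq_trans (leq_addr _ _).
 rewrite -{1}(size_iota 0 n) -count_predT; have /eq_in_count -> // :
 {in iota 0 n, xpredT =1 predU (fun k=> `[< sstrict (c1 k) (c1 k.+1) >]) (fun k=> `[< sstrict (c2 k) (c2 k.+1) >])}.
 move=> k; rewrite mem_iota=> kn; symmetry; apply/orP.
 have [cs Nc cN] := H1 k (ltnW kn); have [cs' Nc' cN'] := H1 k.+1 kn.
 have [cc [v cv Hv]] := H2 k kn.
 have [s1|s1] := pselect (sstrict (c1 k) (c1 k.+1)); [by left; apply/asboolP | right; apply/asboolP].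
 apply: contrapT=> s2.
 have [u yu cu]: exists2 u, ~ y u & c2 k (u *: v).
 apply: contrapT=> no; apply: s2; split=> [_ [a [b [ca Nb ->]]]|].
 by exists a, b; split; auto.
 exists v; first exact: msum_l.
 by move=> u yu cu; apply: no; exists u.
 have [a [b [ca Nb e]]] := cu.
 have cb: c k.+1 b.
 have -> : b = u *: v - a by rewrite e addrC addKr.
 by have [_ _ cZ] := cs'; apply: submodB=> //; [exact: cZ | exact: cc].
 have [u' yu' cu']: exists2 u', ~ y u' & c k (u' *: b).
 apply: contrapT=> no; apply: s1; split; first by move=> w [cw Nw]; split; auto.
 by exists b=> // u' yu' [cu' _]; apply: no; exists u'.
 apply: (Hv (u' * u)); first exact: primenM.
 by rewrite -scalerA e scalerDr; have [_ cD cZ] := cs; apply: cD=> //; apply: cZ.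
- by apply: len_ge_sub h1=> // u [].
- apply: len_ge_sub h2=> //; have [cs Nc cN] := H1 n (leqnn n).
 exact: msum_min.
Qed.
Lemma len_fin_ext V (N N' N'' : set V) : submod N -> submod N' -> submod N'' -> N `<=` N' -> N' `<=` N'' ->
 len_fin N N' -> len_fin N' N'' -> len_fin N N''.
move=> Ns N's N''s NN' NN'' f1 f2; exists (len N N' + len N' N'').+1.
move=> /(len_split Ns N's N''s NN' NN'')[m1 [m2 [h /(len_max Ns NN' f1) h1 /(len_max N's NN'' f2) h2]]].
lia.
Qed.
Lemma len_add V (N N' N'' : set V) : submod N -> submod N' -> submod N'' -> N `<=` N' -> N' `<=` N'' ->
 len_fin N N'' -> len N N'' = (len N N' + len N' N'')%N.
move=> Ns N's N''s NN' NN'' f.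
have f1: len_fin N N' by apply: len_fin_sub f.
have f2: len_fin N' N'' by apply: len_fin_sub f.
have [h _] := lenP Ns (subset_trans NN' NN'') f.
apply/eqP; rewrite eqn_leq; apply/andP; split.
 have [m1 [m2 [hm /(len_max Ns NN' f1) h1 /(len_max N's NN'' f2) h2]]] := len_split Ns N's N''s NN' NN'' h.
 exact: leq_trans hm (leq_add h1 h2).
have [h1 _] := lenP Ns NN' f1; have [h2 _] := lenP N's NN'' f2.
by apply: len_max f (len_cat NN' h1 h2)=> //; apply: subset_trans NN''.
Qed.
Lemma len_ge_map V W (f : V -> W) (A : set V) (C : set W) n : linmap f -> submod A -> submod C ->
 len_ge n (A `&` f @^-1` C) A <-> len_ge n C (msum (f @` A) C).
move=> fl As Cs; have [fD fZ] := fl; split=> [[c [H1 H2]]|[d [H1 H2]]].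
 exists (fun k=> msum (f @` c k) C); split=> k kn.
 have [cs Nc cA] := H1 k kn; split; first exact: msum_sm (img_submod fl cs) Cs.
 exact: msum_r (img_submod fl cs).
 by move=> _ [_ [b [[a ca <-] Cb ->]]]; exists (f a), b; split=> //; exists a; auto.
 have [cc [v cv Hv]] := H2 k kn; have [cs Nc cA] := H1 k (ltnW kn); have [cs' _ cA'] := H1 k.+1 kn; split.
 by move=> _ [_ [b [[a ca <-] Cb ->]]]; exists (f a), b; split=> //; exists a; auto.
 exists (f v); first exact: msum_l.
 move=> u yu [_ [b [[a ca <-] Cb e]]]; apply: (Hv u yu).
 rewrite -[u *: v](subrK a); have [_ cD _] := cs; apply: cD=> //; apply: Nc; split.
 apply: submodB=> //; last exact: cA.
 by have [_ _ AZ] := As; apply: AZ; apply: cA'.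
 by rewrite /= linB // fZ e addrC addKr.
exists (fun k=> A `&` f @^-1` d k); split=> k kn.
 have [ds Nd dA] := H1 k kn; split; first exact: cap_sm As (pre_submod fl ds).
 by move=> a [Aa Ca]; split=> //; apply: Nd.
 by [].
have [dd [v dv Hv]] := H2 k kn; have [ds Nd dA] := H1 k (ltnW kn); have [ds' Nd' dA'] := H1 k.+1 kn; split.
 by move=> a [Aa da]; split=> //; apply: dd.
have [_ [b [[a Aa <-] Cb e]]] := dA' v dv; exists a.
 split=> //; rewrite /=; have -> : f a = v - b by rewrite e addrK.
 by apply: submodB=> //; apply: Nd'.
move=> u yu [_ da]; apply: (Hv u yu); rewrite e scalerDr -fZ.
by have [_ dD dZ] := ds; apply: dD=> //; apply: dZ; apply: Nd.
Qed.
Lemma len_map V W (f : V -> W) (A : set V) (C : set W) : linmap f -> submod A -> submod C ->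
 len (A `&` f @^-1` C) A = len C (msum (f @` A) C).
move=> fl As Cs; congr xget; apply/seteqP; split=> n [h1 h2]; split;
 by [apply/(len_ge_map _ fl As Cs) | move/(len_ge_map _ fl As Cs)].
Qed.
Lemma len_ge_refl V (N : set V) : ~ len_ge 1 N N.
move=> [c [H1 /(_ 0 isT) [_ [v cv Hv]]]]; apply: (Hv 1); first exact: prime1.
have [_ Nc _] := H1 0 isT; have [_ _ cN] := H1 1 isT.
by rewrite scale1r; apply: Nc; apply: cN.
Qed.
Lemma len_killed V (N N' : set V) b : ~ y b -> (forall v, N' v -> N (b *: v)) -> ~ len_ge 1 N N'.
move=> yb H [c [H1 /(_ 0 isT) [_ [v cv Hv]]]]; apply: (Hv b yb).
by have [_ Nc _] := H1 0 isT; have [_ _ cN] := H1 1 isT; apply: Nc; apply: H; apply: cN.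
Qed.
Lemma len_res : ~ len_ge 2 (y : set B^o) setT.
move=> [c [H1 H2]]; have [_ [v cv Hv]] := H2 0 isT; have [_ [w cw Hw]] := H2 1 isT.
have [_ yc _] := H1 0 isT; have [cs _ _] := H1 1 isT.
have yv: ~ y v by move=> yv; apply: (Hv 1); [exact: prime1 | rewrite scale1r; apply: yc].
apply: (Hw v yv); have [_ _ cZ] := cs.
have -> : v *: w = w *: v by apply: mulrC.
exact: cZ.
Qed.
Lemma len_res1 : len_ge 1 (y : set B^o) setT.
have ys: submod (y : set B^o) by split; [exact: prime0 | exact: primeD | move=> b v; exact: primeMl].
exists (fun k=> if k == 0 then y else setT); split=> [[|k] _|[|//] _].
- by split.
- by [].
- split=> //; exists 1=> // u yu.
 by have -> : u *: (1 : B^o) = u by exact: mulr1.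
Qed.
Lemma lenyE : len (y : set B^o) setT = 1%N.
exact: len_eq len_res1 len_res. Qed.
Lemma len0 V (N N' : set V) : submod N -> N `<=` N' -> ~ len_ge 1 N N' -> len N N' = 0%N.
by move=> Ns NN; apply: len_eq; apply: len_ge0. Qed.

Section Finite.
Hypothesis noeB : noe (set0 : set B^o) setT.

(** The hypothesis says that no prime of the support lies strictly below [y]. In a prime filtration
    a factor B/q then has length 0 at [y], or q = [y] and the length is 1. *)
Lemma len_finite (L : set B) V (N N' : set V) : mdom L N N' ->
 (forall q, prime_ideal q -> L `<=` q -> (forall b, (forall v, N' v -> N (b *: v)) -> q b) ->
 q `<=` y -> y `<=` q) -> len_fin N N'.
move=> D H; have [Ns N's NN nN lN] := D.
have D0: mdom set0 N N' by [].
apply: (filtration noeB (Q := fun K=> len_fin N K) D0); first by exists 1; apply: len_ge_refl.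
move=> K v [Ks NK KN] fK N'v pq;
have Kc: K `<=` cyc K v by move=> k Kk; exists 0, k; rewrite add0r; split=> //; exists 0; rewrite ?scale0r.
apply: (len_fin_ext Ns Ks (cyc_submod v Ks) NK Kc fK).
set q := [set c | _] in pq; have [qy|/existsNP[b /not_implyP[qb yb]]] := pselect (q `<=` y); last first.
 exists 1; apply: (len_killed yb)=> _ [_ [k [[c _ <-] Kk ->]]].
 rewrite scalerDr scalerA mulrC -scalerA; have [_ KD KZ] := Ks.
 by apply: KD; apply: KZ.
have yq: y `<=` q.
 apply: H=> // [l Ll|b Hb]; last by apply: NK; apply: Hb.
 by have [k Hk] := lN l Ll; apply: (primeX pq _); apply: NK; apply: Hk.
have eq: q = y by apply/seteqP.
exists 2=> h; apply: len_res; rewrite -eq.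
have -> : q = setT `&` (fun b : B^o=> b *: v) @^-1` K by rewrite setTI.
by apply/(len_ge_map _ (lin_orbit v) _ Ks).
Qed.
Lemma len_additive (G : zmodType) (g : G) (L : set B) :
 (forall q, prime_ideal q -> L `<=` q -> q `<=` y -> y `<=` q) ->
 additiv L (fun V N N'=> g *+ len N N').
split=> [V N N' N'' N's NN' NN'' D|V W f A C fl [_ As _ _ _] [Cs _ _ _ _]]; last by rewrite len_map.
have [Ns N''s _ _ _] := D; rewrite (len_add Ns N's N''s) ?mulrnDr //.
by apply: len_finite D _=> q pq Lq _; apply: H.
Qed.

End Finite.

End Length.

(** * Primes in polynomial rings *)

Section PolyPrimes.
Variable R : idomainType.
Implicit Types (P Q : set {poly R}) (I : set R).

Definition ctr P : set R := [set r | P r%:P].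
Definition ext I : set {poly R} := [set p | forall i, I p`_i].
(** For a prime P this means that P is generated by its contraction, that is, the variable is
    transcendental over R modulo P. *)
Definition isext P := forall p, P p -> forall i, P (p`_i)%:P.

Lemma ctr_prime P : prime_ideal P -> prime_ideal (ctr P).
move=> [P0 PD PM P1 PP]; split; rewrite /ctr /=; rewrite //.
- by move=> a b; rewrite polyCD; apply: PD.
- by move=> a b; rewrite polyCM; apply: PM.
- by move=> a b; rewrite polyCM; apply: PP.
Qed.
Lemma ext_prime I : prime_ideal I -> prime_ideal (ext I).
move=> pI; have [I0 ID IM I1 IP] := pI; split.
- by move=> i; rewrite coef0.
- by move=> p q Ip Iq i; rewrite coefD; apply: ID.
- by move=> p q Iq i; rewrite coefM; apply: (prime_sum pI)=> j _; apply: IM.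
- by move/(_ 0); rewrite coef1.
move=> p q Ipq; have [Ip|] := pselect (ext I p); [by left|right].
have [Iq//|/existsNP nq] := pselect (ext I q); move: b=> /existsNP np.
have np': exists i, `[< ~ I p`_i >] by have [i Hi] := np; exists i; apply/asboolP.
have nq': exists i, `[< ~ I q`_i >] by have [i Hi] := nq; exists i; apply/asboolP.
case: (ex_minnP np')=> m /asboolP pm mmin; case: (ex_minnP nq')=> k /asboolP qk kmin.
have lp i: (i < m)%N -> I p`_i.
 by move=> im; apply: contrapT=> /asboolP/mmin; rewrite leqNgt im.
have lq i: (i < k)%N -> I q`_i.
 by move=> im; apply: contrapT=> /asboolP/kmin; rewrite leqNgt im.
have mS: (m < (m + k).+1)%N by lia.
case: (primenM pI pm qk).
have -> : p`_m * q`_k = (p * q)`_(m + k) - \sum_(j < _.+1 | j != Ordinal mS) p`_j * q`_(m + k - j).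
 by rewrite coefM (bigD1 (Ordinal mS)) //= addKn addrK.
apply: (primeB pI)=> //; apply: (prime_sum pI)=> j jm.
have [jlt|jge] := ltnP j m; first by apply: (primeMr pI); apply: lp.
apply: (primeMl pI); apply: lq.
have jm': (m < j)%N by rewrite ltn_neqAle jge andbT; apply: contra jm=> /eqP e; apply/eqP/val_inj.
by rewrite ltn_subLR ?ltn_add2r -ltnS.
Qed.
Lemma ctr_ext I : prime_ideal I -> ctr (ext I) = I.
move=> [I0 _ _ _ _]; apply/seteqP; split=> r; first by move/(_ 0); rewrite coefC.
by move=> Ir i; rewrite coefC; case: ifP.
Qed.
Lemma ext_isext I : prime_ideal I -> isext (ext I).
by move=> pI p Ip i; have : ctr (ext I) p`_i by rewrite ctr_ext. Qed.
Lemma ext_sub P : prime_ideal P -> ext (ctr P) `<=` P.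
move=> pP p Ip; rewrite -[p]coefK poly_def; apply: (prime_sum pP)=> i _.
by rewrite -mul_polyC; apply: (primeMr pP); apply: Ip.
Qed.
Lemma isextE P : prime_ideal P -> isext P -> P = ext (ctr P).
by move=> pP eP; apply/seteqP; split; [move=> p Pp i; apply: eP | apply: ext_sub]. Qed.
(** A polynomial of least degree outside of the extension of [ctr P]. Over the residue field of
    [ctr P] it generates P; [nonext_div] is the division by it, with denominators cleared. *)
Lemma nonext_gen P : prime_ideal P -> ~ isext P -> exists f, [/\ P f, ~ ctr P (lead_coef f),
 (0 < size f)%N & forall g, P g -> (size g < size f)%N -> ext (ctr P) g].
move=> pP /existsNP[p0 /not_implyP[Pp0 np0]].
have ex: exists k, `[< exists2 p, P p /\ ~ ext (ctr P) p & size p = k >].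
 by exists (size p0); apply/asboolP; exists p0.
case: (ex_minnP ex)=> m /asboolP[f [Pf nf] sf] mmin.
have mn g: P g -> (size g < size f)%N -> ext (ctr P) g.
 move=> Pg sg; apply: contrapT=> ng; have : `[< exists2 p, P p /\ ~ ext (ctr P) p & size p = size g >].
 by apply/asboolP; exists g.
 by move/mmin; rewrite -sf leqNgt sg.
have f0: f != 0 by apply: contra_notN nf=> /eqP -> i; rewrite coef0; case: pP.
exists f; split=> //; last by rewrite size_poly_gt0.
move=> lf; pose g := f - (lead_coef f)%:P * 'X^((size f).-1).
have Pg: P g by apply: (primeB pP)=> //; apply: (primeMr pP).
apply: nf=> i; have ge: ext (ctr P) g.
 apply: mn=> //; rewrite -(ltn_predK (m := 0) (n := size f)) ?size_poly_gt0 //.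
 apply/leq_sizeP=> j; rewrite leq_eqVlt=> /orP[/eqP <-|jf].
 by rewrite coefB coefCM coefXn eqxx mulr1 subrr.
 rewrite coefB coefCM coefXn (gtn_eqF jf) mulr0 subr0 nth_default //.
 by rewrite -(ltn_predK (m := 0) (n := size f)) ?size_poly_gt0.
have := ge i; rewrite coefB coefCM coefXn; have [->|_] := eqVneq i _.-1.
 by [].
by rewrite mulr0 subr0.
Qed.
Lemma nonext_div P f : prime_ideal P -> P f -> ~ ctr P (lead_coef f) -> (0 < size f)%N ->
 (forall g, P g -> (size g < size f)%N -> ext (ctr P) g) ->
 forall g, P g -> exists u a w, [/\ ~ ctr P u, ext (ctr P) w,
 u%:P * g = a * f + w & size a = (size g - (size f).-1)%N].
move=> pP Pf lf sf mn g Pg; have f0: f != 0 by rewrite -size_poly_gt0.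
have e := Pdiv.Idomain.divp_eq g f.
exists (lead_coef f ^+ scalp g f), (g %/ f), (g %% f); split.
- by apply: primenX=> //; apply: ctr_prime.
- apply: mn; last by rewrite ltn_modp.
 have -> : g %% f = (lead_coef f ^+ scalp g f)%:P * g - (g %/ f) * f by rewrite mul_polyC e addrC addKr.
 by apply: (primeB pP); apply: (primeMl pP).
- by rewrite mul_polyC.
- exact: Pdiv.Idomain.size_divp.
Qed.
(** Over the residue field of the common contraction, P is a nonzero prime in one variable, hence
    maximal. The generators of P and Q are compared by pseudo-division. *)
Lemma nonext_max P Q : prime_ideal P -> prime_ideal Q -> P `<=` Q -> ctr Q `<=` ctr P -> ~ isext P ->
 Q `<=` P.
move=> pP pQ PQ c eP.
have c': ctr P = ctr Q by apply/seteqP; split=> // r; apply: PQ.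
have nQ: ~ isext Q.
 by move=> eQ; apply: eP=> p Pp i; rewrite -[P _]/(ctr P _) c'; apply: eQ; apply: PQ.
have [f [Pf lf sf mf]] := nonext_gen pP eP.
have [h [Qh lh sh mh]] := nonext_gen pQ nQ.
have [u [a [w [uQ wQ e sa]]]] := nonext_div pQ Qh lh sh mh (PQ _ Pf).
have wP: P w by apply: (ext_sub pP); rewrite c'.
have Ph: P h.
 have [Pa|//]: P a \/ P h.
 have [_ _ _ _ PP] := pP; apply: PP; have -> : a * h = u%:P * f - w by rewrite e addrK.
 by apply: (primeB pP)=> //; apply: (primeMl pP).
 have ea: ext (ctr P) a -> False.
 move=> ea; have : ext (ctr P) (u%:P * f).
 have pe := ext_prime (ctr_prime pP); rewrite e; apply: (primeD pe); last by rewrite c'.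
 exact: (primeMr pe).
 move/(_ (size f).-1); rewrite coefCM; apply: (primenM (ctr_prime pP))=> //.
 by rewrite c'.
 have [sha|sha] := ltnP (size a) (size f); first by case: ea; apply: mf.
 exfalso.
 move: sha; rewrite sa; case: (size h) (size1_polyC (p := h)) sh=> [|[|k]] // H _.
 by move=> _; apply: lh; rewrite (H isT) lead_coefC /ctr /= -(H isT).
 lia.
move=> g Qg; have [v [b [z [vQ zQ e' _]]]] := nonext_div pQ Qh lh sh mh Qg.
have [_ _ _ _ PP] := pP; have [] // : P v%:P \/ P g; last by rewrite -[P _]/(ctr P v) c'.
apply: PP; rewrite e'; apply: (primeD pP); first exact: (primeMl pP).
by apply: (ext_sub pP); rewrite c'.
Qed.

Hypothesis noeR : noe (set0 : set R^o) setT.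

(* If D = R/P0, then D[x]/P is an increasing union of finitely generated
 D-modules E_N, and E_N / t E_N has length independent of N, although it
 surjects onto polynomials of degree < N over R/Q0. *)
Lemma nonext_between P Q : prime_ideal P -> prime_ideal Q -> P `<=` Q -> ~ isext P -> isext Q ->
 exists p, [/\ prime_ideal p, ctr P `<=` p, p `<=` ctr Q, ~ p `<=` ctr P & ~ ctr Q `<=` p].
move=> pP pQ PQ nP eQ; have pP0 := ctr_prime pP; have pQ0 := ctr_prime pQ.
have [f [Pf lf sf mf]] := nonext_gen pP nP.
apply: contrapT=> no.
have tw p: prime_ideal p -> ctr P `<=` p -> p `<=` ctr Q -> ~ p `<=` ctr P -> ctr Q `<=` p.
 by move=> pp Pp pQ' np; apply: contrapT=> nq; apply: no; exists p.
have [t Qt Pt]: exists2 t, ctr Q t & ~ ctr P t.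
 by exists (lead_coef f)=> //; apply: eQ; apply: PQ.
pose V : lmodType R := {poly R}.
have Ps: submod P.
 split; [by case: pP | by case: pP | move=> b v Pv].
 by rewrite -mul_polyC; apply: (primeMl pP).
pose S n : set V := [set p | (size p <= n)%N].
have Ss n: submod (S n).
 split=> [|u v|b v]; rewrite /S /= ?size_poly0 //.
 by move=> su sv; apply: leq_trans (size_polyD _ _) _; rewrite geq_max su.
 by move=> sv; apply: leq_trans (size_scale_leq _ _) sv.
pose E n : set V := msum (S n) P.
have Es n: submod (E n) by apply: msum_sm.
have PE n: P `<=` E n by apply: msum_r.
pose T n : set V := msum (( *:%R t) @` E n) P.
have tl: linmap (( *:%R t) : V -> V).
 by split=> [u v|b v]; rewrite ?scalerDr // !scalerA mulrC.
have Ts n: submod (T n) by apply: msum_sm=> //; apply: img_submod.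
have PT n: P `<=` T n by apply: msum_r; apply: img_submod.
have EE m n: (m <= n)%N -> E m `<=` E n.
 by move=> mn _ [u [v [su Pv ->]]]; exists u, v; split=> //; apply: leq_trans mn.
have TE n: T n `<=` E n.
 by apply: msum_min=> // _ [u Eu <-]; have [_ _ EZ] := Es n; apply: EZ.
have TT m n: (m <= n)%N -> T m `<=` T n.
 move=> mn _ [_ [v [[u Eu <-] Pv ->]]]; exists (t *: u), v; split=> //; exists u=> //.
 exact: EE mn _ Eu.
have noeE n: noe P (E n).
 elim: n=> [|n IH].
 apply: (noe_sub (@subset_refl _ _) _ (@noe_refl _ _ _)).
 by move=> _ [u [v [+ Pv ->]]]; rewrite /S /= leqn0 size_poly_eq0=> /eqP ->; rewrite add0r.
 apply: (noe_ext (Es n) (Es n.+1) (PE n) (EE _ _ (leqnSn n)) IH).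
 have XE: E n.+1 `<=` msum ((fun b : R^o=> b *: ('X^n)) @` setT) (E n).
 move=> _ [u [v [su Pv ->]]]; exists (u`_n *: 'X^n), (u - u`_n *: 'X^n + v).
 split; [by [] | | by rewrite addrA [_ + (u - _)]addrC subrK].
 exists (u - u`_n *: 'X^n), v; split=> //; apply/leq_sizeP=> j.
 rewrite coefB coefZ coefXn leq_eqVlt=> /orP[/eqP <-|nj]; first by rewrite eqxx mulr1 subrr.
 by rewrite (gtn_eqF nj) mulr0 subr0 nth_default // (leq_trans su).
 apply: (noe_sub (@subset_refl _ _) XE); apply: (noe_img (lin_orbit _) (submodT _) (Es n)).
 exact: noe_sub noeR.
pose r := (size f).-1.
have lP b u: P b%:P -> P (b *: u) by rewrite -mul_polyC; apply: (primeMr pP).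
have kill1 n u: (r <= n)%N -> E n.+1 u -> E n (lead_coef f *: u).
 move=> rn [s [p [ss Pp ->]]]; rewrite scalerDr.
 exists (lead_coef f *: s - s`_n *: ('X^(n - r) * f)), (s`_n *: ('X^(n - r) * f) + lead_coef f *: p).
 split; last by rewrite addrA subrK.
 apply/leq_sizeP=> j nj; rewrite coefB !coefZ mulrC ['X^_ * f]mulrC coefMXn.
 have -> : (j < n - r)%N = false by lia.
 move: nj; rewrite leq_eqVlt=> /orP[/eqP <-|nj].
 by rewrite subKn // subrr.
 rewrite [s`_j]nth_default ?mul0r; last exact: leq_trans ss _.
 rewrite [f`_ _]nth_default ?mulr0 ?subr0 //.
 by rewrite -(ltn_predK sf) ltn_subRL subnK.
 have [_ PD PZ] := Ps; apply: PD; last exact: PZ.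
 by apply: PZ; apply: (primeMl pP).
have kill n u: E (r + n)%N u -> E r (lead_coef f ^+ n *: u).
 elim: n u=> [|n IH] u.
 by rewrite addn0 scale1r.
 rewrite addnS=> /(kill1 _ _ (leq_addr _ _))/IH; rewrite scalerA -exprSr.
 by [].
have fin n: len_fin (ctr Q) (T r) (E n).
 have nT: noe (T r) (E (r + n)) by apply: (noe_sub _ (@subset_refl _ _)).
 have TrE: T r `<=` E (r + n) by apply: subset_trans _ (EE _ _ (leq_addr _ _)).
 suff : len_fin (ctr Q) (T r) (E (r + n)).
 by apply: len_fin_sub=> //; apply: EE; apply: leq_addl.
 apply: (len_finite pQ0 noeR (L := set0)); first by [].
 move=> q pq _ Hq qQ; apply: tw=> //.
 by move=> b Pb; apply: Hq=> v _; apply: PT; apply: lP.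
 move=> qP; have : q (t * lead_coef f ^+ n).
 apply: Hq=> v /kill Ev; rewrite -scalerA; apply: msum_l=> //.
 by exists (lead_coef f ^+ n *: v).
 move/qP; apply: (primenM pP0)=> //; exact: primenX.
have eqlen n: (r <= n)%N -> len (ctr Q) (T n) (E n) = len (ctr Q) (T r) (E r).
 move=> rn; have h1 := len_add pQ0 (Ts r) (Es r) (Es n) (TE r) (EE _ _ rn) (fin n).
 have h2 := len_add pQ0 (Ts r) (Ts n) (Es n) (TT _ _ rn) (TE n) (fin n).
 have eA: E n `&` ( *:%R t) @^-1` T r = E r.
 apply/seteqP; split=> [u [Eu [_ [p [[e Ee <-] Pp eu]]]]|u Eu]; last first.
 split; first exact: EE rn _ Eu.
 exact: msum_l.
 have : P (t%:P * (u - e)) by rewrite mul_polyC scalerBr eu addrC addKr.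
 case/(primeM pP)=> // Pue; rewrite -[u](subrK e); have [_ ED _] := Es r.
 by apply: ED=> //; apply: PE.
 have eT: msum (( *:%R t) @` E n) (T r) = T n.
 apply/seteqP; split.
 by apply: msum_min=> //; [apply: msum_l | apply: TT].
 move=> _ [x [p [Tx Pp ->]]]; exists x, p; split=> //; exact: PT.
 have h3 := len_map (ctr Q) tl (Es n) (Ts r); rewrite eA eT in h3.
 lia.
have big n: len_ge (ctr Q) n (T n) (E n).
 have Qs: submod Q.
 by split; [case: pQ | case: pQ | move=> b v Qv; rewrite -mul_polyC; apply: (primeMl pQ)].
 exists (fun k=> E n `&` msum (S k) Q); split=> k kn.
 split; [by apply: cap_sm; apply: msum_sm | | by []].
 move=> u Tu; split; first exact: TE.
 have [_ [p [[e Ee <-] Pp ->]]] := Tu; apply: msum_r=> //.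
 by apply: (primeD pQ); [rewrite -mul_polyC; apply: (primeMr pQ) | apply: PQ].
 split.
 by move=> u [Eu [s [q [ss Qq e]]]]; split; [| exists s, q; split; [exact: (leqW ss) | exact: Qq |]].
 exists 'X^k.
 split; first by apply: msum_l=> //; rewrite /S /= size_polyXn.
 by apply: msum_l=> //; rewrite /S /= size_polyXn.
 move=> u Qu [_ [s [q [ss Qq e]]]].
 have eq: q = u *: 'X^k - s by rewrite e addrC addKr.
 have := eQ q Qq k; rewrite eq coefB coefZ coefXn eqxx mulr1.
 by rewrite [s`_k]nth_default ?subr0.
pose n := (len (ctr Q) (T r) (E r)).+1.
have fn: len_fin (ctr Q) (T (r + n)) (E (r + n)).
 by apply: len_fin_sub (fin (r + n))=> //; apply: TT; apply: leq_addr.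
have := len_max (Ts _) (TE _) fn (big _).
rewrite eqlen ?leq_addr // => h.
lia.
Qed.

End PolyPrimes.

Lemma noeth_noe (B : cring) : noeth B -> noe (set0 : set B^o) setT.
move=> nB Q [K0 bK0 QK0]; apply: contrapT=> no.
pose good K := between set0 setT K /\ Q K.
have nx (K : {K | good K}) : exists K' : {K | good K}, sval K `<=` sval K' /\ ~ sval K' `<=` sval K.
 case: K=> K [bK QK]; apply: contrapT=> nK; apply: no; exists K; split=> // K' bK' QK' KK'.
 by apply: contrapT=> n; apply: nK; exists (exist _ K' (conj bK' QK')).
have [nxt Hn] := choice nx; pose c k := sval (iter k nxt (exist _ K0 (conj bK0 QK0))).
have cc m n: (m <= n)%N -> c m `<=` c n.
 elim: n=> [|n IH]; first by rewrite leqn0=> /eqP ->.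
 rewrite leq_eqVlt=> /orP[/eqP -> //|mn]; apply: subset_trans (IH mn) _.
 by have [] := Hn (iter n nxt (exist _ K0 (conj bK0 QK0))).
have cs k: submod (c k) by have [[]] := svalP (iter k nxt (exist _ K0 (conj bK0 QK0))).
have [|l [Hl gl]] := nB (\bigcup_k c k).
 split; first by exists 0; case: (cs 0).
 move=> a b [i _ ca] [j _ cb]; exists (maxn i j)=> //; have [_ cD _] := cs (maxn i j).
 by apply: cD; [apply: cc ca; apply: leq_maxl | apply: cc cb; apply: leq_maxr].
 by move=> a b [i _ cb]; exists i=> //; have [_ _ cZ] := cs i; apply: cZ.
have [||m Hm] := @unif_bnd B l (fun x n=> c n x).
- by move=> x i j ij; apply: cc.
- by move=> x /Hl[i _ ci]; exists i.
have [_ []] := Hn (iter m nxt (exist _ K0 (conj bK0 QK0)))=> x cx.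
have /gl : (\bigcup_k c k) x by exists m.+1.
have [c0 cD cZ] := cs m; apply: (@idg_min B [set` l] _)=> [|z zl]; last exact: Hm.
by [].
Qed.

(** * Dimension by counting algebraic variables *)

Section IteratedPolynomials.
Variable F : fieldType.

Fixpoint ip n : idomainType := if n is n'.+1 then ({poly ip n'} : idomainType) else F.

Fixpoint ipC n : F -> ip n :=
 match n return F -> ip n with 0=> id | n'.+1=> fun c=> (ipC n' c)%:P end.

Fixpoint var n (i : nat) : ip n :=
 match n return ip n with 0=> 0 | n'.+1=> if i == n' then 'X else (var n' i)%:P end.

Lemma ipC_rm n : is_rmorph (@ipC n).
elim: n=> [|n [IB [I1 IM]]] /=; first by [].
by split=> [a b|]; [rewrite IB polyCB| split=> [|a b]; rewrite ?I1 ?IM ?polyCM].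
Qed.
Lemma ip_gen n : generated_by (range (@ipC n) `|` [set` [seq var n i | i <- iota 0 n]]).
elim: n=> [|n IH] P P1 PB PM sP; first by move=> a; apply: sP; left.
have P0: P 0 by rewrite -(subrr 1); apply: PB.
have PD a b: P a -> P b -> P (a + b).
 by move=> Pa Pb; rewrite -[b]opprK -[- b]sub0r; apply: (PB)=> //; apply: (PB).
have PC c: P c%:P.
 apply: (IH (fun c : ip n=> P c%:P))=> [|a b Pa Pb|a b Pa Pb|a].
 - by [].
 - by rewrite polyCB; apply: PB.
 - by rewrite polyCM; apply: PM.
 - move=> [[b _ <-]|/mapP[i]]; first by apply: sP; left.
 rewrite mem_iota=> im ->; apply: sP; right; apply/mapP; exists i.
 by rewrite mem_iota /= ltnW.
 by rewrite /= ltn_eqF.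
have PX: P 'X.
 apply: sP; right; apply/mapP; exists n; last by rewrite /= eqxx.
 by rewrite mem_iota /=.
elim/poly_ind=> // p c Pp; apply: PD=> //; exact: PM.
Qed.
Lemma ip_noe n : noe (set0 : set (ip n)^o) setT.
by apply: noeth_noe; apply: fg_noeth (@ipC_rm n) (@ip_gen n). Qed.

(** The dimension of the quotient by a prime, as a transcendence degree: a variable counts if it is
    transcendental over the previous ones modulo P. *)
Fixpoint idim n : set (ip n) -> nat :=
 match n return set (ip n) -> nat with
 | 0=> fun=> 0%N
 | n'.+1=> fun P=> (idim (ctr P) + `[< isext P >])%N
 end.

(** One more than the index of the last variable that is algebraic over the previous ones modulo P,
    and 0 if there is none. *)
Fixpoint lastnf n : set (ip n) -> nat :=
 match n return set (ip n) -> nat with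
 | 0=> fun=> 0%N
 | n'.+1=> fun P=> if `[< isext P >] then lastnf (ctr P) else n'.+1
 end.

Lemma field_prime (P : set F) : prime_ideal P -> P = [set 0].
move=> [P0 PD PM P1 PP]; apply/seteqP; split=> [a Pa|_ -> //]; apply: contrapT=> /eqP a0.
by apply: P1; rewrite -(mulVf a0); apply: PM.
Qed.
Lemma dim_le n (P : set (ip n)) : (idim P <= n)%N.
by elim: n P=> //= n IH P; rewrite -addn1 leq_add // leq_b1. Qed.
Lemma lastnf_le n (P : set (ip n)) : (lastnf P <= n)%N.
by elim: n P=> //= n IH P; case: ifP=> // _; apply: leqW. Qed.
Lemma dim_lastnf n (P : set (ip n)) : (n <= idim P + lastnf P)%N.
elim: n P=> //= n IH P; case: ifP=> _; last lia.
by rewrite addn1 ltnS.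
Qed.
(** The delicate case is P not extended and Q extended: the last variable then counts for Q only, so
    the dimension of the contractions has to drop by two. The prime from [nonext_between] provides
    the second step. *)
Lemma dim_lt n (P Q : set (ip n)) : prime_ideal P -> prime_ideal Q -> P `<=` Q -> ~ Q `<=` P ->
 (idim Q < idim P)%N.
elim: n P Q=> [|n IH] P Q pP pQ PQ nQP.
 by case: nQP; rewrite (field_prime pP) (field_prime pQ).
have pP0 := ctr_prime pP; have pQ0 := ctr_prime pQ.
have PQ0: ctr P `<=` ctr Q by move=> r; apply: PQ.
have [QP0|nQP0] := pselect (ctr Q `<=` ctr P).
 have e: ctr Q = ctr P by apply/seteqP.
 have eP: isext P by apply: contrapT=> nP; apply: nQP; apply: nonext_max nP.
 have nQ: ~ isext Q.
 by move=> eQ; apply: nQP; rewrite (isextE pQ eQ) (isextE pP eP) e.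
 by rewrite /= e (asboolT eP) (asboolF nQ) addn0 addn1.
have h := IH _ _ pP0 pQ0 PQ0 nQP0.
have [eQ|nQ] := pselect (isext Q); last first.
 by rewrite /= (asboolF nQ) addn0; apply: leq_trans h (leq_addr _ _).
have [eP|nP] := pselect (isext P).
 by rewrite /= (asboolT eQ) (asboolT eP) ltn_add2r.
have [p [pp Pp pQ' np nq]] := nonext_between (@ip_noe n) pP pQ PQ nP eQ.
have h2 := IH _ _ pp pQ0 pQ' nq.
by rewrite /= (asboolT eQ) addn1; apply: leq_trans (leq_addr _ _); apply: leq_trans (IH _ _ pP0 pp Pp np).
Qed.
Lemma dim_eq n (P Q : set (ip n)) : prime_ideal P -> prime_ideal Q -> P `<=` Q ->
 (idim P <= idim Q)%N -> P = Q.
move=> pP pQ PQ h; apply/seteqP; split=> //; apply: contrapT=> nQ.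
by have := dim_lt pP pQ PQ nQ; rewrite ltnNge h.
Qed.

(* W is the extension of P cap F[x_0 .. x_(k-1)], where x_k is the last
 variable that is algebraic over the previous ones modulo P. *)
Lemma tower_step n (P : set (ip n)) : prime_ideal P -> (0 < lastnf P)%N ->
 exists (W : set (ip n)) (f : ip n), [/\ prime_ideal W /\ W `<=` P, P f /\ ~ W f, idim W = (idim P).+1,
 (forall g, P g -> exists u a w, [/\ ~ P u, W w & u * g = a * f + w])
 & (forall P', prime_ideal P' -> W `<=` P' -> P' f -> idim P' = idim P -> P' = P \/ (lastnf P' < lastnf P)%N) /\
 (forall i, (i.+1 < lastnf P)%N -> P (var n i) -> W (var n i)) ].
elim: n P=> [|n IH] P pP; first by [].
have pP0 := ctr_prime pP.
have [eP|nP] := pselect (isext P).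
 rewrite /= (asboolT eP)=> l0.
 have [W [f [[pW WP] [Pf Wf] dW gen [smp vars]]]] := IH _ pP0 l0.
 have pE := ext_prime pW;
 exists (ext W), f%:P; split.
 - by split=> // p Wp; apply: (ext_sub pP)=> i; apply: WP.
 - split=> //; by move=> /(_ 0); rewrite coefC.
 - by rewrite ctr_ext // (asboolT (ext_isext pW)) dW.
 - move=> g Pg; have Pgi i: exists u, ~ ctr P u /\ exists a w, W w /\ u * g`_i = a * f + w.
 by have [u [a [w [Pu Ww e]]]] := gen _ (eP g Pg i); exists u; split=> //; exists a, w.
 have [E0 ED EM _ _] := pE.
 pose J := [set g : {poly ip n} | exists u a w, [/\ ~ ctr P u, ext W w & u%:P * g = a * f%:P + w]].
 suff [u [a [w [Pu Ww e]]]] : J g by exists u%:P, a, w.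
 have JM a b: J b -> J (a * b).
 move=> [u [c [w [Pu Ww e]]]]; exists u, (a * c), (a * w); split=> //; first exact: EM.
 by rewrite mulrCA e mulrDr mulrA.
 rewrite -[g]coefK poly_def; elim/big_ind: _=> [|x y [u [a [w [Pu Ww e]]]] [u' [a' [w' [Pu' Ww' e']]]]|i _].
 + by exists 1, 0, 0; split=> //; [apply: (prime1 pP0) | rewrite mulr0 mul0r addr0].
 + exists (u * u'), (u'%:P * a + u%:P * a'), (u'%:P * w + u%:P * w'); split.
 * exact: (primenM pP0).
 * by apply: ED; apply: EM.
 * transitivity (u'%:P * (u%:P * x) + u%:P * (u'%:P * y)); first by rewrite polyCM; ring.
 by rewrite e e'; ring.
 + rewrite -mul_polyC mulrC; apply: JM; have [u [Pu [a [w [Ww e]]]]] := Pgi i.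
 exists u, a%:P, w%:P; split=> //; last by rewrite -!polyCM -polyCD e.
 by move=> j; rewrite coefC; case: ifP=> _; case: pW.
 - split; last first.
 move=> i; case: eqP=> [->|ni] il.
 by have := leq_trans il (lastnf_le _); rewrite ltnNge leqnSn.
 by move=> Pv j; rewrite coefC; case: ifP=> _; [apply: vars | case: pW].
 move=> P' pP' WP' Pf' dP'; have pP'0 := ctr_prime pP'.
 have WP0: W `<=` ctr P' by move=> r Wr; apply: WP'=> i; rewrite coefC; case: ifP=> _; case: pW.
 have nWP0: ~ ctr P' `<=` W by move=> h; apply: Wf; apply: h.
 have h := dim_lt pW pP'0 WP0 nWP0; rewrite dW in h.
 have [eP'|nP'] := pselect (isext P'); last first.
 by move: dP'; rewrite (asboolF nP') addn0 addn1=> e; rewrite e ltnn in h.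
 move: dP'; rewrite (asboolT eP')=> /addIn dP'.
 have [e|lt] := smp _ pP'0 WP0 Pf' dP'; [left | by right].
 by rewrite (isextE pP eP) (isextE pP' eP') e.
rewrite /= (asboolF nP)=> _.
have [f [Pf lf sf mf]] := nonext_gen pP nP.
have pE := ext_prime pP0;
exists (ext (ctr P)), f; split.
- by split=> //; apply: ext_sub.
- by split=> // /(_ (size f).-1).
- by rewrite ctr_ext // (asboolT (ext_isext pP0)) addn0 addn1.
- move=> g Pg; have [u [a [w [Pu Ww e _]]]] := nonext_div pP Pf lf sf mf Pg.
 by exists u%:P, a, w.
- split; last first.
 move=> i; rewrite ltnS=> il; rewrite (ltn_eqF il)=> Pv j; rewrite coefC.
 by case: ifP=> _; case: pP0.
 move=> P' pP' WP' Pf' dP';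
 have PP0: ctr P `<=` ctr P' by move=> r Pr; apply: WP'=> i; rewrite coefC; case: ifP=> _; case: pP0.
 have [PP0'|nPP0'] := pselect (ctr P' `<=` ctr P).
 have PP: P `<=` P'.
 move=> g Pg; have [u [a [w [Pu Ww e _]]]] := nonext_div pP Pf lf sf mf Pg.
 have : P' (u%:P * g) by rewrite e; apply: (primeD pP'); [exact: (primeMl pP') | exact: WP'].
 by case/(primeM pP')=> // /PP0'.
 left; symmetry; apply: (@dim_eq n.+1 P P' pP pP' PP).
 by rewrite /= dP' (asboolF nP).
 right; have h := dim_lt pP0 (ctr_prime pP') PP0 nPP0'.
 have [eP'|nP'] := pselect (isext P').
 by rewrite (asboolT eP'); apply: lastnf_le.
 by move: dP'; rewrite (asboolF nP') !addn0=> e; rewrite e ltnn in h.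
Qed.

(** The prime (x_0, ..., x_(r-1)), or the ideal of all variables if r > n. In the coordinates of a
    stratum it is the ideal of its closure. *)
Fixpoint cp n (r : nat) : set (ip n) :=
 match n return set (ip n) with
 | 0=> [set 0]
 | n'.+1=> if (r <= n')%N then ext (@cp n' r) else [set p | @cp n' r p`_0]
 end.
Arguments cp : clear implicits.

Lemma cp_prime n r : prime_ideal (cp n r).
elim: n=> [|n IH] /=.
 split; rewrite //; [by move=> a b -> ->; rewrite addr0| by move=> a b ->; rewrite mulr0| | ].
 by apply/eqP; apply: oner_neq0.
 by move=> a b /eqP; rewrite mulf_eq0=> /orP[/eqP|/eqP]; [left|right].
case: ifP=> _; first exact: ext_prime.
split; rewrite ?coef0 ?coef1; try (by case: IH).
- by move=> a b; rewrite coefD; apply: primeD.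
- by move=> a b; rewrite coef0M; apply: primeMl.
- by move=> a b; rewrite coef0M; apply: primeM.
Qed.
Lemma cp_dim n r : idim (cp n r) = (n - r)%N.
elim: n=> //= n IH; case: ifP=> rn.
 rewrite ctr_ext; last exact: cp_prime.
 by rewrite IH (asboolT (ext_isext (cp_prime n r))) addn1 subSn.
have -> : ctr [set p | cp n r p`_0] = cp n r by apply/seteqP; split=> x; rewrite /ctr /= coefC.
rewrite asboolF; last first.
 move=> /(_ 'X); rewrite coefX=> /(_ _ 1); rewrite coefX coefC.
 by have [c0 _ _ c1 _] := cp_prime n r=> h; apply: c1; apply: h.
lia.
Qed.
Lemma cp_min n r (I : set (ip n)) : ideal I -> (forall i, (i < r)%N -> (i < n)%N -> I (var n i)) ->
 cp n r `<=` I.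
elim: n I=> [|n IH] I iI H /=; first by move=> _ ->; case: iI.
have [I0 ID IM] := iI.
have ci: ideal (ctr I).
 split; rewrite /ctr /= //; first by move=> a b; rewrite polyCD; apply: ID.
 by move=> a b; rewrite polyCM; apply: IM.
have h: cp n r `<=` ctr I.
 apply: IH=> // i ir im; by have := H i ir (leqW im); rewrite /= ltn_eqF.
case: ifP=> rn p.
 move=> cpp; rewrite -[p]coefK poly_def; elim/big_ind: _=> // i _.
 by rewrite -mul_polyC mulrC; apply: IM; apply: h.
move=> c0; have nr: (n < r)%N by rewrite ltnNge rn.
have IX: I 'X by have := H n nr (leqnn _); rewrite /= eqxx.
have [q e]: exists q, p = q * 'X + (p`_0)%:P.
 exists (\poly_(i < size p) p`_i.+1); apply/polyP=> i; rewrite coefD coefMX coefC.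
 case: i=> [|i]; first by rewrite add0r.
 rewrite addr0 coef_poly; case: ltnP=> // ip; by rewrite nth_default // leqW.
by rewrite e; apply: ID; [apply: IM | apply: h].
Qed.
Lemma cp_var n r i : (i < r)%N -> (i < n)%N -> cp n r (var n i).
elim: n=> //= n IH ir; rewrite ltnS leq_eqVlt=> /orP[/eqP e|im].
 by rewrite e eqxx; case: ifP=> rn; [move: ir; rewrite e ltnNge rn| rewrite coefX; case: (cp_prime n r)].
rewrite (ltn_eqF im); have h := IH ir im; case: ifP=> _; last by rewrite coefC.
by move=> j; rewrite coefC; case: ifP=> _; case: (cp_prime n r).
Qed.

(* A prime in which only the first r variables are algebraic is generic. *)
Lemma generic_eq n r (P : set (ip n)) : prime_ideal P -> cp n r `<=` P -> (lastnf P <= r)%N ->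
 P = cp n r.
move=> pP cP lr; symmetry; apply: dim_eq cP _=> //; first exact: cp_prime.
rewrite cp_dim leq_subLR; apply: leq_trans (dim_lastnf P) _.
lia.
Qed.

End IteratedPolynomials.
Arguments cp : clear implicits.

(** * Cycles, orders of vanishing and lengths of modules *)

Section LinearExtension.
Variables (K : choiceType) (G : zmodType) (g : K -> G).

Definition flin (c : {freeg K / int}) : G := fglift (fun x=> g x : zmodule G) c.

Lemma flinB a b : flin (a - b) = flin a - flin b.
exact: (@lift_is_additive int K (zmodule G) _). Qed.
Lemma flinU k x : flin << k *g x >> = g x *~ k.
exact: (@liftU int (zmodule G) K _ k x). Qed.
Lemma flin0 : flin 0 = 0. by have := flinB 0 0; rewrite !subrr. Qed.
Lemma flinN a : flin (- a) = - flin a. by have := flinB 0 a; rewrite flin0 !sub0r. Qed.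
Lemma flinD a b : flin (a + b) = flin a + flin b.
by rewrite -[b in LHS]opprK flinB flinN opprK. Qed.

End LinearExtension.

Section Bridge.
Variables (F : fieldType) (A : cring) (jA : F -> A) (r : seq A) (jm : is_rmorph jA).
Hypothesis noeA : noe (set0 : set A^o) setT.
Local Notation Y := (qascheme r jm).
Local Notation idy y := (idl (y : qapt r)).
Local Notation glob := (@qaglob A r).

Lemma closure_idl (w y : Y) : closure [set w] y <-> idy w `<=` idy y.
split=> [H b wb|wy U].
 apply: contrapT=> yb; have : nbhs y (D b) by apply: open_nbhs_nbhs; split; [exact: open_D | exact: yb].
 by move/H=> [_ [->]].
rewrite nbhsE=> -[V [oV Vy] VU]; have [s [ys sV]] := oV y Vy.
by exists w; split=> //; apply: VU; apply: sV=> /wy.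
Qed.
Lemma idl_sub_in (p : set A) (y : Y) : prime_ideal p -> p `<=` idy y -> exists z : Y, idy z = p.
move=> pp py; have [x xr yx] := (svalP y).2.
have H: prime_ideal p /\ exists2 x, x \in r & ~ p x by split=> //; exists x=> // /py.
by exists (exist _ p H).
Qed.
Lemma codim_ge_le (y : Y) m n : (m <= n)%N -> codim_ge y n -> codim_ge y m.
by move=> mn [c [c0 H]]; exists c; split=> // k km; apply: H; apply: leq_trans mn. Qed.
Lemma codim_ge0 (y : Y) : codim_ge y 0.
by exists (fun=> y). Qed.
Lemma codim_ge_step (w y : Y) n : idy w `<=` idy y -> w <> y -> codim_ge w n -> codim_ge y n.+1.
move=> wy ny [c [c0 H]]; exists (fun k=> if k is k'.+1 then c k' else y); split=> // -[|k] kn.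
 by rewrite c0; split; [apply/closure_idl | move=> e; apply: ny].
exact: H.
Qed.
Lemma codim_strict (w y : Y) n m : idy w `<=` idy y -> codim_ge w n -> codim y m -> (n >= m)%N -> w = y.
move=> wy wn [_ ym] mn; apply: contrapT=> ny; apply: ym.
exact: codim_ge_step wy ny (codim_ge_le mn wn).
Qed.
Lemma codim_uniq (y : Y) m n : codim y m -> codim y n -> m = n.
move=> [m1 m2] [n1 n2]; apply/eqP; rewrite eqn_leq; apply/andP; split; rewrite leqNgt; apply/negP=> h.
 by apply: n2; apply: codim_ge_le m1.
by apply: m2; apply: codim_ge_le n1.
Qed.
Lemma prime_submod (p : set A) : prime_ideal p -> submod (p : set A^o).
by split; [exact: prime0 | exact: primeD | exact: primeMl]. Qed.
Lemma idadd_sm (p : set A) a : prime_ideal p -> submod (idadd p a : set A^o).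
by move=> /primeI/(idaddI a). Qed.

(** The order at y of the function [a] on the closure of w, computed with A-modules in place of
    ideals of the stalk. *)
Definition qlen (y w : Y) (a : A) : nat := len (idy y) (idadd (idy w) a : set A^o) setT.

Lemma unit_agerm (V : set Y) (s : sec Y V) (x : Y) a t : open V -> V x -> germ (s : qasec V) (x : qapt r) a t ->
 unit_at x s <-> ~ idy x a.
move=> oV Vx g; exact: (unit_germ jA oV Vx g). Qed.
Lemma unit_globE (x : Y) b : unit_at x (glob setT b : sec Y setT) <-> ~ idy x b.
exact: (unit_agerm openT _ (gglob b _)). Qed.

Section LengthBridge.
Variables (w x : Y) (U : set Y) (a : sec Y U) (al s : A).
Hypotheses (wx : idy w `<=` idy x) (oU : open U) (Ux : U x).
Hypotheses (xs : ~ idy x s) (gas : forall y : Y, U y -> ~ idy y s -> germ (a : qasec U) (y : qapt r) al s).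

(** An ideal of germs is sent to the global functions in it. Conversely, a submodule c of A is sent
    to the germs b/u such that v b lies in c for some v outside of x; this keeps a chain strict
    because strictness is tested at x. *)
Lemma length_geE n : length_ge w x a n <-> len_ge (idy x) n (idadd (idy w) al : set A^o) setT.
have px := idlP x; split.
 move=> [I [H1 H2]]; exists (fun k=> [set b | I k setT (glob setT b)]).
 have oT: open _ := @openT Y.
 have gm := glob_rm (r := r) setT.
 have loc k b V: (k <= n)%N -> open V -> V x -> I k V (glob V b) <-> I k setT (glob setT b).
 move=> kn oV Vx; have [[I1 _ _ _] _ _] := H1 k kn.
 by rewrite (I1 _ V _ oT oV (subsetT V) Vx) /= res_glob.
 have cs k: (k <= n)%N -> submod ([set b | I k setT (glob setT b)] : set A^o).
 move=> kn; have [[_ I0 ID IM] _ _] := H1 k kn; split=> /=.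
 - by rewrite (rm0 gm); apply: I0.
 - by move=> u v; rewrite (rmD gm); apply: ID.
 - by move=> b v; rewrite (rmM gm); apply: IM.
 split=> k kn.
 split=> //; first exact: cs.
 have [[I1 I0 ID IM] Ia Iw] := H1 k kn; apply: idadd_min.
 - by have [c0 cD cM] := cs k kn.
 - move=> b wb; apply: Iw=> //; move=> /unit_globE.
 by [].
 - pose V := U `&` D s : set Y; have oV: open V by apply: openI=> //; apply: open_D.
 have Vx: V x by [].
 apply/(loc k al V kn oV Vx).
 have VU: V `<=` U by move=> y [].
 have e: glob V al = glob V s * qares V a.
 apply: germ_ext=> y Vy; have [Uy ys] := Vy; exists al, 1; split; first exact: gglob.
 have g := germM Vy (gglob s Vy) (germ_res VU Vy (gas Uy ys)).
 by apply: (germ_tr Vy g); [exact: prime1 (idlP y) | rewrite mul1r mulr1 mulrC].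
 rewrite e; apply: IM=> //.
 by apply/(I1 U V a oU oV VU Vx).
 have [Hs [V [t [oV Vx It nIt]]]] := H2 k kn; split.
 by move=> b; apply: Hs.
 have [b [u [xu gb]]] := germ_loc t Vx.
 pose W := V `&` D u : set Y; have oW: open W by apply: openI=> //; apply: open_D.
 have Wx: W x by [].
 have WV: W `<=` V by move=> y [].
 have eb: glob W b = glob W u * qares W t.
 apply: germ_ext=> y Wy; have [Vy yu] := Wy; exists b, 1; split; first exact: gglob.
 have g := germM Wy (gglob u Wy) (germ_res WV Wy (gb y Vy yu)).
 by apply: (germ_tr Wy g); [exact: prime1 (idlP y) | rewrite mul1r mulr1 mulrC].
 exists b.
 apply/(loc k.+1 b W kn oW Wx); rewrite eb; have [[I1 I0 ID IM] _ _] := H1 k.+1 kn.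
 by apply: IM=> //; apply/(I1 V W t oV oW WV Wx).
 move=> v xv Iv; apply: nIt; have [[I1 I0 ID IM] _ _] := H1 k (ltnW kn).
 pose Z := W `&` D (v * u) : set Y; have oZ: open Z by apply: openI=> //; apply: open_D.
 have Zx: Z x by split=> //; apply: (primenM px).
 have ZV: Z `<=` V by move=> y [[]].
 have ZD: Z `<=` D (v * u) by move=> y [].
 have e: qares Z t = mkfr 1 ZD * glob Z (v * b).
 apply: germ_ext=> y Zy; have [[Vy yu] yvu] := Zy; exists b, u; split.
 by apply: germ_res=> //; apply: gb.
 have g := germM Zy (germ_fr 1 ZD Zy) (gglob (v * b) Zy).
 by apply: (germ_tr Zy g)=> //; ring.
 apply/(I1 V Z t oV oZ ZV Zx); rewrite /= e; apply: IM=> //.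
 by apply/(loc k _ Z (ltnW kn) oZ Zx).
move=> [c [H1 H2]].
pose I k V : set _ := [set t : sec Y V | exists b u, germ t x b u /\
 exists2 v, ~ idy x v & c k (v * b)].
have IE k V t b u: (k <= n)%N -> V x -> germ t x b u ->
 I k V t <-> exists2 v, ~ idy x v & c k (v * b).
 move=> kn Vx g; split=> [[b' [u' [g' [v xv cv]]]]|[v xv cv]]; last by exists b, u; split=> //; exists v.
 have [z xz e] := germ_feq Vx g' g; have [xu' _] := g'.
 exists (v * z * u'); first by do 2!apply: (primenM px)=> //.
 have -> : v * z * u' * b = (z * u) * (v * b') - v * (z * (b' * u - b * u')) by ring.
 by rewrite e mulr0 subr0; have [[_ _ cZ] _ _] := H1 k kn; apply: cZ.
exists I; split=> k kn.
 have [[c0 cD cZ] cw _] := H1 k kn; split; first split.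
 - move=> V W t oV oW WV Wx; have [b [u g]] := germ_ex t (WV x Wx).
 have h1 := IE k V t b u kn (WV x Wx) g.
 have h2 := IE k W _ b u kn Wx (germ_res WV Wx g).
 by split=> [/(proj1 h1)/(proj2 h2)|/(proj1 h2)/(proj2 h1)].
 - move=> V oV Vx; apply: (proj2 (IE k V 0 0 1 kn Vx (germ0 Vx))).
 by exists 1; [exact: prime1 px | rewrite mulr0].
 - move=> V p q oV Vx [b [u [gp [v xv cv]]]] [b' [u' [gq [v' xv' cv']]]].
 exists (b * u' + b' * u), (u * u'); split; first exact: germD.
 exists (v * v'); first exact: (primenM px).
 have -> : v * v' * (b * u' + b' * u) = (v' * u') * (v * b) + (v * u) * (v' * b') by ring.
 by apply: cD; apply: cZ.
 - move=> V p q oV Vx [b' [u' [gq [v' xv' cv']]]]; have [b [u gp]] := germ_ex p Vx.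
 exists (b * b'), (u * u'); split; first exact: germM.
 exists v'=> //; have -> : v' * (b * b') = b * (v' * b') by ring.
 exact: cZ.
 - exists al, s; split; first exact: gas.
 exists 1; [exact: prime1 px | rewrite mul1r; apply: cw].
 exact: (idadd_x al (primeI (idlP w))).
 - move=> V t oV Vx nt; have [b [u [xu gb]]] := germ_loc t Vx.
 have Vw: V w by have [z [xz zV]] := oV x Vx; apply: zV=> /wx.
 have wu: ~ idy w u by move=> /wx.
 exists b, u; split; first exact: gb.
 exists 1; [exact: prime1 px | rewrite mul1r; apply: cw; apply: idaddS].
 by apply: contrapT=> wb; apply: nt; apply/(unit_agerm oV Vw (gb w Vw wu)).
have [cc [v0 cv0 Hv0]] := H2 k kn.
have [v [cv Hv]] : exists v : A, c k.+1 v /\ forall u, ~ idy x u -> ~ c k (u * v) by exists v0.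
split.
 by move=> V oV Vx t [b [u [g [z xz cz]]]]; exists b, u; split=> //; exists z=> //; apply: cc.
exists setT, (glob setT v); split=> //; first exact: openT.
 exists v, 1; split; first exact: gglob.
 by exists 1; [exact: prime1 px | rewrite mul1r].
have Tx: setT x by [].
move/(proj1 (IE k setT _ v 1 (ltnW kn) Tx (gglob v Tx)))=> [u xu cu].
exact: (Hv u).
Qed.
Lemma ord_lengthE n : ord_length w x a n -> n = qlen x w al.
move=> [/length_geE h1 h2]; rewrite /qlen (len_eq (n := n)) //.
by move=> h; apply: h2; apply/length_geE.
Qed.
Lemma ord_length_len : len_fin (idy x) (idadd (idy w) al : set A^o) setT -> ord_length w x a (qlen x w al).
move=> f; have [h1 h2] := lenP (idadd_sm al (idlP _)) (subsetT _) f.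
by split; [apply/length_geE | move/length_geE].
Qed.

End LengthBridge.

Lemma idadd_eq (p : set A) a b : prime_ideal p -> p (a - b) -> idadd p a = idadd p b.
have H c d: prime_ideal p -> p (c - d) -> idadd p c `<=` idadd p d.
 move=> pp h _ [j [x [pj ->]]]; exists (j + x * (c - d)), x; split; last by ring.
 by apply: (primeD pp)=> //; apply: (primeMl pp).
move=> pp h; apply/seteqP; split; apply: H=> //.
by rewrite -opprB; apply: (primeN pp).
Qed.

Section Orders.
Variables (w y : Y).
Hypotheses (wy : idy w `<=` idy y).
(** That y has codimension one in the closure of w, in terms of the primes of A; it makes the
    lengths below finite. *)
Hypothesis (Hbt : forall p, prime_ideal p -> idy w `<=` p -> p `<=` idy y -> p `<=` idy w \/ idy y `<=` p).
Let pw := idlP (w : qapt r).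
Let py := idlP (y : qapt r).

Lemma qlen_fin a : ~ idy w a -> len_fin (idy y) (idadd (idy w) a : set A^o) setT.
move=> wa; apply: (len_finite py noeA (L := set0)).
 by split; [exact: idadd_sm | exact: submodT | by [] | exact: noe_sub noeA | by []].
move=> q pq _ Hq qy; have [_ _ iM] := idaddI a (primeI pw).
have qI: idadd (idy w) a `<=` q.
 move=> b Ib; apply: Hq=> v _; have -> : b *: v = v * b by apply: mulrC.
 exact: iM.
have wq: idy w `<=` q by move=> b wb; apply: qI; apply: idaddS.
have [qw|//] := Hbt pq wq qy.
by case: wa; apply: qw; apply: qI; apply: idadd_x; apply: primeI.
Qed.
(** The quotient (w, a) / (w, ab) is A / (w, b), by the multiplication by [a] on the domain A /
    w. *)
Lemma qlenM a b : ~ idy w a -> ~ idy w b -> qlen y w (a * b) = (qlen y w a + qlen y w b)%N.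
move=> wa wb; have [w0 wD wM _ _] := pw.
have sub: idadd (idy w) (a * b) `<=` idadd (idy w) a.
 by move=> _ [j [x [wj ->]]]; exists j, (x * b); split=> //; ring.
have wab: ~ idy w (a * b) by apply: (primenM pw).
rewrite /qlen (len_add py (idadd_sm _ pw) (idadd_sm a pw) (submodT _) sub (subsetT _) (qlen_fin wab)).
congr _.
pose f : A^o -> A^o := fun x=> a *: x.
have fl: linmap f by split=> [u v|c v]; rewrite /f ?scalerDr // !scalerA mulrC.
have := len_map (idy y) fl (submodT _) (idadd_sm (a * b) pw); rewrite setTI.
have -> : f @^-1` idadd (idy w) (a * b) = idadd (idy w) b.
 apply/seteqP; split=> [x [j [c [wj e]]]|_ [j [c [wj ->]]]].
 exists (x - c * b), c; rewrite subrK.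
 have : idy w (a * (x - c * b)).
 have -> : a * (x - c * b) = j by rewrite mulrBr -[a * x]/(f x) e; ring.
 by [].
 by case/(primeM pw).
 exists (a * j), c; split; first exact: wM.
 by rewrite /f -[a *: _]/(a * _); ring.
have -> : msum (f @` setT) (idadd (idy w) (a * b)) = idadd (idy w) a.
 apply/seteqP; split=> [_ [_ [_ [[x _ <-] [j [c [wj ->]]] ->]]]|_ [j [c [wj ->]]]].
 exists j, (x + c * b); split=> //; rewrite /f -[a *: x]/(a * x).
 ring.
 exists (f c), j; split; [by exists c | exact: idaddS | ].
 by rewrite /f -[a *: _]/(a * c); ring.
lia.
Qed.
Lemma qlen_unit s : ~ idy y s -> qlen y w s = 0%N.
move=> ys; apply: len0=> //; first exact: idadd_sm.
apply: (len_killed ys)=> v _; exists 0, v; split; first by case: pw.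
by rewrite add0r; apply: mulrC.
Qed.
Lemma order_at_qlen (U : set Y) (f : sec Y U) n al be : open U -> U w -> germ (f : qasec U) (w : qapt r) al be ->
 ~ idy w al -> order_at w y f n -> n = (qlen y w al)%:Z - (qlen y w be)%:Z.
move=> oU Uw gf wal [V [a [b [la [lb [[oV Vy] [ua ub] nu [ola olb] ->]]]]]].
have [wbe _] := gf.
have Vw: V w by have [z [yz zV]] := oV y Vy; apply: zV=> /wy.
have [a0 [s0 [ys0 ga]]] := germ_loc a Vy.
have [b0 [s1 [ys1 gb]]] := germ_loc b Vy.
have ws0: ~ idy w s0 by move=> /wy.
have ws1: ~ idy w s1 by move=> /wy.
have wa0: ~ idy w a0 by apply/(unit_agerm oV Vw (ga w Vw ws0)).
have wb0: ~ idy w b0 by apply/(unit_agerm oV Vw (gb w Vw ws1)).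
rewrite (ord_lengthE wy oV Vy ys0 ga ola) (ord_lengthE wy oV Vy ys1 gb olb).
have Ww: (U `&` V) w by [].
have oW: open (U `&` V) by apply: openI.

have wE: idy w (b0 * al * s0 + - a0 * (s1 * be)).
 by apply: contrapT=> h; apply: nu; apply/(unit_agerm oW Ww (germD Ww (germM Ww (germ_res (@subIsetr _ U V) Ww (gb w Vw ws1)) (germ_res (@subIsetl _ U V) Ww gf))
 (germN Ww (germ_res (@subIsetr _ U V) Ww (ga w Vw ws0))))).
have e: qlen y w (b0 * al * s0) = qlen y w (a0 * (s1 * be)).
 by rewrite /qlen (idadd_eq pw (b := a0 * (s1 * be))) // -mulNr.
have : (qlen y w b0 + qlen y w al = qlen y w a0 + qlen y w be).

 by move: e; rewrite !qlenM ?(qlen_unit ys0) ?(qlen_unit ys1) ?addn0; do ?apply: (primenM pw).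
lia.
Qed.
Lemma order_at_glob al : ~ idy w al -> order_at w y (glob setT al : sec Y setT) (qlen y w al)%:Z.
have oT: open _ := @openT Y.
have w1 := prime1 pw.
exists setT, (glob setT al), (glob setT 1), (qlen y w al), 0%N; split.
- by [].
- by split; apply/unit_globE.
 have sT: [set: Y] `&` [set: Y] `<=` [set: Y] by [].
 have Wi: ([set: Y] `&` [set: Y]) w by [].
 have oW: open ([set: Y] `&` [set: Y]) by apply: openI.

 move/(unit_agerm oW Wi (germD Wi (germM Wi (germ_res sT Wi (gglob 1 I)) (germ_res sT Wi (gglob al I)))
 (germN Wi (germ_res sT Wi (gglob al I))))); have -> : 1 * al * 1 + - al * (1 * 1) = 0 by ring.
 by case: pw.
- split.
 apply: (ord_length_len wy oT I (prime1 py))=> [y' _ _|]; first exact: gglob.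
 exact: qlen_fin.
 have -> : 0%N = qlen y w 1 by rewrite (qlen_unit (prime1 py)).
 apply: (ord_length_len wy oT I (prime1 py))=> [y' _ _|]; first exact: gglob.
 exact: qlen_fin.
- lia.
Qed.

End Orders.

Lemma codim_between (w y : Y) i : codim_ge w i -> codim y i.+1 ->
 forall p, prime_ideal p -> idy w `<=` p -> p `<=` idy y -> p `<=` idy w \/ idy y `<=` p.
move=> cw cy p pp wp py; have [z ez] := idl_sub_in pp py; rewrite -ez in wp py *.
have [->|nw] := pselect (w = z); [by left | right].
by rewrite (codim_strict py (codim_ge_step wp nw cw) cy).
Qed.

Section Filtrations.
Variables (G : zmodType) (lam : mfun A G) (lamP : additiv set0 lam).
Hypothesis lamO : forall p, prime_ideal p -> (forall z : Y, idy z <> p) -> @lam A^o p setT = 0.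
Variables (i : nat) (H : set G).
Hypotheses (H0 : H 0) (HB : forall a b, H a -> H b -> H (a - b))
 (Hi : forall z : Y, codim_ge z i.+1 -> H (@lam A^o (idy z) setT)).

Definition cyclam (c : cycles Y i) : G := flin (fun z=> @lam A^o (idy (val z)) setT) c.

(** In a prime filtration of N'/N, a factor A/q with q of codimension i contributes q to the cycle;
    other factors contribute 0 or an element of H to [lam]. The subgroup H measures the error: it is
    everything if only the cycle is wanted, and 0 in the final application. *)
Lemma cycle_of (V : lmodType A) (N N' : set V) : mdom set0 N N' ->
 (forall z : Y, (forall b, (forall v, N' v -> N (b *: v)) -> idy z b) -> codim_ge z i) ->
 exists c : cycles Y i, (forall y, coeff y c = (len (idy (val y)) N N')%:Z) /\ H (lam N N' - cyclam c).
move=> D supp; have [Ns N's NN nN _] := D.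
have HD a b: H a -> H b -> H (a + b).
 by move=> Ha Hb; rewrite -[b]opprK; apply: HB=> //; rewrite -sub0r; apply: HB.
pose Q K := exists c : cycles Y i, (forall y, coeff y c = (len (idy (val y)) N K)%:Z) /\ H (lam N K - cyclam c).
apply: (filtration noeA (Q := Q) D).
 exists 0; split=> [y|].
 rewrite coeff0 len0 //; apply: len_ge_refl; exact: idlP.
 rewrite /cyclam flin0 subr0 (lam_refl lamP _) //.
 by split=> //; exact: noe_refl.
move=> K v [Ks NK KN] [c [cc Hc]] N'v pq; have cs := cyc_submod v Ks.
have Kc: K `<=` cyc K v by move=> k Kk; exists 0, k; rewrite add0r; split=> //; exists 0; rewrite ?scale0r.
have cN: cyc K v `<=` N'.
 move=> _ [_ [k [[b _ <-] Kk ->]]]; have [_ N'D N'Z] := N's; apply: N'D; last exact: KN.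
 exact: N'Z.
have Dc: mdom set0 K (cyc K v) by apply: dom_sub D.
have DNc: mdom set0 N (cyc K v).
 by apply: (dom_sub Ns cs _ _ cN D)=> //; apply: subset_trans Kc.
set q := [set c | _] in pq.
have annq b: (forall v, N' v -> N (b *: v)) -> q b by move=> h; apply: NK; apply: h.
have e1: lam N (cyc K v) = lam N K + @lam A^o q setT.
 by rewrite (proj1 lamP _ _ _ _ Ks NK Kc DNc) (cyc_iso noeA lamP Ks Dc).
have e2 (y : codim_pt Y i) : len (idy (val y)) N (cyc K v) = (len (idy (val y)) N K + len (idy (val y)) (q : set A^o) setT)%N.
 have py := idlP (val y).
 have ->: len (idy (val y)) (q : set A^o) setT = len (idy (val y)) K (cyc K v).
 have := len_map _ (lin_orbit v) (submodT _) Ks.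
 by rewrite setTI.
 apply: (len_add py)=> //; apply: len_fin_sub (@subset_refl _ N) cN _.
 apply: (len_finite py noeA D)=> p pp _ Hp p_y.
 have [z ez] := idl_sub_in pp p_y.
 have cz: codim_ge z i by apply: supp=> b hb; rewrite ez; apply: Hp.
 have cy: codim (val y) i by apply/asboolP; apply: (svalP y).
 rewrite -ez in p_y *; by rewrite (codim_strict p_y cz cy _).
have qs: submod (q : set A^o) by apply: prime_submod.
have nsub y: ~ q `<=` idy (val y) -> len (idy (val y)) (q : set A^o) setT = 0.
 move=> /existsNP[b /not_implyP[qb yb]]; apply: len0=> //; apply: (len_killed yb)=> u _.
 by have -> : b *: u = u * b by [apply: mulrC]; apply: (primeMl pq).
have [[z ez]|nz] := pselect (exists z : Y, idy z = q); last first.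
 exists c; rewrite e1 lamO ?addr0 //; last by move=> z ez; apply: nz; exists z.
 split=> // y; rewrite e2 nsub ?addn0 // => qy; apply: nz.
 exact: idl_sub_in qy.
have cz: codim_ge z i by apply: supp=> b hb; rewrite ez; apply: annq.
have [cz1|ncz1] := pselect (codim_ge z i.+1).
 exists c; split=> [y|].
 have cy: codim (val y) i by apply/asboolP; apply: (svalP y).
 rewrite e2 nsub ?addn0 // -ez=> zy; have [_ cy'] := cy.
 by apply: cy'; rewrite -(codim_strict zy cz1 cy _).
 rewrite e1 addrAC; apply: HD=> //; rewrite -ez; exact: Hi.
have cdz: codim z i by [].
pose zz : codim_pt Y i := exist _ z (asboolT cdz).
exists (c + << 1 *g zz >>); split=> [y|].
 rewrite coeffD cc e2 coeffU.
 have [<-|ne] := eqVneq zz y; first by rewrite -ez lenyE //; exact: idlP.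
 rewrite nsub // -ez=> zy; have cy: codim (val y) i by apply/asboolP; apply: (svalP y).
 by move/eqP: ne; apply; apply: val_inj; apply: (codim_strict zy cz cy _).
by rewrite e1 /cyclam flinD flinU ez opprD addrACA subrr addr0.
Qed.

End Filtrations.

Lemma idadd_supp (w z : Y) a i : codim_ge w i -> ~ idy w a ->
 (forall b, (forall v : A^o, [set: A^o] v -> idadd (idy w) a (b *: v)) -> idy z b) -> codim_ge z i.+1.
move=> cw wa Hz; have pw := idlP w.
have [_ _ iM] := idaddI a (primeI pw).
have sub: idadd (idy w) a `<=` idy z.
 move=> b Ib; apply: Hz=> v _; have -> : b *: v = v * b by apply: mulrC.
 exact: iM.
apply: codim_ge_step cw; first by move=> b wb; apply: sub; apply: idaddS.
by move=> e; apply: wa; rewrite e; apply: sub; apply: idadd_x; apply: primeI.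
Qed.
Lemma idadd_mdom (w : Y) a : mdom set0 (idadd (idy w) a : set A^o) setT.
have pw := idlP _.
by split; [exact: idadd_sm | exact: submodT | by [] | exact: noe_sub noeA | by []].
Qed.
Lemma qlen_notin (w y : Y) a : ~ idy w `<=` idy y -> qlen y w a = 0%N.
move=> /existsNP[b /not_implyP[wb yb]]; have pw := idlP w.
apply: len0=> //; first exact: idadd_sm.
apply: (len_killed yb)=> u _; apply: idaddS.
by have -> : b *: u = u * b by [apply: mulrC]; apply: (primeMl pw).
Qed.
Lemma div_ex (w : Y) i al : codim w i -> ~ idy w al ->
 exists c : cycles Y i.+1, (forall y, coeff y c = (qlen (val y) w al)%:Z) /\ principal_cycle c.
move=> cw wal; have [cw1 _] := cw.
(* With the zero function and H = [setT], [cycle_of] just says that the divisor is a finite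
   cycle. *)
have lamP: additiv set0 (fun (V : lmodType A) (N N' : set V)=> 0 : int) by [].
have [|||||c [cc _]] := @cycle_of int _ lamP _ i.+1 setT _ _ _ A^o _ setT (idadd_mdom w al).
all: try by [].
 by move=> z; apply: idadd_supp cw1 wal.
exists c; split=> //; exists i, w, setT, (glob setT al); split=> //.
- exact: openT.
- by apply/unit_globE.
move=> y; have cy: codim (val y) i.+1 by apply/asboolP; apply: (svalP y).
split=> [/closure_idl wy|nwy]; rewrite cc.
 by apply: order_at_glob=> //; apply: codim_between cw1 cy.
by rewrite -/(qlen _ w al) qlen_notin // => wy; apply: nwy; apply/closure_idl.
Qed.

Section Relations.
Variables (G : zmodType) (lam : mfun A G) (lamP : additiv set0 lam).
Hypothesis lamO : forall p, prime_ideal p -> (forall z : Y, idy z <> p) -> @lam A^o p setT = 0.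

(** Multiplication by [a] identifies A/w with the submodule (w, a)/w of A/w, so both have the same
    value and the quotient has value 0. *)
Lemma lam_idadd (w : Y) a : ~ idy w a -> @lam A^o (idadd (idy w) a) setT = 0.
move=> wa; have pw := idlP w; have ws := prime_submod pw.
have as_ := idadd_sm a pw.
have Dw: mdom set0 (idy w : set A^o) setT by split=> //; exact: noe_sub noeA.

pose f : A^o -> A^o := fun x=> a *: x.
have fl: linmap f by split=> [u v|c v]; rewrite /f ?scalerDr // !scalerA mulrC.
have eA: [set: A^o] `&` f @^-1` (idy w) = (idy w).
 rewrite setTI; apply/seteqP; split=> x; first by case/(primeM pw).
 exact: (primeMl pw).
have eC: msum (f @` setT) (idy w) = (idadd (idy w) a).
 apply/seteqP; split=> [_ [_ [j [[x _ <-] wj ->]]]|_ [j [c [wj ->]]]].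
 by exists j, x; split=> //; rewrite /f -[a *: x]/(a * _); ring.
 exists (f c), j; split=> //.
 by rewrite /f -[a *: _]/(a * c); ring.
have e2 := proj2 lamP _ _ f setT (idy w) fl; rewrite eA eC in e2.
have Dwa: mdom set0 (idy w : set A^o) (idadd (idy w) a) by apply: dom_sub Dw=> //; apply: idaddS.
move: (proj1 lamP _ _ _ _ as_ (idaddS a) (subsetT _) Dw); rewrite (e2 Dw Dwa)=> /eqP; rewrite -subr_eq0 opprD addNKr oppr_eq0.
by move/eqP.
Qed.

Variables (i : nat) (H : set G).
Hypotheses (H0 : H 0) (HB : forall a b, H a -> H b -> H (a - b))
 (Hi : forall z : Y, codim_ge z i.+1 -> H (@lam A^o (idy z) setT)).

(** If f is al/be at w, its divisor is the difference of the cycles of A/(w, al) and A/(w, be),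
    modules on which [lam] vanishes. *)
Lemma rel_principal (c : cycles Y i) : principal_cycle c -> H (cyclam lam c).
move=> [j [w [U [f [ei cw oU uf dv]]]]]; subst i; have [cw1 _] := cw.
have Uw: U w by have [V [_ Vw VU _]] := uf; apply: VU.
have [al [be gf]] := germ_ex f Uw.
have wal: ~ idy w al by apply/(unit_agerm oU Uw gf).
have [wbe _] := gf.
have [c1 [cc1 H1]] := @cycle_of G lam lamP lamO j.+1 H H0 HB Hi A^o _ setT (idadd_mdom w al) (fun z=> idadd_supp cw1 wal).
have [c2 [cc2 H2]] := @cycle_of G lam lamP lamO j.+1 H H0 HB Hi A^o _ setT (idadd_mdom w be) (fun z=> idadd_supp cw1 wbe).
have -> : c = c1 - c2.
 apply/eqP/freeg_eqP=> y; rewrite coeffB cc1 cc2 -/(qlen _ w al) -/(qlen _ w be).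
 have cy: codim (val y) j.+1 by apply/asboolP; apply: (svalP y).
 have [h1 h2] := dv y; have [wy|nwy] := pselect (idy w `<=` idy (val y)).
 by apply: (order_at_qlen wy (codim_between cw1 cy) oU Uw gf wal); apply: h1; apply/closure_idl.
 by rewrite h2 ?qlen_notin // => /closure_idl.
rewrite /cyclam flinB; rewrite !lam_idadd // !sub0r in H1 H2.
rewrite -[X in X - _]opprK -opprD addrC; have := HB H2 H1.
by rewrite opprD.
Qed.
Lemma rel_rat_triv (c : cycles Y i) : c \in @rat_triv F Y i -> H (cyclam lam c).
rewrite unfold_in=> /asboolP/(_ (fun c=> H (cyclam lam c))); apply.
- by rewrite /cyclam flin0.
- by move=> a b Ha Hb; rewrite /cyclam flinB; apply: HB.
- exact: rel_principal.
Qed.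

End Relations.

End Bridge.

(** * Charts in affine space *)

Section Evaluation.
Variables (F : fieldType) (A : cring) (j : F -> A) (jm : is_rmorph j) (c : nat -> A).

Definition evp (R : idomainType) (f : R -> A) (x : A) (p : {poly R}) : A :=
 \sum_(i < size p) f p`_i * x ^+ i.

Lemma evp_bound (R : idomainType) (f : R -> A) x n (p : {poly R}) : is_rmorph f -> (size p <= n)%N ->
 evp f x p = \sum_(i < n) f p`_i * x ^+ i.
move=> fm pn; rewrite /evp (big_ord_widen n (fun i=> f p`_i * x ^+ i) pn) [RHS](bigID (fun i : 'I_n=> (i < size p)%N)).
rewrite [X in _ = _ + X]big1 ?addr0 // => i; rewrite -leqNgt=> pi.
by rewrite nth_default // (rm0 fm) mul0r.
Qed.
Lemma evp_rm (R : idomainType) (f : R -> A) x : is_rmorph f -> is_rmorph (evp f x).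
move=> fm; have evB p q: evp f x (p - q) = evp f x p - evp f x q.
 set n := maxn (size p) (size q); rewrite (@evp_bound _ f x n _) //; last first.
 by apply: leq_trans (size_polyD _ _) _; rewrite size_polyN.
 rewrite (@evp_bound _ f x n p) ?leq_maxl // (@evp_bound _ f x n q) ?leq_maxr // -sumrB.
 by apply: eq_bigr=> i _; rewrite coefB (rmB fm) mulrBl.
have evC a: evp f x a%:P = f a.
 rewrite (@evp_bound _ f x 1 a%:P) //; last exact: size_polyC_leq1.
 by rewrite big_ord1 coefC mulr1.
have evD p q: evp f x (p + q) = evp f x p + evp f x q.
 have ev0: evp f x 0 = 0 by rewrite evC (rm0 fm).
 by rewrite -[q in LHS]opprK evB -[- q]sub0r evB ev0 sub0r opprK.
have evMC p a: evp f x (p * a%:P) = evp f x p * f a.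
 rewrite (@evp_bound _ f x (size p) _) //; last first.
 by rewrite mulrC mul_polyC size_scale_leq.
 rewrite mulr_suml; apply: eq_bigr=> i _.
 by rewrite coefMC (rmM fm) mulrAC.
have evMX p: evp f x (p * 'X) = evp f x p * x.
 rewrite (@evp_bound _ f x (size p).+1 _) //; last first.
 by apply: leq_trans (size_polyMleq _ _) _; rewrite size_polyX addn2.
 rewrite big_ord_recl coefMX (rm0 fm) mul0r add0r mulr_suml; apply: eq_bigr=> i _.
 by rewrite coefMX -mulrA -exprSr.
split=> //; split; first by rewrite evC (rm1 fm).
move=> p q; elim/poly_ind: q=> [|q a IH]; first by rewrite mulr0 evC (rm0 fm) mulr0.
by rewrite mulrDr evD mulrA evMX IH evMC evD evMX evC mulrDr mulrA.
Qed.
Lemma evpC (R : idomainType) (f : R -> A) x a : is_rmorph f -> evp f x a%:P = f a.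
move=> fm; rewrite (@evp_bound _ f x 1 a%:P) //; last exact: size_polyC_leq1.
by rewrite big_ord1 coefC mulr1.
Qed.
Lemma evpX (R : idomainType) (f : R -> A) x : is_rmorph f -> evp f x 'X = x.
move=> fm; rewrite /evp size_polyX !big_ord_recl big_ord0 !coefX (rm0 fm) (rm1 fm).
ring.
Qed.

Fixpoint ev n : ip F n -> A :=
 match n return ip F n -> A with 0=> j | n'.+1=> evp (@ev n') (c n') end.

Lemma ev_rm n : is_rmorph (@ev n).
by elim: n=> // n IH; apply: evp_rm. Qed.
Lemma evC n a : ev (ipC n a) = j a.
by elim: n=> //= n IH; rewrite evpC //; apply: ev_rm. Qed.
Lemma ev_var n i : (i < n)%N -> ev (var F n i) = c i.
elim: n=> // n IH; rewrite ltnS leq_eqVlt /=; case: eqP=> [-> _|_ im].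
 by rewrite evpX //; apply: ev_rm.
by rewrite evpC ?IH //; apply: ev_rm.
Qed.

End Evaluation.

Lemma ip_ext (F : fieldType) n (S : cring) (f g : ip F n -> S) : is_rmorph f -> is_rmorph g ->
 (forall a, f (ipC n a) = g (ipC n a)) -> (forall i, (i < n)%N -> f (var F n i) = g (var F n i)) -> f =1 g.
move=> fm gm HC HV; apply: ip_gen.
- by rewrite (rm1 fm) (rm1 gm).
- by move=> a b ea eb; rewrite (rmB fm) (rmB gm) ea eb.
- by move=> a b ea eb; rewrite (rmM fm) (rmM gm) ea eb.
- move=> x [[a _ <-]|/mapP[i]]; first exact: HC.
 by rewrite mem_iota=> /HV h ->.
Qed.

Section Charts.
Variables (F : fieldType) (A : cring) (jA : F -> A) (r : seq A) (jm : is_rmorph jA).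
Hypothesis noeA : noe (set0 : set A^o) setT.
Local Notation Y := (qascheme r jm).
Local Notation idy y := (idl (y : qapt r)).
Variables (n : nat) (e : ip F n -> A) (s : ip F n).
Hypotheses (em : is_rmorph e) (te : injective e).
Hypothesis (surj : forall b, exists N g, e s ^+ N * b = e g).
Hypothesis (sO : forall p, prime_ideal p -> ~ p (e s) -> exists2 x, x \in r & ~ p x).

Definition contr (p : set A) : set (ip F n) := [set g | p (e g)].
(** As [e] becomes an isomorphism when s is inverted, [contr] and [satur] are inverse bijections
    between primes that avoid s; [satur] avoids forming the localization. *)
Definition satur (P : set (ip F n)) : set A := [set b | exists N g, P g /\ e s ^+ N * b = e g].

Lemma contr_prime p : prime_ideal p -> prime_ideal (contr p).
move=> [P0 PD PM P1 PP]; rewrite /contr; split=> /=.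
- by rewrite (rm0 em).
- by move=> a b ha hb; rewrite (rmD em); apply: PD.
- by move=> a b hb; rewrite (rmM em); apply: PM.
- by rewrite (rm1 em).
- by move=> a b; rewrite (rmM em); apply: PP.
Qed.
Lemma emX g k : e (g ^+ k) = e g ^+ k. by elim: k=> [|k IH]; rewrite ?(rm1 em) // !exprS (rmM em) IH. Qed.
Lemma satur_ind P b N g : prime_ideal P -> ~ P s -> satur P b -> e s ^+ N * b = e g -> P g.
move=> pP Ps [M [h [Ph eh]]] eg.
have : s ^+ M * g = s ^+ N * h.
 by apply: te; rewrite !(rmM em) !emX -eh -eg mulrCA.
move=> eq; have : P (s ^+ M * g) by rewrite eq; apply: (primeMl pP).
by case/(primeM pP)=> // /(primeX pP).
Qed.
Lemma satur_prime P : prime_ideal P -> ~ P s -> prime_ideal (satur P).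
move=> pP Ps; split.
- by exists 0, 0; split; [case: pP | rewrite mulr0 (rm0 em)].
- move=> a b [N [g [Pg eg]]] [M [h [Ph eh]]]; exists (N + M), (s ^+ M * g + s ^+ N * h).
 split; first by apply: (primeD pP); apply: (primeMl pP).
 by rewrite (rmD em) !(rmM em) !emX -eg -eh exprD; ring.
- move=> a b [N [g [Pg eg]]]; have [M [h eh]] := surj a; exists (M + N), (h * g).
 by split; [exact: (primeMl pP) | rewrite (rmM em) -eh -eg exprD; ring].
- move=> u1; have : P 1 by apply: (satur_ind (N := 0) pP Ps u1); rewrite (rm1 em) mulr1.
 exact: prime1.
move=> a b uab; have [N [g eg]] := surj a; have [M [h eh]] := surj b.
have : P (g * h).
 by apply: (satur_ind (N := (N + M)) pP Ps uab); rewrite (rmM em) -eg -eh exprD; ring.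
by case/(primeM pP)=> Pg; [left; exists N, g | right; exists M, h].
Qed.
Lemma contr_satur P : prime_ideal P -> ~ P s -> contr (satur P) = P.
move=> pP Ps; apply/seteqP; split=> g; last by exists 0, g; rewrite mul1r.
by move=> ug; apply: (satur_ind (N := 0) pP Ps ug); rewrite mul1r.
Qed.
Lemma satur_contr p : prime_ideal p -> ~ p (e s) -> satur (contr p) = p.
move=> pp ps; apply/seteqP; split=> b.
 move=> [N [g [pg eg]]]; have : p (e s ^+ N * b) by rewrite eg.
 by case/(primeM pp)=> // /(primeX pp).
by have [N [g eg]] := surj b; exists N, g; split=> //; rewrite /contr /= -eg; apply: (primeMl pp).
Qed.
Lemma satur_mono P Q : P `<=` Q -> satur P `<=` satur Q.
by move=> PQ b [N [g [/PQ Pg eg]]]; exists N, g. Qed.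
Lemma satur_point P : prime_ideal P -> ~ P s -> exists y : Y, idy y = satur P.
move=> pP Ps; have pu := satur_prime pP Ps.
have us: ~ satur P (e s) by move=> h; apply: (Ps); rewrite -(contr_satur pP Ps).
by exists (exist _ (satur P) (conj pu (sO pu us))).
Qed.

Definition cdim (y : Y) : nat := idim (contr (idy y)).

Lemma cdim_lt (w y : Y) : ~ idy y (e s) -> idy w `<=` idy y -> w <> y -> (cdim y < cdim w)%N.
move=> ys wy ne; have pw := idlP w; have py := idlP y.
have ws: ~ idy w (e s) by move=> /wy.
apply: dim_lt; [exact: contr_prime | exact: contr_prime | by move=> g /wy | ].
move=> h; apply: ne; apply: idl_inj; apply/seteqP; split=> //.
by rewrite -(satur_contr py ys) -(satur_contr pw ws); apply: satur_mono.
Qed.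
Lemma chart_codim_le (y : Y) m : ~ idy y (e s) -> codim_ge y m -> (m + cdim y <= n)%N.
elim: m y=> [|m IH] y ys; first by move=> _; apply: dim_le.
move=> [c [c0 H]]; have [/closure_idl wy ne] := H 0 isT; rewrite c0 in wy ne.
have ws: ~ idy (c 1) (e s) by move=> /wy.
have h1: codim_ge (c 1) m by exists (fun k=> c k.+1); split=> // k km; apply: H.
have h2 := cdim_lt ys wy (fun e=> ne (esym e)).
by apply: leq_trans (IH _ ws h1); rewrite addSnnS leq_add2l.
Qed.
(** [tower_step] transported to Y: on the closure of w the last algebraic variable becomes free, and
    f is the equation that it satisfies at y. *)
Lemma chart_step (y : Y) : ~ idy y (e s) -> (0 < lastnf (contr (idy y)))%N ->
 exists (w : Y) f, [/\ idy w `<=` idy y /\ w <> y, idy y f /\ ~ idy w f, cdim w = (cdim y).+1,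
 (forall b, idy y b -> exists2 u, ~ idy y u & idadd (idy w) f (u * b))
 & (forall y' : Y, idy w `<=` idy y' -> idy y' f -> cdim y' = cdim y -> ~ idy y' (e s) ->
 y' = y \/ (lastnf (contr (idy y')) < lastnf (contr (idy y)))%N) /\
 (forall i, (i.+1 < lastnf (contr (idy y)))%N -> idy y (e (var F n i)) -> idy w (e (var F n i)))].
move=> ys ly; have py := idlP y;
have [W [f [[pW WP] [Pf Wf] dW gen [smp vars]]]] := tower_step (contr_prime py) ly.
have Ws: ~ W s by move=> /WP.
have [w ew] := satur_point pW Ws.
have wy: idy w `<=` idy y by rewrite ew -(satur_contr py ys); apply: satur_mono.
have dw: contr (idy w) = W by rewrite ew; apply: contr_satur.
have wf: ~ idy w (e f) by move=> h; apply: Wf; rewrite -dw.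
exists w, (e f); split.
- by split=> // e1; apply: wf; rewrite e1.
- by [].
- by rewrite /cdim dw.
- move=> b yb; have [N [g eg]] := surj b.
 have Pg: contr (idy y) g by rewrite /contr /= -eg; apply: (primeMl py).
 have [u [a [v [Pu Wv eu]]]] := gen g Pg.
 exists (e u * e s ^+ N); first by apply: (primenM py)=> //; apply: (primenX py).
 exists (e v), (e a); split; first by rewrite -[idy w _]/(contr _ v) dw.
 by rewrite -mulrA eg -!(rmM em) eu (rmD em) addrC.
- split.
 move=> y' wy' yf' dy' ys'; have py' := idlP y'.
 have [|eq|lt] := smp _ (contr_prime py') _ yf' dy'.
 + by move=> g Wg; apply: wy'; rewrite -[idy w _]/(contr _ g) dw.
 + left; apply: idl_inj; by rewrite -(satur_contr py' ys') -(satur_contr py ys) eq.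
 + lia.
 by move=> i il yv; rewrite -[idy w _]/(contr _ _) dw; apply: vars.
Qed.
Lemma chart_codim (y : Y) : ~ idy y (e s) -> codim y (n - cdim y).
move=> ys; split; last first.
 by move=> /(chart_codim_le ys); rewrite addSn subnK ?ltnn //; apply: dim_le.
move: {-2}(n - cdim y)%N (erefl (n - cdim y)%N)=> m; elim: m y ys=> [|m IH] y ys em1; first exact: codim_ge0.
have ly: (0 < lastnf (contr (idy y)))%N.
 have := dim_lastnf (contr (idy y)); rewrite -/(cdim y).
 lia.
have [w [f [[wy ne] _ dw _ _]]] := chart_step ys ly.
apply: (codim_ge_step wy ne); apply: IH; first by move=> /wy.
lia.
Qed.
Lemma chart_codimE (y : Y) i : ~ idy y (e s) -> codim y i -> (i + cdim y = n)%N.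
move=> ys cy; rewrite (codim_uniq cy (chart_codim ys)) subnK //; exact: dim_le.
Qed.
Lemma generic_point k : (k <= n)%N -> ~ cp F n k s ->
 exists g : Y, [/\ idy g = satur (cp F n k), ~ idy g (e s) & codim g k].
move=> kn ks; have pc := @cp_prime F n k; have [g eg] := satur_point pc ks.
have gs: ~ idy g (e s).
 by rewrite eg=> h; apply: (ks); rewrite -(contr_satur pc ks).
exists g; split=> //; have := chart_codim gs.
by rewrite /cdim eg contr_satur // cp_dim subKn.
Qed.
Lemma stratum_codim (y g : Y) k i : ~ idy y (e s) -> (forall l, (l < k)%N -> (l < n)%N -> idy y (e (var F n l))) ->
 idy g = satur (cp F n k) -> codim g k -> codim y i -> (k <= i)%N /\ (i = k -> y = g).
move=> ys yv eg cg cy; have py := idlP y.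
have cpy: cp F n k `<=` contr (idy y) by apply: cp_min=> //; apply: primeI; exact: contr_prime.
have gy: idy g `<=` idy y by rewrite eg -(satur_contr py ys); apply: satur_mono.
have [cg1 _] := cg; have H: (i <= k)%N -> y = g by move=> ik; rewrite (codim_strict gy cg1 cy).
split; last by move=> ei; apply: H; rewrite ei.
rewrite leqNgt; apply/negP=> ik; rewrite (H (ltnW ik)) in cy.
by move: ik; rewrite (codim_uniq cy cg) ltnn.
Qed.
Lemma cp_ideal k (I : set A) : ideal I -> (forall l, (l < k)%N -> (l < n)%N -> I (e (var F n l))) ->
 forall g, cp F n k g -> I (e g).
move=> [I0 ID IM] H; apply: (@cp_min F n k [set g | I _])=> //.
by split=> /=; [rewrite (rm0 em)| move=> a b; rewrite (rmD em); exact: ID | move=> a b; rewrite (rmM em); exact: IM].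
Qed.
Lemma lastnf_generic (y g : Y) k : ~ idy y (e s) -> (forall l, (l < k)%N -> (l < n)%N -> idy y (e (var F n l))) ->
 idy g = satur (cp F n k) -> (lastnf (contr (idy y)) <= k)%N -> y = g.
move=> ys yv eg lk; have py := idlP y; apply: idl_inj.
rewrite eg -(satur_contr py ys); congr satur; apply: generic_eq lk; first exact: contr_prime.
by apply: cp_min=> //; apply: primeI; exact: contr_prime.
Qed.

(* w is a point of codimension one less than g, and the coordinates that vanish
 at g lie locally in the ideal of w and f. *)
Lemma generic_qlen1 (w g : Y) f k : ~ idy g (e s) -> idy g = satur (cp F n k) -> idy w `<=` idy g -> idy g f ->
 (forall l, (l < k)%N -> (l < n)%N -> exists2 u, ~ idy g u & idadd (idy w) f (u * e (var F n l))) ->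
 forall b, idy g b -> exists2 u, ~ idy g u & idadd (idy w) f (u * b).
move=> gs eg wg gf H; have pg := idlP g.
have [i0 iD iM] := idaddI f (primeI (idlP w)).
have HI: forall h, cp F n k h -> exists2 u, ~ idy g u & idadd (idy w) f (u * e h).
 apply: (@cp_ideal k [set b | exists2 u, ~ idy g u & idadd _ f (u * b)])=> //; split=> /=.
 - by exists 1; [exact: prime1 | rewrite mulr0].
 - move=> a b [u gu ua] [v gv vb]; exists (u * v); first exact: (primenM pg).
 by rewrite mulrDr; apply: iD; [rewrite mulrAC mulrC; apply: iM | rewrite -mulrA; apply: iM].
 - by move=> a b [u gu ub]; exists u=> //; rewrite mulrCA; apply: iM.
move=> b; rewrite {1}eg=> -[N [h [/HI[u gu uh] eb]]].
exists (u * e s ^+ N); first by apply: (primenM pg)=> //; apply: (primenX pg).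
by rewrite -mulrA eb.
Qed.

End Charts.

Section Qlen.
Variables (F : fieldType) (A : cring) (jA : F -> A) (r : seq A) (jm : is_rmorph jA).
Hypothesis noeA : noe (set0 : set A^o) setT.
Local Notation Y := (qascheme r jm).
Local Notation idy y := (idl (y : qapt r)).

(** The ideals (w, a) and y agree after localization at y, so [a] is a local parameter there. *)
Lemma qlen1 (y w : Y) a i : codim_ge w i -> codim y i.+1 -> idy w `<=` idy y -> idy y a -> ~ idy w a ->
 (forall b, idy y b -> exists2 u, ~ idy y u & idadd (idy w) a (u * b)) -> qlen y w a = 1%N.
move=> cw cy wy ya wa H; have py := idlP y;
have sy: submod (idy y : set A^o) by split; [exact: prime0 | exact: primeD | move=> b v; exact: primeMl].
have s1 := idadd_sm a (idlP w).
have s2: idadd (idy w) a `<=` idy y.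
 by move=> _ [j [x [wj ->]]]; apply: (primeD py); [exact: wy | exact: (primeMl py)].
rewrite /qlen (len_add py s1 sy _ s2 _ (qlen_fin noeA (codim_between cw cy) wa)) ?lenyE //.
rewrite len0 // => -[c [H1 /(_ 0 isT) [_ [v cv Hv]]]].
have [_ N0 _] := H1 0 isT; have [_ _ N1] := H1 1 isT.
have [u yu h] := H _ (N1 _ cv); exact: (Hv u yu (N0 _ h)).
Qed.

End Qlen.

(** * Generation of cycles by the strata *)

Section Stratification.
Variables (F : fieldType) (A : cring) (jA : F -> A) (r : seq A) (jm : is_rmorph jA).
Hypothesis noeA : noe (set0 : set A^o) setT.
Local Notation Y := (qascheme r jm).
Local Notation idy y := (idl (y : qapt r)).
Variables (C : Type) (n : nat) (e : C -> ip F n -> A) (s : C -> ip F n) (k : C -> nat).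
Hypotheses (em : forall c, is_rmorph (e c)) (te : forall c, injective (e c)).
Hypothesis (surj : forall c b, exists N g, e c (s c) ^+ N * b = e c g).
Hypothesis (sO : forall c p, prime_ideal p -> ~ p (e c (s c)) -> exists2 x, x \in r & ~ p x).
Hypotheses (kn : forall c, (k c <= n)%N) (ks : forall c, ~ cp F n (k c) (s c)).
Variables (st : Y -> C) (lev : C -> nat) (M : nat).
Hypothesis levM : forall c, (lev c <= M)%N.
Hypothesis st_s : forall y, ~ idy y (e (st y) (s (st y))).
Hypothesis st_var : forall y l, (l < k (st y))%N -> (l < n)%N -> idy y (e (st y) (var F n l)).
Hypothesis st_lev : forall w y, idy w `<=` idy y ->
 (lev (st w) <= lev (st y))%N /\ (lev (st w) = lev (st y) -> st w = st y).
Hypothesis st_eq : forall w y, idy w `<=` idy y ->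
 (forall l, (l < k (st y))%N -> (l < n)%N -> idy w (e (st y) (var F n l))) -> st w = st y.

Lemma cycle_sub_gen i (H : set (cycles Y i)) : H 0 -> (forall a b, H a -> H b -> H (a - b)) ->
 forall D : cycles Y i, (forall y, coeff y D != 0 -> H << y >>) -> H D.
move=> H0 HB D HD; have HN a: H a -> H (- a) by move=> Ha; rewrite -sub0r; apply: HB.
have HA a b: H a -> H b -> H (a + b) by move=> Ha Hb; rewrite -[b]opprK; apply: HB=> //; apply: HN.
have Hn y m: H << y >> -> H << m%:Z *g y >>.
 move=> Hy; elim: m=> [|m IH]; first by rewrite freegU0.
 by rewrite -addn1 PoszD -freegUD; apply: HA.
rewrite -(freeg_sumE D) big_seq; elim/big_ind: _=> // y; rewrite mem_dom=> /HD Hy.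
case: (coeff y D)=> m; first exact: Hn.
by rewrite NegzE -freegUN; apply: HN; apply: Hn.
Qed.
(** If more variables are algebraic at y than vanish on its stratum, [chart_step] gives w and f such
    that y occurs once in the divisor of f on the closure of w. Every other point of that divisor
    lies in a stratum of higher level, or in the same stratum with smaller [lastnf]. *)
Lemma stratum_generators i (H : set (cycles Y i)) : H 0 -> (forall a b, H a -> H b -> H (a - b)) ->
 (forall c, principal_cycle c -> H c) ->
 (forall c (g : codim_pt Y i), idy (val g) = satur (e c) (s c) (cp F n (k c)) -> H << g >>) ->
 forall D, H D.
move=> H0 HB Hpr Hg D; apply: cycle_sub_gen=> // y _ {D}.
(* A lexicographic measure, first the level and then [lastnf], which is at most n. *)
pose mu y := ((M - lev (st y)) * n.+1 + lastnf (contr (e (st y)) (idy y)))%N.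
have [N] := ubnP (mu (val y)); elim: N y=> // N IH y; rewrite ltnS=> muy.
have cy: codim (val y) i by apply/asboolP; exact: valP y.
set c := st (val y); have ys := @st_s (val y); have yv := @st_var (val y).
have [g [eg gs cg]] := generic_point jm (@em c) (@te c) (@surj c) (@sO c) (kn c) (@ks c).
have [lk|lk] := leqP (lastnf (contr (e c) (idy (val y)))) (k c).
 by apply: (Hg c); rewrite (lastnf_generic _ _ ys yv eg lk).
have [w [f [[wy nwy] [yf wf] dw gen [smp vars]]]] :=
 chart_step (@em c) (@te c) (@surj c) (@sO c) ys (leq_ltn_trans (leq0n _) lk).
have ws: ~ idy w (e c (s c)) by move=> /wy.
have ey := chart_codimE (@em c) (@te c) (@surj c) (@sO c) ys cy.
have [j ei]: exists j, i = j.+1.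
 have h: (cdim (e c) w <= n)%N by apply: dim_le.
 exists i.-1.
 lia.
subst i.
have cw: codim w j.
 have := chart_codim (@em c) (@te c) (@surj c) (@sO c) ws; rewrite dw -[X in (X - _)%N]ey.
 by rewrite addSnnS addnK.
have [D [Dc Dpr]] := div_ex noeA cw wf.
have [cw1 _] := cw.
have q1: qlen (val y) w f = 1 by apply: (qlen1 noeA cw1 cy wy yf wf gen).
suff HD: H (D - << y >>) by rewrite -[<< y >>](subKr D); apply: HB=> //; apply: Hpr.
apply: cycle_sub_gen=> // y'; rewrite coeffB coeffU Dc.
have [<-|ne] := eqVneq y y'; first lia.
rewrite subr0=> q'.
have cy': codim (val y') j.+1 by apply/asboolP; exact: valP y'.
have wy': idy w `<=` idy (val y').
 by apply: contrapT=> h; rewrite (qlen_notin _ h) in q'.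
have yf': idy (val y') f.
 by apply: contrapT=> h; rewrite (qlen_unit _ h) in q'.
(* As [k c] is less than [lastnf], the coordinates that vanish on the stratum precede the variable
   freed by [chart_step], and they still vanish at w. *)
have sw: st w = c.
 apply: st_eq=> // l lk' ln; apply: vars; first exact: leq_ltn_trans lk.
 exact: yv.
have [l1 l2] := st_lev wy'; rewrite sw in l1 l2.
apply: IH; apply: leq_trans muy; rewrite /mu.
move: l1; rewrite leq_eqVlt=> /orP[/eqP l1|l1].
 have e1 := l2 l1; rewrite -!e1 ltn_add2l.
 have ys' := @st_s (val y'); rewrite -e1 in ys'.
 have ey' := chart_codimE (@em c) (@te c) (@surj c) (@sO c) ys' cy'.
 have [||//] := smp _ wy' yf' _ ys'; last by move=> e2; case/eqP: ne; apply: val_inj.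
 lia.
apply: (@leq_trans ((M - lev (st (val y'))).+1 * n.+1)).
 by rewrite mulSn addnC ltn_add2r ltnS lastnf_le.
apply: leq_trans (leq_addr _ _); rewrite leq_mul2r.
by apply: ltn_sub2l; apply: leq_trans l1 _.
Qed.

End Stratification.

Section Relations.
Variables (F : fieldType) (A : cring) (jA : F -> A) (r : seq A) (jm : is_rmorph jA).
Hypothesis noeA : noe (set0 : set A^o) setT.
Local Notation Y := (qascheme r jm).
Local Notation idy y := (idl (y : qapt r)).

Lemma qlen_supp (w y : Y) f : qlen y w f != 0%N -> idy w `<=` idy y /\ idy y f.
move=> q; split; apply: contrapT=> h; first by rewrite (qlen_notin _ h) in q.
by rewrite (qlen_unit _ h) in q.
Qed.
Lemma div_single (w : Y) i f (g : codim_pt Y i.+1) : codim w i -> ~ idy w f ->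
 (forall y : codim_pt Y i.+1, idy w `<=` idy (val y) -> idy (val y) f -> y = g) ->
 principal_cycle << (qlen (val g) w f)%:Z *g g >>.
move=> cw wf H; have [D [Dc Dpr]] := div_ex noeA cw wf.
suff -> : << (qlen (val g) w f)%:Z *g g >> = D by [].
apply/eqP/freeg_eqP=> y; rewrite coeffU Dc; have [<-|ne] := eqVneq g y; first by rewrite mulr1.
rewrite mulr0; have [->//|/qlen_supp[wy yf]] := eqVneq (qlen (val y) w f) 0.
by case/eqP: ne; rewrite (H y).
Qed.
Lemma div_double (w : Y) i f (g g' : codim_pt Y i.+1) : codim w i -> ~ idy w f -> g <> g' ->
 (forall y : codim_pt Y i.+1, idy w `<=` idy (val y) -> idy (val y) f -> y = g \/ y = g') ->
 principal_cycle (<< (qlen (val g) w f)%:Z *g g >> + << (qlen (val g') w f)%:Z *g g' >>).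
move=> cw wf /eqP gg H; have [D [Dc Dpr]] := div_ex noeA cw wf.
suff -> : << (qlen (val g) w f)%:Z *g g >> + << (qlen (val g') w f)%:Z *g g' >> = D by [].
apply/eqP/freeg_eqP=> y; rewrite coeffD !coeffU Dc; have [<-|ne] := eqVneq g y.
 by rewrite eq_sym (negbTE gg) mulr1 mulr0 addr0.
have [<-|ne'] := eqVneq g' y; first by rewrite mulr0 mulr1.
rewrite !mulr0; have [->//|/qlen_supp[wy yf]] := eqVneq (qlen (val y) w f) 0.
by have [e|e] := H y wy yf; [case/eqP: ne | case/eqP: ne'].
Qed.

End Relations.

Lemma fractions_gen (S S' : cring) (e : S -> S') (s : S) (L : set S') : is_rmorph e -> generated_by L ->
 (forall b, L b -> exists N g, e s ^+ N * b = e g) -> forall b, exists N g, e s ^+ N * b = e g.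
move=> em gl H; apply: gl=> //.
- by exists 0, 1; rewrite (rm1 em) mulr1.
- move=> a b [N [g eg]] [M [h eh]]; exists (N + M), (s ^+ M * g - s ^+ N * h).
 by rewrite (rmB em) !(rmM em) !(rmX _ em) -eg -eh exprD; ring.
- move=> a b [N [g eg]] [M [h eh]]; exists (N + M), (g * h).
 by rewrite (rmM em) -eg -eh exprD; ring.
Qed.

(** * Strata of R and their coordinates *)

Inductive xch := X0 | X1 | X2 | X3.
Inductive tch := T0 | T1 | T2 | T3 | T4.

(* Coordinates of B are numbered x1, y1, x2, y2, z, a, b, v1, v2, v3, w1, w2, w3. *)
Definition bcode S (c : nat -> S) (i : bix) : S :=
 match i with
 | bx1=> c 0%N | by1=> c 1%N | bx2=> c 2%N | by2=> c 3%N | bz=> c 4%N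
 | ba=> c 5%N | bb=> c 6%N | bv k=> c (7 + k)%N | bw k=> c (10 + k)%N
 end.

Definition bnum (i : nat) : bix :=
 nth bz [:: bx1; by1; bx2; by2; bz; ba; bb; bv 0%R; bv 1%R; bv 2%R; bw 0%R; bw 1%R; bw 2%R] i.

(** On a stratum the coordinates in [vX] vanish, the pivot [pX] is invertible and allows to solve
    the equation for [eX], and [oX], which contains the pivot, lists the free coordinates. A
    coordinate such as x1 on X2 vanishes by the equation and is therefore in [eX], not in [vX]. The
    second cone is treated alike; T3 and T4 have v = 0 with b, respectively a, invertible. *)
Definition vX a : seq nat := match a with X0=> [::] | X1=> [:: 0] | X2=> [:: 2; 4] | X3=> [:: 0; 1; 4] end.
Definition oX a : seq nat := match a with X0=> [:: 0; 2; 3; 4] | X1=> [:: 2; 1; 4] | X2=> [:: 1; 3] | X3=> [:: 3] end.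
Definition eX a : nat := match a with X0=> 1 | X1=> 3 | X2=> 0 | X3=> 2 end.
Definition pX a : nat := match a with X0=> 0 | X1=> 2 | X2=> 1 | X3=> 3 end.
Definition vT b : seq nat :=
 match b with T0=> [::] | T1=> [:: 7] | T2=> [:: 7; 8] | T3=> [:: 7; 8; 9] | T4=> [:: 7; 8; 9] end.
Definition oT b : seq nat :=
 match b with T0=> [:: 7; 8; 9; 11; 12; 5; 6] | T1=> [:: 8; 9; 10; 12; 5; 6] | T2=> [:: 9; 10; 11; 5; 6]
 | T3=> [:: 10; 11; 12; 6] | T4=> [:: 10; 11; 12; 5] end.
Definition eT b : nat := match b with T0=> 10 | T1=> 11 | T2=> 12 | T3=> 5 | T4=> 6 end.
Definition pT b : nat := match b with T0=> 7 | T1=> 8 | T2=> 9 | T3=> 6 | T4=> 5 end.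

Definition xn a : nat := match a with X0=> 0 | X1=> 1 | X2=> 2 | X3=> 3 end.
Definition tn b : nat := match b with T0=> 0 | T1=> 1 | T2=> 2 | T3=> 3 | T4=> 4 end.

Definition chart := (xch * tch)%type.
Definition kc (c : chart) : nat := size (vX c.1 ++ vT c.2).
Definition ts (c : chart) : seq nat := (vX c.1 ++ vT c.2) ++ (oX c.1 ++ oT c.2).

Section Equations.
Variable S : cring.
Implicit Type c : nat -> S.

Definition relX c := c 0%N * c 1%N + c 2%N * c 3%N = c 4%N * c 4%N.
Definition relT c := c 5%N * c 6%N = c 7%N * c 10%N + c 8%N * c 11%N + c 9%N * c 12%N.

Definition numX a c : S :=
 match a with X0 | X2=> c 4%N * c 4%N - c 2%N * c 3%N | X1 | X3=> c 4%N * c 4%N - c 0%N * c 1%N end.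
Definition numT b c : S :=
 match b with
 | T0=> c 5%N * c 6%N - (c 8%N * c 11%N + c 9%N * c 12%N)
 | T1=> c 5%N * c 6%N - (c 7%N * c 10%N + c 9%N * c 12%N)
 | T2=> c 5%N * c 6%N - (c 7%N * c 10%N + c 8%N * c 11%N)
 | T3 | T4=> c 7%N * c 10%N + c 8%N * c 11%N + c 9%N * c 12%N
 end.
(** The product of the pivot with h = a + b as a polynomial in chart coordinates; on T3 and T4 the
    equation removes the eliminated one of a, b, as in b (a + b) = b^2 + v.w. *)
Definition hpol b c : S :=
 match b with
 | T3=> c 6%N * c 6%N + numT T3 c
 | T4=> c 5%N * c 5%N + numT T4 c
 | _=> c (pT b) * (c 5%N + c 6%N)
 end.
Definition spol (k : chart) c : S := c (pX k.1) * c (pT k.2) * hpol k.2 c.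

Lemma bSol_code (F : fieldType) (j : F -> S) c : relX c -> relT c -> bSol j (bcode c).
move=> hx ht; split; first exact: hx.
by rewrite dotE !mxE.
Qed.
Lemma bcode_bnum c i : (i < 13)%N -> bcode c (bnum i) = c i.
by do 13? [case: i=> [//|i]]. Qed.
Lemma bSol_rel (F : fieldType) (j : F -> S) (c : bix -> S) : bSol j c -> relX (c \o bnum) /\ relT (c \o bnum).
by move=> [hx ht]; split; first exact: hx; rewrite /relT [LHS]ht dotE !mxE.
Qed.
Lemma eq_iff_sub (a b c d : S) : a - b = c - d \/ a - b = d - c -> a = b <-> c = d.
have H (x y z t : S) : x - y = z - t -> z = t -> x = y.
 by move=> e h; apply: subr0_eq; rewrite e h subrr.
case=> e; split; [exact: H _ | exact: H e | | by move=> h; apply: H e _].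
by move=> h; apply/esym; apply: H _ h.
Qed.
Lemma relX_pivot a c : relX c <-> c (pX a) * c (eX a) = numX a c.
by apply: eq_iff_sub; left; case: a=> /=; ring. Qed.
Lemma relT_pivot b c : relT c <-> c (pT b) * c (eT b) = numT b c.
by apply: eq_iff_sub; case: b=> /=; [right|right|right|left|left]; ring. Qed.
Lemma pol_ext (k : chart) c c' : {in ts k, c =1 c'} ->
 [/\ numX k.1 c = numX k.1 c', numT k.2 c = numT k.2 c', hpol k.2 c = hpol k.2 c' & spol k c = spol k c'].
move=> H.
have eX_: numX k.1 c = numX k.1 c' by case: (k) H=> -[] b H /=; rewrite !H; case: (b).
have eT_: numT k.2 c = numT k.2 c' by case: (k) H=> a [] H /=; rewrite !H; case: (a).
have eH: hpol k.2 c = hpol k.2 c' by case: (k) H eT_=> a [] H /= eT_; rewrite !H; case: (a).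
by rewrite /spol eH !H //; case: (k)=> -[] [].
Qed.
Lemma hpolE b c : relT c -> hpol b c = c (pT b) * (c 5%N + c 6%N).
by move=> h; case: b=> //=; rewrite -h; ring. Qed.

End Equations.

Lemma pol_map (S S' : cring) (f : S -> S') (k : chart) c : is_rmorph f ->
 [/\ f (numX k.1 c) = numX k.1 (f \o c), f (numT k.2 c) = numT k.2 (f \o c),
 f (hpol k.2 c) = hpol k.2 (f \o c) & f (spol k c) = spol k (f \o c)].
move=> fm; case: k=> a b; set k := (a, b).
have eX_: f (numX a c) = numX a (f \o c) by case: a {k} => /=; rewrite (rmB fm) !(rmM fm).
have eT_: f (numT b c) = numT b (f \o c).
 by case: b {k} => /=; rewrite ?(rmB fm) ?(rmD fm) !(rmM fm).
have eH: f (hpol b c) = hpol b (f \o c).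
 by case: b eT_ {k} => eT_; rewrite ?(rmD fm) ?(rmM fm) ?(rmD fm).
by rewrite !(rmM fm) eH.
Qed.

Arguments var : simpl never.
Arguments ip : simpl never.
Arguments ev : simpl never.

Section Charts.
Variable F : fieldType.
Local Notation B := (usol (@bSol F)).
Local Notation jB := (@ustr F _ (@bSol F)).
Definition coordB (i : nat) : B := ugen (@bSol F) (bnum i).
Local Notation gB := coordB.
Definition V (c : chart) (i : nat) : ip F 11 := var F 11 (index i (ts c)).
Definition ech (c : chart) : ip F 11 -> B := @ev F B jB (fun i=> gB (nth 0%N (ts c) i)) 11.
Definition sch (c : chart) : ip F 11 := spol c (V c).

Lemma ech_rm c : is_rmorph (ech c).
exact: (ev_rm (ustr_rm _)). Qed.
Lemma ts_size c : size (ts c) = 11%N.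
by case: c=> -[] []. Qed.
Lemma ts_uniq c : uniq (ts c).
by case: c=> -[] []. Qed.
Lemma ts_cover c i : (i < 13)%N -> (i \in ts c) || (i == eX c.1) || (i == eT c.2).
by case: c=> -[] []; do 13? [case: i=> [//|i]]. Qed.
Lemma ts_elim c : all (fun i=> (i != eX c.1) && (i != eT c.2)) (ts c).
by case: c=> -[] []. Qed.
Lemma ts_lt c : all (fun i=> (i < 13)%N) (ts c).
by case: c=> -[] []. Qed.
Lemma kc_le c : (kc c <= 11)%N.
by case: c=> -[] []. Qed.
Lemma ech_V c i : i \in ts c -> ech c (V c i) = gB i.
move=> ic; rewrite /ech ev_var ?nth_index //; first exact: ustr_rm.
by rewrite -(ts_size c) index_mem.
Qed.
Lemma gB_relX : relX gB.
by have [] := bSol_rel (bSol_gen F). Qed.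
Lemma gB_relT : relT gB.
by have [] := bSol_rel (bSol_gen F). Qed.
Lemma ech_pol c : [/\ ech c (numX c.1 (V c)) = numX c.1 gB, ech c (numT c.2 (V c)) = numT c.2 gB,
 ech c (hpol c.2 (V c)) = gB (pT c.2) * hB F & ech c (sch c) = gB (pX c.1) * gB (pT c.2) * (gB (pT c.2) * hB F)].
have [eX_ eT_ eH es] := pol_map c (V c) (ech_rm c).
have [//|fX fT fH fs] := @pol_ext B c (ech c \o V c) gB; first exact: ech_V.
have hE: hpol c.2 gB = gB (pT c.2) * hB F by exact: (hpolE c.2 gB_relT).
by split; rewrite ?eX_ ?eT_ ?eH ?es ?fX ?fT ?fH ?fs -?hE.
Qed.
Lemma pX_ts c : pX c.1 \in ts c. by case: c=> -[] []. Qed.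
Lemma pT_ts c : pT c.2 \in ts c. by case: c=> -[] []. Qed.
Lemma gB_gen : generated_by (range jB `|` [set` [seq gB i | i <- iota 0 13]]).
apply: usol_generated=> [a|i]; first by left.
right; apply/mapP.
have [m m13 ->]: exists2 m, (m < 13)%N & i = bnum m.
 have k3 (k : 'I_3) : k = 0%R \/ k = 1%R \/ k = 2%R.
 case: k=> [[|[|[|//]]] ?]; [left|right; left|right; right]; exact: val_inj.
 case: i=> [|||||||k|k]; [by exists 0|by exists 1%N|by exists 2%N|by exists 3|by exists 4%N|by exists 5|by exists 6| |].
 by have [->|[->|->]] := k3 k; [exists 7|exists 8|exists 9].
 by have [->|[->|->]] := k3 k; [exists 10|exists 11|exists 12].
by exists m; rewrite // mem_iota.
Qed.
Lemma gB_surj c (b : B) : exists N g, ech c (sch c) ^+ N * b = ech c g.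
have em := ech_rm c; have [enX enT ech_h es] := ech_pol c.
move: b; apply: (fractions_gen em gB_gen).
move=> b [[a _ <-]|/mapP[i]].
 by exists 0, (ipC 11 a); rewrite mul1r /ech evC //; exact: ustr_rm.
rewrite mem_iota=> /andP[_ /(ts_cover c)/orP[/orP[ic|/eqP->]|/eqP->]] -> {b}.
- by exists 0, (V c i); rewrite mul1r ech_V.
- exists 1, (V c (pT c.2) * hpol c.2 (V c) * numX c.1 (V c)).
 rewrite es !(rmM em) ech_h enX -(proj1 (relX_pivot c.1 gB) gB_relX) ech_V ?pT_ts; ring.
exists 1, (V c (pX c.1) * hpol c.2 (V c) * numT c.2 (V c)).
rewrite es !(rmM em) ech_h enT -(proj1 (relT_pivot c.2 gB) gB_relT) ech_V ?pX_ts; ring.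
Qed.

Local Notation K := {fraction ip F 11}.
Local Notation "x %:K" := (@FracField.tofrac (ip F 11) x) (at level 2).

Lemma V_neq0 c i : i \in ts c -> V c i != 0.
move=> ic; have im: (index i (ts c) < 11)%N by rewrite -(ts_size c) index_mem.
apply/eqP=> h; have : @ev F F id (fun=> 1) 11 (V c i) = 1 by rewrite ev_var.
rewrite h (rm0 (ev_rm (rm_id F) _ _))=> /eqP; by rewrite eq_sym oner_eq0.
Qed.

(* Specialise the coordinates that do not vanish on the stratum to 1, except b,
 which is specialised to 0 unless it is the pivot. *)
Lemma sch_nin c : ~ cp F 11 (kc c) (sch c).
pose u i : F := if i == 6 then (if c.2 is T3 then 1 else 0) else (i \in oX c.1 ++ oT c.2)%:R.
pose f := @ev F F id (fun i=> if (i < kc c)%N then 0 else u (nth 0 (ts c) i)) 11.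
have fm: is_rmorph f by exact: (ev_rm _).
have fV i: i \in ts c -> f (V c i) = u i.
 move=> ic; have im: (index i (ts c) < 11)%N by rewrite -(ts_size c) index_mem.
 rewrite /f (ev_var _) // nth_index //.
 have H: (index i (ts c) < kc c)%N -> u i = 0.
 have : all (fun i=> (index i (ts c) < kc c) ==> (i != 6) && (i \notin oX c.1 ++ oT c.2))%N (ts c).
 by case: (c)=> -[] [].
 move=> /allP/(_ i ic).
 by rewrite /u=> /implyP h /h/andP[/negbTE -> /negbTE ->].
 by case: ifP=> // /H.
have [_ _ _ fs] := pol_map c (V c) fm; have [//|_ _ _ us] := @pol_ext F c (f \o V c) u.
move=> h; have : f (sch c) = 0.
 apply: (@cp_min F 11 _ [set g | f g = 0]) h=> [|i ik i11].
 split=> /=; first exact: rm0.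
 by move=> a b fa fb; rewrite (rmD fm) fb addr0.
 by move=> a b fb; rewrite (rmM fm) fb mulr0.
 by rewrite /= /f ev_var ?ik.
rewrite fs us /spol /u; case: (c)=> -[] [] /=; rewrite !(mul1r, mulr1, mul0r, mulr0, add0r, addr0);
 by move/eqP; rewrite oner_eq0.
Qed.

Definition cK (c : chart) (i : nat) : K :=
 if i == eX c.1 then (numX c.1 (V c))%:K / (V c (pX c.1))%:K
 else if i == eT c.2 then (numT c.2 (V c))%:K / (V c (pT c.2))%:K else (V c i)%:K.

(** With the eliminated coordinates as rational functions, [cK] solves the equations of B in the
    fraction field. The map from B so defined restricts to the inclusion of the polynomial ring. *)
Lemma ech_inj c : injective (ech c).
have tm: is_rmorph (@FracField.tofrac (ip F 11)) by apply: rm_of.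
pose jK : F -> K := fun a=> (ipC 11 a)%:K.
have jm: is_rmorph jK by apply: (rm_comp (@ipC_rm F 11) tm).
have cE i: i \in ts c -> cK c i = (V c i)%:K.
 by move=> /(allP (ts_elim c))/andP[/negbTE e1 /negbTE e2]; rewrite /cK e1 e2.
have V0 i: i \in ts c -> (V c i)%:K != 0 by move=> /V_neq0; rewrite tofrac_eq0.
have [eX_ eT_ _ _] := pol_map c (V c) tm.
have [//|fX fT _ _] := @pol_ext K c (@FracField.tofrac _ \o V c) (cK c).
 by move=> i ic; rewrite cE.
have sx: relX (cK c).
 apply/(relX_pivot c.1); rewrite (cE _ (pX_ts c)).
 have -> : cK c (eX c.1) = numX c.1 (cK c) / (V c (pX c.1)) %:K by rewrite {1}/cK eqxx eX_ fX.
 by rewrite mulrC divfK // V0 // pX_ts.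
have sT: relT (cK c).
 apply/(relT_pivot c.2); rewrite (cE _ (pT_ts c)).
 have -> : cK c (eT c.2) = numT c.2 (cK c) / (V c (pT c.2)) %:K.
 by rewrite {1}/cK eqxx eT_ fT; have -> : eT c.2 == eX c.1 = false by case: (c)=> -[] [].
 by rewrite mulrC divfK // V0 // pT_ts.
have sK := bSol_code jK sx sT.
have um := uev_rm jm sK.
suff H g: uev jK (bcode (cK c)) (ech c g) = g%:K.
 by move=> g h eq; apply/eqP; rewrite -tofrac_eq -!H eq.
apply: (@ip_ext F 11 _ (fun g=> uev jK _ _)) g=> //.
- exact: (rm_comp (ech_rm c) um).
- by move=> a; rewrite /ech evC ?(uev_str jm sK) //; exact: ustr_rm.
move=> i i11; rewrite /ech ev_var //; last exact: ustr_rm.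
rewrite (uev_gen jm sK).
have it: nth 0 (ts c) i \in ts c by rewrite mem_nth ?ts_size.
have -> : bcode (cK c) (bnum (nth 0 (ts c) i)) = cK c (nth 0 (ts c) i).
 by apply: bcode_bnum; apply: (allP (ts_lt c)).
by rewrite cE // /V index_uniq ?ts_uniq ?ts_size.
Qed.

End Charts.

Lemma cp_nin (F : fieldType) n k i : (k <= i)%N -> (i < n)%N -> ~ cp F n k (var F n i).
move=> ki im h; pose f := @ev F F id (fun l=> if (l < k)%N then 0 else 1) n.
have fm: is_rmorph f by exact: (ev_rm _).
have : f (var F n i) = 0.
 apply: (@cp_min F n k [set g | f g = 0]) h=> [|l lk ln].
 split=> /=; first exact: rm0.
 by move=> a b fa fb; rewrite (rmD fm) fb addr0.
 by move=> a b fb; rewrite (rmM fm) fb mulr0.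
 by rewrite /= /f (ev_var _) ?lk.
by rewrite /f (ev_var _) // ltnNge ki=> /eqP; rewrite oner_eq0.
Qed.

(** * Generic points of the strata and divisors between them *)

Section Strata.
Variable F : fieldType.
Local Notation B := (usol (@bSol F)).
Local Notation gB := (coordB F).
Local Notation hB := (hB F).
Local Notation Y := (Rs F).
Local Notation idy y := (idl (y : qapt (rB F))).
Implicit Types (p q : set B) (c : chart) (y w : Y).

Definition stX p a := (forall i, i \in vX a -> p (gB i)) /\ ~ p (gB (pX a)).
Definition stT p b := (forall i, i \in vT b -> p (gB i)) /\ ~ p (gB (pT b)).

Lemma noeB : noe (set0 : set B^o) setT.
by have [l gl] := bgen F; apply: noeth_noe; apply: fg_noeth (ustr_rm _) gl. Qed.
Lemma gB_bk i : (i < 4)%N -> ugen _ (bk i) = gB i.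
by do 4? [case: i=> [//|i]]. Qed.
Lemma rB_mem i : (i < 4)%N -> hB * gB i \in rB F.
by move=> i4; rewrite -gB_bk //; apply: (map_f (fun i=> hB * ugen _ (bk i))); rewrite mem_iota. Qed.
Lemma pt_h y : ~ idy y hB.
by have [x /mapP[i _ ->] yx] := (svalP y).2=> h; apply: yx; exact: (primeMr (idlP y)). Qed.
Lemma pt_x y : ~ (forall i, (i < 4)%N -> idy y (gB i)).
have [x /mapP[i + ->] yx] := (svalP y).2; rewrite mem_iota=> i4 h; apply: yx.
by apply: (primeMl (idlP y)); rewrite gB_bk //; exact: h.
Qed.
(** The pivot of an earlier stratum is either listed in [vX], or it is the coordinate [eX], which
    the equation makes vanish. So closures of strata only meet later strata. *)
Lemma stX_low p a a' : prime_ideal p -> stX p a -> (xn a' < xn a)%N -> p (gB (pX a')).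
move=> pp [h1 h2]; have relE: p (gB (eX a)) \/ ~ p (numX a gB).
 have [pn|] := pselect (p (numX a gB)); [left | by right].
 by move: pn; rewrite -(proj1 (relX_pivot a gB) (gB_relX F))=> /(primeM pp)[].
case: a h1 h2 relE=> h1 h2 relE; case: a'=> // _; try exact: h1.
 by case: relE=> // -[]; apply: (primeB pp); apply: (primeMr pp); apply: h1.
case: relE=> // -[]; apply: (primeB pp); apply: (primeMr pp); exact: h1.
Qed.
Lemma stT_low p b b' : prime_ideal p -> stT p b -> (tn b' < tn b)%N -> p (gB (pT b')).
move=> pp [h1 h2]; case: b h1 h2=> h1 h2; case: b'=> // _; try exact: h1.
have : p (numT T4 gB) by do 2?[apply: (primeD pp)]; apply: (primeMr pp); exact: h1.
by rewrite -(proj1 (relT_pivot T4 gB) (gB_relT F))=> /(primeM pp)[].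
Qed.
Lemma stX_mono p q a a' : prime_ideal p -> p `<=` q -> stX p a -> stX q a' -> (xn a <= xn a')%N.
by move=> pp pq h1 [_ h2]; rewrite leqNgt; apply/negP=> /(stX_low pp h1)/pq.
Qed.
Lemma stT_mono p q b b' : prime_ideal p -> p `<=` q -> stT p b -> stT q b' -> (tn b <= tn b')%N.
by move=> pp pq h1 [_ h2]; rewrite leqNgt; apply/negP=> /(stT_low pp h1)/pq.
Qed.
Lemma xn_inj : injective xn. by move=> [] []. Qed.
Lemma tn_inj : injective tn. by move=> [] []. Qed.

Definition stP p c := stX p c.1 /\ stT p c.2.

Lemma stP_uniq p c c' : prime_ideal p -> stP p c -> stP p c' -> c = c'.
move=> pp [x1 t1] [x2 t2]; rewrite [c]surjective_pairing [c']surjective_pairing; congr pair.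
 by apply: xn_inj; apply/eqP; rewrite eqn_leq (stX_mono pp _ x1 x2) ?(stX_mono pp _ x2 x1).
by apply: tn_inj; apply/eqP; rewrite eqn_leq (stT_mono pp _ t1 t2) ?(stT_mono pp _ t2 t1).
Qed.
Lemma stP_ex y : exists c, stP (idy y) c.
have py := idlP y.
have [a ha]: exists a, stX (idy y) a.
 have [h0|h0] := pselect (idy y (gB 0)); last by exists X0.
 have [h2|h2] := pselect (idy y (gB 2)); last by exists X1; split=> // i; rewrite inE=> /eqP->.
 have h4: idy y (gB 4).
 have : idy y (gB 4 * gB 4).
 by rewrite -(gB_relX F); apply: (primeD py); apply: (primeMr py).
 by case/(primeM py).
 have [h1|h1] := pselect (idy y (gB 1)); last first.
 by exists X2; split=> // i; rewrite !inE=> /orP[]/eqP->.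
 exists X3; split=> [i|h3]; first by rewrite !inE=> /or3P[]/eqP->.
 by apply: (@pt_x y)=> -[|[|[|[|i]]]].
have [b hb]: exists b, stT (idy y) b.
 have [h7|h7] := pselect (idy y (gB 7)); last by exists T0.
 have [h8|h8] := pselect (idy y (gB 8)); last by exists T1; split=> // i; rewrite inE=> /eqP->.
 have [h9|h9] := pselect (idy y (gB 9)); last by exists T2; split=> // i; rewrite !inE=> /orP[]/eqP->.
 have hv i: i \in [:: 7; 8; 9] -> idy y (gB i) by rewrite !inE=> /or3P[]/eqP->.
 have [h6|h6] := pselect (idy y (gB 6)); last by exists T3.
 exists T4; split=> // h5; apply: pt_h; exact: (primeD py).
by exists (a, b).
Qed.

Definition st y : chart := sval (cid (stP_ex y)).
Lemma st_P y : stP (idy y) (st y). exact: svalP _. Qed.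
Lemma stP_s y c : stP (idy y) c -> ~ idy y (ech c (sch F c)).
move=> [[_ hx] [_ ht]]; have py := idlP y.
have [_ _ _ ->] := ech_pol F c.
by apply: (primenM py); [exact: (primenM py) | apply: (primenM py)=> //; exact: pt_h].
Qed.
Lemma ech_var c l : (l < kc c)%N -> exists2 i, i \in vX c.1 ++ vT c.2 & ech c (var F 11 l) = gB i.
move=> lk; have l11 := leq_trans lk (kc_le c).
exists (nth 0 (vX c.1 ++ vT c.2) l); first exact: mem_nth.
by rewrite /ech (ev_var (ustr_rm _)) //; rewrite nth_cat lk.
Qed.
Lemma stP_var p c l : stP p c -> (l < kc c)%N -> p (ech c (var F 11 l)).
move=> [[hx _] [ht _]] /ech_var[i + ->].
by rewrite mem_cat=> /orP[/hx|/ht].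
Qed.
Lemma sch_O c p : prime_ideal p -> ~ p (ech c (sch F c)) -> exists2 x, x \in rB F & ~ p x.
move=> pp; have [_ _ _ ->] := ech_pol F c=> ps.
have ph: ~ p hB by move=> h; apply: ps; do 2?[apply: (primeMl pp)].
have px: ~ p (gB (pX c.1)) by move=> h; apply: ps; do 2?[apply: (primeMr pp)].
exists (hB * gB (pX c.1)); last exact: (primenM pp).
by apply: rB_mem; case: c.1.
Qed.
Fact gpt_sig : {g : chart -> Y | forall c, [/\ idy (g c) = satur (ech c) (sch F c) (cp F 11 (kc c)),
 ~ idy (g c) (ech c (sch F c)) & codim (g c) (kc c)]}.
have H c: exists g : Y, [/\ idy g = satur (ech c) (sch F c) (cp F 11 (kc c)),
 ~ idy g (ech c (sch F c)) & codim g (kc c)].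
 exact: (generic_point _ (ech_rm F c) (@ech_inj F c) (gB_surj c) (@sch_O c)
 (kc_le c) (@sch_nin F c)).
by have [g Hg] := choice H; exists g.
Qed.
Definition gpt c : Y := sval gpt_sig c.
Lemma gptP c : [/\ idy (gpt c) = satur (ech c) (sch F c) (cp F 11 (kc c)), ~ idy (gpt c) (ech c (sch F c))
 & codim (gpt c) (kc c)].
exact: (svalP gpt_sig). Qed.
Lemma gpt_st c : stP (idy (gpt c)) c.
have [eg gs cg] := gptP c; have pg := idlP (gpt c).
have gv i: i \in vX c.1 ++ vT c.2 -> idy (gpt c) (gB i).
 move=> ic; have it: i \in ts c by rewrite mem_cat ic.
 rewrite eg -(ech_V F it); exists 0, (V F c i); rewrite mul1r; split=> //.
 have ik: (index i (ts c) < kc c)%N by rewrite index_cat ic index_mem.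
 by apply: cp_var=> //; apply: leq_trans (kc_le c).
have [_ _ _ es] := ech_pol F c; rewrite es in gs.
split; split=> [i ic|h]; try by apply: gv; rewrite mem_cat ic ?orbT.
 by apply: gs; do 2?[apply: (primeMr pg)].
by apply: gs; apply: (primeMr pg); apply: (primeMl pg).
Qed.
Lemma gpt_sub y c : stP (idy y) c -> idy (gpt c) `<=` idy y.
move=> h; have [eg _ _] := gptP c; have py := idlP y.
rewrite eg -(satur_contr (gB_surj c) py (stP_s h)).
apply: satur_mono; apply: cp_min.
 by apply: primeI; apply: contr_prime py; exact: ech_rm.
by move=> l lk _; apply: stP_var.
Qed.
Lemma gpt_codim y c i : stP (idy y) c -> codim y i -> (kc c <= i)%N /\ (i = kc c -> y = gpt c).
move=> h cy; have [eg _ cg] := gptP c.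
apply: (stratum_codim (ech_rm F c) (gB_surj c) (stP_s h) _ eg cg cy)=> l lk _.
exact: stP_var.
Qed.
(** A substitution that is the identity modulo the ideal of the stratum has a prime kernel inside
    this ideal, which yields a point y specialising to [gpt c]. To show that one generic point lies
    in the closure of another, it suffices to choose the substitution so that y falls into the right
    stratum. *)
Lemma specialize c (sg : nat -> ip F 11) : (forall i, i \in ts c -> cp F 11 (kc c) (sg i - V F c i)) ->
 exists y (f : ip F 11 -> ip F 11), [/\ idy y `<=` idy (gpt c), is_rmorph f,
 forall i, i \in ts c -> f (V F c i) = sg i & forall g, idy y (ech c g) <-> f g = 0].
move=> Hs; have [eg gs cg] := gptP c; have pc := @cp_prime F 11 (kc c).
pose f := @ev F (ip F 11) (@ipC F 11) (fun l=> sg (nth 0%N (ts c) l)) 11.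
have fm: is_rmorph f by exact: (ev_rm (@ipC_rm F 11)).
have f_id g: cp F 11 (kc c) (f g - g).
 apply: (@ip_gen F 11 (fun g=> cp F 11 (kc c) (f g - g))).
 - by rewrite (rm1 fm) subrr; case: pc.
 - move=> a b ha hb; rewrite (rmB fm) (_ : _ - _ = (f a - a) - (f b - b)); last by ring.
 exact: (primeB pc).
 - move=> a b ha hb; rewrite (rmM fm) (_ : _ - _ = (f a - a) * f b + a * (f b - b)); last by ring.
 by apply: (primeD pc); [apply: (primeMr pc) | apply: (primeMl pc)].
 move=> a [[x _ <-]|/mapP[l]].
 by rewrite /f (evC (@ipC_rm F 11)) subrr; case: pc.
 rewrite mem_iota=> /andP[_ l11] ->; rewrite /f (ev_var (@ipC_rm F 11)) //.
 have := Hs (nth 0%N (ts c) l); rewrite /V index_uniq ?ts_uniq ?ts_size //; apply.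
 by rewrite mem_nth ?ts_size.
pose P := [set g | f g = 0].
have pP: prime_ideal P.
 split; rewrite /P /=.
 - exact: rm0.
 - by move=> a b fa fb; rewrite (rmD fm) fb addr0.
 - by move=> a b fb; rewrite (rmM fm) fb mulr0.
 - by rewrite (rm1 fm)=> /eqP; rewrite oner_eq0.
 - by move=> a b /eqP; rewrite (rmM fm) mulf_eq0=> /orP[/eqP|/eqP]; [left|right].
have Pc: P `<=` cp F 11 (kc c).
 by move=> g fg; have := f_id g; rewrite [f g]fg sub0r=> /(primeN pc); rewrite opprK.
have Ps: ~ P (sch F c) by move=> /Pc; apply: sch_nin.
have [y ey] := satur_point (ustr_rm _) (ech_rm F c) (@ech_inj F c) (gB_surj c) (@sch_O c) pP Ps.
exists y, f; split=> //.
- by rewrite ey eg; apply: satur_mono.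
- move=> i ic; have im: (index i (ts c) < 11)%N by rewrite -(ts_size c) index_mem.
 by rewrite /f (ev_var (@ipC_rm F 11)) // nth_index.
have := contr_satur (ech_rm F c) (@ech_inj F c) pP Ps; rewrite -ey=> /seteqP[h1 h2].
by split; [exact: h1 | exact: h2].
Qed.
Lemma V_cp c i : i \in vX c.1 ++ vT c.2 -> cp F 11 (kc c) (V F c i).
move=> ic; have ik: (index i (ts c) < kc c)%N by rewrite index_cat ic index_mem.
by apply: cp_var=> //; apply: leq_trans (kc_le c).
Qed.

Opaque coordB.

Opaque V.

Lemma specialize_kill c (Z : seq nat) : {subset Z <= vX c.1 ++ vT c.2} ->
 exists y, [/\ idy y `<=` idy (gpt c), forall i, i \in Z -> idy y (gB i)
 & forall i, i \in ts c -> i \notin Z -> ~ idy y (gB i)].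
move=> sZ; have pc := @cp_prime F 11 (kc c).
have [|y [f [yg fm fV yf]]] := @specialize c (fun i=> if i \in Z then 0 else V F c i).
 move=> i _; case: ifP=> [/sZ iZ|_]; last by rewrite subrr; case: pc.
 by rewrite sub0r; apply: (primeN pc); apply: V_cp.
exists y; split=> // i iZ.
 have it: i \in ts c by rewrite mem_cat sZ.
 by rewrite -(ech_V F it); apply/yf; rewrite fV ?iZ.
move=> /negbTE nZ; rewrite -(ech_V F iZ)=> /yf; rewrite fV // nZ=> /eqP.
by apply/negP; apply: V_neq0.
Qed.
Lemma incl_st c c' y : idy y `<=` idy (gpt c') -> stP (idy y) c -> idy (gpt c) `<=` idy (gpt c').
by move=> h /gpt_sub h' b /h'/h. Qed.
Lemma incl_X01 b : idy (gpt (X0, b)) `<=` idy (gpt (X1, b)).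
have [|y [yg yZ yN]] := @specialize_kill (X1, b) (vT b); first by move=> i ib; rewrite mem_cat ib orbT.
by apply: (incl_st yg); split; split=> //=; apply: yN; case: (b).
Qed.
Lemma incl_X23 b : idy (gpt (X2, b)) `<=` idy (gpt (X3, b)).
have [|y [yg yZ yN]] := @specialize_kill (X3, b) ([:: 0; 4] ++ vT b).
 by move=> i; rewrite !mem_cat=> /orP[|->]; [rewrite !inE=> /orP[]->; rewrite ?orbT| rewrite orbT].
have py := idlP y.
have y0: idy y (gB 0) by apply: yZ.
have y4: idy y (gB 4) by apply: yZ.
have y2: idy y (gB 2).
 have : idy y (numX X3 gB) by apply: (primeB py); apply: (primeMr py).
 rewrite -(proj1 (relX_pivot X3 gB) (gB_relX F))=> /(primeM py)[] //.
 by move=> /yN h; exfalso; apply: h; case: (b).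
apply: (incl_st yg); split; [split=> [i|h] | split=> [i ib|]].
- by rewrite !inE=> /orP[]/eqP->.
- by move: h=> /yN h; apply: h; case: (b).
- by apply: yZ; rewrite mem_cat ib orbT.
by apply: yN; case: (b).
Qed.

Definition tsucc b b' := match b, b' with T0, T1 | T1, T2 | T2, T3 | T2, T4=> true | _, _=> false end.

Lemma incl_T a b b' : tsucc b b' -> idy (gpt (a, b)) `<=` idy (gpt (a, b')).
move=> bb; have sub: all (mem (vT b')) (vT b) && (pT b \in vT b') && (pT b \notin vX a ++ vT b).
 by case: b b' bb=> -[] //= _; case: a.
move/andP: sub=> [/andP[/allP sub pb] nb].
have [|y [yg yZ yN]] := @specialize_kill (a, b') (vX a ++ vT b).
 by move=> i; rewrite !mem_cat=> /orP[->//|/sub h]; apply/orP; right.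
have pt: pT b \in ts (a, b') by rewrite !mem_cat pb orbT.
apply: (incl_st yg); split; [split=> [i ia|] | split=> [i ib|]].
- by apply: yZ; rewrite mem_cat ia.
- by apply: yN; [exact: (pX_ts _) | case: (a); case: (b)].
- by apply: yZ; rewrite mem_cat ib orbT.
exact: yN.
Qed.
Lemma incl_X12 b : idy (gpt (X1, b)) `<=` idy (gpt (X2, b)).
pose c := (X2, b); have pc := @cp_prime F 11 (kc c).
have n7 i: (i < 7)%N -> (i \in vT b) = false.
 have : all (leq 7) (vT b) by case: (b).
 by move=> /allP h i7; apply/negP=> /h; rewrite leqNgt i7.
(* The substitution x2 |-> x2^2 y2, z |-> x2 y2 satisfies x2 y2 = z^2, so that x1 = 0, and it is
   trivial modulo (x2, z). Setting x2 or z alone to 0 would not keep the point on x1 = 0 with x2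
   nonzero. *)
have [sg [sT s2 s4 sE]] : exists sg : nat -> ip F 11, [/\ forall i, i \in vT b -> sg i = 0,
 sg 2%N = V F c 2 * V F c 2 * V F c 3, sg 4%N = V F c 2 * V F c 3
 & forall i, i \notin vT b -> i != 2%N -> i != 4%N -> sg i = V F c i].
 exists (fun i=> if i \in vT b then 0 else if i == 2%N then V F c 2 * V F c 2 * V F c 3
 else if i == 4%N then V F c 2 * V F c 3 else V F c i); split.
 - by move=> i ->.
 - by rewrite (n7 2%N isT); exact: erefl.
 - by rewrite (n7 4%N isT); exact: erefl.
 by move=> i /negbTE-> /negbTE-> /negbTE->.
have c2: cp F 11 (kc c) (V F c 2) by apply: V_cp.
have c4: cp F 11 (kc c) (V F c 4) by apply: V_cp.
have [|y [f [yg fm fV yf]]] := @specialize c sg.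
 move=> i _; have [ib|nb] := boolP (i \in vT b).
 by rewrite (sT _ ib) sub0r; apply: (primeN pc); apply: V_cp; rewrite mem_cat ib orbT.
 have [->|n2] := eqVneq i 2.
 by rewrite s2; apply: (primeB pc _ c2); do 2?[apply: (primeMr pc)].
 have [->|n4] := eqVneq i 4; last by rewrite sE // subrr; case: pc.
 by rewrite s4; apply: (primeB pc _ c4); apply: (primeMr pc).
have py := idlP y.
have yE i: i \in ts c -> idy y (gB i) <-> sg i = 0.
 by move=> it; rewrite -(ech_V F it) -fV.
have V0 i: i \in ts c -> V F c i <> 0 by move=> /(@V_neq0 F)/eqP.
have t1: 1 \in ts c by rewrite /c; case: (b).
have t2: 2 \in ts c by [].
have t3: 3 \in ts c by rewrite /c; case: (b).
have t4: 4 \in ts c by [].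
have s1: sg 1 = V F c 1 by apply: sE; rewrite ?n7.
have s3: sg 3 = V F c 3 by apply: sE; rewrite ?n7.
have y0: idy y (gB 0).
 have : idy y (numX X2 gB).
 have [<- _ _ _] := ech_pol F c; apply/yf.
 rewrite (rmB fm) !(rmM fm).
 have E (x2 x3 x4 u v : ip F 11) : x2 = u * u * v -> x3 = v -> x4 = u * v -> x4 * x4 - x2 * x3 = 0.
 by move=> -> -> ->; ring.
 exact: (E _ _ _ _ _ (etrans (fV _ t2) s2) (etrans (fV _ t3) s3) (etrans (fV _ t4) s4)).
 rewrite -(proj1 (relX_pivot X2 gB) (gB_relX F))=> /(primeM py)[] //.
 by move=> /(yE _ t1); rewrite s1=> /(V0 _ t1).
apply: (incl_st yg); split; [split=> [i|h] | split=> [i ib|h]].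
- by rewrite inE=> /eqP->.
- move: h=> /(yE _ t2); rewrite s2=> /eqP; rewrite !mulf_eq0 -orbA=> /or3P[]/eqP; exact: V0.
- have it: i \in ts c by rewrite !mem_cat ib orbT.
 by apply/(yE _ it); apply: sT.
have tp: pT b \in ts c := pT_ts c; move: h=> /(yE _ tp).
have p7: (5 <= pT b)%N by case: (b).
rewrite sE; first exact: V0.
- by case: (b).
- lia.
lia.
Qed.
(** The minimum reflects that T3 and T4 have the same codimension. *)
Lemma kcE c : kc c = (xn c.1 + minn (tn c.2) 3)%N.
by case: c=> -[] []. Qed.

(* On v = b = 0 the coordinate a is invertible, and conversely. *)
Lemma stT_34 p q b : prime_ideal p -> p `<=` q -> ~ q hB -> prime_ideal q -> stT p T3 -> stT q b -> b = T3.
move=> pp pq qh pq' h1 h2; have := stT_mono pp pq h1 h2; case: b h2=> // -[h2 h3] _.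
case: h3; apply: pq; have [hv hb] := h1.
have : p (numT T3 gB) by do 2?[apply: (primeD pp)]; apply: (primeMr pp); exact: hv.
by rewrite -(proj1 (relT_pivot T3 gB) (gB_relT F))=> /(primeM pp)[].
Qed.
(** The point lies in a later X-stratum and in no earlier T-stratum, and its codimension leaves room
    for one step only. So it is generic in the next X-stratum; only T3 and T4 have to be told apart,
    by [stT_34]. *)
Lemma div_X a a' b y : xn a' = (xn a).+1 -> idy (gpt (a, b)) `<=` idy y -> idy y (gB (pX a)) ->
 codim y (kc (a, b)).+1 -> y = gpt (a', b).
move=> ea wy yf cy; have pw := idlP (gpt (a, b));
have [/= gx gt] := gpt_st (a, b); have := st_P y; case: (st y)=> a2 b2 [/= yx yt].
have h1 := stX_mono pw wy gx yx; have h2 := stT_mono pw wy gt yt.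
have [h3 h4] := gpt_codim (conj yx yt : stP _ (a2, b2)) cy.
have h5: xn a != xn a2 by apply/eqP=> /xn_inj e; case: yx=> _; rewrite -e.
move: h3 h4; rewrite !kcE /= => h3 h4.
have hm: (minn (tn b) 3 <= minn (tn b2) 3)%N by lia.
have e1: xn a2 = (xn a).+1.
 apply/eqP.
 lia.
have e2: minn (tn b) 3 = minn (tn b2) 3.
 apply/eqP.
 lia.
rewrite h4; last by rewrite e1 -e2.
have -> : a2 = a' by apply: xn_inj; rewrite e1.
suff -> : b2 = b by [].
case: b {h3 h4 yf cy gx pw} wy gt h2 hm e2=> wy gt h2 hm e2; try by case: (b2) e2.

 by apply: (stT_34 (idlP (gpt (a, T3))) wy _ (idlP y) gt yt); apply: pt_h.
by case: (b2) h2 {yt e2 hm}.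
Qed.
Lemma div_T a b y : (tn b < 3)%N -> idy (gpt (a, b)) `<=` idy y -> idy y (gB (pT b)) ->
 codim y (kc (a, b)).+1 -> exists2 b', tsucc b b' & y = gpt (a, b').
move=> b3 wy yf cy; have pw := idlP (gpt (a, b)).
have [/= gx gt] := gpt_st (a, b); have := st_P y; case: (st y)=> a2 b2 [/= yx yt].
have h1 := stX_mono pw wy gx yx; have h2 := stT_mono pw wy gt yt.
have [h3 h4] := gpt_codim (conj yx yt : stP _ (a2, b2)) cy.
have h5: tn b != tn b2 by apply/eqP=> /tn_inj e; case: yt=> _; rewrite -e.
move: h3 h4; rewrite !kcE /= => h3 h4.
have ltt: (tn b < tn b2)%N by lia.
have e1: xn a2 = xn a.
 apply/eqP.
 lia.
have e2: minn (tn b2) 3 = (minn (tn b) 3).+1.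
 apply/eqP.
 lia.
exists b2; last by rewrite h4 ?e2 ?addnS (xn_inj e1).
by move: b3 e2 ltt; clear; case: b b2=> -[].
Qed.
Lemma qlen_gpt c c' f : kc c' = (kc c).+1 -> idy (gpt c) `<=` idy (gpt c') -> idy (gpt c') f -> ~ idy (gpt c) f ->
 (forall i, i \in vX c'.1 ++ vT c'.2 -> exists2 u, ~ idy (gpt c') u & idadd (idy (gpt c)) f (u * gB i)) ->
 qlen (gpt c') (gpt c) f = 1%N.
move=> ek cc gf wf H; have [eg gs cg] := gptP c'; have [_ _ [cw _]] := gptP c.
rewrite ek in cg; apply: (qlen1 noeB cw cg cc gf wf)=> b.
apply: (generic_qlen1 (ech_rm F c') gs eg cc gf)=> l lk _.
by have [i ic ->] := ech_var lk; apply: H.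
Qed.

(** The default 0 in other codimensions allows one formula for the generators in all degrees. *)
Definition gcyc (i : nat) c : cycles Y i :=
 match pselect (codim (gpt c) i) with
 | left h=> << (exist _ (gpt c) (asboolT h) : codim_pt Y i) >>
 | right _=> 0
 end.

Lemma gcyc_gen i c (y : codim_pt Y i) : val y = gpt c -> gcyc i c = << y >>.
have cy: codim (val y) i by apply/asboolP; exact: valP y.
move=> e; rewrite /gcyc; case: pselect=> [h|]; last by rewrite -e.
by congr (<< _ >>); apply: val_inj.
Qed.
Lemma gcyc0 i c : kc c != i -> gcyc i c = 0.
move=> ne; rewrite /gcyc; case: pselect=> // h; have [_ _ cg] := gptP c.
by rewrite (codim_uniq cg h) eqxx in ne.
Qed.
Lemma gpt_cod c i : kc c = i -> exists y : codim_pt Y i, val y = gpt c.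
by move=> <-; have [_ _ cg] := gptP c; exists (exist _ (gpt c) (asboolT cg)). Qed.
Lemma rel_single c c' f (m : nat) : kc c' = (kc c).+1 -> ~ idy (gpt c) f -> qlen (gpt c') (gpt c) f = m ->
 (forall y, codim y (kc c).+1 -> idy (gpt c) `<=` idy y -> idy y f -> y = gpt c') ->
 principal_cycle (gcyc (kc c).+1 c' *+ m).
move=> ek wf <- H; have [_ _ cw] := gptP c; have [y ey] := gpt_cod ek.
have := @div_single F B _ _ _ noeB _ _ f y cw wf; rewrite ey.
rewrite (gcyc_gen ey)=> h; have -> : << y >> *+ qlen (gpt c') (gpt c) f = << (qlen (gpt c') (gpt c) f)%:Z *g y >>.
 elim: (qlen _ _ _)=> [|l IH]; first by rewrite freegU0.
 by rewrite mulrSr IH freegUD -PoszD addn1.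
apply: h=> y' wy yf; apply: val_inj; rewrite ey; apply: H=> //.
by apply/asboolP; exact: valP y'.
Qed.
Lemma gpt_pX c : ~ idy (gpt c) (gB (pX c.1)). by have [[]] := gpt_st c. Qed.
Lemma gpt_pT c : ~ idy (gpt c) (gB (pT c.2)). by have [_ []] := gpt_st c. Qed.
Lemma gpt_v c i : i \in vX c.1 ++ vT c.2 -> idy (gpt c) (gB i).
by have [[h _] [h' _]] := gpt_st c; rewrite mem_cat=> /orP[/h|/h']. Qed.
Lemma local1 p q f x : prime_ideal q -> idadd p f x -> exists2 u, ~ q u & idadd p f (u * x).
by exists 1; [exact: prime1 | rewrite mul1r]. Qed.
(** The divisor of x1 on the closure of (X0, b). *)
Lemma rel_X1 b : principal_cycle (gcyc (kc (X0, b)).+1 (X1, b)).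

have inc := incl_X01; have f1: idy (gpt (X1, b)) (gB 0) by apply: gpt_v.
have f0: ~ idy _ _ := @gpt_pX (X0, b).
have q1: qlen (gpt (X1, b)) (gpt (X0, b)) (gB 0) = 1.
 apply: qlen_gpt=> // i; rewrite inE=> /orP[/eqP->|ib]; apply: (local1 (idlP (gpt (X1, b)))).
 exact: (idadd_x _ (primeI (idlP (gpt (X0, b))))).
 by apply: idaddS; apply: gpt_v.
apply: (rel_single _ f0 q1)=> // y cy wy yf.
exact: (div_X _) cy.
Qed.
(** The divisor of y1 on the closure of (X2, b), where x1 = x2 = z = 0. *)
Lemma rel_X3 b : principal_cycle (gcyc (kc (X2, b)).+1 (X3, b)).
have pw := idlP (gpt (X2, b));
have inc := incl_X23; have f1: idy (gpt (X3, b)) (gB 1) by apply: gpt_v.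
have f0: ~ idy _ _ := @gpt_pX (X2, b).
have w0: idy (gpt (X2, b)) (gB 0).
 by have [h _] := gpt_st (X2, b); apply: (stX_low (a' := X0) pw h).
have q1: qlen (gpt (X3, b)) (gpt (X2, b)) (gB 1) = 1.
 apply: qlen_gpt=> // i; rewrite mem_cat !inE=> /orP[/or3P[]/eqP->|ib]; apply: (local1 (idlP (gpt (X3, b)))).
 - exact: idaddS.
 - exact: (idadd_x _ (primeI pw)).
 - by apply: idaddS; apply: gpt_v.
 by apply: idaddS; apply: gpt_v; rewrite mem_cat ib orbT.
apply: (rel_single _ f0 q1)=> // y cy wy yf.
exact: (div_X _) cy.
Qed.
Lemma gpt_free c i : i \in oX c.1 ++ oT c.2 -> ~ idy (gpt c) (gB i).
move=> ic; have it: i \in ts c by rewrite mem_cat ic orbT.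
have [eg _ _] := gptP c; rewrite -(ech_V F it) eg=> h.
have := contr_satur (ech_rm F c) (@ech_inj F c) (@cp_prime F 11 _) (@sch_nin F c).
move=> /seteqP[/(_ _ h) + _]; apply: cp_nin.
 by have := ts_uniq c; rewrite index_cat; case: ifP=> [iv|_ _]; [rewrite cat_uniq=> /and3P[_ /hasPn/(_ i ic)/negP] | exact: leq_addr].
by rewrite -(ts_size c) index_mem.
Qed.

(* On the stratum x1 = 0 one has x2 y2 = z^2, and z is a local parameter at the
 next stratum, so that x2 vanishes there to order two. *)
Lemma rel_X2 b : principal_cycle (gcyc (kc (X1, b)).+1 (X2, b) *+ 2).
have pw := idlP (gpt (X1, b)); have py := idlP (gpt (X2, b)).
have inc := incl_X12.
have f0: ~ idy _ _ := @gpt_pX (X1, b).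
have w0: idy (gpt (X1, b)) (gB 0) by apply: gpt_v.
have y3: ~ idy (gpt (X2, b)) (gB 3) by apply: gpt_free.
have w3: ~ idy (gpt (X1, b)) (gB 3) by move=> /inc.
have eqz: idy (gpt (X1, b)) (gB 2 * gB 3 - gB 4 * gB 4).
 by rewrite -(gB_relX F) opprD addrCA subrr addr0; apply: (primeN pw); apply: (primeMr pw).
have z0: ~ idy (gpt (X1, b)) (gB 4).
 move=> h; have : idy (gpt (X1, b)) (gB 2 * gB 3).
 by rewrite -[_ * _](subrK (gB 4 * gB 4)); apply: (primeD pw)=> //; apply: (primeMr pw).
 by case/(primeM pw).
have [_ _ [cw _]] := gptP (X1, b); have [_ _ cy] := gptP (X2, b).
have q1: qlen (gpt (X2, b)) (gpt (X1, b)) (gB 4) = 1.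
 apply: qlen_gpt=> //; first exact: gpt_v.
 move=> i; rewrite mem_cat !inE=> /orP[/orP[]/eqP->|ib].
 - exists (gB 3)=> //; exists (gB 2 * gB 3 - gB 4 * gB 4), (gB 4).
 by split=> //; ring.
 - by apply: (local1 py); apply: (idadd_x _ (primeI pw)).
 by apply: (local1 py); apply: idaddS; apply: gpt_v; rewrite mem_cat ib orbT.
have bet := codim_between cw cy.
have q4: qlen (gpt (X2, b)) (gpt (X1, b)) (gB 4 * gB 4) = 2 by rewrite (qlenM noeB bet z0 z0) q1.
have q2: qlen (gpt (X2, b)) (gpt (X1, b)) (gB 2) = 2.
 have E (k l m : nat) : k = (l + m) -> m = 0 -> k = 2 -> l = 2 by lia.
 apply: E (qlenM noeB bet f0 w3) (qlen_unit _ y3) _.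
 by rewrite /qlen (idadd_eq pw eqz).
apply: (rel_single _ f0 q2)=> // y cy' wy yf.
exact: (div_X _) cy'.
Qed.
Lemma qlen_T a b b' : tsucc b b' -> qlen (gpt (a, b')) (gpt (a, b)) (gB (pT b)) = 1%N.
move=> bb; have pw := idlP (gpt (a, b)); have py := idlP (gpt (a, b')).
have sub: all (fun i=> (i == pT b) || (i \in vT b)) (vT b') && (pT b \in vT b').
 by case: b b' bb {pw py} => -[].
move/andP: sub=> [/allP sub pb].
apply: qlen_gpt.
- by rewrite !kcE; move: bb; clear; case: b b'=> -[] //= _; rewrite addnS.
- exact: incl_T.
- by apply: gpt_v; rewrite mem_cat pb orbT.
- exact: gpt_pT.
move=> i; rewrite mem_cat=> /orP[ia|/sub/orP[/eqP->|ib]]; apply: (local1 py).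
- by apply: idaddS; apply: gpt_v; rewrite mem_cat ia.
- exact: (idadd_x _ (primeI pw)).
by apply: idaddS; apply: gpt_v; rewrite mem_cat ib orbT.
Qed.
Lemma rel_T a b b' : (tn b < 2)%N -> tsucc b b' -> principal_cycle (gcyc (kc (a, b)).+1 (a, b')).
move=> b2 bb; rewrite -[gcyc _ _]mulr1n; apply: (rel_single _).
- by rewrite !kcE; move: bb; clear; case: b b'=> -[] //= _; rewrite addnS.
- exact: gpt_pT.
- exact: qlen_T.
move=> y cy wy yf; have [b'' bb'' ->] := div_T (leq_trans b2 (leqnSn _)) wy yf cy.
by move: b2 bb bb''; clear; case: b b' b''=> -[] [].
Qed.
(** The divisor of v3 on the closure of v1 = v2 = 0: there ab = v3 w3, so v3 = 0 splits into a = 0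
    and b = 0. *)
Lemma rel_T34 a : principal_cycle (gcyc (kc (a, T2)).+1 (a, T3) + gcyc (kc (a, T2)).+1 (a, T4)).
have k3: kc (a, T3) = (kc (a, T2)).+1 by rewrite !kcE addnS.
have k4: kc (a, T4) = (kc (a, T2)).+1 by [].
have [y3 e3] := gpt_cod k3; have [y4 e4] := gpt_cod k4; have [_ _ cw] := gptP (a, T2).
have := @div_double F B _ _ _ noeB _ _ _ y3 y4 cw (@gpt_pT _).
have q3: qlen (val y3) (gpt (a, T2)) (gB 9) = 1 by rewrite e3; exact: qlen_T.
have q4: qlen (val y4) (gpt (a, T2)) (gB 9) = 1 by rewrite e4; exact: qlen_T.
rewrite q3 q4 (gcyc_gen e3) (gcyc_gen e4); apply.
 move=> e; have : gpt (a, T3) = gpt (a, T4) by rewrite -e3 e.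
 move=> e'; have := gpt_st (a, T4); rewrite -e'=> h.
 by have := stP_uniq (idlP _) (gpt_st _) h.
move=> y wy yf; have cy: codim (val y) (kc (a, T2)).+1 by apply/asboolP; exact: valP y.
have [//|[] // _ ey] := div_T (b := T2) _ wy yf cy.
 by left; apply: val_inj; rewrite e3.
by right; apply: val_inj; rewrite e4.
Qed.

End Strata.

(** * Upper bound: four generators *)

Section Generators.
Variable F : fieldType.
Local Notation B := (usol (@bSol F)).
Local Notation Y := (Rs F).
Local Notation idy y := (idl (y : qapt (rB F))).
Local Notation gcyc := (@gcyc F).

Lemma rt_principal i (c : cycles Y i) : principal_cycle c -> c \in @rat_triv F Y i.
by move=> pc; apply/asboolP=> P _ _; apply. Qed.
Lemma rt_X1 i b : gcyc i (X1, b) \in @rat_triv F Y i.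
have [<-|/gcyc0 ->] := eqVneq (kc (X1, b)) i; last exact: rpred0.
exact: rt_principal (rel_X1 F b).
Qed.
Lemma rt_X2 i b : gcyc i (X2, b) *+ 2 \in @rat_triv F Y i.
have [<-|/gcyc0 ->] := eqVneq (kc (X2, b)) i; last by rewrite mul0rn rpred0.
exact: rt_principal (rel_X2 F b).
Qed.
Lemma rt_X3 i b : gcyc i (X3, b) \in @rat_triv F Y i.
have [<-|/gcyc0 ->] := eqVneq (kc (X3, b)) i; last exact: rpred0.
exact: rt_principal (rel_X3 F b).
Qed.
Lemma rt_T i a b b' : (tn b < 2)%N -> tsucc b b' -> gcyc i (a, b') \in @rat_triv F Y i.
move=> b2 bb; have [<-|/gcyc0 ->] := eqVneq (kc (a, b')) i; last exact: rpred0.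
have -> : kc (a, b') = (kc (a, b)).+1 by rewrite !kcE; move: b2 bb; case: b b'=> -[] //= _ _; rewrite addnS.
exact: rt_principal (rel_T F a b2 bb).
Qed.
Lemma rt_T34 i a : gcyc i (a, T3) + gcyc i (a, T4) \in @rat_triv F Y i.
have [<-|ne] := eqVneq (kc (a, T3)) i; last first.
 by rewrite !gcyc0 ?addr0 ?rpred0.
have -> : kc (a, T3) = (kc (a, T2)).+1 by rewrite !kcE addnS.
exact: rt_principal (rel_T34 F a).
Qed.

Definition gens i (n1 n2 n3 n4 : int) : cycles Y i :=
 gcyc i (X0, T0) *~ n1 + gcyc i (X0, T3) *~ n2 + gcyc i (X2, T0) *~ n3 + gcyc i (X2, T3) *~ n4.

(** Strata with X1, X3, T1 or T2 are rationally trivial, and T4 is the negative of T3. The products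
    of X0, X2 with T0, T3 remain. *)
Lemma CH_gen i (D : cycles Y i) : exists n1 n2 n3 n4, D - gens i n1 n2 n3 n4 \in @rat_triv F Y i.
pose H := [set D : cycles Y i | exists n1 n2 n3 n4, D - gens i n1 n2 n3 n4 \in @rat_triv F Y i].
have Hrt c: c \in @rat_triv F Y i -> H c.
 by exists 0, 0, 0, 0; rewrite /gens !addr0 subr0.
have HB a b: H a -> H b -> H (a - b).
 move=> [n1 [n2 [n3 [n4 h]]]] [m1 [m2 [m3 [m4 k]]]].
 exists (n1 - m1), (n2 - m2), (n3 - m3), (n4 - m4).
 rewrite (_ : _ - _ = (a - gens i n1 n2 n3 n4) - (b - gens i m1 m2 m3 m4)); first exact: rpredB.
 have -> : gens i (n1 - m1) (n2 - m2) (n3 - m3) (n4 - m4) = gens i n1 n2 n3 n4 - gens i m1 m2 m3 m4.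
 have E (V : zmodType) (x y z t x' y' z' t' : V) :
 x - x' + (y - y') + (z - z') + (t - t') = x + y + z + t - (x' + y' + z' + t').
 by rewrite (addrACA x) (addrACA (x + y)) (addrACA (x + y + z)) -!opprD.
 by rewrite /gens !mulrzBr E.
 by rewrite !opprD addrACA.
suff : H D by [].
have H0: H 0 by apply: Hrt; exact: rpred0.
have HA a b: H a -> H b -> H (a + b).
 by move=> ha hb; rewrite -[b]opprK -[- b]sub0r; apply: (HB)=> //; apply: (HB).
have HN a: H a -> H (- a) by rewrite -sub0r; apply: HB.
have Hg c: H (gcyc i c).
 have Hn b: tn b = 1 \/ tn b = 2 -> forall a, H (gcyc i (a, b)).
 case: b=> -[] // _ a; apply: Hrt; [exact: (@rt_T i a T0 T1) | exact: (@rt_T i a T1 T2)].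
 have H3 a: H (gcyc i (a, T3)) -> H (gcyc i (a, T4)).
 move=> h; rewrite -[gcyc i _](addKr (gcyc i (a, T3))); apply: HA; first exact: HN.
 by apply: Hrt; exact: rt_T34.
 have H1 b: H (gcyc i (X1, b)) by apply: Hrt; exact: rt_X1.
 have H3' b: H (gcyc i (X3, b)) by apply: Hrt; exact: rt_X3.
 have [g00 g03]: H (gcyc i (X0, T0)) /\ H (gcyc i (X0, T3)).
 by split; [exists 1, 0, 0, 0 | exists 0, 1, 0, 0]; rewrite /gens !addr0 ?add0r subrr rpred0.
 have [g20 g23]: H (gcyc i (X2, T0)) /\ H (gcyc i (X2, T3)).
 by split; [exists 0, 0, 1, 0 | exists 0, 0, 0, 1]; rewrite /gens ?addr0 !add0r subrr rpred0.
 have H1T a: H (gcyc i (a, T1)) by apply: Hn; left.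
 have H2T a: H (gcyc i (a, T2)) by apply: Hn; right.
 by case: c=> -[] [] //; apply: H3.
(* The level is the sum of the two positions, at most 3 + 4. Both positions grow under
   specialisation, so equal levels force equal strata. *)
have G := @stratum_generators F B _ _ _ (@noeB F) chart 11 _ _ kc
 (@ech_rm F) (@ech_inj F) (@gB_surj F) (@sch_O F) kc_le (@sch_nin F) (@st F) (fun c=> xn c.1 + tn c.2)%N 7%N.
apply: (G _ (fun y=> stP_s (st_P y)) (fun y l lk _=> stP_var (st_P y) lk) _ _ i H)=> // {G}.
- by move=> -[[] []].
- move=> w y wy; have pw := idlP w.
 have [[x1 t1] [x2 t2]] := (st_P w, st_P y).
 have h1 := stX_mono pw wy x1 x2; have h2 := stT_mono pw wy t1 t2.
 split=> [|e]; first exact: leq_add.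
 have e1: xn (st w).1 = xn (st y).1.
 lia.
 move: e; rewrite e1=> /addnI /tn_inj e2.
 by rewrite [LHS]surjective_pairing [RHS]surjective_pairing (xn_inj e1) e2.
- move=> w y wy H4; have [[x1 t1] [x2 t2]] := st_P y.
 apply: (stP_uniq (idlP w) (st_P w)).
 have wv j: j \in vX (st y).1 ++ vT (st y).2 -> idy w (coordB F j).
 move=> jc; have jt: j \in ts (st y) by rewrite mem_cat jc.
 have jk: (index j (ts (st y)) < kc (st y))%N by rewrite index_cat jc index_mem.
 rewrite -(ech_V F jt); exact: (H4 _ jk (leq_trans jk (kc_le _))).
 split; split=> [j jc|/wy //]; apply: wv; by rewrite mem_cat jc ?orbT.
- by move=> c /rt_principal/Hrt.
move=> c g eg; have [eg' _ _] := gptP F c.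
by rewrite -(@gcyc_gen F i c g) //; apply: idl_inj; rewrite eg.
Qed.

End Generators.

(** * Doubling of matrix factorizations *)

Section Doubling.
Variable B : cring.
Implicit Types (V : lmodType B).

Definition hl V n (u : V ^ (n + n)) : V ^ n := [ffun i=> u (lshift n i)].
Definition hr V n (u : V ^ (n + n)) : V ^ n := [ffun i=> u (rshift n i)].
Definition vglue V n (u v : V ^ n) : V ^ (n + n) :=
 [ffun i=> match fintype.split i with inl j=> u j | inr j=> v j end].

Lemma hl_glue V n (u v : V ^ n) : hl (vglue u v) = u.
by apply/ffunP=> i; rewrite !ffunE (fintype.unsplitK (inl i)). Qed.
Lemma hr_glue V n (u v : V ^ n) : hr (vglue u v) = v.
by apply/ffunP=> i; rewrite !ffunE (fintype.unsplitK (inr i)). Qed.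
Lemma half_eq V n (u v : V ^ (n + n)) : hl u = hl v -> hr u = hr v -> u = v.
move=> /ffunP el /ffunP er; apply/ffunP=> i; rewrite -[i]fintype.splitK; case: (fintype.split i)=> j.
 by have := el j; rewrite !ffunE.
by have := er j; rewrite !ffunE.
Qed.
Lemma hl_lin V n : linmap (@hl V n).
by split=> [u v|b v]; apply/ffunP=> i; rewrite !ffunE. Qed.
Lemma hr_lin V n : linmap (@hr V n).
by split=> [u v|b v]; apply/ffunP=> i; rewrite !ffunE. Qed.
Lemma pw_half V n (N : set V) (u : V ^ (n + n)) : pw N u <-> pw N (hl u) /\ pw N (hr u).
split=> [Nu|[Nl Nr] i]; first by split=> i; rewrite ffunE.
rewrite -[i]fintype.splitK; case: (fintype.split i)=> j; first by have := Nl j; rewrite ffunE.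
by have := Nr j; rewrite ffunE.
Qed.
Lemma hl_block V n (a b c d : 'M[B]_n) (u : V ^ (n + n)) :
 hl (mxact (block_mx a b c d) u) = mxact a (hl u) + mxact b (hr u).
apply/ffunP=> i; rewrite !ffunE big_split_ord; congr (_ + _); apply: eq_bigr=> j _; rewrite ffunE.
 by rewrite block_mxEul.
by rewrite block_mxEur.
Qed.
Lemma hr_block V n (a b c d : 'M[B]_n) (u : V ^ (n + n)) :
 hr (mxact (block_mx a b c d) u) = mxact c (hl u) + mxact d (hr u).
apply/ffunP=> i; rewrite !ffunE big_split_ord; congr (_ + _); apply: eq_bigr=> j _; rewrite ffunE.
 by rewrite block_mxEdl.
by rewrite block_mxEdr.
Qed.

(* From f g = Q to F G = Q + s t, with G = dbl g f s t. *)
Definition dbl n (f g : 'M[B]_n) (s t : B) : 'M[B]_(n + n) := block_mx f s%:M t%:M (- g).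

Lemma dbl_mul n (f g : 'M[B]_n) s t q : f *m g = q%:M -> g *m f = q%:M ->
 dbl f g s t *m dbl g f s t = (q + s * t)%:M.
move=> fg gf; rewrite mulmx_block mulmxN mulNmx mulmxN mulNmx opprK fg gf.
rewrite !(mul_mx_scalar, mul_scalar_mx) !subrr !scale_scalar_mx [t * s]mulrC -!raddfD [s * t + q]addrC.
by rewrite [RHS]scalar_mx_block.
Qed.

(* Strong null-homotopies of multiplication by l. *)
Definition snull n (f g : 'M[B]_n) (l : B) := exists r s : 'M[B]_n, r *m f + g *m s = l%:M /\ s *m g + f *m r = l%:M.

Lemma snull_sym n (f g : 'M[B]_n) l : snull f g l -> snull g f l.
by move=> [r [s [e1 e2]]]; exists s, r. Qed.
Lemma snull_nullh n (f g : 'M[B]_n) l : snull f g l -> nullh f g l.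
by move=> [r [s [e1 e2]]]; exists r, s. Qed.
Lemma snull_dbl n (f g : 'M[B]_n) s t l : snull f g l -> snull (dbl f g s t) (dbl g f s t) l.
move=> [r [q [e1 e2]]]; exists (block_mx r 0 0 (- q)), (block_mx q 0 0 (- r)).
rewrite !mulmx_block !(mul0mx, mulmx0, addr0, add0r) !mulNmx !mulmxN !opprK !add_block_mx.
by rewrite e1 e2 !(mul_mx_scalar, mul_scalar_mx) !subrr !addNr -scalar_mx_block.
Qed.
Lemma snull_s n (f g : 'M[B]_n) s t : snull (dbl f g s t) (dbl g f s t) s.
exists (block_mx 0 0 1%:M 0), (block_mx 0 0 1%:M 0).
rewrite !mulmx_block !(mul0mx, mulmx0, addr0, add0r, mul1mx, mulmx1) !add_block_mx !(addr0, add0r).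
by rewrite !subrr [RHS]scalar_mx_block.
Qed.
Lemma snull_t n (f g : 'M[B]_n) s t : snull (dbl f g s t) (dbl g f s t) t.
exists (block_mx 0 1%:M 0 0), (block_mx 0 1%:M 0 0).
rewrite !mulmx_block !(mul0mx, mulmx0, addr0, add0r, mul1mx, mulmx1) !add_block_mx !(addr0, add0r).
by rewrite !addNr [RHS]scalar_mx_block.
Qed.

End Doubling.

(** * Homology on the quotient by a prime *)

Section Evaluation.
Variables (B : cring) (G : zmodType).
Hypothesis noeB : noe (set0 : set B^o) setT.
Implicit Types (P : set B) (lam : mfun B G) (L : set B).
Local Notation T := (setT : set B^o).

Lemma addit_mono L1 L2 lam : L1 `<=` L2 -> additiv L1 lam -> additiv L2 lam.
move=> LL [A1 A2]; split=> [V N N' N'' N's NN' NN'' D|V W h A C hl D D'].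
 by apply: A1=> //; apply: dom_mono D.
by apply: A2=> //; [apply: dom_mono D | apply: dom_mono D'].
Qed.
Lemma prime_submodT P : prime_ideal P -> submod (P : set B^o).
by split; [exact: prime0 | exact: primeD | move=> b v; exact: primeMl]. Qed.
Lemma mdomQ L P : ideal P -> L `<=` P -> mdom L (P : set B^o) T.
move=> [P0 PD PM] LP; split=> //; first exact: noe_sub noeB.
by move=> l /LP Pl; exists 1=> v _; rewrite [_ *: _]mulrC; apply: PM.
Qed.

Section HalfDomain.
Variables (n : nat) (f g : 'M[B]_n) (q : B) (P : set B) (L : set B).
Hypotheses (pP : ideal P) (Pq : P q) (fg : f *m g = q%:M).
Hypothesis LP : forall l, L l -> snull f g l \/ P l.

Let Ps : submod (P : set B^o). by []. Qed.
Let pwP := @pw_sub B B^o n P Ps.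

Lemma pw_scale (x : B) (u : B^o ^ n) : P x -> pw (P : set B^o) (x *: u).
by move=> Px i; rewrite ffunE [_ *: _]mulrC; case: pP=> _ _; apply. Qed.
Lemma pw_fg (u : B^o ^ n) : pw (P : set B^o) (mxact f (mxact g u)).
by rewrite -mxactM fg mxactS; apply: pw_scale. Qed.
Lemma Bd_ZdQ : Bd g (P : set B^o) T `<=` Zd f (P : set B^o) T.
move=> u [w [v [_ Pv ->]]]; split=> //; have [fD _] := mxactL B^o f.
by rewrite fD; have [_ PD _] := pwP; apply: PD; [exact: pw_fg | exact: pw_act].
Qed.
(** A variant of [dom_H] for the module B/P: the product f g is zero only modulo P, as for the
    partial factorizations that occur when pairs are removed one by one. *)
Lemma mdomH : mdom L (Bd g (P : set B^o) T) (Zd f (P : set B^o) T).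
split; [exact: Bd_submod | exact: Zd_submod | exact: Bd_ZdQ | | ].
 apply: (noe_sub _ _ (noe_pw Ps (submodT _) (subsetT _) (noe_sub (sub0set _) (@subset_refl _ _) noeB))).
 move=> u Nu; exists 0, u; rewrite (lin0 (mxactL _ g)) add0r; split=> // i.
 by [].
move=> l /LP[/snull_nullh[r [s e]]|Pl]; exists 1=> u [N'u Nfu].
 exists (mxact s u), (mxact r (mxact f u)); split=> //; first exact: pw_act.
 by rewrite -mxactS e mxactD !mxactM addrC.
exists 0, (l *: u); rewrite (lin0 (mxactL _ g)) add0r; split=> //; exact: pw_scale.
Qed.

End HalfDomain.

Lemma pw_idadd n P t (u : B^o ^ n) : pw (idadd P t : set B^o) u ->
 exists p v : B^o ^ n, pw (P : set B^o) p /\ u = p + t *: v.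
move=> H; have /choice[p Hp] : forall i, exists p : B * B, P p.1 /\ u i = p.1 + p.2 * t.
 by move=> i; have [j [x [Pj e]]] := H i; exists (j, x).
exists [ffun i=> (p i).1], [ffun i=> (p i).2]; split=> [i|]; first by rewrite ffunE; case: (Hp i).
by apply/ffunP=> i; rewrite !ffunE; have [_ ->] := Hp i; rewrite [t *: _]mulrC.
Qed.
Lemma idadd_pw n P t (p v : B^o ^ n) : pw (P : set B^o) p -> pw (idadd P t : set B^o) (p + t *: v).
by move=> Pp i; exists (p i), (v i); rewrite !ffunE [t *: _]mulrC. Qed.
(** Modulo P the doubled matrix is triangular: it is the mapping cone of the multiplication by t,
    which is injective on B/P. So its homology is that of (g, f) on the cokernel B/(P, t), by
    projection to the lower half. *)
Lemma dbl_half n (f g : 'M[B]_n) s t P q L lam : additiv L lam -> prime_ideal P -> P s -> ~ P t -> P q ->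
 f *m g = q%:M -> g *m f = q%:M ->
 (forall l, L l -> snull (dbl f g s t) (dbl g f s t) l \/ P l) ->
 (forall l, L l -> snull f g l \/ idadd P t l) ->
 hml lam (dbl f g s t) (dbl g f s t) (P : set B^o) T = hml lam g f (idadd P t : set B^o) T.
move=> lamP pP Ps Pt Pq fg gf L1 L2; set F := dbl f g s t; set Gm := dbl g f s t; set P' := idadd P t.
have iP := primeI pP; have iP': ideal P' := idaddI t iP.
have PP': P `<=` P' by exact: idaddS.
have sP: submod (P : set B^o) by []. have sP': submod (P' : set B^o) by [].
have FG: F *m Gm = (q + s * t)%:M by apply: dbl_mul.
have Pqs: P (q + s * t) by apply: (primeD pP)=> //; apply: (primeMr pP).
have D1 := mdomH iP Pqs FG L1.
have D2: mdom L (Bd f (P' : set B^o) T) (Zd g (P' : set B^o) T).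
 by apply: (mdomH iP' (PP' _ Pq) gf)=> l /L2[/snull_sym|]; [left|right].
have fl := mxactL B^o f; have [fD fZ] := fl; have [gD gZ] := (mxactL B^o g).
have sw := @pw_sub B B^o n P sP; have [w0 wD wZ] := sw.
have zm (X Y Z W : B^o ^ n) : X - W = X - (Y + (Z + W)) + (Y + Z).
 by rewrite [Y + _]addrA (opprD _ W) [X + (_ - _)]addrA [RHS]addrAC subrK.
have wB (u v : B^o ^ n) := submodB (u := u) (v := v) sw.
have tinj u: pw (P : set B^o) (t *: u) -> pw (P : set B^o) u.
 by move=> H i; have := H i; rewrite ffunE=> /(primeM pP)[].
have eF (u : B^o ^ (n + n)) : hl (mxact F u) = mxact f (hl u) + s *: hr u /\ hr (mxact F u) = t *: hl u - mxact g (hr u).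
 by rewrite hl_block hr_block !mxactS mxactN.
have eG (u : B^o ^ (n + n)) : hl (mxact Gm u) = mxact g (hl u) + s *: hr u /\ hr (mxact Gm u) = t *: hl u - mxact f (hr u).
 by rewrite hl_block hr_block !mxactS mxactN.
have ps u: pw (P : set B^o) (s *: u) by exact: pw_scale.
have pq u: pw (P : set B^o) (mxact g (mxact f u)) by exact: (pw_fg iP Pq gf).
have pq' u: pw (P : set B^o) (mxact f (mxact g u)) by exact: (pw_fg iP Pq fg).
have e1: Zd F (P : set B^o) T `&` (@hr B B^o n) @^-1` Bd f (P' : set B^o) T = Bd Gm (P : set B^o) T.
 apply/seteqP; split=> [u [[_ Fu] [x [c [_ Pc ec]]]]|u Bu].
 have [p [w [Pp ew]]] := pw_idadd Pc; move: Fu=> /pw_half; have [-> ->] := eF u; move=> [_ Fr].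
 have h1: pw (P : set B^o) (hl u - mxact g w).
 apply: (tinj); have -> : t *: (hl u - mxact g w) = (t *: hl u - mxact g (hr u)) + (mxact g (mxact f x) + mxact g p).
 by rewrite ec ew !gD gZ scalerBr.
 apply: (wD)=> //; apply: (wD)=> //; exact: pw_act.
 exists (vglue w (- x)), (u - mxact Gm (vglue w (- x))); split=> //; last by rewrite addrC subrK.
 apply/pw_half.
 rewrite (linB _ _ (hl_lin _ _)) (linB _ _ (hr_lin _ _)); have [-> ->] := eG (vglue w (- x)).
 rewrite hl_glue hr_glue; split; first by rewrite opprD addrA; apply: (wB).
 by rewrite (linN _ fl) opprK ec ew addrCA (addrC (t *: w)) addrK.
 split; first exact: (Bd_ZdQ iP Pqs FG).
 case: Bu=> w [v [_ /pw_half[_ Pv] ->]]; have [hrD _] := hr_lin B^o n.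
 exists (- hr w), (hr v + t *: hl w); split=> //; first exact: idadd_pw.
 by rewrite hrD (proj2 (eG w)) (linN _ fl) [t *: _ - _]addrC -addrA [t *: _ + _]addrC.
have e2: msum ((@hr B B^o n) @` Zd F (P : set B^o) T) (Bd f (P' : set B^o) T) = Zd g (P' : set B^o) T.
 apply/seteqP; split=> [_ [_ [c [[z [_ Fz] <-] Bc ->]]]|u [_ gu]].
 have [_ ZD _] := Zd_submod g sP' (submodT B^o); apply: ZD; last exact: (Bd_ZdQ iP' (PP' _ Pq) gf).
 split=> //; move: Fz=> /pw_half; have [_ ->] := eF z; move=> [_ Fr].
 have -> : mxact g (hr z) = - (t *: hl z - mxact g (hr z)) + t *: hl z by rewrite opprB subrK.
 by apply: idadd_pw; exact: (submodN sw).
 have [p [x [Pp ex]]] := pw_idadd gu.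
 exists u, 0; split; [|exact: (let: And3 h _ _ := Bd_submod f sP' _ in h) | by rewrite addr0].
 exists (vglue x u); last exact: hr_glue.
 split=> //; apply/pw_half; have [-> ->] := eF (vglue x u); rewrite hl_glue hr_glue; split; last first.
 by rewrite ex opprD addrCA subrr addr0; exact: (submodN sw).
 apply: (wD)=> //; apply: (tinj); rewrite -fZ.
 have -> : t *: x = mxact g u - p by rewrite ex addrC addKr.
 by rewrite (linB _ _ fl); apply: (wB)=> //; exact: pw_act.
rewrite /hml -e1 -e2; apply: (proj2 lamP); rewrite ?e1 ?e2 //; exact: hr_lin.
Qed.

End Evaluation.

Section Reduction.
Variables (B : cring) (G : zmodType).
Hypothesis noeB : noe (set0 : set B^o) setT.
Implicit Types (P : set B) (lam : mfun B G) (L J : set B).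
Local Notation T := (setT : set B^o).

Lemma her_dbl n (f g : 'M[B]_n) s t P q L lam : additiv L lam -> prime_ideal P -> P s -> ~ P t -> P q ->
 f *m g = q%:M -> g *m f = q%:M ->
 (forall l, L l -> snull (dbl f g s t) (dbl g f s t) l \/ P l) ->
 (forall l, L l -> snull f g l \/ idadd P t l) ->
 her lam (dbl f g s t) (dbl g f s t) (P : set B^o) T = - her lam f g (idadd P t : set B^o) T.
move=> lamP pP Ps Pt Pq fg gf L1 L2; rewrite /her.
rewrite (dbl_half noeB lamP pP Ps Pt Pq fg gf L1 L2) (dbl_half noeB lamP pP Ps Pt Pq gf fg) ?opprB //.
 by move=> l /L1[/snull_sym|]; [left|right].
by move=> l /L2[/snull_sym|]; [left|right].
Qed.
Lemma mdom_pw L n (V : lmodType B) (N N' : set V) : mdom L N N' -> mdom L (@pw B V n N) (@pw B V n N').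
move=> [Ns N's NN nN LN]; split; [exact: pw_sub | exact: pw_sub | by move=> u Nu i; apply: NN | exact: noe_pw | ].
by move=> l /LN[k Hk]; exists k=> u Nu i; rewrite ffunE; apply: Hk.
Qed.
Lemma mdom_refl L (V : lmodType B) (N : set V) : submod N -> mdom L N N.
move=> Ns; split=> //; first exact: noe_refl.
by exists 1=> v Nv; have [_ _ NZ] := Ns; apply: NZ.
Qed.
Lemma lam_pw1 L lam (V : lmodType B) (N N' : set V) : additiv L lam -> mdom L N N' ->
 lam _ (@pw B V 1 N) (@pw B V 1 N') = lam _ N N'.
move=> lamP D; have [Ns N's NN _ _] := D.
pose p (u : V ^ 1) := u 0.
have pl: linmap p by split=> [u v|b v]; rewrite /p ffunE.
have e1: pw N' `&` p @^-1` N = pw N.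
 apply/seteqP; split=> [u [N'u Nu] i|u Nu]; first by rewrite ord1.
 by split=> [i|]; [apply: NN | exact: Nu].
have e2: msum (p @` pw N') N = N'.
 apply/seteqP; split=> [_ [_ [v [[u Nu <-] Nv ->]]]|v Nv].
 by have [_ ND _] := N's; apply: ND; [exact: Nu | exact: NN].
 exists v, 0; rewrite addr0; split=> //; last by case: Ns.
 by exists [ffun=> v]; rewrite ?/p ?ffunE // => i; rewrite ffunE.
have D1 := mdom_pw 1 D.
by rewrite -[in LHS]e1 -[in RHS]e2; apply: (proj2 lamP); rewrite ?e1 ?e2.
Qed.
(** The map [h] that moves the upper half of a vector to the lower half identifies the two halves,
    so each contributes the same value. This gives vanishing mod 2 in [vanish_double]. *)
Lemma lam_pw2 L lam n (V : lmodType B) (N N' : set V) : additiv L lam ->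
 submod N -> submod N' -> N `<=` N' -> mdom L (@pw B V (n + n) N) (@pw B V (n + n) N') ->
 exists x : G, lam _ (@pw B V (n + n) N) (@pw B V (n + n) N') = x + x.
move=> lamP Ns N's NN D1; have [Ps P's PP _ _] := D1.
pose h := @mxact B V _ _ (block_mx 0 0 1%:M 0 : 'M[B]_(n + n)).
have hl_: linmap h by apply: mxactL.
have hlE u: hl (h u) = 0 by rewrite hl_block !mxact0 addr0.
have hrE u: hr (h u) = hl u by rewrite hr_block mxactS mxact0 scale1r addr0.
pose K := [set u : V ^ (n + n) | pw N' u /\ pw N (hl u)].
have pw0 m X: submod X -> pw X 0 by move=> [X0 _ _] i; rewrite ffunE.
have Ks: submod K by apply: cap_sm P's (pre_submod (hl_lin V n) (pw_sub n Ns)).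
have NK: pw N `<=` K.
 by move=> u Nu; split; [exact: PP | have [] := proj1 (pw_half N u) Nu].
have KN: K `<=` pw N' by move=> u [].
exists (lam _ (pw N) K).
have -> := proj1 lamP _ _ _ _ Ks NK KN D1; congr (_ + _).
have e1: pw N' `&` h @^-1` pw N = K.
 apply/seteqP; split=> [u [N'u Nu]|u [N'u Nu]]; split=> //.
 by have [_] := proj1 (pw_half N _) Nu; rewrite hrE.
 by apply/pw_half; rewrite hlE hrE; split=> //; apply: pw0.
have e2: msum (h @` pw N') (pw N) = K.
 apply/seteqP; split=> [_ [_ [v [[u Nu <-] Nv ->]]]|u [N'u Nu]].
 have [_ KD _] := Ks; apply: KD; last exact: NK.
 split; last by rewrite hlE; apply: pw0.
 by apply/pw_half; rewrite hlE hrE; split; [exact: pw0 | have [] := proj1 (pw_half N' u) Nu].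
 have [_ N'r] := proj1 (pw_half N' u) N'u.
 exists (h (vglue (hr u) 0)), (vglue (hl u) 0); split.
 - exists (vglue (hr u) 0)=> //; apply/pw_half; rewrite hl_glue hr_glue; split=> //; exact: pw0.
 - by apply/pw_half; rewrite hl_glue hr_glue; split=> //; apply: pw0.
 apply: half_eq.
 by rewrite (proj1 (hl_lin V n)) hlE hl_glue add0r.
 by rewrite (proj1 (hr_lin V n)) hrE !(hl_glue, hr_glue) addr0.
rewrite -[in LHS]e1 -[in RHS]e2; apply: (proj2 lamP)=> //; rewrite ?e1 ?e2.
 exact: dom_sub D1.
exact: dom_sub D1.
Qed.
Lemma hml_1 L lam a b P : additiv L lam -> ideal P -> P a -> L `<=` idadd P b ->
 hml lam (a%:M : 'M_1) (b%:M : 'M_1) (P : set B^o) T = lam B^o (idadd P b) T.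
move=> lamP iP Pa Lb;
rewrite -(lam_pw1 lamP (mdomQ noeB (idaddI b iP) Lb)); congr (lam _ _ _).
 apply/seteqP; split=> [u [w [v [_ Pv ->]]]|u /pw_idadd[p [v [Pp ->]]]].
 by rewrite mxactS addrC; apply: idadd_pw.
 by exists v, p; rewrite mxactS addrC.
apply/seteqP; split=> [u []//|u Tu]; split=> //.
by rewrite mxactS=> i; rewrite ffunE [_ *: _]mulrC; case: iP=> _ _; apply.
Qed.
Lemma hml_0 L lam a b P : additiv L lam -> prime_ideal P -> ~ P a -> P b ->
 hml lam (a%:M : 'M_1) (b%:M : 'M_1) (P : set B^o) T = 0.
move=> lamP pP Pa Pb; rewrite /hml; have sw := @pw_sub B B^o 1 P (prime_submodT pP).
have -> : Bd (b%:M) (P : set B^o) T = @pw B B^o 1 P.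
 apply/seteqP; split=> [u [w [v [_ Pv ->]]]|u Pu].
 rewrite mxactS; have [_ wD _] := sw; apply: wD=> // i; rewrite ffunE; exact: (primeMr pP).
 by exists 0, u; rewrite mxactS scaler0 add0r.
have -> : Zd (a%:M) (P : set B^o) T = @pw B B^o 1 P.
 apply/seteqP; split=> [u [_ Pu] i|u Pu].
 by move: Pu; rewrite mxactS=> /(_ i); rewrite ffunE=> /(primeM pP)[].
 by split=> //; rewrite mxactS=> i; rewrite ffunE; apply: (primeMl pP).
exact: (lam_refl lamP (mdom_refl L sw)).
Qed.
Lemma her_1 L lam a b P : additiv L lam -> prime_ideal P -> P a -> ~ P b -> L `<=` idadd P b ->
 her lam (a%:M : 'M_1) (b%:M : 'M_1) (P : set B^o) T = lam B^o (idadd P b) T.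
move=> lamP pP Pa Pb Lb; rewrite /her (hml_1 lamP (primeI pP) Pa Lb).
by rewrite (hml_0 lamP pP Pb Pa) subr0.
Qed.
Lemma kos_1 L lam l P : additiv L lam -> prime_ideal P -> ~ P l -> L `<=` idadd P l ->
 kos lam l (P : set B^o) T = - lam B^o (idadd P l) T.
move=> lamP pP Pl Ll; have P0 := prime0 pP; rewrite /kos /her -[0 : 'M_1](raddf0 scalar_mx).
by rewrite (hml_0 lamP pP Pl P0) (hml_1 lamP (primeI pP) P0 Ll) sub0r.
Qed.

End Reduction.

(** * Vanishing on killed modules *)

Section Vanishing.
Variables (B : cring) (G : zmodType).
Implicit Types (lam : mfun B G) (L J : set B).

Definition killed J (V : lmodType B) (N N' : set V) := forall j, J j -> forall v, N' v -> N (j *: v).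
Definition vanish L J lam := forall (V : lmodType B) (N N' : set V), mdom L N N' -> killed J N N' -> lam V N N' = 0.

Lemma killed_H n (f g : 'M[B]_n) J (V : lmodType B) (N N' : set V) : submod N' -> killed J N N' ->
 killed J (Bd g N N') (Zd f N N').
move=> [N'0 _ _] K j Jj u [N'u _]; exists 0, (j *: u); rewrite (lin0 (mxactL V g)) add0r.
by split=> // i; rewrite ffunE //; apply: K.
Qed.
Lemma vanish_hml n (f g : 'M[B]_n) L J lam : f *m g = 0 -> vanish (L `|` nullh f g) J lam ->
 vanish L J (hml lam f g).
move=> fg v V N N' D K; have [_ N's _ _ _] := D; apply: v; first exact: dom_H.
exact: killed_H.
Qed.
Lemma vanish_mono L L' J J' lam : L `<=` L' -> J `<=` J' -> vanish L J lam -> vanish L' J' lam.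
move=> LL JJ v V N N' D K; apply: v; first exact: dom_mono D.
by move=> j /JJ; apply: K.
Qed.
Lemma vanish_her n (f g : 'M[B]_n) L J lam : f *m g = 0 -> g *m f = 0 ->
 vanish (L `|` (nullh f g `&` nullh g f)) J lam -> vanish L J (her lam f g).
move=> fg gf v V N N' D K; rewrite /her.
have sub1: L `|` (nullh f g `&` nullh g f) `<=` L `|` nullh f g by move=> l [|[]]; [left|right].
have sub2: L `|` (nullh f g `&` nullh g f) `<=` L `|` nullh g f by move=> l [|[]]; [left|right].
rewrite (vanish_hml fg (vanish_mono sub1 (@subset_refl _ J) v) D K).
by rewrite (vanish_hml gf (vanish_mono sub2 (@subset_refl _ J) v) D K) subr0.
Qed.
(** Kernel and cokernel of l are killed by l, which can therefore be added to [J]. *)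
Lemma vanish_kos L J l lam : vanish (l |` L) (l |` J) lam -> vanish L J (kos lam l).
move=> v V N N' D K; have [Ns N's NN _ _] := D.
have z1: (l%:M) *m (0 : 'M[B]_1) = 0 by rewrite mulmx0.
have z2: (0 : 'M[B]_1) *m (l%:M) = 0 by rewrite mul0mx.
have n1: nullh (l%:M : 'M[B]_1) 0 l by exists 1%:M, 0; rewrite mul1mx mul0mx addr0.
have n2: nullh 0 (l%:M : 'M[B]_1) l by exists 0, 1%:M; rewrite mulmx1 mul0mx add0r.
rewrite /kos /her /hml !v ?subr0 //.
- by apply: dom_mono (dom_H z2 D)=> x [->|]; [right|left].
- move=> j [->|Jj] u Zu; last exact: (@killed_H 1 0 l%:M J V N N' N's K j Jj u Zu).
 have [N'u _] := Zu; exists u, 0; rewrite mxactS addr0; split=> // i; rewrite ffunE; by case: Ns.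
- by apply: dom_mono (dom_H z1 D)=> x [->|]; [right|left].
move=> j [->|Jj] u Zu; last exact: (@killed_H 1 l%:M 0 J V N N' N's K j Jj u Zu).
have [_ Nu] := Zu; exists 0, (l *: u); rewrite (lin0 (mxactL V 0)) add0r -mxactS.
by split=> // i; rewrite ffunE; case: N's.
Qed.
Lemma vanish_unit L J lam : additiv L lam -> idg J 1 -> vanish L J lam.
move=> lamP J1 V N N' D K; have [Ns N's NN _ _] := D; apply: (lam_refl lamP D)=> v N'v.
have [N0 ND NZ] := Ns.
have : [set b | forall v, N' v -> N (b *: v)] 1.
 apply: (idg_min _ _ J1)=> //; split=> /=.
 - by move=> u _; rewrite scale0r.
 - by move=> a b ha hb u Nu; rewrite scalerDl; apply: ND; [exact: ha | exact: hb].
 - by move=> a b hb u Nu; rewrite -scalerA; apply: NZ; apply: hb.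
by move=> /(_ v N'v); rewrite scale1r.
Qed.

End Vanishing.

(** * Iterated matrix factorizations *)

Section Chains.
Variables (B : cring) (G : zmodType).
Hypothesis noeB : noe (set0 : set B^o) setT.
Implicit Types (P : set B) (lam : mfun B G) (L J : set B).
Local Notation T := (setT : set B^o).

Lemma snull_a a b : snull (a%:M : 'M[B]_1) b%:M a.
by exists 1%:M, 0; rewrite mulmx0 mul0mx mulmx1 mul1mx addr0 add0r. Qed.
Lemma snull_b a b : snull (a%:M : 'M[B]_1) b%:M b.
by exists 0, 1%:M; rewrite mulmx0 mul0mx mulmx1 mul1mx addr0 add0r. Qed.

Implicit Types (l : seq (B * B)) (a b z x : B).

(* The matrix factorization of a b + s1 t1 + ... + sr tr with last pair outermost first. *)
Fixpoint mfn l : nat := if l is _ :: l' then mfn l' + mfn l' else 1.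
Fixpoint mf l a b : 'M[B]_(mfn l) :=
 match l return 'M[B]_(mfn l) with [::]=> a%:M | p :: l'=> dbl (mf l' a b) (mf l' b a) p.1 p.2 end.
Fixpoint mfv l a b : B := if l is p :: l' then mfv l' a b + p.1 * p.2 else a * b.
Fixpoint mfe l a b : seq B := if l is p :: l' then [:: p.1, p.2 & mfe l' a b] else [:: a; b].

Lemma mfvC l a b : mfv l a b = mfv l b a.
by elim: l=> [|p l /= ->] //=; rewrite mulrC. Qed.
Lemma mf_mul l a b : mf l a b *m mf l b a = (mfv l a b)%:M.
elim: l a b=> [|p l IH] a b /=; first by rewrite -scalar_mxM.
by apply: dbl_mul; rewrite IH mfvC.
Qed.
Lemma snull_mf l a b x : x \in mfe l a b -> snull (mf l a b) (mf l b a) x.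
elim: l a b=> [|p l IH] a b; first by rewrite !inE=> /orP[]/eqP->; [exact: snull_a | exact: snull_b].
by rewrite !inE=> /or3P[/eqP->|/eqP->|/IH h]; [exact: snull_s | exact: snull_t | exact: snull_dbl].
Qed.

Fixpoint mfchain P l : Prop := if l is p :: l' then [/\ prime_ideal P, ~ P p.2 & mfchain (idadd P p.2) l'] else True.
Definition mfend P l := foldl (fun P p=> idadd P p.2) P l.
Definition mfin P l := forall p, p \in l -> P p.1.

Lemma mfv_in P l a b : ideal P -> P a -> mfin P l -> P (mfv l a b).
move=> [P0 PD PM] Pa; elim: l=> [|p l IH] h /=; first by rewrite mulrC; apply: PM.
apply: PD; last by rewrite mulrC; apply: PM; apply: h; rewrite inE eqxx.
by apply: IH=> q ql; apply: h; rewrite inE ql orbT.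
Qed.
Lemma mfe_step P p l a b L : ideal P -> P p.1 -> (forall x, L x -> x \in mfe (p :: l) a b \/ P x) ->
 forall x, L x -> x \in mfe l a b \/ idadd P p.2 x.
move=> iP P1 H x /H[|h]; last by right; exact: idaddS.
by rewrite /= => /or3P[/eqP->|/eqP->|]; [right; exact: idaddS | right; exact: idadd_x | left].
Qed.
Lemma mfin_step P p l : mfin P (p :: l) -> P p.1 /\ mfin (idadd P p.2) l.
by move=> h; split=> [|q ql]; [|apply: idaddS]; apply: h; rewrite inE ?eqxx ?ql ?orbT. Qed.
Lemma mfe_nil P a b L : ideal P -> P a -> (forall x, L x -> x \in mfe [::] a b \/ P x) -> L `<=` idadd P b.
move=> iP Pa H x /H[|h]; last exact: idaddS.
by rewrite !inE=> /orP[]/eqP->; [exact: idaddS | exact: idadd_x].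
Qed.
(** Each pair has its first entry in P and its second one regular on the quotient reached so far.
    [dbl_half] removes it and passes to the quotient by the second entry; the exchange of f and g
    causes the sign. *)
Lemma her_mf l a b L lam P : additiv L lam -> (forall x, L x -> x \in mfe l a b \/ P x) ->
 ideal P -> mfchain P l -> mfin P l -> P a -> prime_ideal (mfend P l) -> ~ mfend P l b ->
 her lam (mf l a b) (mf l b a) (P : set B^o) T = iter (size l) -%R (lam B^o (idadd (mfend P l) b) T).
move=> lamP; elim: l P=> [|p l IH] P HL iP.
 by move=> _ _ Pa pP nb; apply: (her_1 noeB lamP pP Pa nb); apply: mfe_nil HL.
move=> [pP n2 ch] hin Pa pe nb; have [P1 hin'] := mfin_step hin.
have HL' := mfe_step iP P1 HL;

rewrite [LHS](her_dbl noeB lamP pP P1 n2 (mfv_in b iP Pa (l := l) _)) ?mf_mul ?(IH _ HL' (idaddI p.2 iP) ch hin' (idaddS _ Pa) pe nb) //.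
- by move=> q ql; apply: hin; rewrite inE ql orbT.
- by rewrite mfvC.
- by move=> x /HL[/snull_mf|]; [left | right].
by move=> x /HL'[/snull_mf|]; [left | right].
Qed.
Lemma hml_mf l z L lam P : additiv L lam -> (forall x, L x -> x \in mfe l z z \/ P x) ->
 ideal P -> mfchain P l -> mfin P l -> P z ->
 hml lam (mf l z z) (mf l z z) (P : set B^o) T = lam B^o (mfend P l) T.
move=> lamP; elim: l P=> [|p l IH] P HL iP.
 move=> _ _ Pz; rewrite [LHS](hml_1 noeB lamP iP Pz (mfe_nil iP Pz HL)); congr (lam _ _ _).
 by apply/seteqP; split; [apply: idadd_min | exact: idaddS].
move=> [pP n2 ch] hin Pz; have [P1 hin'] := mfin_step hin.
have HL' := mfe_step iP P1 HL;
rewrite -(IH _ HL' (idaddI p.2 iP) ch hin' (idaddS _ Pz)).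
apply: (dbl_half noeB lamP pP P1 n2 (mfv_in z iP Pz (l := l) _)); rewrite ?mf_mul //.
- by move=> q ql; apply: hin; rewrite inE ql orbT.
- by move=> x /HL[/snull_mf|]; [left | right].
by move=> x /HL'[/snull_mf|]; [left | right].
Qed.

End Chains.

Section MoreVanishing.
Variables (B : cring) (G : zmodType).
Implicit Types (lam : mfun B G) (L J : set B).

(** The involution D conjugates f into -g modulo h. On modules killed by h it identifies ker f / im
    g with ker g / im f, so the Herbrand quotient vanishes. For 1 x 1 matrices this is a = -b modulo
    a + b. *)
Definition anticonj (h : B) n (f g : 'M[B]_n) := exists D K1 K2 : 'M[B]_n,
 [/\ D *m D = 1%:M, D *m f *m D + g = h *: K1 & D *m g *m D + f = h *: K2].

Lemma anticonj_1 a b : anticonj (a + b) (a%:M : 'M[B]_1) b%:M.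
by exists 1%:M, 1%:M, 1%:M; rewrite !(mul1mx, mulmx1) -!raddfD [b + a]addrC scale_scalar_mx mulr1.
Qed.
Lemma anticonj_dbl h n (f g : 'M[B]_n) s t : anticonj h f g -> anticonj h (dbl f g s t) (dbl g f s t).
move=> [D [K1 [K2 [DD e1 e2]]]]; exists (block_mx D 0 0 (- D)), (block_mx K1 0 0 (- K2)), (block_mx K2 0 0 (- K1)).
rewrite !mulmx_block !(mulmx0, mul0mx, addr0, add0r) !(mulmxN, mulNmx, opprK) DD -scalar_mx_block.
rewrite !add_block_mx !scale_block_mx !(mul_mx_scalar, mul_scalar_mx, scaler0, scalerN) -e1 -e2.
rewrite -!scalemxAl DD !scalemx1 !addNr !opprD.
by [].
Qed.
Lemma anticonj_mf l a b : anticonj (a + b) (mf l a b) (mf l b a).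
by elim: l=> [|p l IH]; [exact: anticonj_1 | exact: anticonj_dbl]. Qed.
Lemma vanish_anticonj h n (f g : 'M[B]_n) L lam : f *m g = 0 -> g *m f = 0 -> anticonj h f g ->
 additiv (L `|` (nullh f g `&` nullh g f)) lam -> vanish L [set h] (her lam f g).
move=> fg gf [D [K1 [K2 [DD e1 e2]]]] lamP V N N' dN K; have [Ns N's NN _ _] := dN.
have sub1: L `|` (nullh f g `&` nullh g f) `<=` L `|` nullh f g by move=> l [|[]]; [left|right].
have sub2: L `|` (nullh f g `&` nullh g f) `<=` L `|` nullh g f by move=> l [|[]]; [left|right].
have d1 := dom_mono sub1 (dom_H fg dN); have d2 := dom_mono sub2 (dom_H gf dN).
have [DlD DlZ] := (mxactL V D).
have [w0 wD wZ] := pw_sub n Ns.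
have wN u := submodN (v := u) (pw_sub n Ns); have wN' u := submodN (v := u) (pw_sub n N's).
have DDu u: mxact D (mxact D u) = u by rewrite -mxactM DD mxactS scale1r.
have hk M u: pw N' u -> pw N (mxact (h *: M) u).
 move=> Nu; rewrite -mul_scalar_mx mxactM mxactS=> i; rewrite ffunE; apply: K=> //.
 exact: (pw_act M N's Nu).
have swp (x y M : 'M[B]_n) : D *m x *m D + y = h *: M -> D *m x = h *: (M *m D) - y *m D.
 move=> e; have -> : D *m x = (D *m x *m D) *m D by rewrite -mulmxA DD mulmx1.
 by have -> : D *m x *m D = h *: M - y; [rewrite -e addrK| rewrite mulmxBl scalemxAl].
have Df u: mxact D (mxact f u) = mxact (h *: (K1 *m D)) u - mxact g (mxact D u).
 by rewrite -!mxactM (swp _ _ _ e1) mxactD mxactN.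
have Dg u: mxact D (mxact g u) = mxact (h *: (K2 *m D)) u - mxact f (mxact D u).
 by rewrite -!mxactM (swp _ _ _ e2) mxactD mxactN.

have E1: Zd f N N' `&` mxact D @^-1` Bd f N N' = Bd g N N'.
 apply/seteqP; split=> [u [_ [w [v [N'w Nv e]]]]|u Bu].
 exists (- mxact D w), (mxact (h *: (K1 *m D)) w + mxact D v); split.
 - by apply: wN'; apply: pw_act.
 - by apply: wD; [exact: hk | exact: pw_act].
 by rewrite -[u]DDu e DlD Df (linN _ (mxactL V g)) addrCA addrA.
 split; first exact: (Bd_Zd fg).
 case: Bu=> w [v [N'w Nv ->]].
 exists (- mxact D w), (mxact (h *: (K2 *m D)) w + mxact D v); split.
 - by apply: wN'; apply: pw_act.
 - by apply: wD; [exact: hk | exact: pw_act].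
 by rewrite DlD Dg (linN _ (mxactL V f)) addrCA addrA.
have E2: msum (mxact D @` Zd f N N') (Bd f N N') = Zd g N N'.
 apply/seteqP; split=> [_ [_ [c [[z [N'z Nz] <-] Bc ->]]]|u [N'u Nu]].
 have [_ ZD _] := Zd_submod g Ns N's; apply: ZD; last exact: (Bd_Zd gf).
 split; first exact: pw_act.
 have -> : mxact g (mxact D z) = mxact (h *: (K1 *m D)) z - mxact D (mxact f z) by rewrite Df subKr.
 by apply: wD; [exact: hk | apply: wN; exact: pw_act].
 exists u, 0; rewrite addr0; split=> //; last by case: (Bd_submod f Ns N's).
 exists (mxact D u); last exact: DDu.
 split; first exact: pw_act.
 have -> : mxact f (mxact D u) = mxact (h *: (K2 *m D)) u - mxact D (mxact g u) by rewrite Dg subKr.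
 by apply: wD; [exact: hk | apply: wN; exact: pw_act].
apply/eqP; rewrite subr_eq0 /hml -E1 -E2; apply/eqP.
by apply: (proj2 lamP); rewrite ?E1 ?E2.
Qed.
(** If f acts as zero, the homology is the whole of an even power of N'/N, and its value is twice
    another one. *)
Lemma vanish_double n (f : 'M[B]_(n + n)) L J lam : f *m f = 0 -> (forall x : G, x + x = 0) ->
 (forall (V : lmodType B) (N N' : set V) u, submod N -> submod N' -> killed J N N' -> pw N' u -> pw N (mxact f u)) ->
 additiv (L `|` nullh f f) lam -> vanish L J (hml lam f f).
move=> ff G2 fJ lamP V N N' dN K; have [Ns N's NN _ _] := dN.
have d := dom_H ff dN.
have eZ: Zd f N N' = pw N'.
 by apply/seteqP; split=> [u []//|u N'u]; split=> //; apply: fJ N'u.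
have eB: Bd f N N' = pw N.
 apply/seteqP; split=> [u [w [v [N'w Nv ->]]]|u Nu].
 by have [_ wD _] := pw_sub (n + n) Ns; apply: wD=> //; apply: fJ N'w.
 by exists 0, u; rewrite (lin0 (mxactL V f)) add0r; split=> // i; rewrite ffunE; case: N's.
rewrite eZ eB in d; rewrite /hml eZ eB.
by have [x ->] := lam_pw2 lamP Ns N's NN d.
Qed.
Lemma mf_kill l a b J (V : lmodType B) (N N' : set V) u : [set` mfe l a b] `<=` J ->
 submod N -> submod N' -> killed J N N' -> pw N' u -> pw N (mxact (mf l a b) u).
move=> + Ns N's K.
have sc n x w: J x -> pw N' w -> pw N (x *: w).
 by move=> Jx Nw i; rewrite ffunE; apply: K.
elim: l a b u=> [|p l IH] a b u sJ.
 by rewrite mxactS; apply: sc; apply: sJ; rewrite /= inE eqxx.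
have [J1 J2]: J p.1 /\ J p.2 by split; apply: sJ; rewrite /= !inE eqxx ?orbT.
have [s1 s2]: [set` mfe l a b] `<=` J /\ [set` mfe l b a] `<=` J.
 split=> x h; apply: sJ; rewrite /= !inE; apply/or3P; apply: Or33=> //.
 by elim: l h {IH u} => [|q l IH] /=; [rewrite !inE orbC| rewrite !inE=> /or3P[->|->|/IH->]; rewrite ?orbT].
move=> /pw_half[Nl Nr]; apply/pw_half; rewrite hl_block hr_block !mxactS mxactN.
have [_ wD _] := pw_sub (mfn l) Ns; split; apply: (wD); [exact: IH | exact: sc | exact: sc | ].
by apply: (submodN (pw_sub _ Ns)); apply: IH.
Qed.

End MoreVanishing.

Lemma ker_prime (A : cring) (R : idomainType) (f : A -> R) : is_rmorph f -> prime_ideal [set a | f a = 0].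
move=> fm; split=> /=; first exact: rm0.
- by move=> a b fa fb; rewrite (rmD fm) fa fb addr0.
- by move=> a b fb; rewrite (rmM fm) fb mulr0.
- by rewrite (rm1 fm)=> /eqP; rewrite oner_eq0.
by move=> a b /eqP; rewrite (rmM fm) mulf_eq0=> /orP[/eqP|/eqP]; [left|right].
Qed.
Lemma idadd_idg (A : cring) (S : set A) x : idadd (idg S) x = idg (x |` S).
apply/seteqP; split.
 apply: idadd_min; [exact: idg_ideal | apply: idg_mono=> y; right | apply: idg_sub; left]=> //.
apply: idg_min; first by apply: idaddI; exact: idg_ideal.
by move=> y [->|Sy]; [apply: idadd_x; exact: idg_ideal | apply: idaddS; apply: idg_sub].
Qed.

(** * Primes generated by coordinates *)

Section Coordinate.
Variable F : fieldType.
Local Notation B := (usol (@bSol F)).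
Local Notation jB := (@ustr F _ (@bSol F)).
Local Notation gB := (coordB F).
Implicit Types (Z : seq nat) (u v : bool).

Definition cset Z u v : set B :=
 [set b | (exists2 z, z \in Z & b = gB z) \/ (u /\ b = gB 0 - 1) \/ (v /\ b = gB 5 - 1)].

(* The coordinates in Z are specialised to 0; if u then x1 = 1 (and y1 is
 determined), if v then a = 1 (and b is determined). *)
Definition cfg Z u v : set B := idg (cset Z u v).

Definition freeix Z u v : seq nat :=
 [seq i <- iota 0 13 | [&& i \notin Z, ~~ (u && (i < 2)%N) & ~~ (v && (4 < i < 7)%N)]].
(** Conditions under which the quotient by [cfg Z u v] is a polynomial ring: each of the two
    equations either is solved by x1 = 1, respectively a = 1, or is trivial because a factor of each
    of its products is in Z. Coordinates that are specialised to 1 or determined must not be in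
    Z. *)
Definition valid Z u v : bool :=
 [&& all (fun i=> i < 13)%N Z, u || all (mem Z) [:: 0; 2; 4]%N, v || all (mem Z) [:: 5; 7; 8; 9]%N,
 u ==> (0%N \notin Z) && (1%N \notin Z) & v ==> (5%N \notin Z) && (6%N \notin Z)].

Lemma cfg_mono Z Z' u v : {subset Z <= Z'} -> cfg Z u v `<=` cfg Z' u v.
by move=> sZ; apply: idg_mono=> b [[z /sZ zZ ->]|h]; [left; exists z | right]. Qed.
Lemma cfg_cons Z u v z : idadd (cfg Z u v) (gB z) = cfg (z :: Z) u v.
rewrite /cfg idadd_idg; congr idg; apply/seteqP; split=> b.
 by case=> [->|[[z' zZ ->]|h]]; [left; exists z; rewrite ?inE ?eqxx | left; exists z'; rewrite // inE zZ orbT | right].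
by case=> [[z']|h]; [rewrite inE=> /orP[/eqP->|zZ] ->; [left | right; left; exists z'] | right; right].
Qed.
Lemma cfg_ideal Z u v : ideal (cfg Z u v). exact: idg_ideal. Qed.
Lemma cfg_Z Z u v z : z \in Z -> cfg Z u v (gB z).
by move=> zZ; apply: idg_sub; left; exists z. Qed.
Lemma cfg_u Z v : cfg Z true v (gB 0 - 1).
by apply: idg_sub; right; left. Qed.
Lemma cfg_v Z u : cfg Z u true (gB 5 - 1).
by apply: idg_sub; right; right. Qed.
Lemma cfg_min Z u v (I : set B) : ideal I -> (forall z, z \in Z -> I (gB z)) -> (u -> I (gB 0 - 1)) ->
 (v -> I (gB 5 - 1)) -> cfg Z u v `<=` I.
by move=> iI hz hu hv; apply: idg_min=> // b [[z /hz h ->]|[[/hu h ->]|[/hv h ->]]].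
Qed.

Section Determined.
Variables (R : cring) (u v : bool) (c : nat -> R).

Definition sext (i : nat) : R :=
 if u && (i == 0%N) then 1 else if u && (i == 1%N) then c 4%N * c 4%N - c 2%N * c 3%N
 else if v && (i == 5%N) then 1 else if v && (i == 6%N) then c 7%N * c 10%N + c 8%N * c 11%N + c 9%N * c 12%N
 else c i.

Lemma sext_relX : u \/ [/\ c 0%N = 0, c 2%N = 0 & c 4%N = 0] -> relX sext.
rewrite /relX /sext /= !andbF; case: u=> [_|[//|[-> -> ->]]] /=; last by rewrite !mul0r addr0.
by rewrite mul1r subrK.
Qed.
Lemma sext_relT : v \/ [/\ c 5%N = 0, c 7%N = 0, c 8%N = 0 & c 9%N = 0] -> relT sext.
rewrite /relT /sext /= !andbF; case: v=> [_|[//|[-> -> -> ->]]] /=; last by rewrite !mul0r !addr0.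
by rewrite mul1r.
Qed.
Lemma sext_u : u -> sext 0 = 1. by rewrite /sext=> ->. Qed.
Lemma sext_v : v -> sext 5 = 1. by rewrite /sext=> ->; rewrite !andbF. Qed.
Lemma sext_1 : u -> sext 1 = c 4%N * c 4%N - c 2%N * c 3%N. by rewrite /sext=> ->. Qed.
Lemma sext_6 : v -> sext 6 = c 7%N * c 10%N + c 8%N * c 11%N + c 9%N * c 12%N.
by rewrite /sext=> ->; rewrite !andbF. Qed.
Lemma sext_id i : ~~ (u && (i < 2)%N) -> ~~ (v && (4 < i < 7)%N) -> sext i = c i.
rewrite /sext; case: u; case: v=> //=; rewrite ?andbF //=.
- by case: i=> [|[|[|[|[|[|[|]]]]]]].
- by case: i=> [|[|]].
by case: i=> [|[|[|[|[|[|[|]]]]]]].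
Qed.

End Determined.

Lemma determined_cases u v i : [\/ u /\ i = 0%N, u /\ i = 1%N, v /\ i = 5%N | v /\ i = 6%N] \/
 (~~ (u && (i < 2)%N) /\ ~~ (v && (4 < i < 7)%N)).
case: u; case: v; case: i=> [|[|[|[|[|[|[|i]]]]]]] /=; rewrite ?andbF; try (by right);
 left; by [constructor 1 | constructor 2 | constructor 3 | constructor 4].
Qed.

Section Point.
Variables (Z : seq nat) (u v : bool).
Hypothesis val : valid Z u v.
Variable fr : seq nat.
Hypothesis frE : forall i, (i \in fr) = [&& i \notin Z, ~~ (u && (i < 2)%N), ~~ (v && (4 < i < 7)%N) & (i < 13)%N].
Let n := size fr.
Let s' (i : nat) : ip F n := if i \in fr then var F n (index i fr) else 0.
Let s := sext u v s'.

Let s'Z i : i \in Z -> s' i = 0.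
by move=> iZ; rewrite /s'; rewrite frE iZ. Qed.

Let relXs : relX s.
case/and5P: val=> _ hu _ _ _; apply: sext_relX.
by move: hu; case: (u)=> [_|/and4P[z0 z2 z4 _]]; [left | right; split; apply: s'Z].
Qed.

Let relTs : relT s.
case/and5P: val=> _ _ hv _ _; apply: sext_relT.
by move: hv; case: (v)=> [_|/and5P[z5 z7 z8 z9 _]]; [left | right; split; apply: s'Z].
Qed.

Let rho : B -> ip F n := uev (@ipC F n) (bcode s).
Let sB : bSol (@ipC F n) (bcode s) := bSol_code (@ipC F n) relXs relTs.
Let rm : is_rmorph rho := uev_rm (@ipC_rm F n) sB.

Let rho_g i : (i < 13)%N -> rho (gB i) = s i.
by move=> i13; rewrite /rho /coordB (uev_gen (@ipC_rm F n) sB) bcode_bnum. Qed.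

Let e : ip F n -> B := @ev F B jB (fun l=> gB (nth 0%N fr l)) n.
Let em : is_rmorph e := ev_rm (ustr_rm _) _ n.

(** [rho] evaluates B in the free coordinates and [e] maps back. Every b is congruent to e (rho b)
    modulo [cfg Z u v], which is checked on generators; so the kernel of [rho] is no larger. *)
Let cfgE : cfg Z u v = [set b | rho b = 0].
have [Z13 _ _ val3 val4] := and5P val.
have [I0 ID IM] := cfg_ideal Z u v.
have IN x: cfg Z u v x -> cfg Z u v (- x) by rewrite -mulN1r; apply: IM.
apply/seteqP; split.
 apply: cfg_min; first exact: primeI (ker_prime rm).
 - move=> z zZ /=; rewrite rho_g; last exact: (allP Z13).
 have [[[u1 z0]|[u1 z0]|[v1 z0]|[v1 z0]]|[h1 h2]] := determined_cases u v z.
 + by move: val3; rewrite u1 -z0 zZ.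
 + by move: val3; rewrite u1 -z0 zZ andbF.
 + by move: val4; rewrite v1 -z0 zZ.
 + by move: val4; rewrite v1 -z0 zZ andbF.
 by rewrite /s sext_id // s'Z.
 - by move=> u1 /=; rewrite (rmB rm) (rm1 rm) rho_g // /s sext_u // subrr.
 - by move=> v1 /=; rewrite (rmB rm) (rm1 rm) rho_g // /s sext_v // subrr.
have es' i: (i < 13)%N -> ~~ (u && (i < 2)%N) -> ~~ (v && (4 < i < 7)%N) -> cfg Z u v (gB i - e (s' i)).
 move=> i13 h1 h2; rewrite /s'; have [ifr|nfr] := boolP (i \in fr).
 by rewrite /e (ev_var (ustr_rm _)) ?index_mem // nth_index // subrr.
 rewrite (rm0 em) subr0; apply: cfg_Z; move: nfr; rewrite frE h1 h2 i13 /= !andbT.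
 by rewrite negbK.
pose eqI x y := cfg Z u v (x - y).
have eqM x y x' y': eqI x x' -> eqI y y' -> eqI (x * y) (x' * y').
 move=> h1 h2; rewrite /eqI (_ : _ - _ = y * (x - x') + x' * (y - y')); last by ring.
 by apply: ID; apply: IM.
have eqD x y x' y': eqI x x' -> eqI y y' -> eqI (x + y) (x' + y').
 by move=> h1 h2; rewrite /eqI opprD addrACA; apply: ID.
have eqN x x': eqI x x' -> eqI (- x) (- x') by move=> h; rewrite /eqI -opprD; apply: IN.
have eqT x y z: eqI x y -> eqI y z -> eqI x z.
 by move=> h1 h2; rewrite /eqI -[x](subrK y) -addrA; apply: ID.
have es i: (i < 13)%N -> eqI (gB i) (e (s i)).
 move=> i13; have [[[u1 ->]|[u1 ->]|[v1 ->]|[v1 ->]]|[h1 h2]] := determined_cases u v i.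
 - by rewrite /s sext_u // (rm1 em) /eqI u1; exact: cfg_u.
 - rewrite /s sext_1 // (rmB em) !(rmM em).
 have h: eqI (gB 1) (gB 4 * gB 4 - gB 2 * gB 3).
 rewrite /eqI -(gB_relX F) addrK (_ : _ - _ = - gB 1 * (gB 0 - 1)); last by ring.
 by apply: IM; rewrite u1; exact: cfg_u.
 apply: eqT h _; apply: (eqD); last apply: (eqN).
 by apply: (eqM); apply: (es'); rewrite ?andbF.
 by apply: (eqM); apply: (es'); rewrite ?andbF.
 - by rewrite /s sext_v // (rm1 em) /eqI v1; exact: cfg_v.
 - have h: eqI (gB 6) (gB 7 * gB 10 + gB 8 * gB 11 + gB 9 * gB 12).
 rewrite /eqI -(gB_relT F) (_ : _ - _ = - gB 6 * (gB 5 - 1)); last by ring.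
 by apply: IM; rewrite v1; exact: cfg_v.
 rewrite /s sext_6 // !(rmD em) !(rmM em); apply: eqT h _.
 by apply: (eqD); [apply: (eqD)|]; apply: (eqM); apply: (es'); rewrite ?andbF.
 by rewrite /s sext_id //; apply: es'.
have all_b b: eqI b (e (rho b)).
 apply: (@gB_gen F (fun b=> eqI b _)).
 - by rewrite /eqI (rm1 rm) (rm1 em) subrr.
 - by move=> x y ha hb; rewrite (rmB rm) (rmB em); apply: (eqD)=> //; apply: (eqN).
 - by move=> x y ha hb; rewrite (rmM rm) (rmM em); apply: (eqM).
 move=> x [[a _ <-]|/mapP[i]].
 by rewrite /rho (uev_str (@ipC_rm F n) sB) /e (evC (ustr_rm _)) /eqI subrr.
 by rewrite mem_iota add0n=> /andP[_ i13] ->; rewrite rho_g //; apply: es.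
by move=> b /= rb; have := all_b b; rewrite rb (rm0 em) /eqI subr0.
Qed.
Lemma cfg_prime_of : prime_ideal (cfg Z u v).
by rewrite cfgE; exact: ker_prime. Qed.
Lemma cfg_free_of i : i \in fr -> ~ cfg Z u v (gB i).
move=> ifr; have := ifr; rewrite frE=> /and4P[iZ h1 h2 i13].
have si: s i = var F n (index i fr) by rewrite /s sext_id // /s' ifr.
rewrite cfgE /= rho_g // si=> h.
have : @ev F F id (fun=> 1) n (var F n (index i fr)) = 1 by rewrite (ev_var _) // index_mem.
by rewrite h (rm0 (ev_rm (rm_id F) _ _))=> /eqP; rewrite eq_sym oner_eq0.
Qed.

End Point.

Lemma freeE Z u v i : (i \in freeix Z u v) = [&& i \notin Z, ~~ (u && (i < 2)%N), ~~ (v && (4 < i < 7)%N) & (i < 13)%N].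
by rewrite mem_filter mem_iota /= add0n -!andbA. Qed.
Lemma cfg_prime Z u v : valid Z u v -> prime_ideal (cfg Z u v).
by move=> val; apply: cfg_prime_of val _ (freeE Z u v). Qed.
Lemma cfg_free Z u v i : valid Z u v -> i \in freeix Z u v -> ~ cfg Z u v (gB i).
by move=> val; exact: (cfg_free_of val (freeE Z u v)). Qed.

End Coordinate.

(** * Iterated Koszul functions *)

Section IteratedKoszul.
Variables (B : cring) (G : zmodType).
Implicit Types (P K J : set B) (lam : mfun B G) (ls : seq B).
Local Notation T := (setT : set B^o).

Definition kosl ls lam : mfun B G := foldr (fun l m=> kos m l) lam ls.

Lemma seteq_cons l ls K : [set` l :: ls] `|` K `<=` [set` ls] `|` (l |` K).
by move=> x [|Kx]; [rewrite /= => /orP[/eqP->|h]; [right; left | left] | right; right]. Qed.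
Lemma kosl_additive ls K lam : additiv ([set` ls] `|` K) lam -> additiv K (kosl ls lam).
elim: ls K=> [|l ls IH] K lamP; first by apply: addit_mono lamP=> x [|].
by apply: kos_additive; apply: IH; apply: addit_mono lamP; exact: seteq_cons.
Qed.
Lemma kosl_vanish ls K J lam : vanish ([set` ls] `|` K) ([set` ls] `|` J) lam -> vanish K J (kosl ls lam).
elim: ls K J=> [|l ls IH] K J v; first by apply: vanish_mono v=> x [|].
by apply: vanish_kos; apply: IH; apply: vanish_mono v; exact: seteq_cons.
Qed.

Fixpoint regular_chain P ls : Prop :=
 if ls is l :: ls' then [/\ prime_ideal P, ~ P l & regular_chain (idadd P l) ls'] else True.

Hypothesis noeB : noe (set0 : set B^o) setT.

(** An element l outside of a prime P has no kernel on B/P, so [kos] takes minus the value on B/(P,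
    l). *)
Lemma kosl_eval ls K lam P : additiv ([set` ls] `|` K) lam -> K `<=` P -> regular_chain P ls ->
 kosl ls lam (P : set B^o) T = iter (size ls) -%R (lam B^o (foldl (@idadd B) P ls) T).
elim: ls K P=> [|l ls IH] K P lamP KP //= [pP Pl ch].
have lamP' := addit_mono (@seteq_cons l ls K) lamP.
have sub: l |` K `<=` idadd P l.
 by move=> x [->|/KP]; [apply: idadd_x; exact: primeI | exact: idaddS].
by rewrite (kos_1 noeB (kosl_additive lamP') pP Pl sub) (IH _ _ lamP' sub ch).
Qed.

End IteratedKoszul.

(** * The three invariants *)

Section Invariants.
Variable B : cring.
Hypothesis noeB : noe (set0 : set B^o) setT.
Variable c : nat -> B.
Hypotheses (hX : relX c) (hT : relT c).
Implicit Types (P q m L J : set B).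
Local Notation T := (setT : set B^o).

Local Notation "x *^ m" := (fun V N N'=> x *+ @len B m V N N') (at level 40).

(** With these signs the factorizations belong to z z - x1 y1 - x2 y2 and to ab - v.w. The first
    starts from the pair (z, z), hence is of the form (f, f). *)
Definition kpX := [seq (- c p.1, c p.2) | p <- [:: (2, 3); (0, 1)]%N].
Definition kpT := [seq (- c p.1, c p.2) | p <- [:: (9, 12); (8, 11); (7, 10)]%N].
Definition mfX : 'M[B]_(1 + 1 + (1 + 1)) := mf kpX (c 4) (c 4).
Definition mfT := mf kpT (c 5) (c 6).
Definition mfT' := mf kpT (c 6) (c 5).
(** Entries of [mfX], each null-homotopic. By the equation a prime that contains them contains z as
    well. *)
Definition lX := [:: - c 2; c 3; - c 0; c 1].
Definition lT := mfe kpT (c 5) (c 6).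

Lemma mfX_sq : mfX *m mfX = 0.
apply: etrans (mf_mul kpX _ _) _; rewrite -(raddf0 scalar_mx); congr (_%:M).
rewrite -[LHS]/(c 4 * c 4 + - c 0 * c 1 + - c 2 * c 3).
by rewrite !mulNr -addrA -opprD; move: hX; rewrite /relX=> ->; rewrite subrr.
Qed.
Lemma mfT_mul : mfT *m mfT' = 0 /\ mfT' *m mfT = 0.
suff e: mfv kpT (c 5) (c 6) = 0.
 split; [apply: etrans (mf_mul kpT _ _) _ | apply: etrans (mf_mul kpT _ _) _].
 by rewrite e raddf0.
 by rewrite mfvC e raddf0.
rewrite -[LHS]/(c 5 * c 6 + - c 7 * c 10 + - c 8 * c 11 + - c 9 * c 12).
by rewrite !mulNr -!addrA -!opprD addrA; move: hT; rewrite /relT=> ->; rewrite subrr.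
Qed.
Lemma nullX : [set` lX] `<=` nullh mfX mfX.
move=> x hx; apply: snull_nullh; apply: (@snull_mf _ kpX _ _).
by move: hx; rewrite /= !inE=> /or4P[]->; rewrite ?orbT.
Qed.
Lemma nullT : [set` lT] `<=` nullh mfT mfT' `&` nullh mfT' mfT.
move=> x hx; have h: snull mfT mfT' x := snull_mf hx.
by split; [exact: snull_nullh | exact/snull_nullh/snull_sym].
Qed.
Lemma primeN' q x : prime_ideal q -> q (- x) -> q x.
by move=> pq /(primeN pq); rewrite opprK. Qed.
Lemma lX_in q : prime_ideal q -> [set` lX] `<=` q -> forall i, (i < 4)%N -> q (c i).
move=> pq h; have hn x: - x \in lX -> q x by move=> hx; apply: (primeN' pq); apply: h.
by do 4? [case=> [_|]]=> //; [apply: hn | apply: h | apply: hn | apply: h]; rewrite /= !inE eqxx ?orbT.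
Qed.
Lemma lT_in q : prime_ideal q -> [set` lT] `<=` q -> forall i, (4 < i < 13)%N -> q (c i).
move=> pq h; have hn x: - x \in lT -> q x by move=> hx; apply: (primeN' pq); apply: h.
case=> [|[|[|[|[|[|[|[|[|[|[|[|[|i]]]]]]]]]]]]] // _.
all: by [apply: h; rewrite /= !inE eqxx ?orbT| apply: hn; rewrite !inE eqxx ?orbT].
Qed.

Section Base.
Variables (m : set B) (pm : prime_ideal m) (G : zmodType) (g : G).
Lemma base_additive L : (forall q, prime_ideal q -> L `<=` q -> m `<=` q) -> additiv L (g *^ m).
by move=> H; apply: (len_additive pm noeB g)=> q pq Lq _; apply: H. Qed.
End Base.

Section XKilled.
Variables (G : zmodType) (lam : mfun B G).
Hypothesis G2 : forall x : G, x + x = 0.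

Lemma vanishX K J : additiv (K `|` [set` lX]) lam -> (forall i, (i < 5)%N -> J (c i)) ->
 (forall x, J x -> J (- x)) -> vanish K J (hml lam mfX mfX).
move=> lamP hJ JN; apply: (vanish_double (n := 2) mfX_sq G2); last first.
 by apply: addit_mono lamP=> x [|/nullX]; [left|right].
move=> V N N' u Ns N's K'; apply: (@mf_kill _ kpX _ _) Ns N's K'=> x.
by rewrite /= !inE=> /or4P[||| /or3P[]] /eqP->; try apply: JN; apply: hJ.
Qed.
Lemma addX K : additiv (K `|` [set` lX]) lam -> additiv K (hml lam mfX mfX).
by move=> lamP; apply: (par_additive mfX_sq G2); apply: addit_mono lamP=> x [|/nullX]; [left|right]. Qed.
End XKilled.

Section TKilled.
Variables (G : zmodType) (lam : mfun B G).
Lemma addT K : additiv (K `|` [set` lT]) lam -> additiv K (her lam mfT mfT').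
by move=> lamP; apply: (her_additive mfT_mul.1 mfT_mul.2); apply: addit_mono lamP=> x [|/nullT]; [left|right].
Qed.
Lemma vanishT K J : additiv (K `|` [set` lT]) lam -> J (c 5 + c 6) -> vanish K J (her lam mfT mfT').
move=> lamP Jh; apply: (@vanish_mono _ _ K K [set c 5 + c 6])=> //; first by move=> _ ->.
apply: (vanish_anticonj mfT_mul.1 mfT_mul.2); first exact: anticonj_mf.
by apply: addit_mono lamP=> x [|/nullT]; [left|right].
Qed.
End TKilled.

Section Lambdas.
Variables (m : set B) (pm : prime_ideal m).

(** The elements [l2] cut the second cone down to the point a = 1, v = w = 0, and [l3] cut the first
    one down to x1 = 1, x2 = y2 = z = 0; by the equations b = 0, respectively y1 = 0, there. The
    factorization of the other cone then gives the invariants in degrees 2 and 3. In degree 5 both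
    factorizations are used. *)
Definition l2 := [:: c 5 - 1; c 7; c 8; c 9; c 10; c 11; c 12].
Definition l3 := [:: c 0%N - 1; c 2; c 3; c 4].
Definition lam2 : mfun B 'Z_2 := kosl l2 (hml ((1 : 'Z_2) *^ m) mfX mfX).
Definition lam3 : mfun B int := kosl l3 (her ((1 : int) *^ m) mfT mfT').
Definition lam5 : mfun B 'Z_2 := her (hml ((1 : 'Z_2) *^ m) mfX mfX) mfT mfT'.

Lemma Z2_double (x : 'Z_2) : x + x = 0.
by case: x=> -[|[|//]] i; apply/val_inj. Qed.
Lemma lam_van (G : zmodType) (lam : mfun B G) q : prime_ideal q -> vanish set0 q lam -> lam B^o q T = 0.
move=> pq v; apply: v; first exact: (mdomQ noeB (primeI pq)).
by move=> j qj u _; rewrite [_ *: _]mulrC; apply: (primeMl pq).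
Qed.

Section Two.
Hypothesis m2 : forall q, prime_ideal q -> [set` l2] `<=` q -> [set` lX] `<=` q -> m `<=` q.

Let A2 K : [set` l2] `<=` K -> additiv (K `|` [set` lX]) ((1 : 'Z_2) *^ m).
move=> sK; apply: (base_additive pm)=> q pq h; apply: (m2 pq)=> x hx; apply: h; [left; apply: sK | right]=> //.
Qed.

Let A2' : additiv ([set` l2] `|` set0) (hml ((1 : 'Z_2) *^ m) mfX mfX).
by apply: (addX Z2_double); apply: A2=> x; left. Qed.
Lemma lam2_additive : additiv set0 lam2.
exact: kosl_additive. Qed.
Lemma lam2_X q : prime_ideal q -> (forall i, (i < 5)%N -> q (c i)) -> lam2 (q : set B^o) T = 0.
move=> pq hq; apply: (lam_van pq); apply: kosl_vanish.
apply: (vanish_mono (@subset_refl _ _) (@subsetUr _ _ q)).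
by apply: (vanishX Z2_double)=> [||x]; [exact: A2=> x; left | exact: hq | exact: (primeN pq)].
Qed.
(** Modulo [l2] one has a = 1 and v = 0, so b = ab = 0 and h = 1. Adding a or h gives the unit
    ideal. *)
Lemma lam2_unit q : prime_ideal q -> q (c 5) \/ q (c 5 + c 6) -> lam2 (q : set B^o) T = 0.
move=> pq hq; apply: (lam_van pq); apply: kosl_vanish; apply: vanish_unit A2' _.
set I := idg _; have iI: ideal I by exact: idg_ideal.
have [I0 ID IM] := iI; have l2I x: x \in l2 -> I x by move=> hx; apply: idg_sub; left.
have qI: q `<=` I by move=> x qx; apply: idg_sub; right.
have IN x: I x -> I (- x) by rewrite -mulN1r; apply: IM.
have a1: I (c 5 - 1) by apply: l2I; rewrite inE eqxx.
have Ia: I (c 5) -> I 1 by move=> h; rewrite -(subKr (c 5) 1); apply: ID h _; apply: IN.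
case: hq=> /qI h; first exact: Ia.
have Iv: I (c 5 * c 6).
 move: hT; rewrite /relT=> ->; do 2?[apply: (ID)]; apply: IM; apply: l2I; by rewrite !inE eqxx ?orbT.
have Ib: I (c 6).
 rewrite (_ : c 6 = c 5 * c 6 - c 6 * (c 5 - 1)); last by ring.
 by apply: ID Iv _; apply: IN; apply: IM.
by apply: Ia; rewrite -[c 5](addrK (c 6)); apply: ID h _; apply: IN.
Qed.
Lemma lam2_eval P R : regular_chain P l2 -> foldl (@idadd B) P l2 = R -> [set` l2] `<=` R -> ideal R ->
 mfchain R kpX -> mfin R kpX -> R (c 4) -> mfend R kpX = m -> lam2 (P : set B^o) T = 1.
move=> ch eR l2R iR chX hin R4 em.
rewrite /lam2 (kosl_eval noeB A2' (sub0set P) ch) eR.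
have -> : hml ((1 : 'Z_2) *^ m) mfX mfX (R : set B^o) T = 1; last by apply/val_inj.
rewrite (hml_mf noeB (A2 (@subset_refl _ _)) (l := kpX)) ?em ?lenyE // => x [/l2R|]; first by right.
by rewrite /= !inE=> /or4P[]->; rewrite ?orbT; left.
Qed.

End Two.

Section Three.
Hypothesis m3 : forall q, prime_ideal q -> [set` l3] `<=` q -> [set` lT] `<=` q -> m `<=` q.

Let A3 K : [set` l3] `<=` K -> additiv (K `|` [set` lT]) ((1 : int) *^ m).
move=> sK; apply: (base_additive pm)=> q pq h; apply: (m3 pq)=> x hx; apply: h; [left; apply: sK | right]=> //.
Qed.

Let A3' : additiv ([set` l3] `|` set0) (her ((1 : int) *^ m) mfT mfT').
by apply: addT; apply: A3=> x; left. Qed.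
Lemma lam3_additive : additiv set0 lam3.
exact: kosl_additive. Qed.
Lemma lam3_h q : prime_ideal q -> q (c 5 + c 6) -> lam3 (q : set B^o) T = 0.
move=> pq hq; apply: (lam_van pq); apply: kosl_vanish.
by apply: vanishT; [apply: A3=> x; left | right].
Qed.
Lemma lam3_X q : prime_ideal q -> q (c 0) -> lam3 (q : set B^o) T = 0.
move=> pq hq; apply: (lam_van pq); apply: kosl_vanish; apply: vanish_unit A3' _.
set I := idg _; have [_ ID IM]: ideal I by exact: idg_ideal.
rewrite -(subKr (c 0) 1); apply: ID; first by apply: idg_sub; right.
by rewrite -mulN1r; apply: IM; apply: idg_sub; left; rewrite /= inE eqxx.
Qed.
(** The sign comes from four Koszul steps and three doublings. *)
Lemma lam3_eval P R : regular_chain P l3 -> foldl (@idadd B) P l3 = R -> [set` l3] `<=` R -> ideal R ->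
 mfchain R kpT -> mfin R kpT -> R (c 5) -> prime_ideal (mfend R kpT) -> ~ mfend R kpT (c 6) ->
 idadd (mfend R kpT) (c 6) = m -> lam3 (P : set B^o) T = - 1.
move=> ch eR l3R iR chT hin R5 pe ne em.
rewrite /lam3 (kosl_eval noeB A3' (sub0set P) ch) eR.
rewrite (her_mf noeB (A3 (@subset_refl _ _)) _) ?em ?lenyE //= => x [/l3R|]; first by right.
by left.
Qed.

End Three.

Section Five.
Hypothesis m5 : forall q, prime_ideal q -> [set` lX] `<=` q -> [set` lT] `<=` q -> m `<=` q.

Let A5 : additiv ([set` lT] `|` [set` lX]) ((1 : 'Z_2) *^ m).
by apply: (base_additive pm)=> q pq h; apply: (m5 pq)=> x hx; apply: h; [right | left].
Qed.

Let A5' K : [set` lT] `<=` K -> additiv K (hml ((1 : 'Z_2) *^ m) mfX mfX).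
by move=> sK; apply: (addX Z2_double); apply: addit_mono A5=> x [/sK|]; [left | right]. Qed.
Lemma lam5_additive : additiv set0 lam5.
by apply: addT; apply: A5'=> x; right. Qed.
Lemma lam5_h q : prime_ideal q -> q (c 5 + c 6) -> lam5 (q : set B^o) T = 0.
by move=> pq hq; apply: (lam_van pq); apply: vanishT=> //; apply: A5'=> x; right. Qed.
Lemma lam5_X q : prime_ideal q -> (forall i, (i < 5)%N -> q (c i)) -> lam5 (q : set B^o) T = 0.
move=> pq hq; apply: (lam_van pq); apply: (vanish_her mfT_mul.1 mfT_mul.2).
apply: (vanishX Z2_double)=> [||x]; [ | exact: hq | exact: (primeN pq)].
by apply: addit_mono A5=> x [/nullT|]; [left; right | right].
Qed.
Lemma lam5_eval R : let Q := idadd (mfend R kpT) (c 6) in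
 ideal R -> mfchain R kpT -> mfin R kpT -> R (c 5) -> prime_ideal (mfend R kpT) -> ~ mfend R kpT (c 6) ->
 [set` lT] `<=` Q -> ideal Q -> mfchain Q kpX -> mfin Q kpX -> Q (c 4) -> mfend Q kpX = m ->
 lam5 (R : set B^o) T = 1.
move=> Q iR chT hT' R5 pe ne lTQ iQ chX hX' Q4 em.
rewrite /lam5 (her_mf noeB (A5' (@subset_refl _ _)) _) //; last by left.
have -> : hml ((1 : 'Z_2) *^ m) mfX mfX (Q : set B^o) T = 1; last by apply/val_inj.
rewrite (hml_mf noeB A5 (l := kpX)) ?em ?lenyE // => x [/lTQ|]; first by right.
by rewrite /= !inE=> /or4P[]->; rewrite ?orbT; left.
Qed.

End Five.
End Lambdas.
End Invariants.

(** * Values of the invariants at generic points *)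

Section Evaluation.
Variable F : fieldType.
Local Notation B := (usol (@bSol F)).
Local Notation gB := (coordB F).
Local Notation cfg := (@cfg F).
Local Notation hB := (hB F).
Local Notation Y := (Rs F).
Local Notation idy y := (idl (y : qapt (rB F))).
Local Notation T := (setT : set B^o).
Local Notation noeB := (@noeB F).
Implicit Types (q : set B) (y : Y) (Z : seq nat) (u v : bool).

Transparent coordB.

Opaque coordB.

Lemma prime_point q : prime_ideal q -> ~ q hB -> (exists2 i, (i < 4)%N & ~ q (gB i)) -> exists y, idy y = q.
move=> pq qh [i i4 qi]; have [x xr qx]: exists2 x, x \in rB F & ~ q x.
 exists (hB * gB i); [exact: rB_mem | exact: (primenM pq)].
have H: prime_ideal q /\ exists2 x, x \in rB F & ~ q x by split=> //; exists x.
by exists (exist _ q H).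
Qed.
Lemma prime_nopoint q : prime_ideal q -> (forall y, idy y <> q) -> q hB \/ forall i, (i < 5)%N -> q (gB i).
move=> pq ny; have [qh|qh] := pselect (q hB); [by left | right].
have h4 i: (i < 4)%N -> q (gB i).
 by move=> i4; apply: contrapT=> qi; have [y] := prime_point pq qh (ex_intro2 _ _ i i4 qi); exact: ny.
move=> i; rewrite ltnS leq_eqVlt=> /orP[/eqP->|/h4 //].
have : q (gB 4 * gB 4) by rewrite -(gB_relX F); apply: (primeD pq); apply: (primeMr pq); exact: h4.
by case/(primeM pq).
Qed.
Lemma cfg_eqs Z Z' u v : all (mem Z) Z' && all (mem Z') Z -> cfg Z u v = cfg Z' u v.
by move=> /andP[/allP h1 /allP h2]; apply/seteqP; split; apply: cfg_mono. Qed.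
Lemma cfg_hB Z u v : valid Z u v -> {subset [:: 5; 7; 8; 9]%N <= Z} -> 6%N \in freeix Z u v -> ~ cfg Z u v hB.
move=> val sZ f6 h; apply: (@cfg_free F Z u v 6 val f6).
have pq := cfg_prime F val; rewrite -[gB 6](addKr (gB 5)); apply: (primeD pq); last by [].
by apply: (primeN pq); apply: cfg_Z; apply: sZ.
Qed.
Lemma cfg_one Z u : valid Z u true -> ~ cfg Z u true (gB 5).
move=> val h; have pq := cfg_prime F val; have [_ _ _ p1 _] := pq; apply: p1.
by rewrite -(subKr (gB 5) 1); apply: (primeB pq)=> //; exact: cfg_v.
Qed.
Lemma gpt_cfg Z u v c : valid Z u v -> ~ cfg Z u v hB -> stP (cfg Z u v) c -> idy (gpt F c) `<=` cfg Z u v.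
move=> val nh st; have pq := cfg_prime F val.
have [y ey]: exists y, idy y = cfg Z u v.
 by apply: (prime_point pq nh); exists (pX c.1); [case: (c.1) | have [[]] := st].
by rewrite -ey; apply: gpt_sub; rewrite ey.
Qed.
Lemma stT_g5 y : stT (idy y) T3 -> idy y (gB 5).
have py := idlP y; move=> [h1 h2].
have : idy y (gB 5 * gB 6).
 rewrite (gB_relT F); do 2?[apply: (primeD py)]; apply: (primeMr py); apply: h1; by [].
by case/(primeM py).
Qed.
Lemma stX2_g0 y : stX (idy y) X2 -> idy y (gB 0).
by move=> h; apply: (stX_low (a' := X0) (idlP _) h). Qed.
Lemma g23E : idy (gpt F (X2, T3)) = cfg [:: 0; 2; 4; 5; 7; 8; 9]%N false false.
have pg := idlP _; have [sx st] := gpt_st F (X2, T3).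
apply/seteqP; split.
 apply: gpt_cfg=> //; first by apply: cfg_hB=> //; exact: mem_subseq.
 split; split=> [i ic|]; try exact: cfg_free.
 by apply: cfg_Z; move: i ic; apply/allP.
 by apply: cfg_Z; move: i ic; apply/allP.
apply: cfg_min=> //; first exact: primeI.
move=> z; rewrite !inE=> /orP[/eqP->|/orP[/eqP->|/orP[/eqP->|/orP[/eqP->|/orP[/eqP->|/orP[/eqP->|/eqP->]]]]]].
- exact: stX2_g0.
- exact: sx.1.
- exact: sx.1.
- exact: stT_g5.
- exact: st.1.
- exact: st.1.
- exact: st.1.
Qed.
(** At the generic point itself the equation of the first cone is neither solved nor trivial, so
    [cfg_prime] does not apply. The first Koszul element x1 - 1 makes it solvable; in [g20E] a - 1
    does the same for the second cone. *)
Lemma g03E : idadd (idy (gpt F (X0, T3))) (gB 0 - 1) = cfg [:: 5; 7; 8; 9]%N true false.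
have [sx st] := gpt_st F (X0, T3).
have ig := primeI (idlP (gpt F (X0, T3))); have val: valid [:: 5; 7; 8; 9] true false by [].
have pq := cfg_prime F val.
apply/seteqP; split.
 apply: idadd_min; [exact: primeI | | exact: cfg_u].
 apply: gpt_cfg=> //; first exact: cfg_hB.
 split; [split=> [i ic //|h] | split=> [|h]]; try exact: cfg_free h.
 have [_ _ _ p1 _] := pq; apply: p1; rewrite -(subKr (gB 0) 1); apply: (primeB pq)=> //; exact: cfg_u.
 by move=> i ic; apply: cfg_Z; move: i ic; apply/allP.
apply: cfg_min=> //; first exact: idaddI; last by move=> _; apply: idadd_x.
move=> z; rewrite !inE=> /orP[/eqP->|/orP[/eqP->|/orP[/eqP->|/eqP->]]]; apply: idaddS.
- exact: stT_g5.
- exact: st.1.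
- exact: st.1.
- exact: st.1.
Qed.
Lemma g20E : idadd (idy (gpt F (X2, T0))) (gB 5 - 1) = cfg [:: 0; 2; 4]%N false true.
have [sx st] := gpt_st F (X2, T0).
have ig := primeI (idlP (gpt F (X2, T0))); have val: valid [:: 0; 2; 4] false true by [].
have pq := cfg_prime F val.
apply/seteqP; split.
 apply: idadd_min; [exact: primeI | | exact: cfg_v].
 apply: gpt_cfg=> //; last first.
 split; [split=> [i ic|h] | split=> [i //|h]]; try exact: cfg_free h.
 by apply: cfg_Z; move: i ic; apply/allP.
 move=> h; have val': valid [:: 0; 2; 4; 7; 8; 9] false true by [].
 have pq' := cfg_prime F val'; apply: (cfg_one val').
 have h': cfg [:: 0; 2; 4; 7; 8; 9] false true (gB 5 + gB 6).
 by apply: cfg_mono h; exact: mem_subseq.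
 have : cfg [:: 0; 2; 4; 7; 8; 9] false true (gB 5 * gB 6).
 by rewrite (gB_relT F); do 2?[apply: (primeD pq')]; apply: (primeMr pq'); apply: cfg_Z.
 case/(primeM pq')=> // h6; rewrite -[gB 5](addrK (gB 6)); exact: (primeB pq').
apply: cfg_min=> //; first exact: idaddI; last by move=> _; apply: idadd_x.
move=> z; rewrite !inE=> /orP[/eqP->|/orP[/eqP->|/eqP->]]; apply: idaddS.
- exact: stX2_g0.
- exact: sx.1.
- exact: sx.1.
Qed.
(** The point specialises to the generic point of (X2, T3), at which a = 0, so a - 1 cannot vanish
    on it. *)
Lemma g20_regular : ~ idy (gpt F (X2, T0)) (gB 5 - 1).
move=> h; have inc: idy (gpt F (X2, T0)) `<=` idy (gpt F (X2, T3)).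
 by move=> x /(@incl_T F X2 T0 T1 isT)/(@incl_T F X2 T1 T2 isT)/(@incl_T F X2 T2 T3 isT).
have pg := idlP (gpt F (X2, T3)); have [_ st] := gpt_st F (X2, T3).
have [_ _ _ p1 _] := pg; apply: p1; rewrite -(subKr (gB 5) 1).
by apply: (primeB pg); [exact: stT_g5 | exact: inc].
Qed.
Lemma g03_regular : ~ idy (gpt F (X0, T3)) (gB 0 - 1).
move=> h; have pg := idlP (gpt F (X1, T3)); have [sx _] := gpt_st F (X1, T3).
have [_ _ _ p1 _] := pg; apply: p1; rewrite -(subKr (gB 0) 1).
by apply: (primeB pg); [exact: sx.1 | exact: incl_X01].
Qed.

Fixpoint fchain Z u v (zs : seq nat) : bool :=
 if zs is z :: zs' then [&& valid Z u v, z \in freeix Z u v & fchain (z :: Z) u v zs'] else true.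

Lemma fchainP Z u v zs : fchain Z u v zs -> regular_chain (cfg Z u v) [seq gB z | z <- zs] /\
 foldl (@idadd B) (cfg Z u v) [seq gB z | z <- zs] = cfg (catrev zs Z) u v.
elim: zs Z=> [|z zs IH] Z //= /and3P[val fz ch]; rewrite cfg_cons; have [h1 h2] := IH _ ch.
by split=> //; split=> //; [exact: cfg_prime | exact: cfg_free].
Qed.
Lemma mfcfg Z u v (ps : seq (nat * nat)) : fchain Z u v [seq p.2 | p <- ps] -> all (fun p=> p.1 \in Z) ps ->
 let l := [seq (- gB p.1, gB p.2) | p <- ps] in
 [/\ mfchain (cfg Z u v) l, mfin (cfg Z u v) l & mfend (cfg Z u v) l = cfg (catrev [seq p.2 | p <- ps] Z) u v].
move=> /fchainP[ch fo] /allP Z1 l; split; last by rewrite -fo /l; elim: ps (cfg Z u v) {ch fo Z1 l} => /=.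
 by rewrite /l; elim: ps (cfg Z u v) ch {fo Z1 l} => [|p ps IH] P //= [pP nP /IH].
move=> _ /mapP[p /Z1 pZ ->]; have [_ _ IM] := cfg_ideal F Z u v.
by rewrite -mulN1r; apply: IM; exact: cfg_Z.
Qed.
Lemma mfe_cfg Z u v (ps : seq (nat * nat)) i j : all (fun p=> (p.1 \in Z) && (p.2 \in Z)) ((i, j) :: ps) ->
 [set` mfe [seq (- gB p.1, gB p.2) | p <- ps] (gB i) (gB j)] `<=` cfg Z u v.
move=> /andP[/andP[iZ jZ]]; have [_ _ IM] := cfg_ideal F Z u v.
elim: ps=> [_|p ps IH /andP[/andP[p1 p2] /IH h]] x; rewrite /= !inE.
 by move=> /orP[]/eqP->; exact: cfg_Z.
by move=> /or3P[/eqP->|/eqP->|/h//]; [rewrite -mulN1r; apply: IM|]; exact: cfg_Z.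
Qed.

(** [m2], [m3] and [m5] are rational points of Spec B outside of R: the vertex of the first cone
    with a = 1 on the second, the vertex of the second with x1 = 1 on the first, and both
    vertices. *)
Definition m2 := cfg [:: 0; 1; 2; 3; 4; 7; 8; 9; 10; 11; 12]%N false true.
Definition m3 := cfg (iota 2 11) true false.
Definition m5 := cfg (iota 0 13) false false.

Lemma pm2 : prime_ideal m2. exact: cfg_prime. Qed.
Lemma pm3 : prime_ideal m3. exact: cfg_prime. Qed.
Lemma pm5 : prime_ideal m5. exact: cfg_prime. Qed.
Lemma lX5 q : prime_ideal q -> [set` lX gB] `<=` q -> forall i, (i < 5)%N -> q (gB i).
move=> pq /(lX_in pq) h i; rewrite ltnS leq_eqVlt=> /orP[/eqP->|/h //].
have : q (gB 4 * gB 4) by rewrite -(gB_relX F); apply: (primeD pq); apply: (primeMr pq); exact: h.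
by case/(primeM pq).
Qed.
Lemma m2_min q : prime_ideal q -> [set` l2 gB] `<=` q -> [set` lX gB] `<=` q -> m2 `<=` q.
move=> pq h2 /(lX5 pq) h5; apply: cfg_min=> //; first exact: primeI.
 have h z: gB z \in l2 gB -> q (gB z) by apply: h2.
 move=> z; have [z5|z5] := ltnP z 5; first by move=> _; exact: h5.
 rewrite !inE=> hz; apply: h; rewrite !inE; move: hz z5.
 by do 11? [case/orP=> [/eqP->|]; rewrite ?eqxx ?orbT //]; move/eqP=> ->; rewrite eqxx ?orbT.
by move=> _; apply: h2; rewrite /= inE eqxx.
Qed.
Lemma m3_min q : prime_ideal q -> [set` l3 gB] `<=` q -> [set` lT gB] `<=` q -> m3 `<=` q.
move=> pq h3 /(lT_in pq) hT; apply: cfg_min=> //; first exact: primeI.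
 move=> z; rewrite mem_iota=> /andP[z2 z13]; have [z4|z4] := ltnP 4 z; first by apply: hT; rewrite z4.
 apply: h3; rewrite /= !inE; move: z z2 z4 {z13}.
 by case=> [|[|[|[|[|]]]]] // _ _; rewrite eqxx ?orbT.
by move=> _; apply: h3; rewrite /= inE eqxx.
Qed.
Lemma m5_min q : prime_ideal q -> [set` lX gB] `<=` q -> [set` lT gB] `<=` q -> m5 `<=` q.
move=> pq /(lX5 pq) hX /(lT_in pq) hT; apply: cfg_min=> //; first exact: primeI.
move=> z; rewrite mem_iota=> /andP[_ z13]; have [z4|z4] := ltnP 4 z; first by apply: hT; rewrite z4.
exact: hX.
Qed.

Definition lamb2 : mfun B 'Z_2 := lam2 gB m2.
Definition lamb3 : mfun B int := lam3 gB m3.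
Definition lamb5 : mfun B 'Z_2 := lam5 gB m5.

Let rX := gB_relX F.
Let rT := gB_relT F.

Definition supported (G : zmodType) (lam : mfun B G) := additiv set0 lam /\
 forall q, prime_ideal q -> (forall y, idy y <> q) -> @lam B^o q T = 0.

Lemma lamb2_ok : supported lamb2.
split=> [|q pq /(prime_nopoint pq)[qh|h]]; first exact: (lam2_additive noeB rX pm2 m2_min).
 by apply: (lam2_unit noeB rX rT pm2 m2_min pq); right.
exact: (lam2_X noeB rX pm2 m2_min pq).
Qed.
Lemma lamb3_ok : supported lamb3.
split=> [|q pq /(prime_nopoint pq)[qh|h]]; first exact: (lam3_additive noeB rT pm3 m3_min).
 exact: (lam3_h noeB rT pm3 m3_min pq).
by apply: (lam3_X noeB rT pm3 m3_min pq); exact: h.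
Qed.
Lemma lamb5_ok : supported lamb5.
split=> [|q pq /(prime_nopoint pq)[qh|h]]; first exact: (lam5_additive noeB rX rT pm5 m5_min).
 exact: (lam5_h noeB rX rT pm5 m5_min pq).
exact: (lam5_X noeB rX rT pm5 m5_min pq).
Qed.
Lemma lamb2_T3 a : lamb2 (idy (gpt F (a, T3)) : set B^o) T = 0.
have [_ st] := gpt_st F (a, T3).
by apply: (lam2_unit noeB rX rT pm2 m2_min (idlP (gpt F (a, T3)))); left; exact: stT_g5.
Qed.
Lemma lamb2_g20 : lamb2 (idy (gpt F (X2, T0)) : set B^o) T = 1.
have pg := idlP _; pose Z := catrev [:: 7; 8; 9; 10; 11; 12] [:: 0; 2; 4]%N.
have [|ch fo] := @fchainP [:: 0; 2; 4] false true [:: 7; 8; 9; 10; 11; 12]; first by [].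
have [//|//|chX hin e] := @mfcfg Z false true [:: (2, 3); (0, 1)].
apply: (lam2_eval noeB rX pm2 m2_min (R := cfg Z false true) _ _ _ (cfg_ideal _ _ _ _) chX hin).
- by split=> //; [exact: g20_regular | rewrite g20E].
- by rewrite [LHS]/= g20E.
- by move=> x; rewrite /= !inE=> /or4P[||| /or4P[]] /eqP->; [exact: cfg_v | exact: cfg_Z..].
- exact: cfg_Z.
by rewrite [LHS]e; exact: cfg_eqs.
Qed.
Lemma lamb3_g03 : lamb3 (idy (gpt F (X0, T3)) : set B^o) T = - 1.
have pg := idlP (gpt F (X0, T3) : qapt (rB F)); pose Z := catrev [:: 2; 3; 4]%N [:: 5; 7; 8; 9]%N.
have [|ch fo] := @fchainP [:: 5; 7; 8; 9]%N true false [:: 2; 3; 4]%N; first by [].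
have [//|//|chT hin e] := @mfcfg Z true false [:: (9, 12); (8, 11); (7, 10)]%N.
apply: (lam3_eval noeB rT pm3 m3_min (R := cfg Z true false) _ _ _ (cfg_ideal _ _ _ _) chT hin); rewrite ?[mfend _ _]e.
- by split=> //; [exact: g03_regular | rewrite g03E].
- by rewrite [LHS]/= g03E.
- by move=> x; rewrite /= !inE=> /or4P[]/eqP->; [exact: cfg_u | exact: cfg_Z..].
- exact: cfg_Z.
- exact: cfg_prime.
- exact: cfg_free.
by rewrite cfg_cons; exact: cfg_eqs.
Qed.
Lemma lamb5_g23 : lamb5 (idy (gpt F (X2, T3)) : set B^o) T = 1.
pose Z := [:: 0; 2; 4; 5; 7; 8; 9]%N; have [//|//|chT hT' e] := @mfcfg Z false false [:: (9, 12); (8, 11); (7, 10)].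
have [//|//|chX hX' e'] := @mfcfg (6 :: catrev [:: 12; 11; 10] Z) false false [:: (2, 3); (0, 1)].
have eQ: idadd (mfend (cfg Z false false) (kpT gB)) (gB 6) = cfg (6 :: catrev [:: 12; 11; 10] Z) false false.
 by rewrite [mfend _ _]e cfg_cons.
rewrite g23E; apply: (lam5_eval noeB rX pm5 m5_min (cfg_ideal _ _ _ _) chT hT'); rewrite ?eQ //; try exact: cfg_Z.
- by rewrite [mfend _ _]e; exact: cfg_prime.
- by rewrite [mfend _ _]e; exact: cfg_free.
- exact: (@mfe_cfg _ false false [:: (9, 12); _; _] 5 6).
- exact: cfg_ideal.
by rewrite [LHS]e'; exact: cfg_eqs.
Qed.

End Evaluation.

(** * Lower bound and the Chow groups *)

Section LowerBound.
Variable F : fieldType.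
Local Notation B := (usol (@bSol F)).
Local Notation Y := (Rs F).
Local Notation idy y := (idl (y : qapt (rB F))).
Local Notation T := (setT : set B^o).
Local Notation gcyc := (@gcyc F).
Implicit Types (y z : Y).

Section Invariant.
Variables (G : zmodType) (lam : mfun B G).
Hypothesis lamS : supported lam.
Local Notation val_ z := (lam (idy z : set B^o) T).
Local Notation cl i := (@cyclam F B _ (rB F) (ustr_rm _) G lam i).

Lemma cl_gcyc i c : cl i (gcyc i c) = if kc c == i then val_ (gpt F c) else 0.
case: eqP=> [e|/eqP/gcyc0 ->]; last exact: flin0.
by have [y ey] := gpt_cod F e; rewrite (gcyc_gen ey) /cyclam flinU ey.
Qed.
Lemma cl_MZ i (D : cycles Y i) n : cl i (D *~ n) = cl i D *~ n.
have N k: cl i (D *+ k) = cl i D *+ k.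
 by elim: k=> [|k IH]; [exact: flin0 | rewrite !mulrS /cyclam flinD -IH].
by case: n=> k; [exact: N | rewrite /cyclam flinN; congr (- _); exact: N].
Qed.
Lemma cl_rt i (D : cycles Y i) : (forall z, codim_ge z i.+1 -> val_ z = 0) -> D \in @rat_triv F Y i -> cl i D = 0.
move=> V Dr; apply: (@rel_rat_triv F B _ _ _ (@noeB F) G lam lamS.1 lamS.2 i [set 0])=> //.
by move=> a b -> ->; rewrite subr0.
Qed.
Lemma cl_gens i n1 n2 n3 n4 : cl i (gens F i n1 n2 n3 n4) =
 cl i (gcyc i (X0, T0)) *~ n1 + cl i (gcyc i (X0, T3)) *~ n2 + cl i (gcyc i (X2, T0)) *~ n3
 + cl i (gcyc i (X2, T3)) *~ n4.
by rewrite /cyclam !flinD -!cl_MZ. Qed.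
(** Downward induction on the codimension: once [lam] vanishes in codimension i + 1 and above, it
    respects rational equivalence in codimension i, where by [CH_gen] each point is a combination of
    the generators. The generator (X0, T0) has codimension 0 and does not occur for i > d. *)
Lemma descend d : ((d < 2)%N -> val_ (gpt F (X2, T0)) = 0) -> ((d < 3)%N -> val_ (gpt F (X0, T3)) = 0) ->
 ((d < 5)%N -> val_ (gpt F (X2, T3)) = 0) ->
 forall z, codim_ge z d.+1 -> val_ z = 0.
(* The charts have 11 coordinates, so that no point has codimension 12 and the case k = 0 is
   empty. *)
move=> H20 H03 H23; suff V k: forall i, (d < i)%N -> (12 <= i + k)%N -> forall z, codim_ge z i -> val_ z = 0.
 by apply: (V 12)=> //; rewrite leq_addl.
elim: k=> [|k IH] i di ik z cz.
 have := chart_codim_le (ech_rm F _) (gB_surj _) (stP_s (st_P z)) cz.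
 lia.
have V1: forall z, codim_ge z i.+1 -> val_ z = 0.
 by apply: IH; [exact: ltnW | rewrite addSnnS].
have [/V1//|ncz] := pselect (codim_ge z i.+1).
have cz': codim z i by [].
pose y : codim_pt Y i := exist _ z (asboolT cz').
have [n1 [n2 [n3 [n4 /(cl_rt V1)]]]] := CH_gen (<< y >>).
have G0 c: (kc c = i -> val_ (gpt F c) = 0) -> cl i (gcyc i c) = 0 by rewrite cl_gcyc; case: eqP=> // e; apply.
rewrite {1}/cyclam flinB -/(cl i (gens F i n1 n2 n3 n4)) cl_gens !G0 ?mul0rz ?addr0 ?subr0.
- by rewrite flinU.
all: by move=> e; move: di; rewrite -e.
Qed.
Lemma lower d : ((d < 2)%N -> val_ (gpt F (X2, T0)) = 0) -> ((d < 3)%N -> val_ (gpt F (X0, T3)) = 0) ->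
 ((d < 5)%N -> val_ (gpt F (X2, T3)) = 0) -> forall D, D \in @rat_triv F Y d -> cl d D = 0.
by move=> h1 h2 h3 D; apply: cl_rt; exact: descend. Qed.

End Invariant.

(** Twice the class is rationally trivial in codimension 5, and the values of [lamb3] are
    integers. *)
Lemma lamb3_g23 : lamb3 (idy (gpt F (X2, T3)) : set B^o) T = 0.
have V z: codim_ge z 6 -> lamb3 (idy z : set B^o) T = 0 by exact: (descend (lamb3_ok F)).
have := cl_rt (lamb3_ok F) V (rt_X2 F 5 T3).
rewrite /cyclam flinD -![flin _ _]/(cyclam _ _) cl_gcyc eqxx.
lia.
Qed.
Lemma rat_triv0 (c : cycles Y 0) : c \in @rat_triv F Y 0 -> c = 0.
rewrite unfold_in=> /asboolP/(_ [set 0]); apply=> //; first by move=> a b -> ->; rewrite subr0.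
by move=> a [j [w [f [U []]]]].
Qed.

Local Open Scope quotient_scope.

Lemma quot_iso i (G : zmodType) (phi : cycles Y i -> G) : {morph phi : a b / a - b} ->
 (forall c, c \in @rat_triv F Y i -> phi c = 0) -> (forall c, phi c = 0 -> c \in @rat_triv F Y i) ->
 (forall g, exists c, phi c = g) -> zmod_iso (CH i Y) G.
move=> phiB phi0 phiI phiS.
have phiE c: phi (repr (\pi_(Quotient.quot (@rat_triv F Y i)) c)) = phi c.
 apply/eqP; rewrite -subr_eq0 -phiB; apply/eqP; apply: phi0.
 by rewrite Quotient.idealrBE reprK.
pose f (x : CH i Y) : G := phi (repr x).
have fB: zmod_morphism f.
 move=> x y; rewrite -[x]reprK -[y]reprK /f -raddfB !phiE; exact: phiB.
pose f' : {additive CH i Y -> G} := HB.pack f (GRing.isZmodMorphism.Build _ _ f fB).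
exists f'; pose g x := \pi_(Quotient.quot (@rat_triv F Y i)) (sval (cid (phiS x))).
exists g=> x; rewrite /= /f.
 rewrite -[RHS]reprK; apply/eqP; rewrite -Quotient.idealrBE; apply: phiI.
 by rewrite phiB (svalP (cid (phiS _))) subrr.
by rewrite phiE (svalP (cid (phiS _))).
Qed.
Lemma cl_B (G : zmodType) (lam : mfun B G) i : {morph @cyclam F B _ (rB F) (ustr_rm _) G lam i : a b / a - b}.
by move=> a b; rewrite /cyclam flinB. Qed.
Lemma Z2_even (n : int) : (1 : 'Z_2) *~ n = 0 -> exists m, n = m * 2.
move=> n0; exists (n %/ 2)%Z; have := divz_eq n 2; have : (0 <= n %% 2)%Z by exact: modz_ge0.
have : ((n %% 2)%Z < 2)%R by lia.
case: (n %% 2)%Z=> [[|[|k]]|k] // _ _; first lia.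
move=> e; move: n0; rewrite e mulrzDr mulrC mulrzA (_ : 1 *~ 2 = 0) ?mul0rz; last exact: val_inj.
by [].
Qed.
Lemma CH_of i c (G : zmodType) (lam : mfun B G) : kc c = i ->
 (forall D : cycles Y i, exists n, D - gcyc i c *~ n \in @rat_triv F Y i) ->
 (forall D, D \in @rat_triv F Y i -> @cyclam F B _ (rB F) (ustr_rm _) G lam i D = 0) ->
 (forall g : G, exists n, @lam B^o (idy (gpt F c)) T *~ n = g) ->
 (forall n, @lam B^o (idy (gpt F c)) T *~ n = 0 -> gcyc i c *~ n \in @rat_triv F Y i) ->
 zmod_iso (CH i Y) G.
move=> ec gen rt sur inj; apply: (quot_iso (@cl_B G lam i) rt)=> [D D0|g].
 have [n Dn] := gen D; rewrite -(subrK (gcyc i c *~ n) D); apply: rpredD=> //; apply: inj.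
 by have := rt _ Dn; rewrite cl_B D0 cl_MZ cl_gcyc ec eqxx sub0r=> /eqP; rewrite oppr_eq0=> /eqP.
have [n <-] := sur g; exists (gcyc i c *~ n); by rewrite cl_MZ cl_gcyc ec eqxx.
Qed.
Lemma CH_R i : zmod_iso (CH i Y) (if (i == 0%N) || (i == 3%N) then (int : zmodType)
 else if (i == 2%N) || (i == 5%N) then ('Z_2 : zmodType) else ('I_1 : zmodType)).
have Z_sur (x : int) : x = 1 \/ x = - 1 -> forall g, exists n, x *~ n = g.
 by move=> [->|->] g; [exists g | exists (- g)]; rewrite ?mulrNz ?mulNrz ?opprK intz.
have Z_inj (x : int) : x = 1 \/ x = - 1 -> forall n, x *~ n = 0 -> n = 0.
 lia.
have Z2_sur (x : 'Z_2) : x = 1 -> forall g, exists n, x *~ n = g.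
 by move=> -> g; exists g%:Z; rewrite -pmulrn natr_Zp.
have [->|n0] := eqVneq i 0.
 (* In codimension 0 rational equivalence is trivial, so the constant function 1, which sums the
    coefficients of the cycle, serves as the invariant. *)
 apply: (@CH_of 0 (X0, T0) int (fun _ _ _=> 1 : int))=> //.
 - move=> D; have [n1 [n2 [n3 [n4]]]] := CH_gen D; rewrite /gens (@gcyc0 _ _ (X0, T3)) // (@gcyc0 _ _ (X2, T0)) //.
 by rewrite (@gcyc0 _ _ (X2, T3)) // !mul0rz !addr0; exists n1.
 - by move=> D /rat_triv0->; exact: flin0.
 - by apply: Z_sur; left.
 by move=> n /(Z_inj 1 (or_introl erefl))->; rewrite rpred0.
have [->|n3] := eqVneq i 3.
 apply: (CH_of (c := (X0, T3)) _ _ (lower (lamb3_ok F) _ _ (fun _=> lamb3_g23)))=> //.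
 - move=> D; have [n1 [n2 [n3 [n4]]]] := CH_gen D; rewrite /gens gcyc0 // (@gcyc0 _ _ (X2, T0)) //.
 by rewrite (@gcyc0 _ _ (X2, T3)) // !mul0rz !addr0 add0r; exists n2.
 - by apply: Z_sur; right; exact: lamb3_g03.
 by move=> n /(Z_inj _ (or_intror (lamb3_g03 F)))->; rewrite rpred0.
have [->|n2] := eqVneq i 2.
 apply: (CH_of (c := (X2, T0)) _ _ (lower (lamb2_ok F) _ (fun _=> lamb2_T3 _ _) (fun _=> lamb2_T3 _ _)))=> //.
 - move=> D; have [n1 [n2 [n3' [n4]]]] := CH_gen D; rewrite /gens gcyc0 // gcyc0 //.
 by rewrite (@gcyc0 _ _ (X2, T3)) // !mul0rz !addr0 !add0r; exists n3'.
 - by apply: Z2_sur; exact: lamb2_g20.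
 move=> n; rewrite lamb2_g20=> /Z2_even[m ->]; rewrite mulrC mulrzA; apply: rpredMz; exact: rt_X2.
have [->|n5] := eqVneq i 5.
 apply: (CH_of (c := (X2, T3)) _ _ (lower (lamb5_ok F) _ _ _))=> //.
 - move=> D; have [n1 [n2' [n3' [n4]]]] := CH_gen D; rewrite /gens gcyc0 // gcyc0 //.
 by rewrite gcyc0 // !mul0rz !add0r; exists n4.
 - by apply: Z2_sur; exact: lamb5_g23.
 move=> n; rewrite lamb5_g23=> /Z2_even[m ->]; rewrite mulrC mulrzA; apply: rpredMz; exact: rt_X2.
apply: (quot_iso _)=> //.
- by move=> a b; rewrite subr0.
- move=> D _; have [n1 [n2' [n3' [n4]]]] := CH_gen D.
 by rewrite /gens !gcyc0 1?eq_sym // !mul0rz !addr0 subr0.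
by exists 0; rewrite [g]ord1.
Qed.

End LowerBound.

Close Scope ring_scope.
Close Scope classical_set_scope.

Theorem proposition8p1 (F : fieldType) :
  exists (X E : scheme F) (pi : shom E X) (act : action_map ((1 + 3) + (3 + 1)) E),
    smooth X /\ separated_of_finite_type X /\ is_torsor G2 act pi /\
    exists (R : scheme F) (q : shom E R),
      is_torsor SL3 act q /\
      forall i : nat,
        zmod_iso (CH i R)
          (if (i == 0) || (i == 3) then (int : zmodType)
           else if (i == 2) || (i == 5) then ('Z_2 : zmodType)
           else ('I_1 : zmodType)).
Proof.
have [pi hpi] := pi_torsor F; have [q hq] := q_torsor F.
exists _, _, pi, (@act F); split; first exact: Xs_smooth.
by split; [exact: Xs_sft | split=> //; exists _, q; split=> // i; exact: CH_R].
Qed.
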